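(* For every integer $t>0$ there exists an integer $c=c(t)$ such that every graph $G$ that contains no member of $\mathcal{T}_1$ as an induced subgraph and has treewidth more than $c$ contains, as an induced subgraph, one of the following: the complete graph $K_t$, the complete bipartite graph $K_{t,t}$, a subdivision of the wall $W_{t\times t}$, or the line graph of a subdivision of $W_{t\times t}$.
   Context: All graphs are finite and simple; ''$G$ contains $H$'' means $G$ has an induced subgraph isomorphic to $H$. $\mathcal{T}_1$ is the family of all graphs consisting of an induced cycle $C$ of length at least four together with a vertex outside $C$ that has at least two neighbors in $C$. Walls: for an integer $k\ge 1$, let $\Gamma_k$ be the graph with vertex set $\{(i,j):1\le i\le k,\ 0\le j\le 2k-1\}$ in which $(i,j)$ is adjacent to $(i,j+1)$ for all $i$ and all $0\le j\le 2k-2$, and $(i,j)$ is adjacent to $(i+1,j)$ whenever $1\le i\le k-1$ and $i+j$ is odd, with no other edges. The $(k\times k)$-wall $W_{k\times k}$ is obtained from $\Gamma_k$ by deleting its vertices of degree one and then suppressing every remaining vertex of row $1$ or row $k$ that has no neighbor in another row (i.e. deleting such a vertex and joining its two neighbors by an edge). A subdivision of a graph is obtained by replacing edges by paths. The line graph $L(F)$ of a graph $F$ has vertex set $E(F)$, two vertices adjacent iff the corresponding edges share an end. *)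

(* Defs.v *)
From mathcomp Require Import all_boot.
From mathcomp Require Import boolp.

Set Implicit Arguments.
Unset Strict Implicit.
Unset Printing Implicit Defensive.

(** * Finite simple graphs *)

Record sgraph := SGraph {
  vertex :> finType;
  edge : rel vertex;
  edge_sym : symmetric edge;
  edge_irrefl : irreflexive edge
}.

Notation "x -- y" := (edge x y) (at level 30).

Definition neighbors (G : sgraph) (x : G) : {set G} := [set y | x -- y].

Definition degree (G : sgraph) (x : G) : nat := #|neighbors x|.

Definition induced_embedding (H G : sgraph) (f : H -> G) : Prop :=
  injective f /\ forall x y : H, (f x -- f y) = (x -- y).

(** [G] has an induced subgraph isomorphic to [H]. *)
Definition contains (G H : sgraph) : Prop :=
  exists f : H -> G, induced_embedding f.

Section Induced.
Variables (G : sgraph) (S : {set G}).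
Definition induced_edge : rel {x : G | x \in S} :=
  fun x y => val x -- val y.
Fact induced_sym : symmetric induced_edge.
Proof. by move=> x y; apply: edge_sym. Qed.
Fact induced_irrefl : irreflexive induced_edge.
Proof. by move=> x; apply: edge_irrefl. Qed.
Definition induced : sgraph := SGraph induced_sym induced_irrefl.
End Induced.

Section Complete.
Variable n : nat.
Definition complete_edge : rel 'I_n := fun i j => i != j.
Fact complete_sym : symmetric complete_edge.
Proof. by move=> i j; rewrite /complete_edge eq_sym. Qed.
Fact complete_irrefl : irreflexive complete_edge.
Proof. by move=> i; rewrite /complete_edge eqxx. Qed.
Definition complete_graph : sgraph := SGraph complete_sym complete_irrefl.
End Complete.

Section CompleteBipartite.
Variables m n : nat.
Definition bipartite_edge : rel ('I_m + 'I_n)%type := fun x y =>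
  match x, y with
  | inl _, inr _ | inr _, inl _ => true
  | _, _ => false
  end.
Fact bipartite_sym : symmetric bipartite_edge.
Proof. by case=> x [] y. Qed.
Fact bipartite_irrefl : irreflexive bipartite_edge.
Proof. by case. Qed.
Definition complete_bipartite : sgraph := SGraph bipartite_sym bipartite_irrefl.
End CompleteBipartite.

Section Cycle.
Variable n : nat.
Definition cycle_edge : rel 'I_n := fun i j =>
  (i != j) && ((i.+1 %% n == j) || (j.+1 %% n == i)).
Fact cycle_sym : symmetric cycle_edge.
Proof. by move=> i j; rewrite /cycle_edge eq_sym orbC. Qed.
Fact cycle_irrefl : irreflexive cycle_edge.
Proof. by move=> i; rewrite /cycle_edge eqxx. Qed.
Definition cycle_graph : sgraph := SGraph cycle_sym cycle_irrefl.
End Cycle.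

(** Membership of [H] in the family T_1: [f] is the induced cycle, and [H] has
    no vertex besides those of the cycle and [v]. *)
Definition in_T1 (H : sgraph) : Prop :=
  exists (n : nat) (f : cycle_graph n -> H) (v : H),
    [/\ 4 <= n,
        induced_embedding f,
        forall x : H, (x \in codom f) = (x != v)
      & 2 <= #|neighbors v :&: [set x in codom f]| ].

(** * Treewidth *)

Definition connected_graph (G : sgraph) : Prop :=
  forall x y : G, connect (@edge G) x y.

Definition acyclic_graph (G : sgraph) : Prop :=
  forall c : seq G, ucycle (@edge G) c -> size c <= 2.

Definition is_tree (T : sgraph) : Prop :=
  [/\ 0 < #|T|, connected_graph T & acyclic_graph T].

Record tree_decomposition (G : sgraph) := TreeDecomposition {
  td_tree : sgraph;
  td_bag : td_tree -> {set G};
  td_treeP : is_tree td_tree;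
  td_vertex : forall v : G, exists t, v \in td_bag t;
  td_edge : forall u v : G, u -- v ->
    exists t, (u \in td_bag t) && (v \in td_bag t);
  td_connected : forall v : G,
    connected_graph (induced [set t | v \in td_bag t])
}.

(** The graph without vertices gets width 0 instead of -1. *)
Definition td_width (G : sgraph) (D : tree_decomposition G) : nat :=
  (\max_(t : td_tree D) #|td_bag t|).-1.

Definition has_td_of_width (G : sgraph) (w : nat) : bool :=
  `[< exists D : tree_decomposition G, td_width D = w >].

Fact ex_td_width (G : sgraph) : exists w, has_td_of_width G w.
Proof.
have allE (x y : complete_graph 1) : x = y by rewrite [x]ord1 [y]ord1.
have tree1 : is_tree (complete_graph 1).
  split; first by rewrite card_ord.
    by move=> x y; rewrite (allE x y).
  case=> [|x [|y s]] // /andP[_] /=; rewrite inE.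
  by rewrite (allE x y) eqxx.
pose B (_ : complete_graph 1) : {set G} := setT.
have vB v : exists t, v \in B t by exists ord0; rewrite inE.
have eB u v : u -- v -> exists t, (u \in B t) && (v \in B t).
  by move=> _; exists ord0; rewrite !inE.
have cB v : connected_graph (induced [set t | v \in B t]).
  move=> x y; suff -> : x = y by [].
  exact/val_inj/allE.
exists (td_width (TreeDecomposition tree1 vB eB cB)).
by apply/asboolP; exists (TreeDecomposition tree1 vB eB cB).
Qed.

Definition treewidth (G : sgraph) : nat := ex_minn (ex_td_width G).

(** * Walls *)

(** The pair [(i, j)] stands for the vertex in row [i + 1] and column [j]:
    ordinals start at 0, but rows are numbered from 1. *)
Section Gamma.
Variable k : nat.

Definition row_number (x : 'I_k * 'I_(2 * k)) : nat := x.1.+1.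

Definition gamma_arc : rel ('I_k * 'I_(2 * k))%type := fun x y =>
  ((row_number y == row_number x) && (y.2 == x.2.+1 :> nat))
  || [&& row_number y == (row_number x).+1, y.2 == x.2
       & odd (row_number x + x.2)].

Definition gamma_edge : rel ('I_k * 'I_(2 * k))%type := fun x y =>
  gamma_arc x y || gamma_arc y x.

Fact gamma_sym : symmetric gamma_edge.
Proof. by move=> x y; apply: orbC. Qed.

Fact gamma_irrefl : irreflexive gamma_edge.
Proof.
move=> x; rewrite /gamma_edge /gamma_arc.
by rewrite !(ltn_eqF (ltnSn _)) andbF.
Qed.

Definition gamma : sgraph := SGraph gamma_sym gamma_irrefl.
End Gamma.

(** Simultaneous suppression of a set [S] of vertices.  This is the usual
    operation when the vertices of [S] have degree two and no two of them are
    adjacent, which is the case in the definition of [wall]. *)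
Section Suppress.
Variables (G : sgraph) (S : {set G}).
Definition suppress_edge : rel {x : G | x \in ~: S} := fun x y =>
  (x != y) && ((val x -- val y) ||
    [exists s in S, neighbors s == [set val x; val y]]).
Fact suppress_sym : symmetric suppress_edge.
Proof.
move=> x y; rewrite /suppress_edge eq_sym edge_sym; congr (_ && (_ || _)).
by apply: eq_existsb => s; rewrite setUC.
Qed.
Fact suppress_irrefl : irreflexive suppress_edge.
Proof. by move=> x; rewrite /suppress_edge eqxx. Qed.
Definition suppress : sgraph := SGraph suppress_sym suppress_irrefl.
End Suppress.

Definition trimmed_gamma (k : nat) : sgraph :=
  induced [set x : gamma k | degree x != 1].

Definition wall_row (k : nat) (x : trimmed_gamma k) : nat :=
  row_number (val x).

Definition suppressible (k : nat) : {set trimmed_gamma k} :=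
  [set x | ((wall_row x == 1) || (wall_row x == k))
           && [forall y in neighbors x, wall_row y == wall_row x]].

(** The (k x k)-wall; for [k = 1] this is the graph without vertices. *)
Definition wall (k : nat) : sgraph := suppress (suppressible k).

(** * Subdivisions and line graphs *)

(** [H] is (up to isomorphism) a subdivision of [F]: [phi x] is the vertex of
    [H] corresponding to [x], and, for an edge [x -- y] of [F], [P x y] lists
    the interior vertices, from [phi x] to [phi y], of the path replacing it.
    [P x y] may be empty, and is irrelevant when [x -- y] fails. *)
Definition is_subdivision (F H : sgraph) : Prop :=
  exists (phi : F -> H) (P : F -> F -> seq H),
    let full_path x y := phi x :: rcons (P x y) (phi y) in
    [/\ injective phi,
        forall x y, x -- y ->
          [/\ path (@edge H) (phi x) (rcons (P x y) (phi y)),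
              uniq (P x y),
              P y x = rev (P x y)
            & forall z, phi z \notin P x y],
        forall x y x' y', x -- y -> x' -- y' ->
          [set x; y] != [set x'; y'] -> ~~ has (mem (P x y)) (P x' y'),
        forall u : H, (exists x, u = phi x) \/
          (exists x y, x -- y /\ u \in P x y)
      & forall u v : H, u -- v ->
          exists x y, x -- y /\ infix [:: u; v] (full_path x y) ].

Section LineGraph.
Variable F : sgraph.
Definition edge_set : {set {set F}} :=
  [set e | [exists x, exists y, (x -- y) && (e == [set x; y])]].
Definition line_edge : rel {e : {set F} | e \in edge_set} := fun e e' =>
  (e != e') && (val e :&: val e' != set0).
Fact line_sym : symmetric line_edge.
Proof. by move=> e e'; rewrite /line_edge eq_sym setIC. Qed.
Fact line_irrefl : irreflexive line_edge.
Proof. by move=> e; rewrite /line_edge eqxx. Qed.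
Definition line_graph : sgraph := SGraph line_sym line_irrefl.
End LineGraph.

(* Main.v *)
Require Import Defs.
From mathcomp Require Import all_boot boolp zify.

Set Implicit Arguments.
Unset Strict Implicit.
Unset Printing Implicit Defensive.

(** Fix a set [U] of vertices, minimal among those carrying a bramble of large order, and
    assume that there is no large clique. By minimality no clique separates [U], and this
    together with the absence of T_1 makes [G[U]] triangle-free. In a triangle-free graph
    without T_1, any two vertices of an induced subgraph without clique cutsets lie on a
    common hole (by induction along ears). Two neighbours [x], [y] of a vertex [v] never lie
    on a hole avoiding [v], so some clique separates [x] from [y] in [U - v]. If both have
    degree at least three, minimality then forces one of them to have degree three and to
    start, besides its edge to [v], two induced paths of degree-two vertices leading to the
    ends of an edge. Call such a vertex residual and delete one of its two paths.

    The edges between nonresidual vertices of degree at least three form a matching.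
    Contracting them and the remaining paths divides the order of the bramble by at most
    three. By the grid theorem a large grid minor remains, and it lifts to a minor model of
    the wall in which no edge between two vertices of degree at least three joins distinct
    branch sets. As the wall has maximum degree three and the graph is triangle-free, each
    branch set contains an induced subdivided star (or path) joining its contacts with the
    neighbouring branch sets. The union of these is an induced subdivision of the wall: an
    additional edge would join two vertices of degree at least three in distinct branch
    sets. *)

(** Minimality is imposed on a bramble because brambles can be pushed. Suppose that a set [X] can be
    left only through [S], and that some member avoids both. Every member then reaches outside [X],
    and [X] may shrink to a subset [Z]: members lose [X], and those containing a chosen vertex [v]
    receive [Z], where [v |: Z] is connected. The result is a bramble of the same order as soon as
    the vertices of [S] are pairwise adjacent or joined through [v] and [Z]. With [S] a clique and
    [Z] empty this forbids clique cutsets; with [Z] a path or tripod next to [v] it forces the shape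
    of residual vertices and keeps different residual structures apart.

    The factor three of the contraction comes from hitting sets. A member meeting a residual
    structure must leave it, so it contains one of the three vertices [v], [s], [t] around it; a
    contracted edge has only two ends. Hence [k = 3 * k']. Passing from treewidth to brambles costs
    another factor of three. The argument always ends with the complete graph or with the subdivided
    wall. *)

Lemma exists_min (T : Type) (P : T -> Prop) (f : T -> nat) :
  (exists x, P x) -> exists x, P x /\ forall y, P y -> f x <= f y.
Proof.
case=> x; move: {2}(f x) (leqnn (f x)) => n; elim: n x => [|n IH] x fx Px.
  by exists x; split => // y _; move: fx; rewrite leqn0 => /eqP ->.
case: (pselect (exists y, P y /\ f y < f x)) => [[y [Py fy]]|no].
  by apply: (IH y) => //; lia.
exists x; split => // y Py; rewrite leqNgt; apply/negP => fy.
by apply: no; exists y.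
Qed.

Lemma mem_split (T : eqType) (x : T) s : x \in s -> exists s1 s2, s = s1 ++ x :: s2.
Proof. by case/splitPr => s1 s2; exists s1, s2. Qed.

Lemma mem_drop_uniq (T : eqType) (t : seq T) lo z : uniq t ->
  (z \in drop lo t) = (z \in t) && (lo <= index z t).
Proof.
move=> ut; case zt : (z \in t) => /=; last by apply: contraFF zt; apply: mem_drop.
rewrite leqNgt -in_take //; move: zt ut; rewrite -{1 2}(cat_take_drop lo t).
rewrite mem_cat cat_uniq => zt /and3P[_ /hasPn nh _].
case zd : (z \in drop lo t) zt; last by rewrite orbF => ->.
by rewrite (nh _ zd).
Qed.

(** * Connected sets, induced paths and holes *)

Section Basics.
Variables (V : finType) (e : rel V).

(* Avoids walks: no proper nonempty subset of [A] is closed in [A]. The empty set is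
   connected. *)
Definition conn (A : {set V}) : Prop :=
  forall X : {set V}, X \subset A -> X != set0 ->
    (forall x y, x \in X -> y \in A -> e x y -> y \in X) -> A \subset X.

Fixpoint ipath (p : seq V) : bool :=
  if p is x :: p' then
    [&& x \notin p',
        (if p' is y :: p'' then e x y && all (fun z => ~~ e x z) p'' else true)
      & ipath p']
  else true.

(** The list runs once around the cycle. The bound on [size p] makes its length at least four, so
    that triangles are not holes. *)
Definition hole (c : seq V) : bool :=
  if c is x :: p then
    [&& ipath p, 2 < size p, x \notin p
      & all (fun z => e x z == (z == head x p) || (z == last x p)) p]
  else false.

(** Stated for a bare relation, so that it also applies to the restriction of the edge relation to a
    vertex set, without a change of vertex type. *)
Definition T1_free : Prop :=
  forall c v a b, hole c -> v \notin c -> a \in c -> b \in c ->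
    e v a -> e v b -> a = b.

Definition clique (K : {set V}) : Prop :=
  forall x y, x \in K -> y \in K -> x != y -> e x y.

Definition component (A : {set V}) (x : V) : {set V} :=
  [set y in A | connect [rel u v | [&& u \in A, v \in A & e u v]] x y].

Definition nbr (A : {set V}) : {set V} := [set y | [exists x in A, e x y]].

Lemma nbrP (A : {set V}) y : reflect (exists2 x, x \in A & e x y) (y \in nbr A).
Proof.
rewrite inE; apply: (iffP existsP) => [[x /andP[]]|[x xA exy]]; first by exists x.
by exists x; rewrite xA.
Qed.

Lemma conn0 : conn set0.
Proof. by move=> X _ _ _; rewrite sub0set. Qed.

Lemma conn1 x : conn [set x].
Proof.
move=> X /subsetP sX /set0Pn[y yX] _; have := sX _ yX; rewrite inE => /eqP <-.
by rewrite sub1set.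
Qed.

(** By symmetry, a closed set missing [x] has a closed complement in [A]; that complement contains
    [x], hence is all of [A]. *)
Lemma conn_cut (A : {set V}) x (es : symmetric e) : x \in A ->
  (forall X : {set V}, X \subset A -> x \in X ->
    (forall y z, y \in X -> z \in A -> e y z -> z \in X) -> A \subset X) -> conn A.
Proof.
move=> xA H X sX /set0Pn[y yX] clX.
case xX : (x \in X); first exact: H.
have /subsetP sub : A \subset A :\: X.
  apply: H; first by apply: subsetDl.
    by rewrite inE xX.
  move=> u v; rewrite !inE => /andP[uX uA] vA euv; rewrite vA andbT.
  by apply: contra uX => vX; apply: (clX v) => //; rewrite es.
by have := sub _ (subsetP sX _ yX); rewrite inE yX.
Qed.

Lemma conn_closed (A X : {set V}) : conn A ->
  (forall x y, x \in X -> x \in A -> y \in A -> e x y -> y \in X) ->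
  (exists2 x, x \in A & x \in X) -> A \subset X.
Proof.
move=> cA cl [x xA xX].
have /subsetP sub : A \subset X :&: A.
  apply: cA; first exact: subsetIr.
    by apply/set0Pn; exists x; rewrite inE xX.
  by move=> y z; rewrite !inE => /andP[yX yA] zA eyz; rewrite zA (cl y).
by apply/subsetP => y /sub; rewrite inE => /andP[].
Qed.

Lemma connU (A B : {set V}) (es : symmetric e) : conn A -> conn B ->
  (exists a b, [/\ a \in A, b \in B & (a == b) || e a b]) -> conn (A :|: B).
Proof.
move=> cA cB [a [b [aA bB ab]]].
apply: (@conn_cut _ a) => //; first by rewrite inE aA.
move=> X sX aX cl.
have sA : A \subset X.
  apply: conn_closed => //; last by exists a.
  by move=> x y xX xA yA; apply: cl; rewrite // inE yA.
have bX : b \in X.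
  case/orP: ab => [/eqP <- //|ab]; apply: (cl a) => //; by rewrite inE bB orbT.
rewrite subUset sA /=.
apply: conn_closed => //; last by exists b.
by move=> x y xX xA yA; apply: cl; rewrite // inE yA orbT.
Qed.

Lemma conn_bigcup (es : symmetric e) (I : finType) (P : pred I) (F : I -> {set V})
    (A : {set V}) : conn A -> A != set0 -> (forall i, P i -> conn (F i)) ->
  (forall i, P i -> exists a b, [/\ a \in A, b \in F i & (a == b) || e a b]) ->
  conn (A :|: \bigcup_(i | P i) F i).
Proof.
move=> cA /set0Pn[a0 a0A] cF H.
apply: (@conn_cut _ a0) => //; first by rewrite inE a0A.
move=> X sX aX cl.
have sA : A \subset X.
  apply: conn_closed => //; last by exists a0.
  by move=> x y xX xA yA; apply: cl; rewrite // inE yA.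
rewrite subUset sA /=; apply/bigcupsP => i Pi.
have sF z : z \in F i -> z \in A :|: \bigcup_(i | P i) F i.
  by move=> zF; rewrite inE; apply/orP; right; apply/bigcupP; exists i.
have [a [b [aA bF ab]]] := H i Pi.
have aX' : a \in X by apply: (subsetP sA).
have bX : b \in X.
  by case/orP: ab => [/eqP <- //|ab]; apply: (cl a) => //; apply: sF.
apply: conn_closed (cF i Pi) _ _; last by exists b.
by move=> x y xX xA yA; apply: cl => //; apply: sF.
Qed.

Lemma ipath_cat p q : ipath (p ++ q) <->
  [/\ ipath p, ipath q & forall u v, u \in p -> v \in q ->
     u != v /\ e u v = (u == last u p) && (v == head v q)].
Proof.
elim: p => [|x p IH] /=; first by split => [->|[_ ->]].
split.
  case/and3P => xpq adj /IH[ip iq cr].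
  have [xp xq] : x \notin p /\ x \notin q.
    by move: xpq; rewrite mem_cat negb_or => /andP[].
  rewrite xp ip iq; split => //.
    by case: p adj {IH ip cr xp xpq} => //= y p /andP[-> ]; rewrite all_cat => /andP[->].
  move=> u v; rewrite inE => /predU1P[->|up] vq.
    split; first by apply: contraNneq xq => ->.
    case: p adj {IH ip cr xpq} xp => [|y p] /=.
      case: q xq vq {iq} => // y q xq vq /= /andP[exy /allP nq] _.
      rewrite eqxx /=; move: vq; rewrite inE => /predU1P[->|vq]; first by rewrite exy eqxx.
      rewrite (negbTE (nq _ vq)); case: eqP => // vy; move: (nq _ vq); by rewrite vy exy.
    move=> /andP[exy /allP nx] xp.
    have -> : (x == last y p) = false.
      by apply: contraNF xp => /eqP ->; apply: mem_last.
    by apply/negbTE/nx; rewrite mem_cat vq orbT.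
  have [un ->] := cr u v up vq; split => //; congr (_ && _).
  by case: p up {IH xp ip cr xpq adj}.
case=> /and3P[xp adj ip] iq cr.
have xq : x \notin q.
  apply/negP => xq; have [] := cr x x (mem_head _ _) xq; by rewrite eqxx.
have -> : x \notin p ++ q by rewrite mem_cat negb_or xp.
have -> : ipath (p ++ q).
  apply/IH; split => // u v up vq.
  have [|-> ->] := cr u v _ vq; first by rewrite inE up orbT.
  by split => //; congr (_ && _); case: p up {IH xp ip cr adj}.
rewrite andbT /=.
case: p adj IH xp ip cr => [_|y p] /=.
  case: q iq xq => // y q iq xq _ _ _ cr.
  have [_ /=] := cr x y (mem_head _ _) (mem_head _ _); rewrite !eqxx => ->.
  apply/allP => z zq; have [|_ /= ->] := cr x z (mem_head _ _); first by rewrite inE zq orbT.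
  rewrite eqxx /=; apply: contraL iq => /eqP <- /=; by rewrite zq.
move=> /andP[-> ap] _ xp ip cr; rewrite all_cat ap /=.
apply/allP => z zq; have [_ /= ->] := cr x z (mem_head _ _) zq.
suff -> : (x == last y p) = false by [].
by apply: contraNF xp => /eqP ->; apply: mem_last.
Qed.

Lemma ipath_uniq p : ipath p -> uniq p.
Proof. by elim: p => //= x p IH /and3P[-> _ /IH]. Qed.

Lemma ipath_path x p : ipath (x :: p) -> path e x p.
Proof. elim: p x => //= y p IH x /and3P[_ /andP[-> _]] /IH; exact. Qed.

Lemma ipath_catl p q : ipath (p ++ q) -> ipath p.
Proof. by case/ipath_cat. Qed.

Lemma ipath_catr p q : ipath (p ++ q) -> ipath q.
Proof. by case/ipath_cat. Qed.

Lemma ipath_cons x p : ipath (x :: p) -> ipath p.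
Proof. by case/and3P. Qed.

Lemma ipath_head x p z : ipath (x :: p) -> z \in p -> e x z = (z == head z p).
Proof.
move=> H zp; have := @ipath_cat [:: x] p; case=> /(_ H) [_ _ /(_ x z (mem_head _ _) zp)].
by case=> _ ->; rewrite /= eqxx.
Qed.

Lemma ipath_rcons_edge p u z : ipath (rcons (rcons p u) z) -> e u z.
Proof.
rewrite -cats1 => /ipath_cat[_ _ h]; have [|_ ->] := h u z _ (mem_head _ _).
  by rewrite mem_rcons mem_head.
by rewrite last_rcons /= !eqxx.
Qed.

Lemma path_interval x q lo hi : path e x q -> uniq (x :: q) ->
  (exists2 z, z \in x :: q & lo <= index z (x :: q) <= hi) ->
  exists y s, [/\ path e y s & forall z, z \in y :: s =
     (z \in x :: q) && (lo <= index z (x :: q) <= hi)].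
Proof.
move=> pq; set p := x :: q => up [z0 z0p z0i].
have sp : sorted e (drop lo (take hi.+1 p)) by rewrite drop_sorted // take_sorted.
have mt n z : (z \in take n p) = (z \in p) && (index z p < n).
  case zp : (z \in p); first by rewrite in_take.
  by apply: contraFF zp; apply: mem_take.
have E z : z \in drop lo (take hi.+1 p) = (z \in p) && (lo <= index z p <= hi).
  have ut : uniq (take hi.+1 p) by apply: take_uniq.
  rewrite mem_drop_uniq // mt ltnS; case zp : (z \in p); rewrite ?andFb ?andTb //.
  case: (leqP (index z p) hi) => [zh|_]; last by rewrite andbF.
  rewrite andTb andbT; suff -> : index z p = index z (take hi.+1 p) by [].
  by rewrite -{1}(cat_take_drop hi.+1 p) index_cat mt zp ltnS zh.
move: (E z0) sp; rewrite z0p z0i; case Es : (drop _ _) => [//|y s] _ ps.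
by exists y, s; split => // z; rewrite -E Es.
Qed.

Hypothesis es : symmetric e.
Hypothesis ei : irreflexive e.

Lemma neq_edge x y : e x y -> x != y.
Proof. by apply: contraTneq => ->; rewrite ei. Qed.

Lemma ipath_rev p : ipath (rev p) = ipath p.
Proof.
suff H q : ipath q -> ipath (rev q).
  by apply/idP/idP => /H //; rewrite revK.
elim: q => //= x q IH /and3P[xq adj iq].
rewrite rev_cons -cats1; apply/ipath_cat; split => //; first exact: IH.
move=> u v; rewrite mem_rev !inE => uq /eqP ->; rewrite eqxx andbT.
split; first by apply: contraNneq xq => <-.
rewrite es; have -> : last u (rev q) = head u q.
  by case: q {IH adj iq uq xq} => //= y q; rewrite rev_cons last_rcons.
rewrite (@ipath_head x q) //; by rewrite /= xq adj.
Qed.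

Lemma ipath_conn p : ipath p -> conn [set z in p].
Proof.
elim: p => [_|x p IH /= /and3P[xp adj /IH cp]].
  by rewrite (_ : [set z in [::]] = set0); [apply: conn0 | apply/setP=> z; rewrite !inE].
have -> : [set z in x :: p] = [set x] :|: [set z in p] by apply/setP => z; rewrite !inE.
case: p adj cp {IH xp} => [_ _|y p /andP[exy _] cp].
  rewrite (_ : _ :|: _ = [set x]); [exact: conn1 | by apply/setP=> z; rewrite !inE orbF].
apply: connU => //; first exact: conn1.
by exists x, y; rewrite !inE !eqxx exy orbT.
Qed.

Lemma path_conn x p : path e x p -> conn [set z in x :: p].
Proof.
elim: p x => [x _|y p IH x /= /andP[exy /IH cp]].
  rewrite (_ : [set z in [:: x]] = [set x]); first exact: conn1.
  by apply/setP => z; rewrite !inE.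
have -> : [set z in x :: y :: p] = [set x] :|: [set z in y :: p] by apply/setP => z; rewrite !inE.
apply: connU => //; first exact: conn1.
by exists x, y; rewrite !inE !eqxx exy orbT.
Qed.

Lemma ipath_rcons p z : ipath p -> z \notin p ->
  (forall u, u \in p -> e u z = (u == last u p)) -> ipath (rcons p z).
Proof.
move=> ip zp H; rewrite -cats1; apply/ipath_cat; split => //.
move=> u v up; rewrite inE => /eqP -> /=; rewrite eqxx andbT; split; last exact: H.
by apply: contraNneq zp => <-.
Qed.

(* Cut at the first vertex that is equal or adjacent to [w]. *)
Lemma ipath_ext (x : V) p w : ipath (x :: p) -> e (last x p) w ->
  exists q, [/\ ipath (x :: q), last x q = w & {subset x :: q <= w :: x :: p}].
Proof.
move=> ip lw.
pose f u := (u == w) || e u w.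
have : has f (x :: p).
  by apply/hasP; exists (last x p); rewrite ?mem_last // /f lw orbT.
case: (x =P w) => [<- _|/eqP xw].
  exists [::]; split => //= u; rewrite !inE => /eqP ->; by rewrite eqxx.
move=> /split_find; case E: _ _ _ / => [u s1 s2 fu nf].
have ip1 : ipath (rcons s1 u) by apply: (@ipath_catl _ s2); rewrite -E.
have sub : {subset rcons s1 u <= x :: p} by move=> z zs; rewrite E mem_cat zs.
have nf' z : z \in s1 -> ~~ f z by move=> zs; apply: contra nf => fz; apply/hasP; exists z.
case: (u =P w) => [uw|/eqP uw].
  case: s1 E ip1 sub {nf nf'} => [[xu _]|y s1 [<- _]] ip1 sub.
    by move: xw; rewrite xu uw eqxx.
  exists (rcons s1 u); rewrite last_rcons; split => // z zs.
  by rewrite inE mem_cat zs orbT.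
have euw : e u w by move: fu; rewrite /f (negbTE uw).
have ip2 : ipath (rcons (rcons s1 u) w).
  apply: ipath_rcons => //.
    rewrite mem_rcons inE eq_sym negb_or uw /=; apply/negP => ws.
    by move: (nf' _ ws); rewrite /f eqxx.
  move=> z; rewrite last_rcons mem_rcons inE => /predU1P[->|zs]; first by rewrite euw eqxx.
  have := nf' _ zs; rewrite /f negb_or => /andP[_ /negbTE ->].
  apply/esym/negbTE; apply: contraTneq zs => ->.
  by have := ipath_uniq ip1; rewrite rcons_uniq => /andP[].
case: s1 E ip1 ip2 sub {nf nf'} => [[xu _]|y s1 [<- _]] ip1 ip2 sub.
  subst u; exists [:: w]; split => // z; rewrite !inE /= => /orP[->|->]; by rewrite ?orbT.
exists (rcons (rcons s1 u) w); rewrite last_rcons; split => // z.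
rewrite -rcons_cons mem_rcons inE => /predU1P[->|zs]; first exact: mem_head.
by rewrite inE mem_cat zs orbT.
Qed.

(** The set of vertices reached from [x] by induced paths is closed, by [ipath_ext]. *)
Lemma conn_ipath (A : {set V}) x y : conn A -> x \in A -> y \in A ->
  exists p, [/\ ipath (x :: p), last x p = y & {subset x :: p <= A}].
Proof.
move=> cA xA yA.
pose X := [set z in A | `[< exists p, [/\ ipath (x :: p), last x p = z & {subset x :: p <= A}] >]].
have /subsetP/(_ _ yA) : A \subset X.
  apply: (conn_closed cA); last first.
    exists x => //; rewrite inE xA; apply/asboolP; exists [::]; split => // z.
    by rewrite inE => /eqP ->.
  move=> u w; rewrite !inE => /andP[_ /asboolP[p [ip lp sp]]] uA wA euw.
  rewrite wA; apply/asboolP; subst u.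
  have [q [iq lq sq]] := ipath_ext ip euw.
  exists q; split => // z /sq; rewrite inE => /predU1P[->//|]; exact: sp.
by rewrite inE => /andP[_ /asboolP].
Qed.

Lemma conn_first (A : {set V}) x (f : pred V) : conn A -> x \in A ->
  (exists2 y, y \in A & f y) ->
  exists p z, [/\ ipath (rcons p z), f z, ~~ has f p, head z p = x &
                  {subset rcons p z <= A}].
Proof.
move=> cA xA [y yA fy].
have [q [iq lq sq]] := conn_ipath cA xA yA.
have : has f (x :: q) by apply/hasP; exists y => //; rewrite -lq mem_last.
move=> /split_find; case E: _ _ _ / => [u s1 s2 fu nf].
exists s1, u; split => //.
- by apply: (@ipath_catl _ s2); rewrite -E.
- by case: s1 E {nf} => [|a s] [-> _].
- by move=> z zs; apply: sq; rewrite E mem_cat zs.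
Qed.

(** Stop an induced path at its first vertex satisfying [f], then restart it at the last vertex up
    to there that satisfies [g]. *)
Lemma conn_link (A : {set V}) (g f : pred V) : conn A ->
  (exists2 x, x \in A & g x) -> (exists2 y, y \in A & f y) ->
  exists p, [/\ p != [::], ipath p, {subset p <= A},
     forall z, z \in p -> g z = (z == head z p) &
     forall z, z \in p -> f z = (z == last z p)].
Proof.
move=> cA [x xA gx] fA.
have [s [z [is_ fz nf hs ss]]] := conn_first cA xA fA.
have : has g (rev (rcons s z)).
  rewrite has_rev; apply/hasP; exists x => //; by rewrite -hs; case: (s) => [|a l]; rewrite ?mem_head.
move=> /split_find; case E: _ _ _ / => [u s1 s2 gu ng].
have {}E : rcons s z = rev s2 ++ u :: rev s1.
  by rewrite -[LHS]revK E rev_cat rev_rcons.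
exists (u :: rev s1); split => //.
- by apply: (@ipath_catr (rev s2)); rewrite -E.
- by move=> w ws; apply: ss; rewrite E mem_cat ws orbT.
- move=> w; rewrite inE mem_rev /= => /predU1P[->|ws]; first by rewrite gu eqxx.
  have -> : g w = false by apply: contraNF ng => gw; apply/hasP; exists w.
  have iu : ipath (u :: rev s1) by apply: (@ipath_catr (rev s2)); rewrite -E.
  apply/esym/negbTE; apply: contraTneq ws => ->; rewrite -mem_rev.
  by case/andP: iu.
move=> w ws /=.
have lz : last u (rev s1) = z.
  have := congr1 (last z) E; by rewrite last_rcons last_cat.
have un : uniq (rcons s z) by apply: ipath_uniq.
have wz : w \in rcons s z by rewrite E mem_cat ws orbT.
rewrite lz; move: wz; rewrite mem_rcons inE => /predU1P[->|wz]; first by rewrite fz eqxx.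
have -> : f w = false by apply: contraNF nf => fw; apply/hasP; exists w.
by apply/esym/negbTE; apply: contraTneq wz => ->; move: un; rewrite rcons_uniq => /andP[].
Qed.

Lemma comp_in (A : {set V}) x : x \in A -> x \in component A x.
Proof. by move=> xA; rewrite inE xA connect0. Qed.

Lemma comp_sub (A : {set V}) x : component A x \subset A.
Proof. by apply/subsetP => y; rewrite inE => /andP[]. Qed.

Lemma comp_closed (A : {set V}) x u v : u \in component A x -> v \in A -> e u v -> v \in component A x.
Proof.
rewrite !inE => /andP[uA c] vA euv; rewrite vA /=.
by apply: connect_trans c (connect1 _); rewrite /= uA vA.
Qed.

Lemma comp_max (A : {set V}) x (B : {set V}) : B \subset A -> conn B ->
  (exists2 y, y \in B & y \in component A x) -> B \subset component A x.
Proof.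
move=> /subsetP sBA cB ex; apply: (conn_closed cB) => // u v uc uB vB euv.
by apply: comp_closed uc _ euv; apply: sBA.
Qed.

Lemma comp_conn (A : {set V}) x : x \in A -> conn (component A x).
Proof.
move=> xA; apply: (@conn_cut _ x) => //; first exact: comp_in.
move=> X sX xX cl; apply/subsetP => y; rewrite inE => /andP[yA /connectP[p pp ->]].
have clC u v := @comp_closed A x u v.
have xC := comp_in xA; move: xC xX pp {xA yA}.
move: (component A x) cl sX clC => C cl sX clC.
elim: p x => //= u p IH x xC xX /andP[/and3P[xA uA exu] pp].
have uC : u \in C by apply: clC exu.
by apply: (IH u uC) => //; apply: (cl x).
Qed.

End Basics.
Arguments ipath : simpl never.
Arguments hole : simpl never.

(** * Ear decompositions of atoms *)

Section Holes.
Variables (V : finType) (e : rel V).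
Hypothesis es : symmetric e.
Hypothesis ei : irreflexive e.
Hypothesis tf : forall x y z, e x y -> e y z -> e x z -> False.
Hypothesis T1 : T1_free e.

Notation ipath := (ipath e).
Notation hole := (hole e).
Notation conn := (conn e).
Notation clique := (clique e).

Lemma ipath_glue s b t : ipath (rcons s b) -> ipath (b :: t) ->
  (forall u v, u \in s -> v \in t -> u != v /\ ~~ e u v) -> ipath (s ++ b :: t).
Proof.
rewrite -cats1 => /ipath_cat[i1 _ c1] i2 cr; apply/ipath_cat; split => //.
move=> u v us; rewrite inE => /predU1P[->|vt]; first by apply: c1 => //; rewrite inE.
have [un en] := cr u v us vt; split => //.
rewrite (negbTE en) /=; case: eqP => //= _; apply/esym/negbTE.
apply: contraTneq vt => ->; by case/andP: i2.
Qed.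

Lemma hole_rot1 x y p : hole (x :: y :: p) -> hole (y :: rcons p x).
Proof.
move=> /and4P[iyp sz xyp /allP H].
have ip := ipath_cons iyp.
move: xyp; rewrite inE negb_or => /andP[xy xp].
have yp : y \notin p by case/andP: iyp.
have i1 : ipath (rcons p x).
  apply: ipath_rcons => // u up.
  have /H/eqP : u \in y :: p by rewrite inE up orbT.
  rewrite es => ->; have -> : (u == y) = false by apply: contraNF yp => /eqP <-.
  by rewrite /=; case: (p) up.
rewrite /hole i1 size_rcons sz mem_rcons inE negb_or eq_sym xy yp /=.
apply/allP => z; rewrite mem_rcons inE last_rcons => /predU1P[->|zp].
  by rewrite eqxx orbT es; have /H := mem_head y p => /eqP ->; rewrite /= eqxx.
rewrite (ipath_head iyp zp).
have -> : (z == x) = false by apply: contraNF xp => /eqP <-.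
by rewrite orbF; case: (p) zp.
Qed.

Lemma hole_rebase c x : hole c -> x \in c -> exists p, hole (x :: p) /\ c =i x :: p.
Proof.
move=> hc /rot_to[i p E].
have H n : hole (rot n c).
  elim: n => [|n IH]; first by rewrite rot0.
  case: (ltnP n (size c)) => [lt|ge]; last by rewrite rot_oversize // ltnW.
  rewrite rotS //; move: IH; case: (rot n c) => // u [|v q]; first by [].
  by move=> /hole_rot1; rewrite rot1_cons.
exists p; split; first by rewrite -E.
by move=> z; rewrite -E mem_rot.
Qed.

Lemma hole_uniq c : hole c -> uniq c.
Proof. by case: c => //= x p /and4P[/ipath_uniq -> _ -> _]. Qed.

Lemma hole_size c : hole c -> 3 < size c.
Proof. by case: c => //= x p /and4P[_ sz _ _]. Qed.

Lemma hole_two_paths a b p q : ipath (a :: rcons p b) -> ipath (a :: rcons q b) ->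
  ~~ e a b -> (forall u v, u \in p -> v \in q -> u != v /\ ~~ e u v) ->
  hole (a :: p ++ b :: rev q).
Proof.
move=> ip iq nab cr.
case: p ip cr => [|p0 p] ip cr; first by move: nab; have := ipath_path ip; rewrite /= => /andP[->].
case: q iq cr => [|q0 q] iq cr; first by move: nab; have := ipath_path iq; rewrite /= => /andP[->].
have up := ipath_uniq ip; have uq := ipath_uniq iq.
have i1 : ipath ((p0 :: p) ++ b :: rev (q0 :: q)).
  apply: ipath_glue.
  - exact: ipath_cons ip.
  - by rewrite -rev_rcons (ipath_rev es); apply: ipath_cons iq.
  - by move=> u v us; rewrite mem_rev => vs; apply: cr.
rewrite /hole /= -cat_cons i1; apply/and4P; split=> //.
- by rewrite size_cat /= size_rev /=; lia.
- move: up uq; rewrite /= !inE !mem_cat !mem_rcons !inE !negb_or mem_rev inE negb_or.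
  by move=> /andP[/and3P[-> -> ->] _] /andP[/and3P[-> _ ->] _].
have -> : last p0 (p ++ b :: rev (q0 :: q)) = q0.
  by rewrite last_cat /= rev_cons last_rcons.
suff : all (fun z => e a z == (z == p0) || (z == q0))
  ((p0 :: p) ++ b :: rev (q0 :: q)) by [].
apply/allP => z; rewrite mem_cat [z \in b :: _]inE mem_rev => /or3P[zp|/eqP ->|zq].
- have zr : z \in rcons (p0 :: p) b by rewrite mem_rcons inE zp orbT.
  rewrite (ipath_head ip zr) /=.
  have [|zq _] := cr z q0 zp; first exact: mem_head.
  by rewrite (negbTE zq) orbF.
- rewrite (negbTE nab); move: up uq; rewrite /= !mem_rcons !inE !negb_or.
  by move=> /andP[_ /andP[/andP[]]]; rewrite eq_sym => /negbTE -> _ _ /andP[_ /andP[/andP[]]]; rewrite eq_sym => /negbTE ->.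
have zr : z \in rcons (q0 :: q) b by rewrite mem_rcons inE zq orbT.
rewrite (ipath_head iq zr) /=.
have [|pz _] := cr p0 z _ zq; first exact: mem_head.
by rewrite [z == p0]eq_sym (negbTE pz).
Qed.

Lemma hole_arcs c a b : hole c -> a \in c -> b \in c -> a != b -> ~~ e a b ->
  exists p q, [/\ ipath (a :: rcons p b), ipath (a :: rcons q b),
    c =i a :: b :: p ++ q & forall u v, u \in p -> v \in q -> u != v /\ ~~ e u v].
Proof.
move=> hc ac bc ab nab.
have [p [hp cp]] := hole_rebase hc ac.
have /and4P[ip sz ap /allP H] := hp.
have bp : b \in p by move: bc; rewrite cp inE eq_sym (negbTE ab).
have bh : b != head a p /\ b != last a p.
  by have /H := bp; rewrite (negbTE nab) => /eqP/esym/negbT; rewrite negb_or => /andP[].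
case/splitPr: p / bp ip sz ap H bh hp cp => p q ip sz ap H [bh bl] hp cp.
have uq := ipath_uniq ip.
have [ip1 iq1 cr] := (ipath_cat e p (b :: q)).1 ip.
case: p ip sz ap H bh bl hp cp uq ip1 cr => [|p0 p] ip sz ap H bh bl hp cp uq ip1 cr.
  by rewrite eqxx in bh.
case/lastP: q ip sz ap H bl hp cp uq iq1 cr {bh} => [|q ql] ip sz ap H bl hp cp uq iq1 cr.
  by rewrite last_cat eqxx in bl.
have i1 : ipath (rcons (p0 :: p) b).
  by apply: (@ipath_catl _ _ _ (rcons q ql)); rewrite cat_rcons.
have Hh z : z \in p0 :: p -> e a z = (z == p0).
  move=> zp; have /H/eqP -> : z \in (p0 :: p) ++ b :: rcons q ql by rewrite mem_cat zp.
  rewrite /= last_cat /= last_rcons.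
  suff -> : (z == ql) = false by rewrite orbF.
  have [|zn _] := cr z ql zp; last exact/negbTE.
  by rewrite inE mem_rcons mem_head orbT.
have Hl z : z \in rcons q ql -> e a z = (z == ql).
  move=> zp; have /H/eqP -> : z \in (p0 :: p) ++ b :: rcons q ql by rewrite mem_cat [z \in b :: _]inE zp !orbT.
  rewrite /= last_cat /= last_rcons.
  suff -> : (z == p0) = false by [].
  have [||zn _] := cr p0 z; rewrite ?mem_head // ?inE ?zp ?orbT //.
  by rewrite eq_sym; apply/negbTE.
have an z : z \in (p0 :: p) ++ b :: rcons q ql -> a != z by move=> zs; apply: contraNneq ap => ->.
exists (p0 :: p), (rev (rcons q ql)); split.
- apply: (ipath_cat e [:: a] (rcons (p0 :: p) b)).2; split => //.
  move=> u v; rewrite inE => /eqP -> /=; rewrite eqxx /= -rcons_cons mem_rcons inE => /predU1P[->|vs].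
    split; first by apply: an; rewrite mem_cat mem_head orbT.
    rewrite (negbTE nab); apply/esym/negbTE; apply: contraTneq uq => ->.
    by rewrite /= mem_cat mem_head orbT.
  split; last exact: Hh.
  by apply: an; rewrite mem_cat vs.
- apply: (ipath_cat e [:: a] (rcons (rev (rcons q ql)) b)).2; split => //.
    by rewrite -rev_cons (ipath_rev es).
  move=> u v; rewrite inE => /eqP -> /=; rewrite eqxx /= mem_rcons inE mem_rev => /predU1P[->|vs].
    split; first by apply: an; rewrite mem_cat mem_head orbT.
    rewrite (negbTE nab) rev_rcons /=; apply/esym/negbTE; apply: contraTneq uq => ->.
    by rewrite cat_uniq /= mem_rcons mem_head !andbF.
  split; last by rewrite rev_rcons; apply: Hl.
  by apply: an; rewrite mem_cat [v \in b :: _]inE vs !orbT.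
- move=> z; rewrite cp !inE !mem_cat !inE mem_rev.
  by do ![case: (_ == _) => //=]; rewrite ?orbT.
move=> u v us; rewrite mem_rev => vs.
have [|un ->] := cr u v us; first by rewrite inE vs orbT.
split => //; rewrite /= negb_and; apply/orP; right.
by apply: contraTneq vs => ->; move: uq; rewrite cat_uniq => /and3P[_ _ /andP[]].
Qed.

(** A clique meets a hole in at most two vertices, and these are consecutive. After rotating a
    vertex [z] of [K] to the front, only the two ends of the remaining path can lie in [K], and not
    both, as they are nonadjacent. *)
Lemma hole_minus_clique c K : hole c -> clique K -> conn ([set z in c] :\: K).
Proof.
move=> hc cK.
case: (pselect (exists2 z, z \in K & z \in c)) => [[z zK zc]|no]; last first.
  have -> : [set z in c] :\: K = [set z in c].
    apply/setP => z; rewrite !inE; case zc: (z \in c); rewrite ?andbF // andbT.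
    by apply/negP => zK; apply: no; exists z.
  case: (c) hc {no} => // x p /and4P[ip sz xp /allP H].
  apply: path_conn => //; case: p ip sz xp H => // y p ip sz xp H.
  by rewrite /= (ipath_path ip) (eqP (H _ (mem_head _ _))) eqxx.
have [p [hp cp]] := hole_rebase hc zc.
have /and4P[ip sz zp /allP H] := hp.
have -> : [set z in c] :\: K = [set z in p] :\: K.
  apply/setP => w; rewrite !inE cp inE; case: eqP => // ->; by rewrite zK.
have un := ipath_uniq ip.
have HK w : w \in p -> w \in K -> w = head z p \/ w = last z p.
  move=> wp wK; have zw : z != w by apply: contraNneq zp => ->.
  have := H _ wp; rewrite (cK z w zK wK zw) => /eqP/esym/orP[]/eqP; by [left|right].
case: p ip sz un HK {hp cp H zp} => // a p ip sz un HK.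
case/lastP: p ip sz un HK => // p b ip sz un HK.
have nab : ~~ e a b.
  have bp : b \in rcons p b by rewrite mem_rcons mem_head.
  rewrite (ipath_head ip bp); case: (p) sz un => //= p0 p' _ /and3P[_ + _].
  by apply: contraNneq => <-; rewrite mem_rcons mem_head.
have abn : a != b by move: un; rewrite /= mem_rcons inE negb_or => /andP[/andP[]].
move: HK; rewrite /= last_rcons => HK.
case aK : (a \in K); case bK : (b \in K).
- by move: nab; rewrite cK.
- have -> : [set z in a :: rcons p b] :\: K = [set z in rcons p b].
    apply/setP => w; rewrite !inE; case: eqP => [->|wa /=].
      by rewrite aK /=; move: un => /= /andP[/negbTE ->].
    case wp: (w \in rcons p b); rewrite ?andbF ?andbT //.
    apply/negP => wK; have [|//|wb] := HK w _ wK; first by rewrite inE wp orbT.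
    by rewrite wb bK in wK.
  by apply: (@ipath_conn _ e) => //; apply: ipath_cons ip.
- have -> : [set z in a :: rcons p b] :\: K = [set z in a :: p].
    apply/setP => w; rewrite !inE mem_rcons inE.
    case: (w =P b) => [->|wb /=].
      rewrite bK /=; move: un; rewrite -rcons_cons rcons_uniq inE => /andP[/negbTE ->] //.
    case wp: ((w == a) || (w \in p)); rewrite ?andbF ?andbT //.
    apply/negP => wK; have [|wa|//] := HK w _ wK.
      by rewrite inE mem_rcons inE orbCA wp orbT.
    by rewrite wa aK in wK.
  by apply: (@ipath_conn _ e) => //; apply: (@ipath_catl _ _ _ [:: b]); rewrite cats1.
have -> : [set z in a :: rcons p b] :\: K = [set z in a :: rcons p b].
  apply/setP => w; rewrite [LHS]in_setD andbC; case wp: (w \in _) => //=.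
  move: wp; rewrite inE => wp.
  apply/negP => wK; have [//|wa|wb] := HK w _ wK.
    by rewrite wa aK in wK.
  by rewrite wb bK in wK.
by apply: (@ipath_conn _ e).
Qed.

Definition good (A : {set V}) : Prop := forall x y, x \in A -> y \in A ->
  exists c, [/\ hole c, {subset c <= A}, x \in c & y \in c].

(** A set without clique cutset. [K] may be empty, so an atom is connected; the bound on the size
    excludes single vertices and edges, which lie on no hole. *)
Definition atom (A : {set V}) : Prop :=
  (forall K, clique K -> conn (A :\: K)) /\ 2 < #|A|.

(** Nonadjacency of [a] and [b] and the last clause are what is needed to close the ear to a hole
    with any induced path of [S] from [a] to [b]. *)
Definition ear (S : {set V}) r a b : Prop :=
  [/\ ipath (a :: rcons r b), ~~ e a b, a \in S /\ b \in S,
      forall u, u \in r -> u \notin S &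
      forall u w, u \in r -> w \in S -> e u w -> w = a \/ w = b].

(** Two neighbours of [v] in [S] would lie on a hole inside [S], which avoids [v]. *)
Lemma good_one S v a b : good S -> v \notin S -> a \in S -> b \in S ->
  e v a -> e v b -> a = b.
Proof.
move=> gS vS aS bS; have [c [hc sc ac bc]] := gS a b aS bS.
by apply: (T1 hc) => //; apply: contra vS; apply: sc.
Qed.

Lemma clique1 x : clique [set x].
Proof. by move=> u v; rewrite !inE => /eqP -> /eqP ->; rewrite eqxx. Qed.

Lemma cliq0 : clique set0.
Proof. by move=> u v; rewrite inE. Qed.

Lemma ear_rev S r a b : ear S r a b -> ear S (rev r) b a.
Proof.
case=> ir nab [aS bS] rS att; split => //.
- by rewrite -(ipath_rev es) rev_cons rev_rcons revK.
- by rewrite es.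
- by move=> u; rewrite mem_rev; apply: rS.
- by move=> u w; rewrite mem_rev => ur wS /(att u w ur wS)[]; [right|left].
Qed.

Lemma ear_neq S r a b : ear S r a b -> a != b.
Proof.
case=> /ipath_uniq /= /andP[]; rewrite mem_rcons inE negb_or => /andP[] //.
Qed.

(** By T1-freeness [z] lies on [c], so [c] is [z] followed by an induced path between [a] and [b].
    Replacing [z] by [r] gives a hole that avoids [z] but contains its two neighbours [a] and
    [b]. *)
Lemma no_common_nbr c a b z r : hole c -> a \in c -> b \in c -> ~~ e a b -> a != b ->
  e z a -> e z b -> ipath (a :: rcons r b) -> (forall u, u \in r -> u \notin c) ->
  (forall u w, u \in r -> w \in c -> e u w -> [\/ w = a, w = b | w = z]) ->
  z \notin r -> False.
Proof.
move=> hc ac bc nab ab za zb ir rc att zr.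
case zc : (z \in c); last by move: ab; rewrite (T1 hc (negbT zc) ac bc za zb) eqxx.
have [p [hp cp]] := hole_rebase hc zc.
have /and4P[ip sz zp /allP H] := hp.
have an : a != z by rewrite eq_sym (neq_edge ei).
have bn : b != z by rewrite eq_sym (neq_edge ei).
have ap : a \in p by move: ac; rewrite cp inE (negbTE an).
have bp : b \in p by move: bc; rewrite cp inE (negbTE bn).
have [p' [ip' sp']] : exists p', ipath (a :: rcons p' b) /\ a :: rcons p' b =i p.
  have := H _ ap; have := H _ bp; rewrite za zb => /eqP/esym + /eqP/esym.
  case: p ip sz {H hp cp zp ap bp} => // x p ip sz; case/lastP: p ip sz => // p y ip sz.
  rewrite /= last_rcons => /orP[]/eqP eb /orP[]/eqP ea.
  - by move: ab; rewrite ea eb eqxx.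
  - exists (rev p); rewrite ea eb; split; last first.
      by move=> w; rewrite !inE !mem_rcons !inE mem_rev; do 2!case: (w == _).
    by rewrite -(ipath_rev es) rev_cons rev_rcons revK.
  - by exists p; rewrite ea eb.
  - by move: ab; rewrite ea eb eqxx.
have rc' u : u \in a :: rcons p' b -> u \in c by move=> us; rewrite cp inE -sp' us orbT.
have hh : hole (a :: p' ++ b :: rev r).
  apply: hole_two_paths => // u v up vr.
  have uc : u \in c by apply: rc'; rewrite inE mem_rcons inE up !orbT.
  split; first by apply: contraNneq (rc v vr) => <-.
  rewrite es; apply/negP => /(att v u vr uc) [] eu.
  - by move: (ipath_uniq ip'); rewrite /= mem_rcons inE -eu up orbT.
  - by move: (ipath_uniq ip'); rewrite -rcons_cons rcons_uniq inE -eu up orbT.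
  - by move: zp; rewrite -sp' -eu inE mem_rcons inE up !orbT.
move: ab; rewrite (T1 (v := z) hh _ _ _ za zb) ?eqxx ?mem_head //.
  move: zp; rewrite -sp' !inE mem_rcons !inE mem_cat inE mem_rev (negbTE zr) !negb_or andbT.
  by move=> /and3P[-> -> ->].
by rewrite inE mem_cat mem_head !orbT.
Qed.

(** The vertices of [S] attached to a component of [A :\: S] do not form a clique, since [A] is an
    atom. A shortest path through the component between two nonadjacent attachments [a], [b] is an
    ear: a further attachment is impossible by minimality and T1-freeness. *)
Lemma ear_exists (A S : {set V}) y : atom A -> S \subset A -> good S -> S != set0 ->
  y \in A -> y \notin S ->
  exists r a b, ear S r a b /\ {subset r <= A :\: S}.
Proof.
move=> [cA _] /subsetP sSA gS /set0Pn[s0 s0S] yA yS.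
pose D := component e (A :\: S) y.
have yAS : y \in A :\: S by rewrite inE yS.
have cD : conn D := comp_conn es yAS.
have yD : y \in D := comp_in e yAS.
have sD : {subset D <= A :\: S} by apply/subsetP/comp_sub.
pose K := nbr e D :&: S.
have [a0 [b0 [aK bK ab0 nab0]]] : exists a b, [/\ a \in K, b \in K, a != b & ~~ e a b].
  apply: contrapT => no.
  have cK : clique K.
    by move=> u v uK vK uv; apply: contrapT => /negP nuv; apply: no; exists u, v.
  (* If the attachments formed a clique, connectedness of [A :\: K] would push all of it into [D];
     then [S], and with it a whole hole, would lie in the clique [K]. *)
  have sub : A :\: K \subset D.
    apply: conn_closed (cA K cK) _ _; last first.
      by exists y => //; rewrite in_setD yA andbT in_setI (negbTE yS) andbF.
    move=> u v uD _ vAK euv; move: vAK; rewrite in_setD => /andP[vK vA].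
    apply: (comp_closed uD _ euv); rewrite inE vA andbT; apply: contra vK => vS.
    by rewrite /K in_setI vS andbT; apply/nbrP; exists u.
  have SK u : u \in S -> u \in K.
    move=> uS; apply: contraT => uK.
    have /sD : u \in D by apply: (subsetP sub); rewrite in_setD uK sSA.
    by rewrite inE uS.
  have [c [hc sc _ _]] := gS _ _ s0S s0S.
  case: c hc sc => // x p /and4P[ip sz xp /allP H] sc.
  case: p ip sz xp H sc => // p1 [|p2 [|p3 p]] // ip _ xp H sc.
  have := H p2; rewrite !inE eqxx orbT => /(_ isT) /=.
  have := ipath_uniq ip; rewrite /= !inE !negb_or => /and4P[/and3P[p12 _ _] p2p _ _].
  have -> : (p2 == last p3 p) = false.
    by apply/negbTE; move: p2p; rewrite -negb_or -in_cons; apply: contraNneq => ->; apply: mem_last.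
  rewrite orbF [p2 == p1]eq_sym (negbTE p12) cK //.
  - by apply/SK/sc/mem_head.
  - by apply/SK/sc; rewrite !inE eqxx !orbT.
  - by apply: contraNneq xp => ->; rewrite !inE eqxx !orbT.
pose P r := exists a b, [/\ ipath r, {subset r <= D}, r != [::] &
   [/\ a \in S, b \in S, a != b, ~~ e a b & e a (head a r) /\ e b (last b r)]].
have exP : exists r, P r.
  move: aK bK; rewrite !inE => /andP[/existsP[u /andP[uD ua]] aS] /andP[/existsP[w /andP[wD wb]] bS].
  have [p [ip lp sp]] := conn_ipath cD uD wD.
  exists (u :: p), a0, b0; split => //; split => //=.
  by rewrite lp es ua es wb.
have [r [[a [b [ir rD r0 [aS bS ab nab [ea eb]]]]] rmin]] := exists_min size exP.
have rS u : u \in r -> u \notin S by move=> /rD/sD; rewrite inE => /andP[].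
(* attachments away from the head, resp. the last vertex, would give a shorter path *)
have sh1 r1 u r2 w : r = r1 ++ u :: r2 -> r1 != [::] -> w \in S -> e u w ->
    (w == b) || e w b.
  move=> E r1n wS euw; apply: contraT; rewrite negb_or => /andP[wb nwb].
  have : P (u :: r2).
    exists w, b; split => //.
    - by move: ir; rewrite E => /ipath_catr.
    - by move=> z zr; apply: rD; rewrite E mem_cat zr orbT.
    split => //=; split; first by rewrite es.
    by move: eb; rewrite E last_cat.
  by move=> /rmin; rewrite E size_cat -{2}[size (u :: r2)]add0n leq_add2r leqn0 size_eq0 (negbTE r1n).
have sh2 r1 u r2 w : r = r1 ++ u :: r2 -> r2 != [::] -> w \in S -> e u w ->
    (w == a) || e w a.
  move=> E r2n wS euw; apply: contraT; rewrite negb_or => /andP[wa nwa].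
  have : P (rcons r1 u).
    exists a, w; split => //.
    - by move: ir; rewrite E -cat_rcons => /ipath_catl.
    - by move=> z zr; apply: rD; rewrite E -cat_rcons mem_cat zr.
    - by case: (r1).
    split => //; rewrite 1?eq_sym //; first by rewrite es.
    split; last by rewrite last_rcons es.
    by move: ea; rewrite E; case: (r1).
  by move=> /rmin; rewrite E size_cat size_rcons addnS ltnS -{2}[size r1]addn0 leq_add2l leqn0 size_eq0 (negbTE r2n).
have ea' u : u \in r -> e a u = (u == head u r).
  move=> ur; have [r1 [r2 E]] := mem_split ur.
  apply/idP/eqP => [eau|]; last by move=> ->; move: ea r0; case: (r).
  case: r1 E => [->//|x r1] E.
  have := @sh1 (x :: r1) u r2 a; rewrite E es eau => /(_ erefl isT aS isT).
  by rewrite (negbTE ab) (negbTE nab).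
have eb' u : u \in r -> e u b = (u == last u r).
  move=> ur; have [r1 [r2 E]] := mem_split ur.
  rewrite es; apply/idP/eqP => [ebu|lu]; last first.
    by rewrite lu; move: eb r0; case: (r).
  case: r2 E => [|x r2] E; first by rewrite E last_cat.
  have := @sh2 r1 u (x :: r2) b; rewrite E es ebu => /(_ erefl isT bS isT).
  by rewrite eq_sym (negbTE ab) es (negbTE nab).
have iar : ipath (a :: rcons r b).
  apply: (ipath_cat e [:: a] (rcons r b)).2; split => //.
    apply: ipath_rcons => //; first by apply/negP => /rS; rewrite bS.
  move=> u v; rewrite inE => /eqP -> /=; rewrite eqxx mem_rcons inE => /predU1P[->|vr].
    split => //; rewrite (negbTE nab); apply/esym/negbTE.
    case: (r) r0 rS => //= x r' _ rS; apply: contraNneq (rS x (mem_head _ _)) => <- //.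
  split; first by apply: contraNneq (rS v vr) => <-.
  by rewrite ea' //; case: (r) vr.
exists r, a, b; split; last by move=> u /rD/sD.
split => //.
move=> u0 z u0r zS ez; apply: contrapT => /not_orP[za zb].
(* An attachment other than [a] and [b] is adjacent to both of them, by minimality from either side.
   Such attachments on a hole through [a] and [b] all coincide with [z], and then [no_common_nbr]
   applies. *)
have inner u w : u \in r -> w \in S -> e u w -> w <> a -> w <> b ->
    [/\ e w a, e w b & exists x r1 r2 y1, r = x :: r1 ++ u :: rcons r2 y1].
  move=> ur wS ew wa wb.
  have [r1 [r2 E]] := mem_split ur.
  case: r1 E => [|x r1] E.
    case: wa; apply: (good_one gS (v := u)) => //; first exact: rS.
    by move: ea; rewrite E /= es.
  case/lastP: r2 E => [|r2 y1] E.
    case: wb; apply: (good_one gS (v := u)) => //; first exact: rS.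
    by move: eb; rewrite E last_cat /= es.
  have := sh1 (x :: r1) u (rcons r2 y1) w; rewrite E => /(_ erefl isT wS ew) /orP[/eqP//|->].
  have := sh2 (x :: r1) u (rcons r2 y1) w; rewrite E => /(_ erefl _ wS ew) /orP[|/eqP//|->].
    by case: (r2).
  by split => //; exists x, r1, r2, y1.
have [eza ezb _] := inner _ _ u0r zS ez za zb.
have [c [hc sc ac bc]] := gS a b aS bS.
(* two inner attachments [z <> w] would be nonadjacent, and joined by a shorter path *)
have uniqz u w : u \in r -> w \in c -> e u w -> [\/ w = a, w = b | w = z].
  move=> ur wc ew; apply: contrapT => no.
  have wS := sc _ wc.
  have [wa wb wz] : [/\ w <> a, w <> b & w <> z].
    by split => h; apply: no; [apply: Or31|apply: Or32|apply: Or33].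
  have [ewa ewb [x [r1 [r2 [y1 E]]]]] := inner _ _ ur wS ew wa wb.
  have nzw : ~~ e z w by apply/negP => h; apply: (tf h ewa eza).
  have uu : u0 != u.
    apply/negP => /eqP h; case: wz; apply/esym; apply: (good_one gS (v := u)) => //; first exact: rS.
    by rewrite -h.
  have short s : ipath s -> {subset s <= r} -> size s < size r -> s != [::] ->
      (e z (head z s) /\ e w (last w s)) \/ (e w (head w s) /\ e z (last z s)) -> False.
    move=> is_ ss sz sn h.
    suff /rmin : P s by rewrite leqNgt sz.
    by case: h => h; [exists z, w|exists w, z]; split => //; (try by move=> v /ss/rD); split => //;
      rewrite 1?es //; apply/eqP => // h'; apply: wz.
  move: u0r; rewrite {1}E inE mem_cat inE mem_rcons inE => /or4P[/eqP h|u0r|h|].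
  - subst x; case: za; apply: (good_one gS (v := u0)) => //.
      by apply: rS; rewrite E mem_head.
    by move: ea; rewrite E /= es.
  - case/splitPr: r1 / u0r E => r1 r3 E.
    apply: (short (u0 :: rcons r3 u)).
    - have E' : r = (x :: r1) ++ (u0 :: rcons r3 u) ++ rcons r2 y1 by rewrite E /= -catA /= cat_rcons.
      by move: ir; rewrite E' => /ipath_catr /ipath_catl.
    - move=> v; rewrite E !(inE, mem_cat, mem_rcons) => /or3P[] -> //; by rewrite ?orbT.
    - by rewrite E /=; do ?rewrite ?(size_cat, size_rcons) /=; clear; lia.
    - by [].
    - by left; rewrite /= last_rcons es ez es ew.
  - by rewrite h in uu.
  case/orP => [/eqP h|u0r].
    subst y1; case: zb; apply: (good_one gS (v := u0)) => //.
      by apply: rS; rewrite E !(inE, mem_cat, mem_rcons) eqxx !orbT.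
    by move: eb; rewrite E /= last_cat /= last_rcons es.
  case/splitPr: r2 / u0r E => r2 r3 E.
  apply: (short (u :: rcons r2 u0)).
  - have E' : r = (x :: r1) ++ (u :: rcons r2 u0) ++ rcons r3 y1 by rewrite E /= rcons_cat /= cat_rcons.
    by move: ir; rewrite E' => /ipath_catr /ipath_catl.
  - move=> v; rewrite E !(inE, mem_cat, mem_rcons) => /or3P[] -> //; by rewrite ?orbT.
  - by rewrite E /=; do ?rewrite ?(size_cat, size_rcons) /=; clear; lia.
  - by [].
  - by right; rewrite /= last_rcons es ew es ez.
apply: (no_common_nbr hc ac bc nab ab eza ezb iar) => //.
  by move=> u ur; apply: contra (rS _ ur); apply: sc.
by apply/negP => /rS; rewrite zS.
Qed.

Lemma hole_card c : hole c -> 2 < #|[set z in c]|.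
Proof.
move=> hc; rewrite cardsE (card_uniqP (hole_uniq hc)).
exact: ltnW (hole_size hc).
Qed.

Lemma good_minus_clique S K : good S -> clique K -> conn (S :\: K).
Proof.
move=> gS cK X sX /set0Pn[y yX] cl; apply/subsetP => w wSK.
have := subsetP sX _ yX; rewrite inE => /andP[yK yS].
have [wK wS] : w \notin K /\ w \in S by move: wSK; rewrite inE => /andP[].
have [c [hc sc yc wc]] := gS y w yS wS.
have /subsetP : [set z in c] :\: K \subset X.
  apply: (conn_closed (hole_minus_clique hc cK)).
    move=> u v uX _; rewrite !inE => /andP[vK vc] euv.
    by apply: (cl u) => //; rewrite inE vK sc.
  by exists y; rewrite ?inE ?yK.
by apply; rewrite !inE wK.
Qed.

Lemma ear_hole S r a b : good S -> ear S r a b -> exists c,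
  [/\ hole c, {subset c <= S :|: [set z in r]}, a \in c, b \in c & {subset r <= c}].
Proof.
move=> gS er; have ab := ear_neq er; case: er => ir nab [aS bS] rS att.
have [c [hc sc ac bc]] := gS a b aS bS.
have [p [q [ip iq cpq _]]] := hole_arcs hc ac bc ab nab.
have pc u : u \in p -> u \in c by move=> up; rewrite cpq !inE mem_cat up !orbT.
exists (a :: p ++ b :: rev r); split.
- apply: hole_two_paths => // u v up vr; have uS := sc _ (pc _ up).
  split; first by apply: contraNneq (rS v vr) => <-.
  rewrite es; apply/negP => /(att v u vr uS) [] eu.
    by move: (ipath_uniq ip); rewrite /= mem_rcons inE -eu up orbT.
  by move: (ipath_uniq ip); rewrite -rcons_cons rcons_uniq inE -eu up orbT.
- move=> u; rewrite !(inE, mem_cat, mem_rev) => /or4P[/eqP->|up|/eqP->|->]; rewrite ?aS ?bS ?orbT //.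
  by rewrite sc ?pc.
- exact: mem_head.
- by rewrite !(inE, mem_cat) eqxx !orbT.
by move=> u ur; rewrite !(inE, mem_cat, mem_rev) ur !orbT.
Qed.

(** Without [K], the set is the union of the connected sets [S :\: K] and hole minus [K], for a hole
    through the ear. They share [a] or [b], since these are nonadjacent and cannot both lie in
    [K]. *)
Lemma ear_atom S r a b : good S -> ear S r a b -> atom (S :|: [set z in r]).
Proof.
move=> gS er; have [c [hc sc ac bc rc]] := ear_hole gS er.
split; last first.
  apply: leq_trans (hole_card hc) (subset_leq_card _).
  by apply/subsetP => z; rewrite inE; apply: sc.
move=> K cK.
have ab := ear_neq er; case: er => _ nab [aS bS] _ _.
have -> : (S :|: [set z in r]) :\: K = (S :\: K) :|: ([set z in c] :\: K).
  apply/setP => z; rewrite !inE -andb_orr; congr (_ && _).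
  apply/idP/idP => [/orP[->//|/rc ->]|/orP[->//|/sc]]; rewrite ?orbT //.
  by rewrite !inE.
apply: connU => //; first exact: good_minus_clique.
  exact: hole_minus_clique.
case aK : (a \in K); last by exists a, a; rewrite !inE aK aS ac eqxx.
exists b, b; rewrite !inE bS bc eqxx.
case bK : (b \in K) => //; by move: nab; rewrite cK.
Qed.

(** Removing the empty clique or a single neighbour [u] leaves [A] connected, so [x] has a second
    neighbour. An induced path avoiding [x], from [u] to the first other neighbour of [x], closes up
    to a hole; it is long enough because there are no triangles. *)
Lemma hole_through A x : atom A -> x \in A ->
  exists c, [/\ hole c, {subset c <= A} & x \in c].
Proof.
move=> [cA cardA] xA.
have [u [uA exu]] : exists u, u \in A /\ e x u.
  apply: contrapT => no; have := cA set0 cliq0; rewrite setD0 => c0.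
  have : A \subset [set x].
    apply: (conn_closed c0); last by exists x; rewrite ?inE.
    by move=> y z; rewrite !inE => /eqP -> _ zA exz; case: no; exists z.
  by move=> /subset_leq_card; rewrite cards1; lia.
have [w [wA exw wu]] : exists w, [/\ w \in A, e x w & w != u].
  apply: contrapT => no.
  have : A :\: [set u] \subset [set x].
    apply: (conn_closed (cA _ (@clique1 u))); last first.
      by exists x; rewrite ?inE // xA andbT (neq_edge ei).
    move=> y z; rewrite !inE => /eqP -> _ /andP[zu zA] exz; case: no; exists z; by split.
  move=> /subset_leq_card; rewrite cards1 cardsDS ?sub1set // cards1; lia.
pose f := [pred z | e x z && (z != u)].
have ux : u != x by rewrite eq_sym (neq_edge ei).
have [p [z [ip fz nf hz sp]]] : exists p z, [/\ ipath (rcons p z), f z, ~~ has f p,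
    head z p = u & {subset rcons p z <= A :\: [set x]}].
  apply: conn_first (cA _ (@clique1 x)) _ _ => //; first by rewrite !inE ux.
  by exists w; rewrite /= ?inE ?exw ?wu // wA andbT eq_sym (neq_edge ei).
move: fz => /= /andP[exz zu].
exists (x :: rcons p z); split; last exact: mem_head; last first.
  by move=> y; rewrite inE => /predU1P[->//|/sp]; rewrite !inE => /andP[].
case: p ip hz nf sp => [|u' p] ip /= hz nf sp.
  by rewrite hz eqxx in zu.
subst u'; case: p ip nf sp => [|v p] ip nf sp.
  case: (tf exu _ exz); by have := ipath_path ip; rewrite /= andbT.
apply/and4P; split=> //.
- by rewrite /= size_rcons.
- by apply/negP => /sp; rewrite !inE eqxx.
apply/allP => y; rewrite /= last_rcons !(inE, mem_rcons) => yp.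
have un := ipath_uniq ip.
case: (y =P u) => [->|/eqP yu]; first by rewrite exu.
case: (y =P z) => [->|/eqP yz]; first by rewrite exz.
rewrite (negbTE yu) (negbTE yz) /= in yp.
apply/eqP/negbTE; apply/negP => exy; case/negP: nf.
by apply/orP; right; apply/hasP; exists y; rewrite /= ?exy // !inE.
Qed.

(* The induction step of [atom_good], for the pair formed by a vertex of [T] and a
   vertex of [r]; [S = T :|: E] is [T] with one ear, and [r] is an ear of [S]
   leading from [T] to a vertex [b] of that ear. *)
Lemma tripod_shortcut (A T : {set V}) E p q r a b E1 E2 x y :
  (forall A' : {set V}, A' \proper A -> atom A' -> good A') ->
  A = T :|: [set z in E] :|: [set z in r] -> good T -> ear T E p q ->
  ear (T :|: [set z in E]) r a b -> a \in T -> E = E1 ++ b :: E2 ->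
  E2 != [::] -> x \in T -> y \in r ->
  (exists c, [/\ hole c, {subset c <= A}, x \in c & y \in c]) \/ (p == a) || e p a.
Proof.
move=> IH eA gT eE er aT defE E2n xT yr.
case: (boolP ((p == a) || e p a)); [by right|rewrite negb_or => /andP[pa npa]; left].
have pq := ear_neq eE.
have [iE npq [pT qT] ET attE] := eE; have [ir nab _ rS attr] := er.
have rT u : u \in r -> u \notin T by move=> /rS; rewrite inE negb_or => /andP[].
have rE u : u \in r -> u \notin E by move=> /rS; rewrite !inE negb_or => /andP[].
have bE : b \in E by rewrite defE mem_cat mem_head orbT.
have bT := ET _ bE.
have uE : uniq (rcons E q) by have /= /andP[] := ipath_uniq iE.
have E1E u : u \in E1 -> u \in E by move=> uE1; rewrite defE mem_cat uE1.
have [uE12 bE2] : (forall u, u \in E1 -> u \notin E2) /\ b \notin E2.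
  move: uE; rewrite rcons_uniq defE cat_uniq /= => /and5P[_ _ /norP[_ /hasPn h] -> _]; split => // u u1.
  by apply/negP => /h; rewrite u1.
have bE1 : b \notin E1.
  by move: uE; rewrite rcons_uniq defE cat_uniq /= => /and4P[_ _]; rewrite negb_or => /andP[].
have E2l z0 : last z0 E \in E2.
  by rewrite defE last_cat /=; case: (E2) E2n => //= v s _; apply: mem_last.
have Eq u : u \in E -> e u q -> u \in E2.
  move: iE; rewrite -cats1 -cat_cons => /ipath_cat[_ _ h] ue euq.
  have [|_] := h u q _ (mem_head _ _); first by rewrite inE ue orbT.
  by rewrite euq => /esym/andP[/eqP -> _] /=.
(* Follow [E] from [p] to [b], then [r] backwards to [a]. Adding this ear to [T] misses the end of
   [E] beyond [b], which is nonempty, so the induction hypothesis applies. *)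
have ex : ear T (E1 ++ b :: rev r) p a.
  split => //.
  - rewrite rcons_cat rcons_cons -cat_cons; apply: ipath_glue.
    + by move: iE; rewrite defE rcons_cat rcons_cons -cat_rcons -cat_cons => /ipath_catl.
    + by rewrite -rev_cons -rev_rcons (ipath_rev es) rcons_cons.
    move=> u v up; rewrite mem_rcons inE mem_rev => /predU1P[->|vr].
      move: up; rewrite inE => /predU1P[->//|u1].
      split; first by apply: contraNneq (ET _ (E1E _ u1)) => ->.
      apply/negP => eua; case: (attE _ _ (E1E _ u1) aT eua) => [ap|aq].
        by rewrite ap eqxx in pa.
      by move: (uE12 _ u1); rewrite Eq ?E1E // -aq.
    have uS : u \in T :|: [set z in E].
      move: up; rewrite !inE => /predU1P[->|/E1E ->]; by rewrite ?pT ?orbT.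
    split; first by apply: contraNneq (rS _ vr) => <-.
    rewrite es; apply/negP => /(attr _ _ vr uS) [] h; move: up; rewrite h inE.
      by rewrite eq_sym (negbTE pa) => /E1E/ET; rewrite aT.
    by rewrite (negbTE bE1) orbF => /eqP bp; rewrite bp pT in bT.
  - by move=> u; rewrite mem_cat inE mem_rev => /or3P[/E1E/ET|/eqP ->|/rT].
  move=> u w; rewrite mem_cat inE mem_rev => /or3P[u1|/eqP->|ur] wT euw.
  - case: (attE _ _ (E1E _ u1) wT euw); first by left.
    by move=> wq; move: (uE12 _ u1); rewrite Eq ?E1E // -wq.
  - case: (attE _ _ bE wT euw); first by left.
    by move=> wq; move: bE2; rewrite Eq // -wq.
  case: (attr _ w ur _ euw); first by rewrite inE wT.
    by right.
  by move=> wb; rewrite -wb wT in bT.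
have gA' : good (T :|: [set z in E1 ++ b :: rev r]).
  apply: IH (ear_atom gT ex); rewrite properE; apply/andP; split.
    rewrite eA; apply/subsetP => z; rewrite !inE !mem_cat inE mem_rev.
    by case/or4P => [->|/E1E ->|/eqP ->|->]; rewrite ?bE ?orbT.
  apply/subsetPn; exists (last b E).
    by rewrite eA !inE defE mem_cat inE -defE E2l !orbT.
  rewrite inE negb_or; apply/andP; split.
    by apply: ET; rewrite defE mem_cat inE -defE E2l !orbT.
  rewrite inE mem_cat inE mem_rev; apply/negP => /or3P[/uE12|/eqP h|/rE].
  - by rewrite E2l.
  - by move: bE2; rewrite -h E2l.
  by rewrite {2}defE mem_cat inE E2l !orbT.
have [||c [hc sc xc yc]] := gA' x y.
- by rewrite inE xT.
- by rewrite !inE mem_cat inE mem_rev yr !orbT.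
exists c; split => // z /sc; rewrite eA !inE mem_cat inE mem_rev.
by case/or4P => [->|/E1E ->|/eqP ->|->]; rewrite ?bE ?orbT.
Qed.

(* The end [E = rcons E1 b] of the case analysis: the ear [r] closes up with [E1] and
   a path of [T] avoiding [q], a vertex adjacent to both [a] and [b]. *)
Lemma tripod_end (T : {set V}) E1 p q r a b :
  good T -> ear T (rcons E1 b) p q -> ear (T :|: [set z in rcons E1 b]) r a b ->
  a \in T -> E1 != [::] -> (q == a) || e q a -> False.
Proof.
move=> gT eE er aT E1n.
have pq := ear_neq eE; have ab := ear_neq er.
have [iE npq [pT qT] ET attE] := eE; have [ir nab _ rS attr] := er.
have bT : b \notin T by apply: ET; rewrite mem_rcons mem_head.
have ebq : e b q.
  move: iE; rewrite -rcons_cons -cats1 => /ipath_cat[_ _ h].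
  have [|_ ->] := h b q _ (mem_head _ _); first by rewrite -rcons_cons mem_rcons mem_head.
  by rewrite /= last_rcons !eqxx.
case/orP => [/eqP qa|eqa]; first by move: nab; rewrite -qa es ebq.
have aq : a != q by rewrite eq_sym (neq_edge ei).
have aTq : a \in T :\: [set q] by rewrite !inE aq.
have pTq : p \in T :\: [set q] by rewrite !inE pq.
have [s [is_ ls ss]] := conn_ipath (good_minus_clique gT (@clique1 q)) aTq pTq.
have sT u : u \in a :: s -> u \in T /\ u != q by move=> /ss; rewrite !inE => /andP[].
have i1 : ipath (a :: rcons (s ++ E1) b).
  rewrite rcons_cat -cat_cons; apply/ipath_cat; split => //.
    by move: iE; rewrite -cats1 -cat_cons => /ipath_catl/ipath_cons.
  move=> u v us vE; have [uT uq] := sT _ us.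
  split; first by apply: contraNneq (ET _ vE) => <-.
  have lp : last u (a :: s) = p by rewrite /= ls.
  have eE1 : head v (rcons E1 b) = head v (rcons (rcons E1 b) q) by case: (E1).
  rewrite lp; case: (u =P p) => [->|up] /=.
    rewrite (ipath_head iE) ?mem_rcons ?inE ?vE ?orbT //; by rewrite eE1.
  rewrite es; apply/negP => /(attE _ _ vE uT) [] // h.
  by rewrite h eqxx in uq.
have hh : hole (a :: (s ++ E1) ++ b :: rev r).
  apply: hole_two_paths => // u v us vr.
  have uS : u \in T :|: [set z in rcons E1 b].
    move: us; rewrite !inE mem_rcons inE mem_cat => /orP[us|->]; rewrite ?orbT //.
    by have /sT[-> _] : u \in a :: s by rewrite inE us orbT.
  split; first by apply: contraNneq (rS _ vr) => <-.
  rewrite es; apply/negP => /(attr _ _ vr uS) [] h; have := ipath_uniq i1.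
    by rewrite /= -h mem_rcons inE us orbT.
  by rewrite -rcons_cons rcons_uniq inE -h us orbT.
move: ab; rewrite (T1 (v := q) (a := a) (b := b) hh _ _ _ eqa) ?eqxx //.
- rewrite !(inE, mem_cat, mem_rev) (eq_sym q a) (negbTE aq) /=; apply/negP => /orP[/orP[us|uE]|/orP[/eqP h|ur]].
  + by have := sT q; rewrite inE us orbT => /(_ isT)[_ /eqP].
  + by have := ET q; rewrite mem_rcons inE uE orbT qT => /(_ isT).
  + by rewrite -h qT in bT.
  by have := rS _ ur; rewrite inE qT.
- exact: mem_head.
- by rewrite !(inE, mem_cat) eqxx !orbT.
by rewrite es.
Qed.

(** Take a largest atom [S] inside [A] that contains [c] and misses [y]. An ear of [S] avoiding [y]
    would enlarge it. *)
Lemma ear_around (A : {set V}) c y :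
  (forall A' : {set V}, A' \proper A -> atom A' -> good A') ->
  atom A -> hole c -> {subset c <= A} -> y \in A -> y \notin c ->
  exists (S : {set V}) r a b, [/\ S \subset A, {subset c <= S}, y \notin S,
    good S & [/\ ear S r a b, y \in r & {subset r <= A :\: S}]].
Proof.
move=> IH aA hc sc yA yc.
pose P (S : {set V}) := [/\ S \subset A, {subset c <= S}, y \notin S & atom S].
have exP : exists S, P S.
  exists [set z in c]; split.
  - by apply/subsetP => z; rewrite inE; apply: sc.
  - by move=> z; rewrite inE.
  - by rewrite inE.
  by split; [move=> K cK; apply: hole_minus_clique|apply: hole_card].
have [S [[sSA cS yS aS] Smax]] := exists_min (fun S : {set V} => #|V| - #|S|) exP.
have gS : good S.
  apply: IH => //; rewrite properE sSA; apply/subsetPn; by exists y.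
have [|r [a [b [er rA]]]] := ear_exists aA sSA gS _ yA yS.
  have /hasP[c0 cc _] : has predT c by rewrite has_predT (ltn_trans _ (hole_size hc)).
  by apply/set0Pn; exists c0; apply: cS.
exists S, r, a, b; split => //; split => //; apply: contraT => yr.
have /Smax : P (S :|: [set z in r]).
  split.
  - by rewrite subUset sSA; apply/subsetP => z; rewrite inE => /rA; rewrite inE => /andP[].
  - by move=> z zc; rewrite inE cS.
  - by rewrite !inE negb_or yS.
  exact: ear_atom er.
have : S \proper S :|: [set z in r].
  rewrite properE subsetUl; apply/subsetPn; exists (head a r).
    rewrite !inE; case: r er {rA yr} => [[+ nab] _|z r _ /=]; last by rewrite mem_head orbT.
    by move=> /ipath_path /=; rewrite (negbTE nab).
  case: r er {rA yr} => [[+ nab] _|z r [_ _ _ h _] /=]; last by apply: h; rewrite mem_head.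
  by move=> /ipath_path /=; rewrite (negbTE nab).
move=> /proper_card lt; have := max_card (S :|: [set z in r]); move: lt; clear; lia.
Qed.

(** Induction on the size. A hole through [x] grows to a maximal [S] missing [y], with an ear [r]
    through [y]; only [A = S :|: r] remains. If a hole of [S] through [x] and [a] also contains [b],
    its arc through [x] closes up with [r]. Otherwise the same construction inside [S], with [b] for
    [y], gives [T] and an ear [E] through [b]: now [r] leads from [T] into [E]. Dropping either half
    of [E] beyond [b] leaves a smaller atom unless an end of [E] is equal or adjacent to [a]. *)
Theorem atom_good (A : {set V}) : atom A -> good A.
Proof.
move: {2}#|A| (leqnn #|A|) => n; elim: n A => [|n IHn] A cn aA.
  by case: aA; rewrite leqNgt => _; rewrite (leq_ltn_trans cn).
have IH (A' : {set V}) : A' \proper A -> atom A' -> good A'.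
  by move=> /proper_card lt; apply: IHn; rewrite -ltnS (leq_trans lt).
suff main x y : x \in A -> y \in A -> x != y ->
    exists c, [/\ hole c, {subset c <= A}, x \in c & y \in c].
  move=> x y xA yA; case: (x =P y) => [<-|/eqP]; last exact: main.
  by have [c [hc sc xc]] := hole_through aA xA; exists c.
move=> xA yA xy.
have [c0 [hc0 sc0 xc0]] := hole_through aA xA.
case yc0 : (y \in c0); first by exists c0.
have [S [r [a [b [sSA cS yS gS [er yr rA]]]]]] := ear_around IH aA hc0 sc0 yA (negbT yc0).
have xS := cS _ xc0.
have ab := ear_neq er.
have eA : A = S :|: [set z in r] \/ exists c, [/\ hole c, {subset c <= A}, x \in c & y \in c].
  have sub : S :|: [set z in r] \subset A.
    by rewrite subUset sSA; apply/subsetP => z; rewrite inE => /rA; rewrite inE => /andP[].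
  case: (boolP (A \subset S :|: [set z in r])) => [h|h].
    by left; apply/eqP; rewrite eqEsubset h.
  right; have g' : good (S :|: [set z in r]).
    by apply: IH (ear_atom gS er); rewrite properE sub.
  have [||c [hc sc xc yc]] := g' x y; rewrite ?inE ?xS ?yr ?orbT //.
  by exists c; split => // z /sc; apply/subsetP.
case: eA => [eA|//].
have [ir nab [aS bS] rS attr] := er.
have [c1 [hc1 sc1 xc1 ac1]] := gS x a xS aS.
have pS : S \proper A.
  by rewrite properE sSA; apply/subsetPn; exists y.
case bc1 : (b \in c1).
  have [p [q [ip iq cpq _]]] := hole_arcs hc1 ac1 bc1 ab nab.
  have arc s : ipath (a :: rcons s b) -> {subset s <= c1} -> x \in a :: b :: s ->
      exists c, [/\ hole c, {subset c <= A}, x \in c & y \in c].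
    move=> is_ ss xs; exists (a :: s ++ b :: rev r); split.
    - apply: hole_two_paths => // u v us vr; have uS := sc1 _ (ss _ us).
      split; first by apply: contraNneq (rS v vr) => <-.
      rewrite es; apply/negP => /(attr v u vr uS) [] eu; have := ipath_uniq is_.
        by rewrite /= mem_rcons inE -eu us orbT.
      by rewrite -rcons_cons rcons_uniq inE -eu us orbT.
    - move=> u; rewrite eA !(inE, mem_cat, mem_rev) => /or4P[/eqP->|/ss/sc1->|/eqP->|->];
        by rewrite ?aS ?bS ?orbT.
    - by move: xs; rewrite !(inE, mem_cat) => /or3P[]->; rewrite ?orbT.
    by rewrite !(inE, mem_cat, mem_rev) yr !orbT.
  have pc u : u \in p -> u \in c1 by move=> up; rewrite cpq !inE mem_cat up !orbT.
  have qc u : u \in q -> u \in c1 by move=> up; rewrite cpq !inE mem_cat up !orbT.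
  move: xc1; rewrite cpq !inE mem_cat orbA => /orP[h|/orP[h|h]].
  - by apply: (arc p ip pc); rewrite !inE orbA h.
  - by apply: (arc p ip pc); rewrite !inE h !orbT.
  by apply: (arc q iq qc); rewrite !inE h !orbT.
have aS' : atom S.
  split; first by move=> K; apply: good_minus_clique.
  by apply: leq_trans (hole_card hc1) (subset_leq_card _); apply/subsetP => z; rewrite inE; apply: sc1.
have IHS (A' : {set V}) : A' \proper S -> atom A' -> good A'.
  by move=> h; apply: IH; apply: proper_trans h pS.
have [T [E [p [q [sTS cT bT gT [eE bE ES]]]]]] := ear_around IHS aS' hc1 sc1 bS (negbT bc1).
have aT := cT _ ac1; have xT := cT _ xc1.
have sTE : T :|: [set z in E] \subset S.
  by rewrite subUset sTS; apply/subsetP => z; rewrite inE => /ES; rewrite inE => /andP[].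
have er' : ear (T :|: [set z in E]) r a b.
  split => //.
  - by rewrite !inE aT bE orbT.
  - by move=> u /rS; apply: contra => /(subsetP sTE).
  by move=> u w ur /(subsetP sTE); apply: attr.
case: (boolP (S \subset T :|: [set z in E])) => [h|h]; last first.
  have gTE : good (T :|: [set z in E]).
    by apply: IHS (ear_atom gT eE); rewrite properE sTE.
  have g' : good (T :|: [set z in E] :|: [set z in r]).
    apply: IH (ear_atom gTE er'); rewrite properE eA setSU //=.
    have /subsetPn[w wS wT] := h; apply/subsetPn; exists w; first by rewrite inE wS.
    rewrite inE negb_or wT inE /=; apply: contraL wS; exact: rS.
  have [||c [hc sc xc yc]] := g' x y; rewrite ?inE ?xT ?yr ?orbT //.
  exists c; split => // z /sc; rewrite eA inE => /orP[/(subsetP sTE)|]; rewrite !inE => ->; by rewrite ?orbT.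
have {}eA : A = T :|: [set z in E] :|: [set z in r].
  by rewrite eA; congr (_ :|: _); apply/eqP; rewrite eqEsubset h.
case/splitPr: E / bE eE ES sTE er' h eA => E1 E2 eE ES sTE er' h eA.
have eA' : A = T :|: [set z in rev (E1 ++ b :: E2)] :|: [set z in r].
  by rewrite eA; congr (_ :|: _ :|: _); apply/setP => z; rewrite !inE mem_rev.
have er2 : ear (T :|: [set z in rev (E1 ++ b :: E2)]) r a b.
  suff -> : [set z in rev (E1 ++ b :: E2)] = [set z in E1 ++ b :: E2] by [].
  by apply/setP => z; rewrite !inE mem_rev.
have rE : rev (E1 ++ b :: E2) = rev E2 ++ b :: rev E1 by rewrite rev_cat rev_cons cat_rcons.
case: (E2 =P [::]) => [E20|/eqP E2n].
  case: (E1 =P [::]) => [E10|/eqP E1n].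
    subst E1 E2; case: eE => iE npq [pT qT] ET _; have := ipath_path iE; rewrite /= => /and3P[epb ebq _].
    have := ipath_uniq iE; rewrite /= !inE (good_one (v := b) gT bT pT qT) ?eqxx ?orbT //.
    by rewrite es.
  have [|//|h2] := tripod_shortcut IH eA' gT (ear_rev eE) er2 aT rE _ xT yr.
    by case: (E1) E1n => // *; rewrite rev_cons; case: (rev _).
  subst E2; rewrite cats1 in eE er'.
  by case: (tripod_end gT eE er' aT E1n h2).
have [//|h1] := tripod_shortcut IH eA gT eE er' aT erefl E2n xT yr.
case: (E1 =P [::]) => [E10|/eqP E1n].
  subst E1; have eE2 := ear_rev eE; rewrite rE cats1 in eE2 er2.
  case: (tripod_end gT eE2 er2 aT _ h1).
  by case: (E2) E2n => // *; rewrite rev_cons; case: (rev _).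
have [|//|h2] := tripod_shortcut IH eA' gT (ear_rev eE) er2 aT rE _ xT yr.
  by case: (E1) E1n => // *; rewrite rev_cons; case: (rev _).
have pq := ear_neq eE; have [iE npq [pT qT] ET attE] := eE.
(* Both ends [p], [q] of [E] are now equal or adjacent to [a]. Being distinct and nonadjacent, they
   have [a] as a common neighbour, which [no_common_nbr] excludes. *)
case/orP: h1 => [/eqP pa|epa].
  move: h2; rewrite -pa eq_sym (negbTE pq) /= es (negbTE npq) //.
case/orP: h2 => [/eqP qa|eqa]; first by move: npq; rewrite qa epa.
have [c [hc sc pc qc]] := gT p q pT qT.
case: (@no_common_nbr c p q a (E1 ++ b :: E2)) => //; rewrite 1?es //.
- by move=> u /ET; apply: contra; apply: sc.
- by move=> u w uE /sc wT euw; case: (attE u w uE wT euw) => ->; [apply: Or31|apply: Or32].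
by apply/negP => /ET; rewrite aT.
Qed.

(* A minimal subset of [A] in which no clique separates [x] from [y] is an atom. *)
Theorem hole_or_clique_cut (A : {set V}) x y : x \in A -> y \in A -> x != y -> ~~ e x y ->
  (exists c, [/\ hole c, {subset c <= A}, x \in c & y \in c]) \/
  exists K X : {set V}, [/\ clique K, x \notin K /\ y \notin K, X \subset A :\: K,
    x \in X /\ y \notin X &
    forall u v, u \in X -> v \in A :\: K -> e u v -> v \in X].
Proof.
move: {2}#|A| (leqnn #|A|) => n; elim: n A => [|n IHn] A cn xA yA xy nxy.
  by move: xA; rewrite leqn0 cards_eq0 in cn; rewrite (eqP cn) inE.
case: (pselect (exists K X : {set V}, [/\ clique K, x \notin K /\ y \notin K, X \subset A :\: K,
    x \in X /\ y \notin X &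
    forall u v, u \in X -> v \in A :\: K -> e u v -> v \in X])) => [|nosep]; [by right|left].
case: (pselect (forall K, clique K -> conn (A :\: K))) => [cA|/existsNP[K /not_implyP[cK nc]]].
  have aA : atom A.
    split => //; rewrite ltnNge; apply/negP => c2.
    have eA : A = [set x; y].
      by apply/esym/eqP; rewrite eqEcard subUset !sub1set xA yA cards2 xy.
    apply: nosep; exists set0, [set x]; split; rewrite ?inE ?eqxx //.
    - exact: cliq0.
    - by rewrite setD0 sub1set.
    - by split => //; rewrite eq_sym.
    move=> u v; rewrite setD0 eA !inE => /eqP -> /orP[//|/eqP ->]; by rewrite (negbTE nxy).
  exact: atom_good aA x y xA yA.
have [X /not_implyP[sX /not_implyP[X0 /not_implyP[clX nX]]]] : exists X : {set V},
    ~ (X \subset A :\: K -> X != set0 ->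
    (forall x y, x \in X -> y \in A :\: K -> e x y -> y \in X) -> A :\: K \subset X).
  exact/existsNP.
(* The case that [x] and [y] lie on the same side of the cutset, or in it. Induction applies after
   deleting the other side [Y]; a cutset [K1] obtained there has to be shown to separate in [A] as
   well. *)
have half (Q Y : {set V}) : Q :|: Y = A :\: K -> [disjoint Q & Y] -> Y != set0 ->
    (forall u v, u \in Q -> v \in Y -> ~~ e u v) ->
    x \in Q :|: K -> y \in Q :|: K ->
    exists c, [/\ hole c, {subset c <= A}, x \in c & y \in c].
  move=> eXY dXY Y0 noe xXK yXK {X0 clX nX sX X}.
  have YA : Y \subset A by apply: subset_trans (subsetUr Q Y) _; rewrite eXY subsetDl.
  have nY u : u \in Q :|: K -> u \notin Y.
    rewrite inE => /orP[uX|uK]; first by rewrite (disjointFr dXY uX).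
    apply/negP => uY; have : u \in Q :|: Y by rewrite inE uY orbT.
    by rewrite eXY inE uK.
  have [|||||[c [hc sc xc yc]]|] := IHn (A :\: Y).
  - have : A :\: Y \proper A.
      rewrite properE subsetDl; have /set0Pn[u uY] := Y0; apply/subsetPn; exists u.
        exact: (subsetP YA).
      by rewrite inE uY.
    by move=> /proper_card lt; rewrite -ltnS (leq_trans lt).
  - by rewrite inE xA nY.
  - by rewrite inE yA nY.
  - by [].
  - by [].
  - by exists c; split => // z /sc; rewrite inE => /andP[].
  case=> K1 [X1 [cK1 [xK1 yK1] sX1 [xX1 yX1] cl1]]; case: nosep.
  have X1A u : u \in X1 -> [/\ u \notin K1, u \in A & u \notin Y].
    by move=> /(subsetP sX1); rewrite !inE => /and3P[-> -> ->].
  (* The part of the clique [K] outside [K1] lies on one side of [K1]. Since [Y] is attached only to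
     [K], it joins the side of [x] exactly when that side meets [K]. *)
  pose Z := if [exists k in K, k \in X1] then X1 :|: (Y :\: K1) else X1.
  have Z1 u : u \in Z -> u \in X1 \/ (u \in Y /\ exists2 k, k \in K & k \in X1).
    rewrite /Z; case: ifP => [/existsP[k /andP[kK kX]]|_]; last by left.
    by rewrite !inE => /orP[|/andP[_ uY]]; [left|right; split => //; exists k].
  have X1Z u : u \in X1 -> u \in Z.
    by move=> uX; rewrite /Z; case: ifP => // _; rewrite inE uX.
  have YZ u k : u \in Y -> u \notin K1 -> k \in K -> k \in X1 -> u \in Z.
    move=> uY uK1 kK kX; rewrite /Z; case: existsP => [_|[]]; first by rewrite !inE uY uK1 orbT.
    by exists k; rewrite kK.
  exists K1, Z; split => //.
  - apply/subsetP => u; rewrite /Z; case: ifP => _; last first.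
      by move=> /X1A[u1 uA _]; rewrite inE u1.
    rewrite !inE => /orP[/X1A[-> ->] //|/andP[-> /(subsetP YA) ->] //].
  - split; first exact: X1Z.
    by apply/negP => /Z1 [|[yY _]]; [apply/negP|move: (nY _ yXK); rewrite yY].
  move=> u v uZ; rewrite inE => /andP[vK1 vA] euv.
  case: (boolP (v \in Y)) => vY.
    case: (Z1 u uZ) => [uX1|[_ [k kK kX]]]; last exact: (YZ v k).
    have [uK1 uA uY] := X1A _ uX1.
    apply: (YZ v u) => //; apply: contraT => uK.
    have : u \in Q :|: Y by rewrite eXY inE uK.
    by rewrite inE (negbTE uY) orbF => uX; move: (noe u v uX vY); rewrite euv.
  apply: X1Z; case: (Z1 u uZ) => [uX1|[uY [k kK kX]]].
    by apply: cl1 uX1 _ euv; rewrite !inE vK1 vY.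
  have vK : v \in K.
    apply: contraT => vK; have : v \in Q :|: Y by rewrite eXY inE vK.
    by rewrite inE (negbTE vY) orbF => vX; move: (noe v u vX uY); rewrite es euv.
  case: (k =P v) => [<- //|/eqP kv].
  by apply: cl1 kX _ (cK _ _ kK vK kv); rewrite !inE vK1 vY.
pose Y := (A :\: K) :\: X.
have eXY : X :|: Y = A :\: K.
  apply/setP => z; rewrite !inE; case zX: (z \in X) => //=.
  by have := subsetP sX z zX; rewrite inE => ->.
have dXY : [disjoint X & Y].
  by rewrite disjoint_subset; apply/subsetP => u uX; rewrite !inE uX.
have Y0 : Y != set0 by apply/set0Pn; have /negP/subsetPn[w w1 w2] := nX; exists w; rewrite inE w2.
have noe u v : u \in X -> v \in Y -> ~~ e u v.
  move=> uX; rewrite inE => /andP[vX vA]; apply: contra vX; exact: clX.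
have inY z : z \in A -> z \notin X :|: K -> z \in Y.
  by move=> zA; rewrite !inE negb_or zA andbT.
have halfY : x \in Y :|: K -> y \in Y :|: K ->
    exists c, [/\ hole c, {subset c <= A}, x \in c & y \in c].
  apply: (half Y X) => //; [by rewrite setUC|by rewrite disjoint_sym|].
  by move=> u v uY vX; rewrite es; apply: noe.
case: (boolP (x \in X :|: K)) => xX; case: (boolP (y \in X :|: K)) => yX.
- exact: (half X Y).
- have yY := inY y yA yX; case: (boolP (x \in K)) => xK.
    by apply: halfY; rewrite inE ?xK ?yY ?orbT.
  case: nosep; exists K, X; move: xX yX; rewrite !inE (negbTE xK) orbF negb_or => xX /andP[yX yK].
  by split.
- have xY := inY x xA xX; case: (boolP (y \in K)) => yK.
    by apply: halfY; rewrite inE ?yK ?xY ?orbT.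
  case: nosep; exists K, Y; split => //.
  - by move: xX; rewrite inE negb_or => /andP[].
  - exact: subsetDl.
  - by split => //; move: yX; rewrite !inE (negbTE yK) orbF => ->.
  move=> u v uY vA euv; rewrite inE vA andbT; apply/negP => vX.
  by move: (noe v u vX uY); rewrite es euv.
by apply: halfY; rewrite inE inY.
Qed.

End Holes.

(** * Menger's theorem *)

Section Menger.
Variable V : finType.
Implicit Types (e : rel V) (A B S T : {set V}).

Definition ABpath e A B (p : seq V) : bool :=
  if p is x :: q then [&& x \in A, path e x q & last x q \in B] else false.

Definition linked e A B k : Prop := exists L : 'I_k -> seq V,
  (forall i, ABpath e A B (L i) /\ uniq (L i)) /\
  (forall i j z, z \in L i -> z \in L j -> i = j).

Definition separates e A B S : Prop := forall p, ABpath e A B p -> has (mem S) p.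

Lemma ABpath_uniq e A B p : ABpath e A B p ->
  exists q, [/\ ABpath e A B q, uniq q & {subset q <= p}].
Proof.
case: p => // x p /and3P[xA pp lB].
move: lB; case/shortenP: pp => q pq uq sq lB.
exists (x :: q); split => //=; first by rewrite xA pq.
by move=> z; rewrite !inE => /predU1P[->|/sq ->]; rewrite ?eqxx ?orbT.
Qed.

Lemma linked_of_disjoint e A B k (L : 'I_k -> seq V) :
  (forall i, ABpath e A B (L i)) ->
  (forall i j z, z \in L i -> z \in L j -> i = j) -> linked e A B k.
Proof.
move=> H D; have [M HM] := choice (fun i => ABpath_uniq (H i)).
exists M; split => [i|i j z]; first by have [] := HM i.
by have [_ _ si] := HM i; have [_ _ sj] := HM j; move=> /si zi /sj; apply: D.
Qed.

Lemma linkedW e A B k m : m <= k -> linked e A B k -> linked e A B m.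
Proof.
move=> mk [L [H D]]; exists (fun i => L (widen_ord mk i)); split => // i j z zi zj.
by have /(congr1 val) /= := D _ _ _ zi zj; apply: val_inj.
Qed.

Lemma linked_sub e e' A A' B B' k : (forall u v, e u v -> e' u v) ->
  A \subset A' -> B \subset B' -> linked e A B k -> linked e' A' B' k.
Proof.
move=> ee /subsetP sA /subsetP sB [L [H D]]; exists L; split => // i.
have [] := H i; case: (L i) => // x p /and3P[xA pp lB] u; split => //=.
by rewrite sA // sB // (sub_path ee).
Qed.

Lemma ABpath_cat e A B s z t : ABpath e A B (s ++ z :: t) ->
  ABpath e A [set z] (rcons s z) /\ ABpath e [set z] B (z :: t).
Proof.
case: s => [|x s] /=; first by case/and3P => -> pt lB; rewrite pt lB inE eqxx.
rewrite cat_path last_cat last_rcons rcons_path inE eqxx /= => /and3P[-> /and3P[-> -> ->]] ->.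
by split.
Qed.

Lemma ABpath_glue e A B s z t : ABpath e A [set z] (rcons s z) ->
  ABpath e [set z] B (z :: t) -> ABpath e A B (s ++ z :: t).
Proof.
case: s => [|x s] /=; first by case/andP => -> _ /andP[].
rewrite rcons_path last_cat cat_path /= => /and3P[-> /andP[-> ->] _] /and3P[_ -> ->] //.
Qed.

Section Step.
Variables (e : rel V) (A B : {set V}) (k : nat) (x y : V).
Hypothesis exy : e x y.
Let e' := [rel u v | e u v && ((u, v) != (x, y))].

Lemma path_src u s : path e u s -> x \notin belast u s -> path e' u s.
Proof.
elim: s u => //= v s IH u /andP[euv ps]; rewrite inE negb_or => /andP[xu xs].
by rewrite euv IH // andbT /= xpair_eqE negb_and eq_sym xu.
Qed.

Lemma path_tgt u s : path e u s -> y \notin s -> path e' u s.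
Proof.
elim: s u => //= v s IH u /andP[euv ps]; rewrite inE negb_or => /andP[yv ys].
by rewrite euv IH // andbT /= xpair_eqE negb_and [v == y]eq_sym yv orbT.
Qed.

Variable S : {set V}.
Hypothesis sepS : separates e' A B S.

(** A path of [e] from [A] to [B] passes through [x] or does not use the arc, so it meets [x |: S].
    Its part up to the first vertex there does not use the arc, hence meets [T]. *)
Lemma sep_left T : separates e' A (x |: S) T -> separates e A B T.
Proof.
move=> sT p; case: p => // a p abp; have /and3P[aA pp lB] := abp.
have : has (mem (x |: S)) (a :: p).
  case xp : (x \in a :: p); first by apply/hasP; exists x; rewrite //= !inE eqxx.
  have /sepS/hasP[u up uS] : ABpath e' A B (a :: p).
    rewrite /= aA lB andbT path_src //; apply: contraFN xp; exact: mem_belast.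
  by apply/hasP; exists u; rewrite //= inE [u \in S]uS orbT.
move=> /split_find; case E : _ _ _ / => [u s1 s2 uP nP].
have : ABpath e' A (x |: S) (rcons s1 u).
  have := abp; rewrite E cat_rcons => /ABpath_cat[+ _].
  case: s1 {E} nP => [|b s1] nP /=; first by case/andP => -> _ /=.
  move=> /and3P[-> ps _]; rewrite path_src //=; first by rewrite last_rcons.
  rewrite belast_rcons; apply: contra nP => xb; apply/hasP; exists x => //=.
  by rewrite !inE eqxx.
by move=> /sT; rewrite has_cat => ->.
Qed.

Lemma sep_right T : separates e' (y |: S) B T -> separates e A B T.
Proof.
move=> sT p; case: p => // a p abp; have /and3P[aA pp lB] := abp.
have : has (mem (y |: S)) (rev (a :: p)).
  rewrite has_rev.
  case yp : (y \in a :: p); first by apply/hasP; exists y; rewrite //= !inE eqxx.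
  have /sepS/hasP[u up uS] : ABpath e' A B (a :: p).
    by rewrite /= aA lB andbT path_tgt //; apply: contraFN yp => yp; rewrite inE yp orbT.
  by apply/hasP; exists u; rewrite //= inE [u \in S]uS orbT.
move=> /split_find; case E : _ _ _ / => [u s1 s2 uP nP].
have {}E : a :: p = rev s2 ++ u :: rev s1 by rewrite -[LHS]revK E rev_cat rev_rcons.
have : ABpath e' (y |: S) B (u :: rev s1).
  have := abp; rewrite E => /ABpath_cat[_ /= /and3P[_ ps ->]].
  rewrite [u \in _]uP path_tgt // mem_rev; apply: contra nP => yb; apply/hasP; exists y => //=.
  by rewrite !inE eqxx.
by move=> /sT; rewrite E has_cat => ->; rewrite orbT.
Qed.

(** The arc-deletion proof. If [S] separates after deletion of the arc from [x] to [y] and is too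
    small, then [x |: S] and [y |: S] have exactly [k] vertices, and the two linkages end and start
    in all of them. Paths of the two linkages meet only in [S], since otherwise they would combine
    to a walk avoiding [S]. Glue them at the vertices of [S], and along the arc from [x] to [y]. *)
Lemma menger_step : #|S| < k -> (forall T, separates e A B T -> k <= #|T|) ->
  linked e' A (x |: S) k -> linked e' (y |: S) B k -> linked e A B k.
Proof.
move=> Sk Hk [LP [HP DP]] [LQ [HQ DQ]].
have cardP (z : V) : k <= #|z |: S| -> #|z |: S| = k /\ z \notin S.
  by rewrite cardsU1; case: (z \in S) => /=; move: Sk; clear; lia.
have [cP xS] : #|x |: S| = k /\ x \notin S.
  apply: cardP; apply/Hk/sep_left; case=> // a p /and3P[_ _ l]; apply/hasP; exists (last a p) => //.
  exact: mem_last.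
have [cQ yS] : #|y |: S| = k /\ y \notin S.
  apply: cardP; apply/Hk/sep_right; case=> // a p /and3P[aP _ _]; apply/hasP; exists a => //.
  exact: mem_head.
pose lP i := last x (LP i); pose hQ i := head x (LQ i).
have lPin i : lP i \in LP i /\ lP i \in x |: S.
  by rewrite /lP; have [] := HP i; case: (LP i) => // a p /and3P[_ _ l] _; rewrite /= mem_last.
have hQin i : hQ i \in LQ i /\ hQ i \in y |: S.
  by rewrite /hQ; have [] := HQ i; case: (LQ i) => // a p /and3P[l _ _] _; rewrite /= mem_head.
have lPsurj u : u \in x |: S -> exists i, lP i = u.
  have inj : injective lP by move=> i j h; apply: (DP i j (lP i)); [case: (lPin i)|rewrite h; case: (lPin j)].
  have : [set lP i | i : 'I_k] == x |: S.
    rewrite eqEcard card_imset // card_ord cP leqnn andbT.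
    by apply/subsetP => _ /imsetP[i _ ->]; case: (lPin i).
  by move=> /eqP <- /imsetP[i _ ->]; exists i.
have hQsurj u : u \in y |: S -> exists i, hQ i = u.
  have inj : injective hQ by move=> i j h; apply: (DQ i j (hQ i)); [case: (hQin i)|rewrite h; case: (hQin j)].
  have : [set hQ i | i : 'I_k] == y |: S.
    rewrite eqEcard card_imset // card_ord cQ leqnn andbT.
    by apply/subsetP => _ /imsetP[i _ ->]; case: (hQin i).
  by move=> /eqP <- /imsetP[i _ ->]; exists i.
have onlyP i z : z \in LP i -> z \in x |: S -> z = lP i.
  by move=> zi /lPsurj[j h]; rewrite -h; congr lP; apply: (DP j i z) => //; rewrite -h; case: (lPin j).
have onlyQ i z : z \in LQ i -> z \in y |: S -> z = hQ i.
  by move=> zi /hQsurj[j h]; rewrite -h; congr hQ; apply: (DQ j i z) => //; rewrite -h; case: (hQin j).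
have cross i j z : z \in LP i -> z \in LQ j -> [/\ z \in S, z = lP i & z = hQ j].
  move=> zi zj.
  have [s1 [s2 E1]] := mem_split zi; have [t1 [t2 E2]] := mem_split zj.
  have [p1 u1] := HP i; have [p2 u2] := HQ j.
  have q1 : ABpath e' A [set z] (rcons s1 z) by move: p1; rewrite E1 => /ABpath_cat[].
  have q2 : ABpath e' [set z] B (z :: t2) by move: p2; rewrite E2 => /ABpath_cat[].
  have /sepS/hasP[w wp wS] := ABpath_glue q1 q2.
  have wP : w \in x |: S by rewrite inE [w \in S]wS orbT.
  have wQ : w \in y |: S by rewrite inE [w \in S]wS orbT.
  suff wz : w = z.
    split; [by rewrite -wz|by apply: onlyP; rewrite -?wz // wz|by apply: onlyQ; rewrite -?wz // wz].
  move: wp; rewrite mem_cat inE => /or3P[ws|/eqP //|wt].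
    have := onlyP i w; rewrite E1 mem_cat ws /lP E1 last_cat /= => /(_ isT wP) h.
    by move: u1; rewrite E1 cat_uniq => /and3P[_ /hasPn/(_ w) + _]; rewrite h mem_last -h ws => /(_ isT).
  have := onlyQ j w; rewrite E2 mem_cat inE wt !orbT /hQ E2 => /(_ isT wQ).
  case: t1 E2 => [|b t1] E2 //= h.
  by move: u2; rewrite E2 /= -h mem_cat inE wt !orbT.
have HM i : exists j M, [/\ ABpath e A B M, hQ j = (if lP i == x then y else lP i) &
    forall z, z \in M -> z \in LP i \/ z \in LQ j].
  have [li lPS] := lPin i.
  have [j hj] : exists j, hQ j = (if lP i == x then y else lP i).
    apply: hQsurj; case: eqP => [_|/eqP lx]; first by rewrite !inE eqxx.
    by move: lPS; rewrite !inE (negbTE lx) => /= ->; rewrite orbT.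
  have [p1 _] := HP i; have [p2 _] := HQ j.
  have sub u v : e' u v -> e u v by case/andP.
  case E1 : (LP i) p1 => [//|a p] /and3P[aA pp lp].
  case E2 : (LQ j) p2 => [//|b q] /and3P[bQ pq lq].
  have lPe : lP i = last a p by rewrite /lP E1.
  have hQe : hQ j = b by rewrite /hQ E2.
  move: hj; rewrite lPe hQe; case: eqP => [lx|lx] hb.
    exists j, ((a :: p) ++ b :: q); split => //.
    - rewrite /= aA cat_path last_cat /= (sub_path sub pp) (sub_path sub pq) lq lx.
      by rewrite hb exy.
    - by rewrite hQe.
    by move=> z; rewrite mem_cat => /orP[|]; [left|right; rewrite E2].
  exists j, ((a :: p) ++ q); split => //.
  - by rewrite /= aA cat_path last_cat (sub_path sub pp) -hb (sub_path sub pq) lq.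
  - by rewrite hQe.
  by move=> z; rewrite mem_cat => /orP[|zq]; [left|right; rewrite E2 inE zq orbT].
have [J HJ] := choice HM; have [M {}HM] := choice HJ.
apply: (@linked_of_disjoint e A B k M); first by move=> i; have [] := HM i.
have mixed i i' z : z \in LP i -> z \in LQ (J i') -> i = i'.
  move=> zi zj; have [zS zl zh] := cross _ _ _ zi zj.
  have [_ + _] := HM i'; rewrite -zh; case: eqP => [_ zy|_ zl'].
    by move: yS; rewrite -zy zS.
  by apply: (DP i i' z) => //; rewrite zl'; case: (lPin i').
move=> i i' z; have [_ h s] := HM i; have [_ h' s'] := HM i'.
move=> /s [zi|zi] /s' [zj|zj].
- exact: DP zi zj.
- exact: mixed zi zj.
- by apply/esym; apply: mixed zj zi.
have jj := DQ _ _ _ zi zj.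
have : lP i = lP i'.
  move: h'; rewrite -jj h; case: eqP => [->|_]; case: eqP => [->|_] //.
    by move=> h2; move: (lPin i') => [_]; rewrite -h2 !inE (negbTE yS) orbF => /eqP ->.
  by move=> h2; move: (lPin i) => [_]; rewrite h2 !inE (negbTE yS) orbF => /eqP ->.
move=> ll; apply: (DP i i' (lP i)); first by case: (lPin i).
by rewrite ll; case: (lPin i').
Qed.

End Step.

(** Induction on the number of arcs of the directed graph [e]. Without arcs, [A :&: B] is a
    separator and supplies one-vertex paths. *)
Theorem menger e A B k : (forall S, separates e A B S -> k <= #|S|) -> linked e A B k.
Proof.
move: {2}#|[set u : V * V | e u.1 u.2]| (leqnn #|[set u : V * V | e u.1 u.2]|) => n.
elim: n e A B k => [|n IHn] e A B k cn H.
  have noe u v : e u v = false.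
    move: cn; rewrite leqn0 cards_eq0 => /eqP/setP/(_ (u, v)); by rewrite !inE.
  have kS : k <= #|A :&: B|.
    apply: H; case=> // a [|b p]; last by rewrite /= noe andbF.
    by move=> /and3P[aA _ aB]; apply/hasP; exists a; rewrite ?mem_head //= inE aA.
  apply: (@linked_of_disjoint _ _ _ _ (fun i => [:: enum_val (widen_ord kS i)])).
    by move=> i /=; have := enum_valP (widen_ord kS i); rewrite inE => /andP[-> ->].
  move=> i j z; rewrite !inE => /eqP -> /eqP /enum_val_inj /(congr1 val) /= h; exact: val_inj.
case: (pselect (exists x y, e x y)) => [[x [y exy]]|no]; last first.
  apply: IHn => //; rewrite (_ : [set u | _] = set0) ?cards0 //.
  by apply/setP => -[u v]; rewrite !inE /=; apply/negP => euv; apply: no; exists u, v.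
pose e' := [rel u v | e u v && ((u, v) != (x, y))].
have cn' : #|[set u : V * V | e' u.1 u.2]| <= n.
  have /proper_card : [set u : V * V | e' u.1 u.2] \proper [set u : V * V | e u.1 u.2].
    rewrite properE; apply/andP; split.
      by apply/subsetP => -[u v]; rewrite !inE => /andP[].
    by apply/subsetPn; exists (x, y); rewrite !inE /= ?exy // eqxx.
  by move=> lt; rewrite -ltnS (leq_trans lt).
case: (pselect (forall S, separates e' A B S -> k <= #|S|)) => [H'|/existsNP[S /not_implyP[sS /negP]]].
  by apply: linked_sub (IHn _ _ _ _ cn' H') => // u v /andP[].
rewrite -ltnNge => Sk.
apply: (menger_step exy sS) => //; apply: IHn => // T sT; apply: H.
  exact: sep_left sT.
exact: sep_right sT.
Qed.

End Menger.

(** * Brambles and treewidth *)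

Definition touch (V : finType) (e : rel V) (A B : {set V}) : Prop :=
  exists a b, [/\ a \in A, b \in B & (a == b) || e a b].

Definition bramble (V : finType) (e : rel V) (B : {set {set V}}) (k : nat) : Prop :=
  [/\ forall b, b \in B -> conn e b /\ b != set0,
      forall b b', b \in B -> b' \in B -> touch e b b'
    & forall S : {set V}, #|S| < k -> exists2 b, b \in B & [disjoint b & S]].

(** * Trees given by parent functions *)

Section ParentTree.
Variables (n : nat) (par : nat -> nat).
Hypothesis n0 : 0 < n.
Hypothesis par_lt : forall i, 0 < i < n -> par i < i.

Definition ptree_edge : rel 'I_n := fun i j =>
  ((0 < j) && (i == par j :> nat)) || ((0 < i) && (j == par i :> nat)).

Lemma ptree_sym : symmetric ptree_edge.
Proof. by move=> i j; rewrite /ptree_edge orbC. Qed.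

Lemma ptree_irrefl : irreflexive ptree_edge.
Proof.
move=> i; rewrite /ptree_edge orbb; apply/negP => /andP[i0 /eqP h].
by have := @par_lt i; rewrite i0 ltn_ord -h ltnn => /(_ isT).
Qed.

Definition ptree : sgraph := SGraph ptree_sym ptree_irrefl.

Lemma ptree_connected (P : pred nat) (r : 'I_n) :
  P r -> (forall i : 'I_n, P i -> i != r -> 0 < i /\ P (par i)) ->
  connected_graph (induced [set i : ptree | P i]).
Proof.
move=> Pr H.
have rP : r \in [set i : ptree | P i] by rewrite inE.
pose rr : induced [set i : ptree | P i] := exist _ r rP.
have toR m (x : induced [set i : ptree | P i]) : (val x : 'I_n) <= m -> connect (@edge _) x rr.
  elim: m x => [|m IH] x xm.
    case: (x =P rr) => [->|/eqP xr]; first exact: connect0.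
    have := H (val x); have := valP x; rewrite inE => -> /(_ isT).
    by rewrite -(inj_eq val_inj) in xr => /(_ xr)[]; move: xm; rewrite leqn0 => /eqP ->.
  case: (x =P rr) => [->|/eqP xr]; first exact: connect0.
  have Px : P (val x : 'I_n) by have := valP x; rewrite inE.
  have [x0 Pp] : 0 < (val x : 'I_n) /\ P (par (val x : 'I_n)).
    by apply: H => //; rewrite -(inj_eq val_inj) in xr.
  have plt := @par_lt (val x : 'I_n); rewrite x0 ltn_ord in plt; have {}plt := plt isT.
  have pn : par (val x : 'I_n) < n by apply: ltn_trans plt (ltn_ord _).
  have yP : Ordinal pn \in [set i : ptree | P i] by rewrite inE.
  pose y : induced [set i : ptree | P i] := exist _ (Ordinal pn) yP.
  apply: connect_trans (connect1 _) (IH y _).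
    by rewrite /= /induced_edge /= /ptree_edge /= eqxx andbT x0 orbT.
  by rewrite /= -ltnS (leq_trans plt).
have s : connect_sym (@edge (induced [set i : ptree | P i])).
  by apply: sym_connect_sym => a b; apply: edge_sym.
move=> x y; apply: connect_trans (toR _ x (leqnn _)) _.
by rewrite s; apply: toR (leqnn _).
Qed.

(** On a cycle, the vertex of largest index has its parent as the only possible neighbour, while a
    cycle of length at least three gives it two. *)
Lemma ptree_is_tree : is_tree ptree.
Proof.
split; first by rewrite card_ord.
  have H (i : 'I_n) : predT (i : nat) -> i != Ordinal n0 -> 0 < i /\ predT (par i).
    by move=> _ ni; split => //; rewrite lt0n; apply: contra ni => /eqP h; apply/eqP/val_inj.
  have c := @ptree_connected predT (Ordinal n0) isT H.
  have sub (a b : induced [set i : ptree | predT (i : 'I_n)]) :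
      connect (@edge _) a b -> connect ptree_edge (val a) (val b).
    move=> /connectP[p pp ->]; elim: p a pp => [|d p IH] a /=; first by rewrite connect0.
    by move=> /andP[ad pp]; apply: connect_trans (connect1 _) (IH _ pp).
  have inT (z : ptree) : z \in [set i : ptree | predT (i : 'I_n)] by rewrite inE.
  by move=> x y; apply: sub (exist _ x (inT x)) (exist _ y (inT y)) (c _ _).
move=> c /andP[cc uc]; rewrite leqNgt; apply/negP => sz.
have [x0 x0c] : exists x0, x0 \in c by case: (c) sz => // x *; exists x; rewrite mem_head.
pose f (i : ptree) : nat := nat_of_ord (i : 'I_n).
pose m := [arg max_(i > x0 | i \in c) f i].
have [mc mmax] : m \in c /\ forall j, j \in c -> f j <= f m.
  by rewrite /m; case: arg_maxnP.
have Hn (j : 'I_n) : j \in c -> ptree_edge m j -> (j == par m :> nat).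
  move=> jc /orP[/andP[j0 /eqP h]|/andP[] //].
  have := mmax j jc; have := @par_lt j; rewrite j0 ltn_ord -h => /(_ isT).
  by rewrite ltnNge => /negbTE ->.
have [i p E] := rot_to mc.
have cp : cycle ptree_edge (m :: p) by rewrite -E rot_cycle.
have up : uniq (m :: p) by rewrite -E rot_uniq.
have sp : 2 < size (m :: p) by rewrite -E size_rot.
have pc z : z \in p -> z \in c by move=> zp; rewrite -(mem_rot i) E inE zp orbT.
case: p cp up sp pc {E} => [|a p] //; case/lastP: p => [|p b] // cp up _ pc.
move: cp; rewrite /= rcons_path last_rcons => /and3P[ma _ bm].
have ac : a \in c by apply: pc; rewrite mem_head.
have bc : b \in c by apply: pc; rewrite inE mem_rcons mem_head orbT.
have ha := Hn a ac ma; rewrite ptree_sym in bm; have hb := Hn b bc bm.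
have ab : a = b by apply: val_inj; rewrite /= (eqP ha) (eqP hb).
by move: up; rewrite ab /= mem_rcons mem_head andbF.
Qed.
End ParentTree.

Section Decomposition.
Variables (G : sgraph) (m : nat).
Notation e := (@edge G).
Implicit Types (U W S : {set G}).

(* A rooted tree decomposition of width below [m] of the subgraph induced by [U], with
   [W] in the root bag: node [i > 0] has parent [par i < i], and the nodes whose bag
   contains [v] have a topmost element [r]. *)
Definition rooted_td U W : Prop := exists n (par : nat -> nat) (bag : nat -> {set G}),
  [/\ 0 < n /\ (forall i, 0 < i < n -> par i < i),
      forall i, i < n -> bag i \subset U /\ #|bag i| <= m,
      forall u v, u \in U -> v \in U -> (u == v) || e u v ->
        exists2 i, i < n & (u \in bag i) && (v \in bag i),
      forall v, v \in U -> exists r, [/\ r < n, v \in bag r &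
        forall i, i < n -> v \in bag i -> i != r -> 0 < i /\ v \in bag (par i)]
    & W \subset bag 0].

Lemma rooted_td_base U W : W \subset U -> #|U| <= m -> rooted_td U W.
Proof.
move=> WU Um; exists 1, (fun _ => 0), (fun _ => U); split => //.
- by split => // i; rewrite ltnS leqn0; case: i.
- by move=> u v uU vU _; exists 0; rewrite // uU.
by move=> v vU; exists 0; split => // i; rewrite ltnS leqn0 => /eqP ->.
Qed.

Lemma rooted_tdW U W W' : W' \subset W -> rooted_td U W -> rooted_td U W'.
Proof.
move=> sW [n [par [bag [h1 h2 h3 h4 h5]]]]; exists n, par, bag; split => //.
exact: subset_trans h5.
Qed.

(** The nodes of the second tree are shifted by [n1] and its root becomes a child of the first root.
    A vertex common to both parts lies in both root bags, so its nodes still have a topmost one. *)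
Lemma rooted_td_glue U1 W1 U2 W2 : rooted_td U1 W1 -> rooted_td U2 W2 ->
  U1 :&: U2 \subset W1 -> U1 :&: U2 \subset W2 ->
  (forall u v, u \in U1 -> v \in U2 -> e u v -> u \in U2 \/ v \in U1) ->
  rooted_td (U1 :|: U2) W1.
Proof.
move=> [n1 [p1 [b1 [[n10 h11] h12 h13 h14 h15]]]] [n2 [p2 [b2 [[n20 h21] h22 h23 h24 h25]]]] s1 s2 noe.
pose n := n1 + n2.
pose par i := if i < n1 then p1 i else if i == n1 then 0 else n1 + p2 (i - n1).
pose bag i := if i < n1 then b1 i else b2 (i - n1).
have inl i : i < n1 -> i < n by move=> h; apply: leq_trans h (leq_addr _ _).
have inr j : j < n2 -> n1 + j < n by rewrite ltn_add2l.
have pos j : 0 < n1 + j by rewrite addn_gt0 n10.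
have nz j : n1 + j <> n1 -> 0 < j by move=> h; rewrite lt0n; apply/eqP => j0; apply: h; rewrite j0 addn0.
have nlt j : (n1 + j < n1) = false by rewrite ltnNge leq_addr.
have bagl i : i < n1 -> bag i = b1 i by rewrite /bag => ->.
have bagr i : bag (n1 + i) = b2 i by rewrite /bag ltnNge leq_addr addKn.
have split_ i : i < n -> i < n1 \/ exists2 j, j < n2 & i = n1 + j.
  by move=> lt; case: (ltnP i n1) => h; [left|right; exists (i - n1); [rewrite ltn_subLR|rewrite subnKC]].
have sub1 i u : i < n1 -> u \in b1 i -> u \in U1 by move=> /h12[/subsetP h _] /h.
have sub2 i u : i < n2 -> u \in b2 i -> u \in U2 by move=> /h22[/subsetP h _] /h.
exists n, par, bag; split.
- split; first exact: inl.
  move=> i /andP[i0 /split_[lt|[j lt ->]]]; rewrite /par.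
    by rewrite lt; apply: h11; rewrite i0.
  rewrite nlt addKn; case: eqP => h; first exact: pos.
  by rewrite ltn_add2l; apply: h21; rewrite lt andbT; apply: nz.
- move=> i /split_[lt|[j lt ->]]; rewrite ?bagr ?bagl //.
    by have [a b] := h12 i lt; split => //; apply: subset_trans a (subsetUl _ _).
  by have [a b] := h22 j lt; split => //; apply: subset_trans a (subsetUr _ _).
- have left u v : u \in U1 -> v \in U1 -> (u == v) || e u v ->
      exists2 i, i < n & (u \in bag i) && (v \in bag i).
    move=> uU vU uv; have [i lt h] := h13 u v uU vU uv.
    by exists i; [apply: inl|rewrite bagl].
  have right u v : u \in U2 -> v \in U2 -> (u == v) || e u v ->
      exists2 i, i < n & (u \in bag i) && (v \in bag i).
    move=> uU vU uv; have [i lt h] := h23 u v uU vU uv.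
    by exists (n1 + i); [apply: inr|rewrite bagr].
  move=> u v; rewrite !inE => /orP[u1|u2] /orP[v1|v2] uv.
  + exact: left.
  + case/orP: (uv) => [/eqP E|euv]; first by apply: left => //; rewrite -E.
    by case: (noe u v u1 v2 euv) => h; [apply: right|apply: left].
  + case/orP: (uv) => [/eqP E|euv]; first by apply: left => //; rewrite E.
    rewrite edge_sym in euv.
    by case: (noe v u v1 u2 euv) => h; [apply: right|apply: left].
  + exact: right.
- move=> v vU; case v1 : (v \in U1); case v2 : (v \in U2).
  + have vW1 : v \in b1 0 by apply: (subsetP h15); apply: (subsetP s1); rewrite inE v1.
    have vW2 : v \in b2 0 by apply: (subsetP h25); apply: (subsetP s2); rewrite inE v1.
    have [r1 [lr1 vr1 H1]] := h14 v v1; have [r2 [lr2 vr2 H2]] := h24 v v2.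
    have r10 : r1 = 0 by apply/eqP; apply: contraT; rewrite eq_sym => h; have [] := H1 0 n10 vW1 h.
    have r20 : r2 = 0 by apply/eqP; apply: contraT; rewrite eq_sym => h; have [] := H2 0 n20 vW2 h.
    subst r1 r2; exists 0; split; [exact: inl|by rewrite bagl|].
    move=> i /split_[lt|[j lt ->]].
      rewrite bagl // => vi i0; have [h0 h] := H1 i lt vi i0; split => //.
      by rewrite /par lt bagl //; apply: leq_trans (h11 i _) (ltnW lt); rewrite h0.
    rewrite bagr => vj _; split; first exact: pos.
    rewrite /par nlt addKn; case: eqP => h; first by rewrite bagl.
    by rewrite bagr; have [|_] := H2 j lt vj; first by rewrite -lt0n; apply: nz.
  + have [r1 [lr1 vr1 H1]] := h14 v v1.
    exists r1; split; [exact: inl|by rewrite bagl|].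
    move=> i /split_[lt|[j lt ->]].
      rewrite bagl // => vi i0; have [h0 h] := H1 i lt vi i0; split => //.
      by rewrite /par lt bagl //; apply: leq_trans (h11 i _) (ltnW lt); rewrite h0.
    by rewrite bagr => /(sub2 _ _ lt); rewrite v2.
  + have [r2 [lr2 vr2 H2]] := h24 v v2.
    exists (n1 + r2); split; [exact: inr|by rewrite bagr|].
    move=> i /split_[lt|[j lt ->]]; first by rewrite bagl // => /(sub1 _ _ lt); rewrite v1.
    rewrite bagr eqn_add2l => vj jr; have [h0 h] := H2 j lt vj jr; split; first exact: pos.
    rewrite /par nlt addKn; case: eqP => h'; last by rewrite bagr.
    by move: h0; rewrite -(ltn_add2l n1) addn0 h' ltnn.
  by move: vU; rewrite inE v1 v2.
by rewrite bagl.
Qed.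

Lemma rooted_td_treewidth : rooted_td setT set0 -> treewidth G <= m.
Proof.
case=> n [par [bag [[n0 hp] hb he hv _]]].
pose B (i : ptree hp) : {set G} := bag (i : 'I_n).
have tree := ptree_is_tree n0 hp.
have vB v : exists t, v \in B t.
  have [r [lr vr _]] := hv v (in_setT _); by exists (Ordinal lr).
have eB u v : u -- v -> exists t, (u \in B t) && (v \in B t).
  move=> uv; have [|i lt h] := he u v (in_setT _) (in_setT _); first by rewrite uv orbT.
  by exists (Ordinal lt).
have cB v : connected_graph (induced [set t | v \in B t]).
  have [r [lr vr H]] := hv v (in_setT _).
  apply: (@ptree_connected n par hp (fun i => v \in bag i) (Ordinal lr)) => //.
  by move=> i vi ir; apply: H.
pose D := TreeDecomposition tree vB eB cB.
have wD : td_width D <= m.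
  rewrite /td_width; apply: leq_trans (leq_pred _) _.
  by apply/bigmax_leqP => i _; have [] := hb (i : 'I_n) (ltn_ord _).
apply: leq_trans wD; rewrite /treewidth; case: ex_minnP => w _; apply.
by apply/asboolP; exists D.
Qed.

End Decomposition.

Lemma setU_split (T : finType) (R Q D N : {set T}) : D \subset Q -> N \subset R ->
  R :|: Q = (R :|: (Q :\: D)) :|: (D :|: N).
Proof.
move=> /subsetP DQ /subsetP NR; apply/setP => z.
have := introT implyP (DQ z); have := introT implyP (NR z); rewrite !inE.
by case: (z \in R); case: (z \in Q); case: (z \in D); case: (z \in N).
Qed.

Lemma setI_split (T : finType) (R Q D N : {set T}) : (forall z, z \in D -> z \notin R) ->
  (R :|: (Q :\: D)) :&: (D :|: N) \subset N.
Proof.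
move=> h; apply/subsetP => z; have := introT implyP (h z); rewrite !inE.
by case: (z \in R); case: (z \in Q); case: (z \in D); case: (z \in N).
Qed.

(** * Tree decompositions in the absence of brambles *)

Section Duality.
Variables (G : sgraph) (k : nat).
Hypothesis k0 : 0 < k.
Notation e := (@edge G).
Hypothesis nobr : forall B, ~ bramble e B k.
Let es : symmetric e := @edge_sym G.

(** Otherwise every set of fewer than [k] vertices leaves a component with more than half of [W].
    Two such components meet inside [W], so they form a bramble of order [k]. *)
Lemma balanced_separator (W : {set G}) : exists S : {set G}, #|S| < k /\
  forall x, x \notin S -> 2 * #|component e (~: S) x :&: W| <= #|W|.
Proof.
apply: contrapT => no.
pose big (S : {set G}) x := [/\ #|S| < k, x \notin S & #|W| < 2 * #|component e (~: S) x :&: W|].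
pose B := [set b : {set G} | `[< exists S x, big S x /\ b = component e (~: S) x >]].
apply: (nobr (B := B)); split.
- move=> b; rewrite inE => /asboolP[S [x [[Sk xS _] ->]]].
  have xSc : x \in ~: S by rewrite inE.
  split; first exact: comp_conn.
  by apply/set0Pn; exists x; apply: comp_in.
- move=> b b'; rewrite !inE => /asboolP[S [x [[_ _ h] ->]]] /asboolP[S' [x' [[_ _ h'] ->]]].
  set C := component _ _ _ in h *; set C' := component _ _ _ in h' *.
  have : (C :&: W) :&: (C' :&: W) != set0.
    apply/negP => /eqP h0; have := cardsUI (C :&: W) (C' :&: W); rewrite h0 cards0 addn0.
    have : #|(C :&: W) :|: (C' :&: W)| <= #|W|.
      by apply: subset_leq_card; rewrite subUset !subsetIr.
    by move: h h'; clear; lia.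
  by case/set0Pn => z; rewrite !in_setI => /andP[/andP[zC _] /andP[zC' _]]; exists z, z; rewrite zC zC' eqxx.
move=> S Sk; have [x [xS h]] : exists x, x \notin S /\ #|W| < 2 * #|component e (~: S) x :&: W|.
  apply: contrapT => no'; apply: no; exists S; split => // x xS.
  by rewrite leqNgt; apply/negP => h; apply: no'; exists x.
exists (component e (~: S) x); first by rewrite inE; apply/asboolP; exists S, x.
by rewrite disjoints_subset; apply: comp_sub.
Qed.

(** A vertex [v] is added to [W] to guarantee progress, and the root bag [R] consists of this [W']
    and a balanced separator [S]: at most [2 * k] and fewer than [k] vertices. A component [D] of
    the rest sees at most half of [W'] and the set [S], hence fewer than [2 * k] vertices [N];
    recursion applies to [D :|: N] with root set [N]. *)
Lemma rooted_td_rec n (U W : {set G}) : W \subset U -> #|W| < 2 * k -> #|U :\: W| <= n ->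
  rooted_td (3 * k) U W.
Proof.
elim: n U W => [|n IHn] U W WU Wk UWn.
  apply: rooted_td_base => //; have := cardsID W U; rewrite (setIidPr WU).
  by move: Wk UWn; clear; lia.
case: (leqP #|U| (3 * k)) => Uk; first exact: rooted_td_base.
have [v vUW] : exists v, v \in U :\: W.
  apply/set0Pn; rewrite -card_gt0; have := cardsID W U; rewrite (setIidPr WU).
  by move: Uk Wk; clear; lia.
have [vW vU] : v \notin W /\ v \in U by move: vUW; rewrite inE => /andP[].
pose W' := v |: W.
have W'k : #|W'| <= 2 * k by rewrite cardsU1 vW; move: Wk; clear; lia.
have [S [Sk HS]] := balanced_separator W'.
pose R := W' :|: (S :&: U).
have WR : W \subset R by rewrite /R /W' -setUA; apply: subset_trans (subsetUr _ _); apply: subsetUl.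
have RU : R \subset U.
  by rewrite /R /W' !subUset sub1set vU WU subsetIr.
have Rk : #|R| <= 3 * k.
  have := cardsU W' (S :&: U); have := subset_leq_card (subsetIl S U).
  by rewrite -/R; move: W'k Sk; clear; lia.
apply: (rooted_tdW WR).
(* The components of [U :\: R] are attached to the root one at a time; [Q] is a union of such
   components. *)
suff step q (Q : {set G}) : #|Q| <= q -> Q \subset U :\: R ->
    (forall x y, x \in Q -> y \in U :\: R -> e x y -> y \in Q) -> rooted_td (3 * k) (R :|: Q) R.
  have := @step _ (U :\: R) (leqnn _) (subxx _).
  rewrite (_ : R :|: _ = U); first by apply.
  by apply/setP => z; rewrite in_setU in_setD; case zR : (z \in R) => //=; rewrite (subsetP RU).
elim: q Q => [|q IHq] Q Qq QU clQ.
  move: Qq; rewrite leqn0 cards_eq0 => /eqP ->; rewrite setU0; exact: rooted_td_base.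
case: (set_0Vmem Q) => [->|[x xQ]]; first by rewrite setU0; apply: rooted_td_base.
have xUR := subsetP QU _ xQ.
pose D := component e (U :\: R) x.
have cD : conn e D by apply: comp_conn.
have xD : x \in D by apply: comp_in.
have DU : D \subset U :\: R := comp_sub e _ _.
have DQ : D \subset Q.
  apply: (conn_closed cD); last by exists x.
  by move=> y z yQ _ /(subsetP DU) zU; apply: clQ.
pose N := nbr e D :&: R.
have nD z : z \in D -> z \notin R by move=> /(subsetP DU); rewrite inE => /andP[].
have Nk : #|N| < 2 * k.
  have xS : x \notin S.
    by move: xUR; rewrite !inE !negb_or !negb_and => /andP[/andP[_ /orP[//|/negbTE ->]]].
  have Dc : D \subset component e (~: S) x.
    apply: comp_max => //; last by exists x => //; apply: comp_in; rewrite inE.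
    apply/subsetP => z zD; rewrite inE; have := subsetP DU _ zD.
    by rewrite !inE !negb_or !negb_and => /andP[/andP[_ /orP[//|/negbTE ->]]].
  have : N \subset (component e (~: S) x :&: W') :|: S.
    apply/subsetP => z; rewrite in_setI => /andP[/nbrP[w wD ewz] zR].
    rewrite inE; case zS : (z \in S); rewrite ?orbT // orbF in_setI; apply/andP; split; last first.
      by move: zR; rewrite inE [z \in S :&: U]inE zS orbF.
    by apply: (comp_closed (subsetP Dc _ wD) _ ewz); rewrite inE zS.
  move=> /subset_leq_card; have := HS x xS; have := cardsU (component e (~: S) x :&: W') S.
  by move: W'k Sk k0; clear; lia.
have t1 : rooted_td (3 * k) (R :|: (Q :\: D)) R.
  apply: IHq.
  - have := cardsID D Q; rewrite (setIidPr DQ).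
    have : 0 < #|D| by rewrite card_gt0; apply/set0Pn; exists x.
    by move: Qq; clear; lia.
  - by apply: subset_trans (subsetDl _ _) QU.
  move=> y z; rewrite !in_setD => /andP[yD yQ] /andP[zR zU] eyz.
  have zQ : z \in Q by apply: (clQ y z yQ _ eyz); rewrite in_setD zR.
  rewrite zQ andbT; apply: contra yD => zD.
  apply: (comp_closed zD); last by rewrite es.
  exact: (subsetP QU).
have t2 : rooted_td (3 * k) (D :|: N) N.
  apply: IHn => //; first exact: subsetUr.
  have : (D :|: N) :\: N \subset (U :\: W) :\ v.
    apply/subsetP => z; rewrite in_setD in_setU => /andP[zN]; rewrite (negbTE zN) orbF => zD.
    have := subsetP DU _ zD; rewrite !inE !negb_or => /andP[/andP[/andP[-> ->] _] ->] //.
  move=> /subset_leq_card; have := cardsD1 v (U :\: W); rewrite vUW.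
  by move: UWn; clear; lia.
have eU : R :|: Q = (R :|: (Q :\: D)) :|: (D :|: N).
  by apply: setU_split => //; apply: subsetIr.
have eI : (R :|: (Q :\: D)) :&: (D :|: N) \subset N by apply: setI_split.
rewrite eU; apply: (rooted_td_glue t1 t2 _ eI).
  by apply: subset_trans eI (subsetIr _ _).
move=> u v' + /setUP[vD|vN] euv; last first.
  by right; apply/setUP; left; apply: (subsetP (subsetIr (nbr e D) R)).
move=> /setUP[uR|]; last rewrite in_setD => /andP[uD uQ].
  by left; apply/setUP; right; rewrite in_setI uR andbT; apply/nbrP; exists v' => //; rewrite es.
case/negP: uD; apply: (comp_closed vD); last by rewrite es.
exact: (subsetP QU).
Qed.

End Duality.

(** A weak form of the duality of treewidth and brambles: the bags have at most [3 * k] vertices. *)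
Theorem bramble_of_treewidth (G : sgraph) k : 0 < k -> 3 * k < treewidth G ->
  exists B, bramble (@edge G) B k.
Proof.
move=> k0 tw; apply: contrapT => no; move: tw; rewrite ltnNge => /negP; apply.
apply: rooted_td_treewidth; apply: (@rooted_td_rec G k k0 _ #|[set: G] :\: set0|); rewrite ?sub0set ?cards0 //.
  by move=> B hB; apply: no; exists B.
by rewrite muln_gt0.
Qed.

(** * The grid theorem *)

Section Tangle.
Variables (V : finType) (e : rel V) (B : {set {set V}}) (k : nat).
Hypothesis es : symmetric e.
Hypothesis brB : bramble e B k.
Implicit Types (S C X Y Z : {set V}).

(* [C] is the component of [V \ S] singled out by the bramble. *)
Definition big_comp S C : Prop :=
  [/\ conn e C, [disjoint C & S],
      forall u v, u \in C -> v \notin S -> e u v -> v \in C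
    & exists b, [/\ b \in B, [disjoint b & S] & b \subset C]].

Lemma bramble_el b : b \in B -> conn e b /\ exists x, x \in b.
Proof. by case: brB => H _ _ /H[cb /set0Pn]. Qed.

Lemma big_comp_exists S : #|S| < k -> exists C, big_comp S C.
Proof.
case: brB => _ _ H /H[b bB dbS]; have [cb [x xb]] := bramble_el bB.
have sb : b \subset ~: S by rewrite -disjoints_subset.
have xS : x \in ~: S by apply: (subsetP sb).
exists (component e (~: S) x); split.
- exact: comp_conn.
- by rewrite disjoints_subset; apply: comp_sub.
- by move=> u v uC vS; apply: (comp_closed uC); rewrite inE.
exists b; split => //; apply: comp_max => //; exists x => //; exact: comp_in.
Qed.

Lemma big_comp_disj S C u : big_comp S C -> u \in C -> u \notin S.
Proof. by case=> _ d _ _ uC; rewrite (disjointFr d uC). Qed.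

Lemma big_comp_max S C D : big_comp S C -> conn e D -> [disjoint D & S] ->
  (exists2 x, x \in D & x \in C) -> D \subset C.
Proof.
move=> [_ _ cl _] cD dD ex; apply: (conn_closed cD) => // u v uC _ vD.
by apply: cl => //; rewrite (disjointFr dD vD).
Qed.

(** [C] contains a member that avoids [S], and [b] touches this member. *)
Lemma big_comp_el S C b : big_comp S C -> b \in B -> [disjoint b & S] -> b \subset C.
Proof.
move=> hC bB dbS; have [cb _] := bramble_el bB.
apply: (big_comp_max hC) => //; case: (hC) => _ _ cl [b0 [b0B db0 sb0]].
case: brB => _ /(_ b0 b b0B bB)[x [y [xb0 yb xy]]] _.
exists y => //; case/orP: xy => [/eqP <-|exy]; first exact: (subsetP sb0).
by apply: (cl x) => //; [apply: (subsetP sb0)|rewrite (disjointFr dbS yb)].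
Qed.

Lemma big_comp_in S C : big_comp S C -> exists x, x \in C.
Proof. by case=> _ _ _ [b [bB _ bC]]; have [_ [x xb]] := bramble_el bB; exists x; apply: (subsetP bC). Qed.

Lemma big_comp_mono S S' C C' : big_comp S C -> big_comp S' C' -> S \subset S' -> C' \subset C.
Proof.
move=> hC hC' sS; case: (hC') => cC' dC' _ [b [bB db sb]].
have d' (D : {set V}) : [disjoint D & S'] -> [disjoint D & S].
  by rewrite !disjoints_subset => h; apply: subset_trans h _; rewrite setCS.
apply: (big_comp_max hC) => //; first exact: d'.
have [_ [x xb]] := bramble_el bB; exists x; first exact: (subsetP sb).
exact: (subsetP (big_comp_el hC bB (d' _ db))).
Qed.

(** Otherwise [C'] would be closed in the connected set [C], hence equal to it, but [v] is not in
    [C']. *)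
Lemma big_comp_adj S C v C' : big_comp S C -> v \in C -> big_comp (v |: S) C' ->
  exists2 w, w \in C' & e v w.
Proof.
move=> hC vC hC'; have C'C := big_comp_mono hC hC' (subsetUr _ _).
apply: contrapT => no; have [x xC'] := big_comp_in hC'.
case: (hC) => cC _ _ _.
have : C \subset C'.
  apply: (conn_closed cC).
    move=> y z yC' yC zC eyz; case: (hC') => _ _ cl _; apply: (cl y) => //.
    rewrite !inE negb_or (big_comp_disj hC zC) andbT; apply/negP => /eqP zv.
    by apply: no; exists y; rewrite // es -zv.
  by exists x => //; apply: (subsetP C'C).
move=> /subsetP/(_ _ vC) vC'; have := big_comp_disj hC' vC'; by rewrite !inE eqxx.
Qed.

(* The handle [P] of a comb: by the last clause it cannot be avoided by the bramble
   with fewer than [h] vertices, so Menger yields [h] disjoint teeth from [P] to [X],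
   on the boundary of [C]. *)
Definition comb_data h (P : seq V) X C : Prop :=
  [/\ (exists x q, P = x :: q /\ path e x q), uniq P, #|X| = h, big_comp X C &
      [/\ [disjoint [set z in P] & C] &
      forall S C', #|S| < h -> big_comp S C' -> exists2 z, z \in P & z \in C']].

(** Among the paths that avoid the big component [C] of a set [S] of fewer than [h] vertices and end
    next to a vertex [v] of [C], take a longest one, and append [v] to the path and to [S]. If a set
    [S2] of fewer than [h] vertices had a big component missing the new path, the path could be
    prolonged from [v] up to that component. That the new [S] has exactly [h] vertices follows by
    applying the last clause to it. *)
Lemma comb_exists h : 1 < h -> 2 * h <= k -> exists P X C, comb_data h P X C.
Proof.
move=> h1 hk.
have hk' m : m <= h -> m < k by move: h1 hk; clear; lia.
pose T := (seq V * {set V} * {set V})%type.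
pose ok (t : T) := let '(P, S0, C) := t in [/\ (exists x q, P = x :: q /\ path e x q /\
   exists2 w, w \in C & e (last x q) w), uniq P, #|S0| < h, big_comp S0 C &
   [disjoint [set z in P] & C]].
have ex0 : exists t, ok t.
  have [C0 hC0] : exists C, big_comp set0 C by apply: big_comp_exists; rewrite cards0 hk'.
  have [v vC0] := big_comp_in hC0.
  have [C hC] : exists C, big_comp (v |: set0) C.
    by apply: big_comp_exists; rewrite setU0 cards1 hk' // ltnW.
  exists ([:: v], (v |: set0), C); split => //.
  - exists v, [::]; split => //; split => //; exact: big_comp_adj hC0 vC0 hC.
  - by rewrite setU0 cards1.
  rewrite disjoints_subset; apply/subsetP => z; rewrite !inE => /eqP ->.
  by apply/negP => /(big_comp_disj hC); rewrite !inE eqxx.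
have [[[P S] C] [[[x [q [eP [pq [v vC lv]]]]] uP Sh hC dPC] Pmax]] :=
  exists_min (fun t : T => #|V| - size t.1.1) ex0.
have vS := big_comp_disj hC vC.
have [C' hC'] : exists C', big_comp (v |: S) C'.
  by apply: big_comp_exists; rewrite hk' // cardsU1 vS.
have vP : v \notin P by apply/negP => vP; have := disjointFr dPC (x := v); rewrite inE vP vC => /(_ isT).
have C'C := big_comp_mono hC hC' (subsetUr _ _).
have vC' : v \notin C' by apply/negP => /(big_comp_disj hC'); rewrite !inE eqxx.
have PC' z : z \in P -> z \notin C'.
  by move=> zP; apply: contraFN (disjointFr dPC (x := z) _) => [/(subsetP C'C)|]; rewrite ?inE.
case: (pselect (forall S C', #|S| < h -> big_comp S C' -> exists2 z, z \in rcons P v & z \in C')) => [good|].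
  exists (rcons P v), (v |: S), C'; split => //.
  - by exists x, (rcons q v); rewrite eP rcons_path pq lv.
  - by rewrite rcons_uniq vP.
  - apply/eqP; rewrite eqn_leq cardsU1 vS add1n Sh /=; apply: contraT; rewrite -ltnNge => lt.
    have [|z zP zC'] := good (v |: S) C' _ hC'; first by rewrite cardsU1 vS.
    by move: zP; rewrite mem_rcons inE => /predU1P[zv|/PC' zn]; [rewrite -zv zC' in vC'|rewrite zC' in zn].
  split => //; rewrite disjoints_subset; apply/subsetP => z.
  by rewrite !inE mem_rcons inE => /predU1P[->|/PC'].
move=> /existsNP[S2 /existsNP[C2 /not_implyP[S2h /not_implyP[hC2 nz]]]].
have PC2 z : z \in rcons P v -> z \notin C2 by move=> zP; apply/negP => zC2; apply: nz; exists z.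
(* At most [h] vertices and fewer than [h] vertices together stay below [2 * h]. The big component
   of the union lies in [C'] and in [C2], so these two meet. *)
have [C3 hC3] : exists C3, big_comp ((v |: S) :|: S2) C3.
  apply: big_comp_exists; apply: leq_ltn_trans (leq_card_setU _ _) _; rewrite cardsU1 vS.
  by move: Sh S2h hk; clear; lia.
have [w wC3] := big_comp_in hC3.
have wC' : w \in C' by apply: (subsetP (big_comp_mono hC' hC3 _)) => //; apply: subsetUl.
have wC2 : w \in C2 by apply: (subsetP (big_comp_mono hC2 hC3 _)) => //; apply: subsetUr.
have [u uC' evu] := big_comp_adj hC vC hC'.
have cvC' : conn e (v |: C').
  by apply: connU => //; [apply: conn1|case: hC'|exists v, u; rewrite inE eqxx uC' evu orbT].
have [|w' [z [iz zC2 nC2 hz sz]]] := conn_first (x := v) (f := mem C2) cvC' (setU11 _ _).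
  by exists w => //; rewrite inE wC' orbT.
case: w' iz nC2 hz sz => [|v' w'] iz nC2 /= hz sz.
  by have := PC2 v; rewrite mem_rcons mem_head -hz [z \in C2]zC2 => /(_ isT).
subst v'.
have pz := ipath_path iz; move: pz; rewrite rcons_path => /andP[pw lz].
have uz := ipath_uniq iz; rewrite rcons_uniq in uz; case/andP: uz => zw uw.
have sw t : t \in v :: w' -> t \in v |: C'.
  by move=> tw; apply: sz; rewrite -rcons_cons mem_rcons inE tw orbT.
have /Pmax /= : ok (P ++ v :: w', S2, C2).
  split => //.
  - exists x, (q ++ v :: w'); rewrite eP; split => //; rewrite cat_path last_cat /= pq lv pw.
    by split => //; exists z.
  - rewrite cat_uniq uP uw andbT /=; apply/norP; split => //.
    apply/hasPn => t tw; apply/negP => tP.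
    have := sw t; rewrite inE tw orbT => /(_ isT) /setU1P[tv|tC'].
      by rewrite -tv tP in vP.
    by move: (PC' _ tP); rewrite tC'.
  rewrite disjoints_subset; apply/subsetP => t; rewrite !inE mem_cat => /orP[tP|tw].
    by apply: PC2; rewrite mem_rcons inE tP orbT.
  by apply: contra nC2 => tC2; apply/hasP; exists t.
have : size (P ++ v :: w') <= #|V|.
  rewrite -(card_uniqP _) ?max_card //; rewrite cat_uniq uP uw andbT /=; apply/norP; split => //.
  apply/hasPn => t tw; apply/negP => tP.
  have := sw t; rewrite inE tw orbT => /(_ isT) /setU1P[tv|tC'].
    by rewrite -tv tP in vP.
  by move: (PC' _ tP); rewrite tC'.
by rewrite size_cat /=; clear; lia.
Qed.

Definition restr (A : {set V}) : rel V := fun u v => [&& u \in A, v \in A & e u v].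

Lemma restr_path A x p : path (restr A) x p -> path e x p /\ {subset p <= A}.
Proof.
elim: p x => //= y p IH x /andP[/and3P[xA yA exy] /IH[pp sp]]; rewrite exy; split => //.
by move=> z; rewrite inE => /predU1P[->|/sp].
Qed.

Lemma path_restr (A : {set V}) x p : path e x p -> {subset x :: p <= A} -> path (restr A) x p.
Proof.
elim: p x => //= y p IH x /andP[exy pp] sA; rewrite /= /restr exy !sA ?inE ?eqxx ?orbT //=.
by apply: IH => // z zp; apply: sA; rewrite inE zp orbT.
Qed.

Section WithComb.
Variables (h : nat) (P : seq V) (X C : {set V}).
Hypothesis hk : 2 * h <= k.
Hypothesis data : comb_data h P X C.

Lemma comb_notin z : z \in P -> z \notin C.
Proof. by case: data => _ _ _ _ [d _] zP; rewrite (disjointFr d) ?inE. Qed.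

(** Suppose that fewer than [h] vertices [S] separate. The big component of [S :\: C] contains [C]
    and, by the last clause of [comb_data], a vertex of [P]. Within it [P] is joined to [C]; since
    [C] is entered only through [X], this gives a path from [P] to [X] outside [C] that avoids
    [S]. *)
Lemma comb_legs : linked (restr (~: C)) [set z in P] X h.
Proof.
apply: menger => S sepS; rewrite leqNgt; apply/negP => Sh.
case: (data) => [_ _ cX hC [dPC wide]].
pose S' := S :\: C.
have S'h : #|S'| < h by apply: leq_ltn_trans Sh; apply: subset_leq_card; apply: subsetDl.
have [C2 hC2] : exists C2, big_comp S' C2.
  by apply: big_comp_exists; move: S'h hk; clear; lia.
have CC2 : C \subset C2.
  have [b [bB db sb]] : exists b, [/\ b \in B, [disjoint b & X] & b \subset C] by case: hC.
  have dbS' (D : {set V}) : D \subset C -> [disjoint D & S'].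
    move=> sD; rewrite disjoints_subset; apply/subsetP => z zD; rewrite !inE negb_and negbK.
    by rewrite (subsetP sD).
  have [_ [x xb]] := bramble_el bB.
  apply: (big_comp_max hC2); [by case: hC|exact: dbS'|exists x; first exact: (subsetP sb)].
  by apply: (subsetP (big_comp_el hC2 bB (dbS' _ sb))).
have [x xP xC2] := wide _ _ S'h hC2.
have [w wC] := big_comp_in hC.
have cC2 : conn e C2 by case: hC2.
have [|p [z [iz fz nf hz sz]]] := conn_first (f := [pred z | (z \in X) || (z \in C)]) cC2 xC2.
  by exists w; [apply: (subsetP CC2)|rewrite /= wC orbT].
have pC u : u \in p -> u \notin C.
  by move=> up; apply: contra nf => uC; apply/hasP; exists u; rewrite //= uC orbT.
have pX u : u \in p -> u \notin X.
  by move=> up; apply: contra nf => uC; apply/hasP; exists u; rewrite //= uC.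
have zC : z \notin C.
  apply/negP => zC; case/lastP: p iz hz sz {nf} pC pX => [|p u] iz hz sz pC pX.
    by move: hz => /= hz; rewrite hz in zC; rewrite (negbTE (comb_notin xP)) in zC.
  have euz := ipath_rcons_edge iz.
  have uC : u \notin C by apply: pC; rewrite mem_rcons mem_head.
  have uX : u \notin X by apply: pX; rewrite mem_rcons mem_head.
  by case: hC => _ _ cl _; rewrite (cl z u zC uX) // es in uC.
have zX : z \in X by case/orP: fz => // h'; rewrite h' in zC.
have sub u : u \in rcons p z -> u \in ~: C.
  by rewrite inE mem_rcons inE => /predU1P[->|/pC].
have : ABpath (restr (~: C)) [set z in P] X (rcons p z).
  case: p iz hz sz sub {nf pC pX} => [|y p] iz /= hz sz sub; first by rewrite hz inE xP -hz zX.
  by rewrite hz inE xP last_rcons zX andbT; apply: path_restr; [rewrite -hz; apply: ipath_path|rewrite -hz].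
move=> /sepS/hasP[u up uS]; have := sz u up => /(big_comp_disj hC2).
by rewrite inE [u \in S]uS andbT negbK => uC; have := sub u up; rewrite inE uC.
Qed.

(** Suppose that fewer than [n] vertices [S] separate. The big component [C'] of [X] and [S :&: C]
    together cannot have neighbours in both [Y] and [Z], since a path through it would avoid [S]. If
    it has none in [Y], say, its neighbourhood [N] has fewer than [(h - n) + n] vertices and still
    has [C'] as big component, so [C'] would meet [P], contrary to being inside [C]. *)
Lemma comb_links n Y Z : Y \subset X -> Z \subset X -> [disjoint Y & Z] ->
  n <= #|Y| -> n <= #|Z| -> linked (restr C) (nbr e Y :&: C) (nbr e Z :&: C) n.
Proof.
move=> YX ZX dYZ nY nZ; apply: menger => S sepS; rewrite leqNgt; apply/negP => Sn.
case: (data) => [_ _ cX hC [dPC wide]].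
have nh : n <= h by apply: leq_trans nY _; rewrite -cX subset_leq_card.
pose S' := S :&: C.
have S'n : #|S'| < n by apply: leq_ltn_trans Sn; apply: subset_leq_card; apply: subsetIl.
have XS'k : #|X :|: S'| < k.
  by apply: leq_ltn_trans (leq_card_setU _ _) _; rewrite cX; move: S'n nh hk; clear; lia.
have [C' hC'] := big_comp_exists XS'k.
have C'C := big_comp_mono hC hC' (subsetUl _ _).
pose N := nbr e C' :&: (X :|: S').
have hN : big_comp N C'.
  case: (hC') => c d cl [b [bB db sb]]; split => //.
  - by apply: disjointWr d; apply: subsetIr.
  - move=> u v uC' vN euv; apply: (cl u) => //; apply: contra vN => vXS; rewrite in_setI vXS andbT.
    by apply/nbrP; exists u.
  by exists b; split => //; apply: disjointWr db; apply: subsetIr.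
have no y z : y \in Y -> y \in N -> z \in Z -> z \in N -> False.
  move=> yY /setIP[/nbrP[c1 c1C' e1] _] zZ /setIP[/nbrP[c2 c2C' e2] _].
  have cC' : conn e C' by case: hC'.
  have [p [ip lp sp]] := conn_ipath cC' c1C' c2C'.
  have : ABpath (restr C) (nbr e Y :&: C) (nbr e Z :&: C) (c1 :: p).
    rewrite /= lp !in_setI !(subsetP C'C) // !andbT; apply/and3P; split.
    - by apply/nbrP; exists y; rewrite // es.
    - by apply: path_restr (ipath_path ip) _ => u /sp; apply: (subsetP C'C).
    by apply/nbrP; exists z; rewrite // es.
  move=> /sepS/hasP[u /sp uC' uS]; have := big_comp_disj hC' uC'.
  by rewrite !inE [u \in S]uS (subsetP C'C) // orbT.
have small (Q : {set V}) : Q \subset X -> n <= #|Q| -> [disjoint Q & N] -> False.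
  move=> QX nQ dQ.
  have Nh : #|N| < h.
    have : N \subset (X :\: Q) :|: S'.
      apply/subsetP => u uN; have /setIP[_ /setUP[uX|uS]] := uN; last by rewrite inE uS orbT.
      by rewrite !inE uX andbT (disjointFl dQ uN).
    move=> /subset_leq_card; have [le1 _] := leq_card_setU (X :\: Q) S'; move: le1.
    have := cardsID Q X; rewrite (setIidPr QX) cX; move: S'n nQ nh; clear; lia.
  have [z zP zC'] := wide _ _ Nh hN.
  by move: (comb_notin zP); rewrite (subsetP C'C).
case: (set_0Vmem (Y :&: N)) => [Y0|[y /setIP[yY yN]]].
  by apply: (small Y) => //; rewrite -setI_eq0 Y0.
case: (set_0Vmem (Z :&: N)) => [Z0|[z /setIP[zZ zN]]].
  by apply: (small Z) => //; rewrite -setI_eq0 Z0.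
exact: no yY yN zZ zN.
Qed.

(** The [h] legs are trimmed to start at their last vertex on [P]. Ranking their feet along [P] and
    cutting [P] into [m] intervals with [n] feet each, a block is such an interval together with its
    legs, which end in [n] distinct vertices of [X]. *)
Lemma comb_blocks m n : 0 < n -> h = m * n -> exists T : 'I_m -> {set V},
  [/\ forall i, conn e (T i), forall i j z, z \in T i -> z \in T j -> i = j,
      forall i z, z \in T i -> z \notin C & forall i, n <= #|T i :&: X|].
Proof.
move=> n0 hmn; have [L [HL DL]] := comb_legs.
case: (data) => [[x [q [eP pq]]] uP _ _ _].
have HM i : exists M : V * seq V, [/\ M.1 \in P, ~~ has (mem P) M.2,
    path e M.1 M.2 /\ last M.1 M.2 \in X, {subset M.1 :: M.2 <= L i} &
    forall z, z \in M.1 :: M.2 -> z \notin C].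
  have [] := HL i; case: (L i) => // y s abp _.
  have : has (mem P) (rev (y :: s)).
    rewrite has_rev; apply/hasP; exists y; first exact: mem_head.
    by have /and3P[] := abp; rewrite inE.
  move=> /split_find; case E : _ _ _ / => [u s1 s2 uin nP].
  have {}E : y :: s = rev s2 ++ u :: rev s1 by rewrite -[LHS]revK E rev_cat rev_rcons.
  have /= /and3P[_ /restr_path[pu su] lX] : ABpath (restr (~: C)) [set u] X (u :: rev s1).
    by have := abp; rewrite E => /ABpath_cat[].
  exists (u, rev s1); split => //=.
  - by rewrite has_rev.
  - by move=> z zs; rewrite E mem_cat zs orbT.
  by move=> z; rewrite inE => /predU1P[->|/su]; [apply: comb_notin|rewrite inE].
have [M {}HM] := choice HM.
pose pos i := index (M i).1 P.
have posI i j : pos i = pos j -> i = j.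
  have [fi _ _ si _] := HM i; have [fj _ _ sj _] := HM j.
  move=> /(congr1 (nth x P)); rewrite !nth_index // => f; apply: (DL i j (M i).1).
    by apply: si; apply: mem_head.
  by rewrite f; apply: sj; apply: mem_head.
have rkP i : #|[set j | pos j < pos i]| < h.
  have : [set j | pos j < pos i] \proper [set: 'I_h].
    by rewrite properT; apply/eqP => /setP/(_ i); rewrite !inE ltnn.
  by move=> /proper_card; rewrite cardsT card_ord.
pose rk i : 'I_h := Ordinal (rkP i).
have rk_lt i j : pos i < pos j -> rk i < rk j.
  move=> lt; apply: proper_card; rewrite properE; apply/andP; split.
    by apply/subsetP => l; rewrite !inE => l1; apply: ltn_trans l1 lt.
  by apply/subsetPn; exists i; rewrite !inE ?ltnn.
have rk_le i j : rk i <= rk j -> pos i <= pos j.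
  by rewrite leqNgt => nl; rewrite leqNgt; apply: contra nl; apply: rk_lt.
have rk_le' i j : pos i <= pos j -> rk i <= rk j.
  rewrite leq_eqVlt => /orP[/eqP/posI -> //|/rk_lt]; exact: ltnW.
have rkI : injective rk.
  by move=> i j E; apply: posI; apply/eqP; rewrite eqn_leq !rk_le ?E.
pose ri := invF rkI.
have rkri r : rk (ri r) = r by apply: f_invF.
have bnd (b : 'I_m) r : r < n -> b * n + r < h.
  move=> rn; rewrite hmn; apply: (@leq_trans (b.+1 * n)); first by rewrite mulSn addnC ltn_add2r.
  by rewrite leq_mul2r ltn_ord orbT.
have n1 : n.-1 < n by rewrite prednK.
pose lo b := pos (ri (Ordinal (bnd b 0 n0))).
pose hi b := pos (ri (Ordinal (bnd b n.-1 n1))).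
have inblk i (b : 'I_m) : (lo b <= pos i <= hi b) = (rk i %/ n == b).
  apply/idP/eqP.
    move=> /andP[/rk_le' h1 /rk_le' h2]; move: h1 h2; rewrite !rkri [val _]/= [val _]/= addn0.
    move=> /= h1 h2; apply/eqP; rewrite eqn_leq leq_divRL // h1 andbT -ltnS ltn_divLR //.
    by apply: leq_ltn_trans h2 _; rewrite mulSn [n + _]addnC ltn_add2l.
  move=> E; have lt := ltn_pmod (rk i) n0.
  have h0 : b * n + 0 <= rk i by rewrite addn0 -E leq_trunc_div.
  have h2 : rk i <= b * n + n.-1.
    by rewrite -E {1}(divn_eq (rk i) n) leq_add2l -ltnS prednK.
  by apply/andP; split; apply: rk_le; rewrite rkri.
pose Seg b := [set z | (z \in P) && (lo b <= index z P <= hi b)].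
pose leg i := [set z in (M i).1 :: (M i).2].
pose T (b : 'I_m) := Seg b :|: \bigcup_(i | rk i %/ n == b) leg i.
have fSeg i (b : 'I_m) : rk i %/ n == b -> (M i).1 \in Seg b.
  by rewrite -inblk inE => ->; have [-> _] := HM i.
have inT b z : z \in T b -> z \in Seg b \/ exists2 i, rk i %/ n == b & z \in leg i.
  by move=> /setUP[|/bigcupP[i ib zi]]; [left|right; exists i].
have blk0 (b : 'I_m) : rk (ri (Ordinal (bnd b 0 n0))) %/ n == b.
  by rewrite rkri /= addn0 mulnK.
exists T; split.
- move=> b; apply: conn_bigcup => //.
  + have up' : uniq (x :: q) by rewrite -eP.
    have [|y [s [ps Es]]] := path_interval (lo := lo b) (hi := hi b) pq up'.
      exists (M (ri (Ordinal (bnd b 0 n0)))).1; rewrite -eP; last by rewrite inblk.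
      by have [] := HM (ri (Ordinal (bnd b 0 n0))).
    rewrite (_ : Seg b = [set z in y :: s]); first exact: path_conn.
    by apply/setP => z; rewrite !inE -in_cons Es -eP.
  + by apply/set0Pn; exists (M (ri (Ordinal (bnd b 0 n0)))).1; apply: fSeg.
  + by move=> i _; have [_ _ [pi _] _ _] := HM i; apply: path_conn.
  move=> i ib; exists (M i).1, (M i).1; rewrite fSeg // eqxx; split => //.
  by rewrite /leg in_set mem_head.
- have SS (b b' : 'I_m) z : b < b' -> z \in Seg b -> z \in Seg b' -> False.
    move=> lt; rewrite !inE => /andP[_ /andP[_ h1]] /andP[_ /andP[h2 _]].
    have : lo b' <= hi b by apply: leq_trans h2 h1.
    move=> /rk_le'; rewrite !rkri /= addn0 leqNgt => /negP; apply.
    apply: (@leq_trans (b.+1 * n)); last by rewrite leq_mul2r lt orbT.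
    by rewrite mulSn addnC ltn_add2r.
  have SL (b b' : 'I_m) i z : rk i %/ n == b' -> z \in leg i -> z \in Seg b -> b = b'.
    move=> ib' zi /[!inE] /andP[zP]; have [_ nP _ _ _] := HM i.
    move: zi; rewrite !inE => /predU1P[->|zt].
      by rewrite inblk (eqP ib') => /eqP h1; apply: val_inj.
    by case/hasP: nP; exists z.
  move=> b b' z /inT [zb|[i ib zi]] /inT [zb'|[i' ib' zi']].
  + by apply: val_inj; case: (ltngtP b b') => // lt; [case: (SS b b' z)|case: (SS b' b z)].
  + exact: SL ib' zi' zb.
  + by apply/esym; apply: SL ib zi zb'.
  have ii : i = i'.
    have [_ _ _ si _] := HM i; have [_ _ _ si' _] := HM i'.
    by move: zi zi'; rewrite /leg !in_set => /si zi /si'; apply: DL.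
  by apply: val_inj; apply: etrans (esym (eqP ib)) _; rewrite ii; exact: (eqP ib').
- move=> b z /inT [|[i _]]; first by rewrite inE => /andP[/comb_notin].
  by rewrite /leg in_set; have [_ _ _ _ h1] := HM i; apply: h1.
move=> b; pose g (r : 'I_n) := let i := ri (Ordinal (bnd b r (ltn_ord r))) in last (M i).1 (M i).2.
have gi : injective g.
  move=> r r' E; pose i := ri (Ordinal (bnd b r (ltn_ord r))); pose i' := ri (Ordinal (bnd b r' (ltn_ord r'))).
  have [_ _ _ si _] := HM i; have [_ _ _ si' _] := HM i'.
  have : i = i'.
    apply: (DL _ _ (g r)); first by apply/si/mem_last.
    by rewrite E; apply/si'/mem_last.
  by move=> /(congr1 rk); rewrite !rkri => /(congr1 val) /= /addnI h1; apply: val_inj.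
rewrite -[X in X <= _](card_ord n) -(card_imset _ gi); apply: subset_leq_card.
apply/subsetP => _ /imsetP[r _ ->]; have [_ _ [_ lX] _ _] := HM (ri (Ordinal (bnd b r (ltn_ord r)))).
rewrite inE lX andbT; apply/setUP; right; apply/bigcupP; exists (ri (Ordinal (bnd b r (ltn_ord r)))).
  by rewrite rkri /= divnMDl // divn_small // addn0.
by rewrite /leg in_set mem_last.
Qed.

End WithComb.
End Tangle.

Lemma path_infixP (T : eqType) (r : rel T) x q :
  reflect (forall u v, infix [:: u; v] (x :: q) -> r u v) (path r x q).
Proof.
apply: (iffP idP).
  move=> pq u v /infixP[s [s' E]].
  have : sorted r (s ++ u :: v :: s') by rewrite -[_ ++ _]E.
  by move=> /cat_sorted2[_ /= /andP[]].
elim: q x => [//|y q IH] x H; rewrite [path _ _ _]/= H ?IH //.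
  by move=> u v /infixP[s1 [s2 E]]; apply: H; apply/infixP; exists (x :: s1), s2; rewrite E.
by apply/infixP; exists [::], q.
Qed.

Lemma infix_mem (T : eqType) (u v : T) s : infix [:: u; v] s -> u \in s /\ v \in s.
Proof. by move=> /infixP[s1 [s2 ->]]; rewrite !mem_cat !inE !eqxx !orbT. Qed.

(** * Separators ordering a path system along a linkage *)

Section Families.
Variable V : finType.

Definition cons_edge n (F : 'I_n -> seq V) : rel V := fun u v =>
  [exists i, infix [:: u; v] (F i) || infix [:: v; u] (F i)].

Lemma cons_edge_sym n (F : 'I_n -> seq V) : symmetric (cons_edge F).
Proof. by move=> u v; apply: eq_existsb => i; rewrite orbC. Qed.

Lemma cons_edge_mem n (F : 'I_n -> seq V) u v : cons_edge F u v ->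
  exists i, u \in F i /\ v \in F i.
Proof. by case/existsP => i /orP[]/infix_mem[]; exists i. Qed.

Definition disjoint_family n (F : 'I_n -> seq V) : Prop :=
  forall i j z, z \in F i -> z \in F j -> i = j.

Section Cut.
Variables (p q : nat) (P : 'I_p -> seq V) (L : 'I_q -> seq V) (A B : {set V}).
Variables (i1 : 'I_q) (p0 : 'I_p).
Hypothesis dP : disjoint_family P.
Hypothesis dL : disjoint_family L.
Hypothesis PN : forall i, exists x s, P i = x :: s.
Hypothesis LAB : forall i, exists x s, [/\ L i = x :: s, x \in A & last x s \in B].
Hypothesis uL : forall i, uniq (L i).

Let t := find (mem (P p0)) (L i1).
Let eu : rel V := fun u v => cons_edge P u v || cons_edge L u v.

Definition cut_rel (x0 y0 : V) : rel V := fun u v =>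
  [&& eu u v, (u, v) != (x0, y0) & (v, u) != (x0, y0)].

Hypothesis t0 : 0 < t.
Hypothesis hit : has (mem (P p0)) (L i1).
Variable d : V.
Let x0 := nth d (L i1) t.-1.
Let y0 := nth d (L i1) t.
Let e' := cut_rel x0 y0.
Hypothesis nlinked : ~ linked e' A B q.

Let y0P : y0 \in P p0. Proof. exact: (nth_find d hit). Qed.

Let tsz : t < size (L i1). Proof. by rewrite -has_find. Qed.

Let x0P : x0 \notin P p0.
Proof. by apply: negbT; apply: (before_find d); rewrite -/t ltn_predL. Qed.

Let x0L : x0 \in L i1. Proof. by apply: mem_nth; apply: leq_ltn_trans tsz; apply: leq_pred. Qed.

Let e'_sym : symmetric e'.
Proof.
move=> u v; rewrite /e' /cut_rel /eu cons_edge_sym (cons_edge_sym L); congr (_ && _).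
by rewrite andbC.
Qed.

Lemma cut_edge_notP : ~~ cons_edge P x0 y0.
Proof.
apply/negP => /cons_edge_mem[i [xi yi]]; move: x0P.
by rewrite (dP y0P yi) xi.
Qed.

Lemma cut_edge_L : cons_edge L x0 y0.
Proof.
apply/existsP; exists i1; apply/orP; left; apply/infixP.
exists (take t.-1 (L i1)), (drop t.+1 (L i1)).
rewrite -[LHS](cat_take_drop t.-1); congr (_ ++ _).
rewrite (drop_nth d) ?prednK //; last by apply: ltnW.
by rewrite (drop_nth d tsz).
Qed.

Let Pedge i u v : infix [:: u; v] (P i) -> e' u v.
Proof.
move=> h; have E : cons_edge P u v by apply/existsP; exists i; rewrite h.
apply/and3P; split; [by rewrite /eu E| |]; apply/eqP => -[h1 h2].
  by move: cut_edge_notP; rewrite -h1 -h2 E.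
by move: cut_edge_notP; rewrite cons_edge_sym -h1 -h2 E.
Qed.

Let Ledge i u v : i != i1 -> infix [:: u; v] (L i) -> e' u v.
Proof.
move=> ii h; have E : cons_edge L u v by apply/existsP; exists i; rewrite h.
have [ui vi] := infix_mem h.
apply/and3P; split; [by rewrite /eu E orbT| |]; apply/eqP => -[h1 h2]; move/eqP: ii; apply.
  by apply: (dL ui); rewrite h1; apply: x0L.
by apply: (dL vi); rewrite h1; apply: x0L.
Qed.

Let L1edge u v s1 s2 : L i1 = s1 ++ u :: v :: s2 -> size s1 != t.-1 -> e' u v.
Proof.
move=> E st.
have El : cons_edge L u v.
  by apply/existsP; exists i1; rewrite E; apply/orP; left; apply/infixP; exists s1, s2.
have iu : index u (L i1) = size s1.
  have := uL i1; rewrite E index_cat cat_uniq /= negb_or => /and3P[_ /andP[/negbTE -> _] _].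
  by rewrite eqxx addn0.
have iv : index v (L i1) = (size s1).+1.
  have := uL i1; rewrite E index_cat cat_uniq /= !negb_or ?inE ?negb_or.
  move=> /and3P[_ /and3P[_ /negbTE -> _] /andP[/andP[/negbTE -> _] _]].
  by rewrite eqxx addn1.
have ix : index x0 (L i1) = t.-1.
  by rewrite index_uniq //; apply: leq_ltn_trans tsz; apply: leq_pred.
have iy : index y0 (L i1) = t by rewrite index_uniq.
apply/and3P; split; [by rewrite /eu El orbT| |]; apply/eqP => -[h1 h2].
  by move: st; rewrite -iu h1 ix eqxx.
have h3 : (size s1).+1 = t.-1 by rewrite -iv h1.
have h4 : size s1 = t by rewrite -iu h2.
by move: h3 t0; rewrite h4; move: (t) => n; clear; lia.
Qed.

(** After deleting the edge just before the first vertex of [P p0] on [L i1], no [q] disjoint paths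
    remain, so Menger gives a separator [S] of fewer than [q] vertices. Let [R] be the region
    reachable from [A] without [S]. It contains an initial part of each [L i], ending at index [t]
    on [L i1] and at the vertex of [S] on the others. A path [P j] avoiding [S] loses no edge, so it
    lies in [R] or outside; where it meets [L i1] decides which. *)
Lemma cut_order : exists S : {set V}, #|S| < q /\ forall j j' i z z' w w',
  [/\ z \in P j, z \in L i1 & index z (L i1) < t] ->
  [/\ z' \in P j', z' \in L i1 & t <= index z' (L i1)] ->
  ~~ has (mem S) (P j) -> ~~ has (mem S) (P j') ->
  w \in P j -> w \in L i -> w' \in P j' -> w' \in L i ->
  index w (L i) < index w' (L i).
Proof.
have [S [sepS Sq]] : exists S, separates e' A B S /\ #|S| < q.
  apply: contrapT => no; apply: nlinked; apply: menger => S sS.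
  by rewrite leqNgt; apply/negP => lt; apply: no; exists S.
exists S; split => //.
have Lpath i : i != i1 -> has (mem S) (L i).
  move=> ii; have [x [s [E xA lB]]] := LAB i; apply: sepS; rewrite E /= xA lB andbT.
  by apply/path_infixP => u v; rewrite -E; apply: Ledge.
have [x1 [s1 [E1 _ _]]] := LAB i1.
pose sg i := nth x1 (L i) (find (mem S) (L i)).
have sgS i : i != i1 -> sg i \in S /\ sg i \in L i.
  by move=> /Lpath h; split; [exact: (nth_find x1 h)|apply: mem_nth; rewrite -has_find].
(* Each of the [q - 1] other paths survives the deletion and meets [S]. As they are disjoint and [S]
   has fewer than [q] vertices, each contains exactly one vertex of [S], and [L i1] contains
   none. *)
have Seq : [set sg i | i in [set~ i1]] = S.
  apply/eqP; rewrite eqEcard; apply/andP; split.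
    by apply/subsetP => _ /imsetP[i + ->]; rewrite !inE => /sgS[].
  rewrite card_in_imset.
    by rewrite cardsC1 card_ord -ltnS prednK //; apply: leq_ltn_trans Sq.
  move=> i j; rewrite !inE => /sgS[_ h1] /sgS[_ h2] E; apply: (dL h1); by rewrite E.
have S1 z : z \in L i1 -> z \notin S.
  rewrite -Seq => zi; apply/imsetP => -[i + E]; rewrite !inE => ii.
  have [_ h] := sgS i ii; rewrite -E in h; by rewrite (dL h zi) eqxx in ii.
have Sone i z : i != i1 -> z \in L i -> z \in S -> z = sg i.
  rewrite -{1}Seq => ii zi /imsetP[j + E]; rewrite !inE => jj.
  by have [_ h] := sgS j jj; rewrite -E in h; rewrite E (dL h zi).
pose R : {set V} := [set z | `[< exists pa, ABpath e' A [set z] pa /\ ~~ has (mem S) pa >]].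
have RP z : z \in R -> exists pa, ABpath e' A [set z] pa /\ ~~ has (mem S) pa.
  by rewrite inE => /asboolP.
have Rstep u v : u \in R -> e' u v -> v \notin S -> v \in R.
  move=> /RP[[|a pa] [// /and3P[aA pp lu] nS]] euv vS; rewrite inE; apply/asboolP.
  exists (a :: rcons pa v); split.
    by rewrite /= aA rcons_path pp last_rcons inE eqxx andbT /=; move: lu; rewrite inE => /eqP ->.
  by rewrite -rcons_cons has_rcons negb_or [mem S v](negbTE vS).
have RB z pa : z \in R -> path e' z pa -> last z pa \in B -> ~~ has (mem S) pa -> False.
  move=> /RP[[|a s] [// /and3P[aA ps la] nS]] pz lB nS'.
  have /sepS : ABpath e' A B (a :: s ++ pa).
    move: la; rewrite inE => /eqP la.
    by rewrite /= aA cat_path last_cat ps la pz.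
  by rewrite -cat_cons has_cat (negbTE nS) (negbTE nS').
have RA a : a \in A -> a \notin S -> a \in R.
  by move=> aA aS; rewrite inE; apply/asboolP; exists [:: a]; rewrite /= aA inE eqxx orbF.
have Rconn i z w : ~~ has (mem S) (P i) -> z \in P i -> w \in P i -> z \in R -> w \in R.
  move=> nS zi wi zR; have [x [s E]] := PN i.
  have cP : conn e' [set y in P i].
    by rewrite E; apply: path_conn => //; apply/path_infixP => u v; rewrite -E; apply: Pedge.
  have /subsetP : [set y in P i] \subset R.
    apply: (conn_closed cP); last by exists z => //; rewrite inE.
    move=> u v uR _; rewrite inE => vP euv; apply: Rstep uR euv _.
    by apply: contra nS => vS; apply/hasP; exists v.
  by apply; rewrite inE.
(* before a cut vertex a row is reachable from [A], after it no longer *)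
have pre i s2 s3 z s : L i = s2 ++ s3 -> z \in s2 -> ~~ has (mem S) s2 ->
    (forall u v, infix [:: u; v] s2 -> e' u v) -> s = s2 -> z \in R.
  move=> E + nS H _; have [x [s' [Ex xA _]]] := LAB i; rewrite E in Ex.
  case: s2 Ex nS H {E} => // y s2 [-> _] /= /norP[xS nS] H zs.
  have c2 : conn e' [set y in x :: s2] by apply: path_conn => //; apply/path_infixP.
  have /subsetP : [set y in x :: s2] \subset R.
    apply: (conn_closed c2); last by exists x; [rewrite inE mem_head|apply: RA].
    move=> u v uR _ vs euv; apply: Rstep uR euv _.
    move: vs; rewrite inE => /predU1P[->//|vs].
    by apply: contra nS => vS; apply/hasP; exists v.
  by apply; rewrite inE.
have post i s2 z s3 : L i = s2 ++ z :: s3 -> ~~ has (mem S) s3 ->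
    (forall u v, infix [:: u; v] (z :: s3) -> e' u v) -> z \notin R.
  move=> E nS H; apply/negP => zR; apply: (RB z s3) => //; first exact/path_infixP.
  have [x [s' [Ex _ lB]]] := LAB i; rewrite E in Ex.
  by have := congr1 (last x) Ex; rewrite last_cat /= => ->.
have rowlt i z : i != i1 -> z \in L i -> z \notin S -> (z \in R) = (index z (L i) < index (sg i) (L i)).
  move=> ii zi zS; have [sS si] := sgS i ii.
  have [s2 [s3 E]] := mem_split si.
  have ui := uL i; have nS s4 : {subset s4 <= L i} -> sg i \notin s4 -> ~~ has (mem S) s4.
    move=> sub ns; apply/hasPn => y ys; apply/negP => yS.
    by move: ns; rewrite -(Sone i y ii (sub y ys) yS) ys.
  move: zi; rewrite E mem_cat inE; have un := ui; rewrite E cat_uniq /= in un.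
  case/and3P: un => _ /norP[ns2 /hasPn dj] /andP[ns3 us3].
  have is_ : index (sg i) (s2 ++ sg i :: s3) = size s2.
    by rewrite index_cat (negbTE ns2) /= eqxx addn0.
  rewrite is_ => /or3P[zs|/eqP zs|zs].
  - rewrite index_cat zs index_mem zs; apply: (pre i s2 (sg i :: s3) z s2) => //.
      by apply: nS => // y ys; rewrite E mem_cat ys.
    by move=> u v h; apply: (Ledge ii); rewrite E; apply: infix_trans h _; apply: prefix_infix; apply: prefix_prefix.
  - by rewrite zs sS in zS.
  have zs2 := dj z zs; rewrite index_cat (negbTE zs2) ltnNge leq_addr /=.
  have [s4 [s5 E']] := mem_split zs.
  apply/negbTE; apply: (post i (s2 ++ sg i :: s4) z s5).
  - by rewrite E E' -catA.
  - apply: nS; first by move=> y ys; rewrite E E' mem_cat inE mem_cat inE ys !orbT.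
    by apply: contra ns3 => h; rewrite E' mem_cat inE h !orbT.
  move=> u v h; apply: (Ledge ii); rewrite E E'; apply: infix_trans h _.
  by apply/infixP; exists (s2 ++ sg i :: s4), [::]; rewrite cats0 -catA.
have row1 z : z \in L i1 -> (z \in R) = (index z (L i1) < t).
  move=> zi.
  have nS s4 : {subset s4 <= L i1} -> ~~ has (mem S) s4.
    by move=> sub; apply/hasPn => y /sub; apply: S1.
  have E := cat_take_drop t (L i1).
  case: ltnP => lt.
    apply: (pre i1 (take t (L i1)) (drop t (L i1)) z _ (esym E) _ _ _ erefl).
    - by rewrite in_take.
    - by apply: nS => y; apply: mem_take.
    move=> u v /infixP[s2 [s3 E2]].
    apply: (@L1edge u v s2 (s3 ++ drop t (L i1))); first by rewrite -[LHS]E E2 -catA.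
    have := congr1 size E2; rewrite size_take tsz !size_cat /=; move: t0; move: (t) => n; clear; lia.
  have [s2 [s3 E2]] := mem_split zi.
  have iz : index z (L i1) = size s2.
    have := uL i1; rewrite E2 index_cat cat_uniq /= negb_or => /and3P[_ /andP[/negbTE -> _] _].
    by rewrite eqxx addn0.
  apply/negbTE; apply: (post i1 s2 z s3 E2).
    by apply: nS => y ys; rewrite E2 mem_cat inE ys !orbT.
  move=> u v /infixP[s4 [s5 E4]].
  apply: (@L1edge u v (s2 ++ s4) s5); first by rewrite E2 E4 -catA.
  rewrite size_cat neq_ltn; apply/orP; right; apply: leq_trans (leq_addr _ _); by rewrite prednK // -iz.
move=> j j' i z z' w w' [zj zi zt] [zj' zi' zt'] nSj nSj' wj wi wj' wi'.
have wR : w \in R by apply: (Rconn j z w) => //; rewrite row1.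
have wR' : w' \notin R.
  apply/negP => wR'; have := Rconn j' w' z' nSj' wj' zj' wR'; by rewrite row1 // ltnNge zt'.
case: (i =P i1) => [ii|/eqP ii].
  subst i; move: wR wR'; rewrite !row1 // -leqNgt; exact: leq_trans.
have wS : w \notin S by apply: contra nSj => h; apply/hasP; exists w.
have wS' : w' \notin S by apply: contra nSj' => h; apply/hasP; exists w'.
move: wR wR'; rewrite (rowlt i w) // (rowlt i w') // -leqNgt; exact: leq_trans.
Qed.

End Cut.
End Families.

Lemma find_le_index (T : eqType) (f : pred T) s z : z \in s -> f z -> find f s <= index z s.
Proof.
move=> zs fz; rewrite leqNgt; apply/negP => /(before_find z).
by rewrite nth_index // fz.
Qed.

Lemma last_split (T : Type) (f : pred T) s : has f s ->
  exists s1 u s2, [/\ s = s1 ++ u :: s2, f u & ~~ has f s2].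
Proof.
elim: s => //= x s IH; case hs : (has f s).
  by case: (IH hs) => s1 [u [s2 [-> fu h]]] _; exists (x :: s1), u, s2.
by rewrite orbF => fx; exists [::], x, s; rewrite hs.
Qed.

Section Link.
Variable (T : eqType).

(** Both orientations of [p] are allowed, so that the relation between [f] and [g] is symmetric; [h]
    is what the interior has to avoid. *)
Definition segment (p : seq T) (f g h : pred T) : Prop := exists s1 u m v s2,
  [/\ p = s1 ++ u :: m ++ v :: s2 \/ p = rev (s1 ++ u :: m ++ v :: s2),
      f u, g v & ~~ has h m].

Lemma segment_sym p f g h : segment p f g h -> segment p g f h.
Proof.
case=> s1 [u [m [v [s2 [E fu gv hm]]]]]; exists (rev s2), v, (rev m), u, (rev s1).
have R : rev (s1 ++ u :: m ++ v :: s2) = rev s2 ++ v :: rev m ++ u :: rev s1.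
  by rewrite rev_cat rev_cons rev_cat rev_cons -!cats1 -!catA.
split; rewrite ?has_rev //; rewrite -R revK; by case: E; [right|left].
Qed.

(** Running from [z] towards [w], take the first vertex satisfying [g], and then the last vertex
    before it that satisfies [f]. *)
Lemma segment_exists p (f g : pred T) z w : z \in p -> w \in p -> f z -> g w ->
  (forall y, f y -> ~~ g y) -> segment p f g (predU f g).
Proof.
move=> zp wp fz gw dj.
have H s x t : p = s ++ x :: t \/ p = rev (s ++ x :: t) -> f x -> has g t -> segment p f g (predU f g).
  move=> E fx; move=> /split_find; case Et : _ _ _ / => [v m s2 gv nm].
  have : has f (x :: m) by rewrite /= fx.
  move=> /last_split[s1 [u [m' [E' fu nm']]]].
  have E2 : s ++ x :: t = (s ++ s1) ++ u :: m' ++ v :: s2.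
    by rewrite Et cat_rcons -cat_cons E' -!catA.
  exists (s ++ s1), u, m', v, s2; rewrite -E2; split => //.
  apply/hasPn => y ym; rewrite /= negb_or (hasPn nm' _ ym) /=.
  have : y \in x :: m by rewrite E' mem_cat inE ym !orbT.
  by rewrite inE => /predU1P[->|/(hasPn nm)//]; apply: dj.
have wz : w != z by apply: contraTneq gw => ->; apply: dj.
have [s1 [s2 E]] := mem_split zp.
have := wp; rewrite E mem_cat inE (negbTE wz) /= => /orP[ws|ws]; rewrite -E.
  apply: (H (rev s2) z (rev s1)) => //.
    right; rewrite -[LHS]revK E; congr rev.
    by rewrite rev_cat rev_cons cat_rcons.
  by rewrite has_rev; apply/hasP; exists w.
by apply: (H s1 z s2) => //; [left|apply/hasP; exists w].
Qed.

End Link.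

(** If every vertex has fewer than [a] neighbours in [I], the ball [Lv k] about [x] has at most
    [a ^ k] elements. If moreover no path of [I] has [a] vertices, the ball of radius [a] is all of
    [I]. *)
Lemma path_or_star (T : finType) (r : rel T) (I : {set T}) a : symmetric r ->
  conn r I -> a ^ a < #|I| ->
  (exists s, [/\ size s = a, uniq s, sorted r s & {subset s <= I}]) \/
  exists2 h, h \in I & a <= #|(nbr r [set h] :&: I) :\ h|.
Proof.
move=> rs cI big.
case: (pselect (exists2 h, h \in I & a <= #|(nbr r [set h] :&: I) :\ h|)) => [|no]; first by right.
have deg h : h \in I -> #|(nbr r [set h] :&: I) :\ h| < a.
  by move=> hI; rewrite ltnNge; apply/negP => lt; apply: no; exists h.
have [x xI] : exists x, x \in I.
  by apply/set0Pn; rewrite -card_gt0; apply: leq_ltn_trans big.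
pose Lv := fix Lv k : {set T} := if k is k'.+1 then Lv k' :|: \bigcup_(h in Lv k') ((nbr r [set h] :&: I) :\ h) else [set x].
have LvI k : Lv k \subset I.
  elim: k => [|k IH] /=; first by rewrite sub1set.
  rewrite subUset IH /=; apply/bigcupsP => h _; apply: subset_trans (subsetDl _ _) _; exact: subsetIr.
have cLv k : #|Lv k| <= a ^ k.
  elim: k => [|k IH] /=; first by rewrite cards1.
  have [le1 _] := leq_card_setU (Lv k) (\bigcup_(h in Lv k) ((nbr r [set h] :&: I) :\ h)).
  apply: leq_trans le1 _; apply: (@leq_trans (#|Lv k| + \sum_(h in Lv k) a.-1)).
    rewrite leq_add2l.
    apply: (@leq_trans (\sum_(h in Lv k) #|(nbr r [set h] :&: I) :\ h|)).
      elim/big_rec2: _ => [|h n A _ le]; first by rewrite cards0.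
      have [le2 _] := leq_card_setU ((nbr r [set h] :&: I) :\ h) A.
      by apply: leq_trans le2 _; rewrite leq_add2l.
    apply: leq_sum => h hL; have := deg h (subsetP (LvI k) _ hL); by case: (a).
  have a0 : 0 < a by apply: leq_ltn_trans (deg _ xI).
  by rewrite sum_nat_const -mulnS prednK // expnSr leq_mul2r IH orbT.
have mono k k' : k <= k' -> Lv k \subset Lv k'.
  move=> /subnK <-; elim: (k' - k) => [|d IH]; first by rewrite add0n.
  by apply: subset_trans IH _; rewrite addSn /= subsetUl.
have reach p y : path r x p -> {subset x :: p <= I} -> last x p = y -> y \in Lv (size p).
  elim/last_ind: p y => [|p z IH] y /=; first by rewrite inE => _ _ ->.
  rewrite rcons_path last_rcons size_rcons => /andP[pp lz] sub <- /=.
  have lp : last x p \in Lv (size p).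
    by apply: IH => // w wp; apply: sub; rewrite -rcons_cons mem_rcons inE wp orbT.
  rewrite inE; case: (z =P last x p) => [->|/eqP zl]; first by rewrite lp.
  apply/orP; right; apply/bigcupP; exists (last x p) => //.
  rewrite in_setD1 zl in_setI sub ?andbT; last by rewrite -rcons_cons mem_rcons mem_head.
  by apply/nbrP; exists (last x p); rewrite ?inE.
left; apply: contrapT => short.
have : I \subset Lv a.
  apply/subsetP => y yI; have [p [ip lp sp]] := conn_ipath cI xI yI.
  have pp := ipath_path ip; have up := ipath_uniq ip.
  apply: (subsetP (mono (size p) a _)); last exact: reach.
  rewrite leqNgt; apply/negP => lt; apply: short.
  exists (take a (x :: p)); split.
  - by rewrite size_takel //= ltnW // ltnW.
  - exact: take_uniq.
  - by apply: take_sorted.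
  by move=> z /mem_take /sp.
by move=> /subset_leq_card; rewrite leqNgt (leq_ltn_trans (cLv a) big).
Qed.

(** * Grid minors assembled from ordered rows *)

Section Grid.
Variables (V : finType) (e : rel V).

Definition adjacent (X Y : {set V}) : Prop := exists x y, [/\ x \in X, y \in Y & e x y].

Definition grid_minor a b (U : {set V}) : Prop := exists B : nat -> nat -> {set V},
  [/\ forall i j, i < a -> j < b -> [/\ conn e (B i j), B i j != set0 & B i j \subset U],
      forall i j i' j' z, i < a -> j < b -> i' < a -> j' < b ->
        z \in B i j -> z \in B i' j' -> i = i' /\ j = j',
      forall i j, i.+1 < a -> j < b -> adjacent (B i j) (B i.+1 j) &
      forall i j, i < a -> j.+1 < b -> adjacent (B i j) (B i j.+1)].

Lemma grid_minor_sub a b (U U' : {set V}) : U \subset U' -> grid_minor a b U -> grid_minor a b U'.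
Proof.
move=> sU [B [H1 H2 H3 H4]]; exists B; split => // i j ia jb.
by have [c n s] := H1 i j ia jb; split => //; apply: subset_trans sU.
Qed.

(** Each row is cut into [a * b] slots by [lo]. A column of the grid takes [a] consecutive slots,
    and slot [j * a + c] is reserved for the link from row [c] to row [c.+1] in column [j], so links
    of different rows do not interfere. The interior [D] of a link is added to the branch set of row
    [c]. *)
Lemma grid_of_rows a b (U : {set V}) (R : nat -> seq V) (lo : nat -> nat -> nat)
    (Z : nat -> {set V}) : symmetric e ->
  (forall c, c < a -> [/\ uniq (R c), sorted e (R c) & {subset R c <= U}]) ->
  (forall c c' z, c < a -> c' < a -> z \in R c -> z \in R c' -> c = c') ->
  (forall c n, c < a -> n < a * b -> lo c n < lo c n.+1) ->
  (forall c n, c < a -> n <= a * b -> lo c n < size (R c)) ->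
  (forall n n' z, n < a * b -> n' < a * b -> z \in Z n -> z \in Z n' -> n = n') ->
  (forall n, n < a * b -> Z n \subset U) ->
  (forall c n, c.+1 < a -> n < a * b -> exists (D : {set V}) u m v,
    [/\ D \subset Z n, forall z c', z \in D -> c' < a -> z \notin R c',
        u \in R c, lo c n <= index u (R c) < lo c n.+1 &
        [/\ conn e (u |: D), m \in u |: D, v \in R c.+1,
            lo c.+1 n <= index v (R c.+1) < lo c.+1 n.+1 & e m v]]) ->
  grid_minor a b U.
Proof.
move=> es HR dR loS loB dZ ZU HD.
have lo_le c n n' : c < a -> n <= n' -> n' <= a * b -> lo c n <= lo c n'.
  move=> ca /subnK <-; elim: (n' - n) => [|d IH] // le.
  rewrite addSn in le *; apply: leq_trans (IH (ltnW le)) _; apply: ltnW; exact: loS.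
have lo_lt c n n' : c < a -> n < n' -> n' <= a * b -> lo c n < lo c n'.
  move=> ca lt le; apply: leq_trans (loS _ _ ca _) (lo_le _ _ _ ca lt le); exact: leq_trans lt le.
pose blk c j := [set z | (z \in R c) && (lo c (j * a) <= index z (R c) <= (lo c (j.+1 * a)).-1)].
have jab j : j < b -> j.+1 * a <= a * b by move=> jb; rewrite mulnC leq_mul2l jb orbT.
have jlt j : 0 < a -> j * a < j.+1 * a by move=> a0; rewrite ltn_mul2r a0 ltnS leqnn.
have lopos c j : c < a -> j < b -> 0 < lo c (j.+1 * a).
  move=> ca jb; apply: leq_ltn_trans (leq0n _) (lo_lt _ _ _ ca (jlt j _) (jab _ jb)).
  exact: leq_ltn_trans ca.
have inblk c j z : c < a -> j < b -> (z \in blk c j) =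
    (z \in R c) && (lo c (j * a) <= index z (R c) < lo c (j.+1 * a)).
  by move=> ca jb; rewrite inE -[X in _ = _ && (_ && (_ < X))](prednK (lopos _ _ ca jb)).
have reg c n : c < a -> n < a * b -> [/\ n %/ a < b, n %/ a * a <= n & n < (n %/ a).+1 * a].
  move=> ca lt; have a0 : 0 < a by apply: leq_ltn_trans ca.
  split; first by rewrite ltn_divLR // mulnC.
    exact: leq_trunc_div.
  by rewrite mulSn addnC {1}(divn_eq n a) ltn_add2l ltn_pmod.
have idx c j : c < a -> j < b -> [/\ j * a + c < a * b, (j * a + c) %/ a = j & (j * a + c) %% a = c].
  move=> ca jb; have a0 : 0 < a by apply: leq_ltn_trans ca.
  split; last by rewrite modnMDl modn_small.
    by apply: leq_trans (jab _ jb); rewrite mulSn addnC ltn_add2r.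
  by rewrite divnMDl // divn_small // addn0.
have HD' cn : exists D : {set V}, cn.1.+1 < a -> cn.2 < a * b -> exists u m v,
    [/\ D \subset Z cn.2, forall z c', z \in D -> c' < a -> z \notin R c',
        u \in R cn.1, lo cn.1 cn.2 <= index u (R cn.1) < lo cn.1 cn.2.+1 &
        [/\ conn e (u |: D), m \in u |: D, v \in R cn.1.+1,
            lo cn.1.+1 cn.2 <= index v (R cn.1.+1) < lo cn.1.+1 cn.2.+1 & e m v]].
  case: cn => c n /=.
  case: (boolP ((c.+1 < a) && (n < a * b))) => [/andP[h1 h2]|h].
    by have [D [u [m [v H]]]] := HD c n h1 h2; exists D => _ _; exists u, m, v.
  by exists set0 => h1 h2; rewrite h1 h2 in h.
have [Dt HDt] := choice HD'.
pose Ds c j : {set V} := if c.+1 < a then Dt (c, j * a + c) else set0.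
pose B c j := blk c j :|: Ds c j.
have DsP c j z : c < a -> j < b -> z \in Ds c j -> [/\ c.+1 < a, z \in Z (j * a + c) &
    forall c', c' < a -> z \notin R c'].
  move=> ca jb; rewrite /Ds; case: ifP => [c1a zD|_]; last by rewrite inE.
  have [h1 _ _] := idx _ _ ca jb.
  have [u [m [v [sD nD _ _ _]]]] := HDt (c, j * a + c) c1a h1.
  by split => //; [apply: (subsetP sD)|move=> c'; apply: nD].
have blkR c j z : z \in blk c j -> z \in R c by rewrite inE => /andP[].
have cblk c j : c < a -> j < b -> conn e (blk c j) /\ exists2 z, z \in blk c j & index z (R c) = lo c (j * a).
  move=> ca jb; have [uR sR _] := HR c ca.
  have jl : j * a <= a * b by apply: leq_trans (jab _ jb); rewrite mulSn leq_addl.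
  have := loB c (j * a) ca jl; case E : (R c) sR uR => [|x q] //= sR uR ls.
  have a0 : 0 < a by apply: leq_ltn_trans ca.
  pose z := nth x (x :: q) (lo c (j * a)).
  have iz : index z (x :: q) = lo c (j * a) by apply: index_uniq.
  have zb : z \in blk c j.
    by rewrite inblk // E iz leqnn mem_nth //=; apply: lo_lt => //; [apply: jlt|apply: jab].
  split; last by exists z.
  have [|y [s [ps Es]]] := path_interval (lo := lo c (j * a)) (hi := (lo c (j.+1 * a)).-1) sR uR.
    by exists z; [apply: mem_nth|move: zb; rewrite inE E => /andP[]].
  rewrite (_ : blk c j = [set z in y :: s]); first exact: path_conn.
  by apply/setP => w; rewrite /blk !in_set E Es.
have blkj c j j' z : c < a -> j < b -> j' < b -> z \in blk c j -> z \in blk c j' -> j = j'.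
  move=> ca jb jb'; rewrite !inblk // => /andP[_ /andP[h1 h2]] /andP[_ /andP[h3 h4]].
  have W i i' : i < i' -> i' < b -> lo c (i.+1 * a) <= lo c (i' * a).
    move=> lt ib; apply: lo_le => //; first by rewrite leq_mul2r lt orbT.
    by rewrite mulnC leq_mul2l ltnW ?orbT.
  case: (ltngtP j j') => // lt.
    by have := leq_trans (leq_trans h2 (W _ _ lt jb')) h3; rewrite ltnn.
  by have := leq_trans (leq_trans h4 (W _ _ lt jb)) h1; rewrite ltnn.
have rblk c n u : c < a -> n < a * b -> u \in R c -> lo c n <= index u (R c) < lo c n.+1 ->
    u \in blk c (n %/ a).
  move=> ca na uR /andP[h1 h2]; have [h3 h4 h5] := reg c n ca na.
  rewrite inblk // uR /=; apply/andP; split.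
    by apply: leq_trans h1; apply: lo_le => //; apply: ltnW.
  by apply: leq_trans h2 _; apply: lo_le => //; apply: jab.
have link c j : c.+1 < a -> j < b -> exists u m v, [/\ u \in blk c j, conn e (u |: Ds c j),
   m \in u |: Ds c j, v \in blk c.+1 j & e m v].
  move=> c1a jb; have ca := ltnW c1a; have [h1 h2 h3] := idx _ _ ca jb.
  have [u [m [v [sD nD uR ui [cD mD vR vi emv]]]]] := HDt (c, j * a + c) c1a h1.
  exists u, m, v; rewrite /Ds c1a; split => //.
    by have := rblk _ _ _ ca h1 uR ui; rewrite h2.
  by have := rblk _ _ _ c1a h1 vR vi; rewrite h2.
exists B; split.
- move=> c j ca jb; have [cb [z zb _]] := cblk c j ca jb; split.
  + case: (ltnP c.+1 a) => c1a; last by rewrite /B /Ds ltnNge c1a /= setU0.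
    have [u [m [v [ub cD _ _ _]]]] := link c j c1a jb.
    rewrite /B (_ : blk c j = blk c j :|: [set u]); last first.
      by apply/esym/setUidPl; rewrite sub1set.
    by rewrite -setUA; apply: connU => //; exists u, u; rewrite ub !inE eqxx.
  + by apply/set0Pn; exists z; rewrite inE zb.
  rewrite subUset; apply/andP; split; apply/subsetP => w.
    by move=> /blkR; have [_ _] := HR c ca; apply.
  move=> /(DsP _ _ _ ca jb)[_ wZ _]; apply: (subsetP (ZU (j * a + c) _)) => //.
  by have [] := idx _ _ ca jb.
- move=> c j c' j' z ca jb ca' jb' /setUP[zb|zD] /setUP[zb'|zD'].
  + have E := dR _ _ _ ca ca' (blkR _ _ _ zb) (blkR _ _ _ zb'); subst c'.
    by split => //; apply: blkj zb zb'.
  + by have [_ _ /(_ c ca)] := DsP _ _ _ ca' jb' zD'; rewrite (blkR _ _ _ zb).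
  + by have [_ _ /(_ c' ca')] := DsP _ _ _ ca jb zD; rewrite (blkR _ _ _ zb').
  have [_ h _] := DsP _ _ _ ca jb zD; have [_ h' _] := DsP _ _ _ ca' jb' zD'.
  have [i1 i2 i3] := idx _ _ ca jb; have [i1' i2' i3'] := idx _ _ ca' jb'.
  have E := dZ _ _ _ i1 i1' h h'.
  by rewrite E i2' in i2; rewrite E i3' in i3.
- move=> c j c1a jb; have [u [m [v [ub _ mD vb emv]]]] := link c j c1a jb.
  exists m, v; split => //; last by rewrite inE vb.
  by move: mD => /setU1P[->|mD]; rewrite inE ?ub ?mD ?orbT.
move=> c j ca j1b; have jb := ltnW j1b.
have [_ [y yb iy]] := cblk c j.+1 ca j1b.
have yR := blkR _ _ _ yb; have [_ sR _] := HR c ca.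
have lop := lopos _ _ ca jb; rewrite -iy in lop.
exists (nth y (R c) (index y (R c)).-1), y.
have ys : index y (R c) < size (R c) by rewrite index_mem.
have ps : (index y (R c)).-1 < size (R c) by apply: leq_ltn_trans (leq_pred _) ys.
split; last 1 first.
- have /(sortedP y)/(_ (index y (R c)).-1) := sR; rewrite prednK // => /(_ ys).
  by rewrite nth_index.
- rewrite inE inblk // mem_nth //= index_uniq //; last by have [] := HR c ca.
  rewrite -iy -[X in X || _]andbC prednK // leqnn -ltnS prednK // iy andTb; apply/orP; left.
  apply: lo_lt => //; [|exact: jab]; apply: jlt; exact: leq_ltn_trans ca.
by rewrite inE yb.
Qed.
End Grid.

Lemma pigeonhole (p M : nat) (C : finType) (f : 'I_p -> C) : #|C| * M < p ->
  exists c, M <= #|[set j | f j == c]|.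
Proof.
move=> lt; apply: contrapT => no.
have : p <= #|C| * M; last by rewrite leqNgt lt.
rewrite -{1}(card_ord p) -sum1_card (partition_big f xpredT) //= -sum_nat_const.
apply: leq_sum => c _; rewrite sum1_card leqNgt; apply/negP => lt'.
apply: no; exists c; apply: ltnW; apply: leq_trans lt' _.
by apply: subset_leq_card; apply/subsetP => j; rewrite !inE => /eqP ->.
Qed.

(** * Grids from two crossing linkages *)

Section Families.
Variable V : finType.

Lemma ABpath_nil (r : rel V) A B s : ABpath r A B s ->
  exists x q, [/\ s = x :: q, x \in A, path r x q & last x q \in B].
Proof. by case: s => // x q /and3P[]; exists x, q. Qed.

(* Choosing [L] with as few edges outside [P] as possible makes each such edge a cut
   edge of the linkage; these cuts order the paths of [P] along [L]. *)
Lemma min_linkage (e : rel V) (U A B : {set V}) p q (P : 'I_p -> seq V) : symmetric e ->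
  linked (restr e U) A B q ->
  (forall i u v, infix [:: u; v] (P i) -> restr e U u v) ->
  exists L : 'I_q -> seq V, [/\ forall i, ABpath (restr e U) A B (L i) /\ uniq (L i),
    disjoint_family L & forall x y, cons_edge L x y -> ~~ cons_edge P x y ->
      ~ linked (cut_rel P L x y) A B q].
Proof.
move=> es lk HP.
pose D (L : 'I_q -> seq V) := [set w : V * V | cons_edge L w.1 w.2 && ~~ cons_edge P w.1 w.2].
have [L [[HL dL] min]] := exists_min (fun L => #|D L|) lk.
exists L; split => // x y xyL xyP [L' [HL' dL']].
have rs : symmetric (restr e U) by move=> u v; rewrite /restr es andbCA.
have Lr i u v : infix [:: u; v] (L i) -> restr e U u v.
  have [/ABpath_nil[z [s [-> _ pp _]]] _] := HL i; exact: (path_infixP _ _ _ pp).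
have sub u v : cut_rel P L x y u v -> restr e U u v.
  by case/and3P => /orP[]/existsP[i /orP[]] h _ _; first [exact: HP h|exact: Lr h|rewrite rs; first [exact: HP h|exact: Lr h]].
have /min : (forall i, ABpath (restr e U) A B (L' i) /\ uniq (L' i)) /\
    (forall i j z, z \in L' i -> z \in L' j -> i = j).
  split => // i; have [/ABpath_nil[z [s [-> zA pp lB]]] u'] := HL' i; split => //.
  by rewrite /= zA lB andbT; apply: sub_path pp.
apply/negP; rewrite -ltnNge; apply: proper_card; rewrite properE; apply/andP; split.
  apply/subsetP => -[u v]; rewrite !inE /= => /andP[L'uv nP]; rewrite nP andbT.
  have L'r i u' v' : infix [:: u'; v'] (L' i) -> cut_rel P L x y u' v'.
    have [/ABpath_nil[z [s [-> _ pp _]]] _] := HL' i; exact: (path_infixP _ _ _ pp).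
  case/existsP: L'uv => i /orP[] /L'r /and3P[/orP[]]; rewrite ?(negbTE nP) //.
  - by rewrite cons_edge_sym (negbTE nP).
  by rewrite cons_edge_sym.
apply/subsetPn; exists (x, y); rewrite !inE /= ?xyL // negb_and.
apply/orP; left; apply/existsP => -[i].
have L'r u' v' : infix [:: u'; v'] (L' i) -> cut_rel P L x y u' v'.
  have [/ABpath_nil[z [s [-> _ pp _]]] _] := HL' i; exact: (path_infixP _ _ _ pp).
by case/orP => /L'r /and3P[_ h1 h2]; rewrite eqxx in h1 h2.
Qed.

Section Order.
Variables (p q : nat) (P : 'I_p -> seq V) (L : 'I_q -> seq V) (A B : {set V}).
Hypothesis dP : disjoint_family P.
Hypothesis dL : disjoint_family L.
Hypothesis PN : forall i, exists x s, P i = x :: s.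
Hypothesis LAB : forall i, exists x s, [/\ L i = x :: s, x \in A & last x s \in B].
Hypothesis uL : forall i, uniq (L i).
Hypothesis min : forall x y, cons_edge L x y -> ~~ cons_edge P x y ->
      ~ linked (cut_rel P L x y) A B q.
Variables (I : {set 'I_q}) (J : {set 'I_p}) (i1 : 'I_q).
Hypothesis hitIJ : forall i j, i \in I -> j \in J -> has (mem (P j)) (L i).
Hypothesis i1I : i1 \in I.

(** Sort the paths of [J] by their first vertex on [L i1] and apply [cut_order] at every path whose
    rank is a positive multiple of [2 * q]. A path between two consecutive cuts that avoids both
    separators is on the correct side of either cut along every [L i]; choosing one in each interval
    gives [W]. *)
Lemma order_paths g : 0 < g -> 2 * q * g <= #|J| -> exists W : nat -> 'I_p,
  (forall n, n < g -> W n \in J) /\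
  forall n n' i w w', n < n' -> n' < g -> i \in I -> w \in P (W n) -> w \in L i ->
    w' \in P (W n') -> w' \in L i -> index w (L i) < index w' (L i).
Proof.
move=> g0 big.
have q0 : 0 < q by apply: leq_ltn_trans (ltn_ord i1).
have [j0 j0J] : exists j, j \in J.
  apply/set0Pn; rewrite -card_gt0; apply: leq_trans big; by rewrite !muln_gt0 q0 g0.
have [d [s0 [Ed _ _]]] := LAB i1.
pose tP j := find (mem (P j)) (L i1).
have tPin j : j \in J -> nth d (L i1) (tP j) \in P j by move=> jJ; exact: (nth_find d (hitIJ i1I jJ)).
have tPI : {in J &, injective tP}.
  move=> j j' jJ j'J E; apply: (dP (tPin _ jJ)); rewrite E; exact: tPin.
pose s := sort leq [seq tP j | j <- enum J].
have ss : sorted ltn s.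
  rewrite ltn_sorted_uniq_leq sort_uniq sort_sorted ?andbT; last exact: leq_total.
  rewrite map_inj_in_uniq ?enum_uniq // => j j'; rewrite !mem_enum; exact: tPI.
have sz : size s = #|J| by rewrite size_sort size_map -cardE.
have jjE k : exists j, k < #|J| -> j \in J /\ tP j = nth 0 s k.
  case: (ltnP k #|J|) => lt; last by exists j0.
  have : nth 0 s k \in s by rewrite mem_nth ?sz.
  by rewrite mem_sort => /mapP[j]; rewrite mem_enum => jJ ->; exists j.
have [jj Hjj] := choice jjE.
have jj_lt k k' : k < k' -> k' < #|J| -> tP (jj k) < tP (jj k').
  move=> lt lt'; have [_ ->] := Hjj _ (ltn_trans lt lt'); have [_ ->] := Hjj _ lt'.
  by apply: (sorted_ltn_nth ltn_trans 0 ss); rewrite ?inE ?sz //; apply: ltn_trans lt'.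
have jjI k k' : k < #|J| -> k' < #|J| -> jj k = jj k' -> k = k'.
  move=> h h' E; case: (ltngtP k k') => // lt.
    by have := jj_lt _ _ lt h'; rewrite E ltnn.
  by have := jj_lt _ _ lt h; rewrite E ltnn.
have cut n : exists S : {set V}, #|S| < q /\ (0 < n < g -> forall k k', k < 2 * q * n -> 2 * q * n <= k' -> k' < #|J| ->
   ~~ has (mem S) (P (jj k)) -> ~~ has (mem S) (P (jj k')) -> forall i w w',
   w \in P (jj k) -> w \in L i -> w' \in P (jj k') -> w' \in L i -> index w (L i) < index w' (L i)).
  case: (boolP (0 < n < g)) => [/andP[n0 ng]|_]; last by exists set0; rewrite cards0.
  have lt : 2 * q * n < #|J| by apply: leq_trans big; rewrite ltn_mul2l ng muln_gt0 q0.
  have t0 : 0 < tP (jj (2 * q * n)).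
    by apply: leq_ltn_trans (leq0n _) (jj_lt 0 _ _ lt); rewrite !muln_gt0 q0.
  have hit := hitIJ i1I (Hjj _ lt).1.
  have nl := min (cut_edge_L t0 hit d) (cut_edge_notP dP t0 hit d).
  have [S [Sq H]] := cut_order dP dL PN LAB uL t0 hit nl.
  exists S; split => // _ k k' kn nk' k'J nS nS' i w w' wP wi wP' wi'.
  have kJ : k < #|J| by apply: ltn_trans lt.
  have fin l : l < #|J| -> let z := nth d (L i1) (tP (jj l)) in
      [/\ z \in P (jj l), z \in L i1 & index z (L i1) = tP (jj l)].
    move=> lJ; have h := hitIJ i1I (Hjj _ lJ).1; rewrite has_find in h.
    split; [exact: tPin (Hjj _ lJ).1|exact: mem_nth|exact: index_uniq].
  have [z1 z2 z3] := fin k kJ; have [z1' z2' z3'] := fin k' k'J.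
  apply: (H (jj k) (jj k') i _ _ _ _ (And3 z1 z2 _) (And3 z1' z2' _)) => //.
    by rewrite z3; apply: jj_lt.
  rewrite z3'; move: nk'; rewrite leq_eqVlt => /orP[/eqP <- //|h]; apply: ltnW; exact: jj_lt.
have [S HS] := choice cut.
(* The two separators together have fewer than [2 * q] vertices, so they miss one of the [2 * q]
   disjoint paths of the interval. *)
have pick n : exists r, n < g -> r < 2 * q /\ ~~ has (mem (S n :|: S n.+1)) (P (jj (2 * q * n + r))).
  case: (ltnP n g) => ng; last by exists 0.
  have bnd r : r < 2 * q -> 2 * q * n + r < #|J|.
    move=> rq; apply: leq_trans big; apply: (@leq_trans (2 * q * n.+1)).
      by rewrite mulnS addnC ltn_add2r.
    by rewrite leq_mul2l ng orbT.
  apply: contrapT => no.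
  have ex (r : 'I_(2 * q)) : exists z, z \in S n :|: S n.+1 /\ z \in P (jj (2 * q * n + r)).
    apply: contrapT => no'; apply: no; exists r => _; split; first exact: ltn_ord.
    by apply/hasPn => z zP; apply/negP => zS; apply: no'; exists z.
  have [f Hf] := choice ex.
  have fi : injective f.
    move=> r r' E; have [_ h] := Hf r; have [_ h'] := Hf r'; rewrite -E in h'.
    have := jjI _ _ (bnd _ (ltn_ord r)) (bnd _ (ltn_ord r')) (dP h h').
    by move=> /addnI/val_inj.
  have : 2 * q <= #|S n :|: S n.+1|.
    rewrite -[X in X <= _](card_ord (2 * q)) -(card_imset _ fi); apply: subset_leq_card.
    by apply/subsetP => _ /imsetP[r _ ->]; have [] := Hf r.
  have [le _] := leq_card_setU (S n) (S n.+1); have [h1 _] := HS n; have [h2 _] := HS n.+1.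
  by move: le h1 h2; clear; lia.
have [r Hr] := choice pick.
have bnd n : n < g -> [/\ 2 * q * n <= 2 * q * n + r n, 2 * q * n + r n < 2 * q * n.+1 & 2 * q * n + r n < #|J|].
  move=> ng; have [rq _] := Hr n ng.
  have h : 2 * q * n + r n < 2 * q * n.+1 by rewrite mulnS addnC ltn_add2r.
  split; rewrite ?leq_addr //; apply: leq_trans h (leq_trans _ big).
  by rewrite leq_mul2l ng orbT.
pose W n := jj (2 * q * n + r n).
have WJ n : n < g -> W n \in J by move=> /bnd[_ _ h]; exact: (Hjj _ h).1.
exists W; split => // n n' i w w' lt n'g iI wP wi wP' wi'.
elim: n' lt n'g w' wP' wi' => // n' IH lt n'g w' wP' wi'.
have step v : v \in P (W n') -> v \in L i -> index v (L i) < index w' (L i).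
  move=> vP vi; have [_ Hs] := HS n'.+1.
  have [_ h1] := Hr n' (ltnW n'g); have [_ h2] := Hr n'.+1 n'g.
  have nS (X X' : {set V}) l : X \subset X' -> ~~ has (mem X') l -> ~~ has (mem X) l.
    move=> sX; apply: contra => /hasP[z zl zX]; apply/hasP; exists z => //; exact: (subsetP sX).
  have [b1 b2 b3] := bnd n' (ltnW n'g); have [b1' b2' b3'] := bnd _ n'g.
  apply: (Hs _ _ _ b2 b1' b3') => //.
  - by apply: nS h1; apply: subsetUr.
  by apply: nS h2; apply: subsetUl.
have n'g' := ltnW n'g.
move: lt; rewrite ltnS leq_eqVlt => /orP[/eqP E|lt]; first by subst n'; apply: step.
have /hasP[v vi vP] := hitIJ iI (WJ _ n'g').
exact: ltn_trans (IH lt n'g' v vP vi) (step v vP vi).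
Qed.

End Order.

Lemma segment_link (e : rel V) p (f g h : pred V) : symmetric e -> sorted e p -> segment p f g h ->
  exists u m v, [/\ {subset u :: rcons m v <= p}, path e u m, e (last u m) v, f u & g v /\ ~~ has h m].
Proof.
move=> es sp [s1 [u [m [v [s2 [E fu gv hm]]]]]]; exists u, m, v.
have {E}[q [sq sub]] : exists q, sorted e (s1 ++ u :: m ++ v :: s2) /\
    q = s1 ++ u :: m ++ v :: s2 /\ {subset q <= p}.
  exists (s1 ++ u :: m ++ v :: s2); split; last by split => // z; case: E => ->; rewrite ?mem_rev.
  case: E => E; first by rewrite -E.
  rewrite -[X in sorted _ X]revK -E rev_sorted; apply: sub_sorted sp => x y; by rewrite es.
case: sub => Eq sub; subst q.
have /= := cat_sorted2 sq; rewrite -cat_rcons => -[_]; rewrite cat_path rcons_path => /andP[/andP[pm lm] _].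
split => // z; rewrite -rcons_cons mem_rcons !inE => zm; apply: sub.
rewrite mem_cat !inE mem_cat inE.
by case/or3P: zm => ->; rewrite ?orbT.
Qed.

(** All paths of [J] meet the same members [I] of [L] and join the same pairs of them directly;
    [gam] is the graph of these pairs. The paths [W n] cut each row into slots, and [a * b] slots
    need one path more. A path in [gam] gives the rows of a grid, linked along the paths [W n]; from
    a star the leaves become the rows, and the links pass through the centre. *)
Lemma rows_grid (e : rel V) (U : {set V}) a b p q (P : 'I_p -> seq V) (L : 'I_q -> seq V)
    (A B : {set V}) (I : {set 'I_q}) (J : {set 'I_p}) (gam : rel 'I_q) :
  symmetric e -> 0 < a -> 0 < b ->
  disjoint_family P -> disjoint_family L -> (forall i, uniq (L i)) ->
  (forall j, sorted e (P j) /\ {subset P j <= U}) ->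
  (forall i, sorted e (L i) /\ {subset L i <= U}) ->
  (forall i, exists x s, P i = x :: s) ->
  (forall i, exists x s, [/\ L i = x :: s, x \in A & last x s \in B]) ->
  (forall x y, cons_edge L x y -> ~~ cons_edge P x y -> ~ linked (cut_rel P L x y) A B q) ->
  (forall i j, j \in J -> (i \in I) = has (mem (P j)) (L i)) ->
  (forall i i' j, j \in J -> gam i i' <-> segment (P j) (mem (L i)) (mem (L i')) [pred z | [exists i, z \in L i]]) ->
  a ^ a < #|I| -> 2 * q * (a * b).+1 <= #|J| -> grid_minor e a b U.
Proof.
move=> es a0 b0 dP dL uL HP HL PN LAB min HI Hg bigI bigJ.
have [i1 i1I] : exists i, i \in I by apply/set0Pn; rewrite -card_gt0; apply: leq_ltn_trans bigI.
have q0 : 0 < q by apply: leq_ltn_trans (ltn_ord i1).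
have [j0 j0J] : exists j, j \in J.
  by apply/set0Pn; rewrite -card_gt0; apply: leq_trans bigJ; rewrite !muln_gt0 q0.
have hitIJ i j : i \in I -> j \in J -> has (mem (P j)) (L i) by move=> iI jJ; rewrite -HI.
have [W [WJ ord]] := order_paths dP dL PN LAB uL min hitIJ i1I (ltn0Sn _) bigJ.
set on := [pred z | [exists i, z \in L i]] in Hg.
have gs : symmetric gam.
  by move=> i i'; apply/idP/idP => /(Hg _ _ _ j0J)/segment_sym/(Hg _ _ _ j0J).
(* A single path of [J] already meets all members of [I], so between any two parts of [I] it
   contains a segment whose interior avoids [L]. *)
have cI : conn gam I.
  move=> X XI /set0Pn[x xX] cl; apply/subsetP => y yI; apply: contraT => yX.
  have xI := subsetP XI x xX.
  pose f := [pred z | [exists i in X, z \in L i]].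
  pose g := [pred z | [exists i in I :\: X, z \in L i]].
  have /hasP[z zi zP] := hitIJ _ _ xI j0J; have /hasP[w wi wP] := hitIJ _ _ yI j0J.
  have fg v : f v -> ~~ g v.
    case/exists_inP => i iX vi; apply/exists_inP => -[i' + vi'].
    by rewrite !inE -(dL _ _ _ vi vi') iX.
  have [||s1 [u [m [v [s2 [E /exists_inP[i iX ui] /exists_inP[i' + vi'] nm]]]]]] := segment_exists zP wP _ _ fg.
  - by apply/exists_inP; exists x.
  - by apply/exists_inP; exists y; rewrite // !inE yX.
  rewrite inE => /andP[i'X i'I]; case/negP: i'X; apply: (cl i) => //.
  apply/(Hg _ _ _ j0J); exists s1, u, m, v, s2; split => //.
  apply/hasPn => t tm; apply/negP => /existsP[k tk].
  have tP : t \in P j0 by case: E => ->; rewrite ?mem_rev !(mem_cat, inE) tm ?orbT.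
  have kI : k \in I by rewrite (HI _ _ j0J); apply/hasP; exists t.
  case/negP: (hasPn nm _ tm) => /=; apply/orP; case kX : (k \in X); [left|right]; apply/exists_inP; exists k => //.
  by rewrite inE kX.
pose lo i n := find (mem (P (W n))) (L i).
have nW n : n <= a * b -> W n \in J by move=> h; apply: WJ.
have loE i n : i \in I -> n <= a * b -> exists z, [/\ z \in L i, z \in P (W n) & index z (L i) = lo i n].
  move=> iI nab; have h := hitIJ _ _ iI (nW _ nab); have [x [s [E _ _]]] := LAB i.
  exists (nth x (L i) (lo i n)).
  have ls : lo i n < size (L i) by rewrite /lo -has_find.
  split; [exact: mem_nth|exact: (nth_find x h)|exact: index_uniq].
have loS i n : i \in I -> n < a * b -> lo i n < lo i n.+1.
  move=> iI nab; have [z [z1 z2 <-]] := loE i n iI (ltnW nab); have [z' [z1' z2' <-]] := loE i n.+1 iI nab.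
  exact: (ord n n.+1).
have loB i n : i \in I -> n <= a * b -> lo i n < size (L i).
  by move=> iI nab; have [z [zi _ <-]] := loE i n iI nab; rewrite index_mem.
have loI i n z : i \in I -> n < a * b -> z \in L i -> z \in P (W n) -> lo i n <= index z (L i) < lo i n.+1.
  move=> iI nab zi zP; apply/andP; split; first exact: find_le_index.
  by have [z' [z1' z2' <-]] := loE i n.+1 iI nab; apply: (ord n n.+1).
have WI n n' : n <= a * b -> n' <= a * b -> W n = W n' -> n = n'.
  move=> h h' E; have [z [z1 z2 _]] := loE _ _ i1I h; have [z' [z1' z2' _]] := loE _ _ i1I h'.
  case: (ltngtP n n') => // lt.
    by have := ord n n' i1 z z lt h' i1I z2 z1; rewrite -E ltnn => /(_ z2 z1).
  by have := ord n' n i1 z' z' lt h i1I z2' z1'; rewrite E ltnn => /(_ z2' z1').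
have seg i i' n : gam i i' -> n < a * b -> exists u m v,
   [/\ {subset u :: rcons m v <= P (W n)}, path e u m, e (last u m) v, u \in L i &
   v \in L i' /\ forall z k, z \in m -> z \notin L k].
  move=> gi nab; have /(Hg _ _ _ (nW _ (ltnW nab))) := gi.
  move=> /(segment_link es (HP (W n)).1)[u [m [v [h1 h2 h3 h4 [h5 h6]]]]].
  exists u, m, v; split => //; split => // z k zm; have := hasPn h6 _ zm.
  by rewrite inE => /existsPn.
have [[s [ss us sg sI]]|[h hI star]] := path_or_star gs cI bigI.
  have fI c : c < a -> nth i1 s c \in I by move=> ca; apply: sI; rewrite mem_nth ?ss.
  apply: (@grid_of_rows _ e a b U (fun c => L (nth i1 s c)) (fun c n => lo (nth i1 s c) n)
            (fun n => [set z in P (W n)])) => //.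
  - by move=> c ca; have [] := HL (nth i1 s c).
  - move=> c c' z ca ca' zc zc'; have := dL _ _ _ zc zc'.
    by move=> /eqP; rewrite nth_uniq ?ss // => /eqP.
  - by move=> c n /fI; apply: loS.
  - by move=> c n /fI; apply: loB.
  - move=> n n' z nab nab'; rewrite !inE => h1 h2; apply: WI (ltnW nab) (ltnW nab') (dP _ _ _ h1 h2).
  - move=> n nab; apply/subsetP => z; rewrite inE; have [_ hs] := HP (W n); exact: hs.
  move=> c n c1a nab; have /(sortedP i1)/(_ c) := sg; rewrite ss => /(_ c1a) gc.
  have [u [m [v [h1 h2 h3 h4 [h5 h6]]]]] := seg _ _ n gc nab.
  have E : u |: [set z in m] = [set z in u :: m] by apply/setP => z; rewrite !inE.
  exists [set z in m], u, (last u m), v; split => //.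
  - by apply/subsetP => z; rewrite !inE => zm; apply: h1; rewrite inE mem_rcons inE zm !orbT.
  - by move=> z c'; rewrite inE => zm _; apply: h6.
  - by apply: loI => //; [apply: fI; apply: ltnW|apply: h1; apply: mem_head].
  split => //.
  - by rewrite E; apply: path_conn.
  - by rewrite E inE mem_last.
  by apply: loI => //; [apply: fI|apply: h1; rewrite inE mem_rcons mem_head orbT].
(* The star with centre [h]: the link between consecutive leaves follows [W n] to the path [L h],
   runs inside slot [n] of it, here [H n], and leaves along [W n] again. Different links use
   different slots of [L h]. *)
pose s := enum ((nbr gam [set h] :&: I) :\ h).
have ss : a <= size s by rewrite -cardE.
have us : uniq s by apply: enum_uniq.
have sP i : i \in s -> [/\ gam h i, i \in I & i != h].
  rewrite mem_enum in_setD1 in_setI => /and3P[ih /nbrP[h' + gi] iI].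
  by rewrite inE => /eqP hh; subst h'.
have fP c : c < a -> [/\ gam h (nth i1 s c), nth i1 s c \in I & nth i1 s c != h].
  by move=> ca; apply: sP; rewrite mem_nth //; apply: leq_trans ss.
have fI c : c < a -> nth i1 s c \in I by case/fP.
pose H n := [set z in L h | lo h n <= index z (L h) < lo h n.+1].
have lo_le n n' : n <= n' -> n' <= a * b -> lo h n <= lo h n'.
  move=> /subnK <-; elim: (n' - n) => [|d IH] // le.
  rewrite addSn in le *; apply: leq_trans (IH (ltnW le)) _; apply: ltnW; exact: loS.
have HH n n' z : n < n' -> n' < a * b -> z \in H n -> z \in H n' -> False.
  move=> lt nab; rewrite !inE => /andP[_ /andP[_ h1]] /andP[_ /andP[h2 _]].
  have := leq_trans h1 (leq_trans (lo_le _ _ lt (ltnW nab)) h2); by rewrite ltnn.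
have PH n n' z : n < a * b -> n' < a * b -> z \in P (W n) -> z \in H n' -> n = n'.
  move=> nab nab' zP zH; have zh : z \in L h by move: zH; rewrite inE => /andP[].
  have zH' : z \in H n by rewrite inE zh; apply: loI.
  by case: (ltngtP n n') => // lt; [case: (HH n n' z)|case: (HH n' n z)].
apply: (@grid_of_rows _ e a b U (fun c => L (nth i1 s c)) (fun c n => lo (nth i1 s c) n)
            (fun n => [set z in P (W n)] :|: H n)) => //.
- by move=> c ca; have [] := HL (nth i1 s c).
- move=> c c' z ca ca' zc zc'; have := dL _ _ _ zc zc'.
  by move=> /eqP; rewrite nth_uniq ?(leq_trans _ ss) // => /eqP.
- by move=> c n /fI; apply: loS.
- by move=> c n /fI; apply: loB.
- move=> n n' z nab nab' /setUP[+|zH] /setUP[+|zH'].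
  + by rewrite !inE => h1 h2; apply: WI (ltnW nab) (ltnW nab') (dP _ _ _ h1 h2).
  + by rewrite inE => h1; apply: PH h1 zH'.
  + by rewrite inE => h1; apply/esym; apply: PH h1 zH.
  by case: (ltngtP n n') => // lt; [case: (HH n n' z)|case: (HH n' n z)].
- move=> n nab; rewrite subUset; apply/andP; split; apply/subsetP => z; rewrite inE.
    have [_ hs] := HP (W n); exact: hs.
  by move=> /andP[zh _]; have [_ hs] := HL h; apply: hs.
move=> c n c1a nab; have [g1 iI1 _] := fP _ (ltnW c1a); have [g2 iI2 _] := fP _ c1a.
rewrite gs in g1.
have [u [m1 [v1 [h1 h2 h3 h4 [h5 h6]]]]] := seg _ _ n g1 nab.
have [v2 [m2 [w [k1 k2 k3 k4 [k5 k6]]]]] := seg _ _ n g2 nab.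
have inH z : z \in L h -> z \in P (W n) -> z \in H n by move=> zh zP; rewrite inE zh; apply: loI.
have v1H : v1 \in H n by apply: inH => //; apply: h1; rewrite inE mem_rcons mem_head orbT.
have v2H : v2 \in H n by apply: inH => //; apply: k1; rewrite mem_head.
have cH : conn e (H n).
  have [x [t [E _ _]]] := LAB h; have uh := uL h; have [sh _] := HL h; rewrite E in uh sh.
  have l0 : 0 < lo h n.+1 by apply: leq_ltn_trans (loS _ _ hI nab).
  have HE z : (z \in H n) = (z \in x :: t) && (lo h n <= index z (x :: t) <= (lo h n.+1).-1).
    by rewrite inE E -[index z _ <= _.-1]ltnS prednK.
  have [|y [s' [ps Es]]] := path_interval (lo := lo h n) (hi := (lo h n.+1).-1) sh uh.
    by exists v1; have := v1H; rewrite HE => /andP[].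
  rewrite (_ : H n = [set z in y :: s']); first exact: path_conn.
  by apply/setP => z; rewrite HE in_set Es.
have E1 : u |: [set z in m1] = [set z in u :: m1] by apply/setP => z; rewrite !inE.
pose D := [set z in m1] :|: (H n :|: [set z in v2 :: m2]).
exists D, u, (last v2 m2), w; split => //.
- rewrite /D; apply/subsetP => z; rewrite !in_setU ![z \in [set _ in _]]inE => /or3P[zm|->|zm].
  + by rewrite h1 // inE mem_rcons inE zm !orbT.
  + by rewrite orbT.
  by rewrite k1 //; move: zm; rewrite -rcons_cons mem_rcons !inE => /orP[] ->; rewrite !orbT.
- have Lh z c' : z \in L h -> c' < a -> z \notin L (nth i1 s c').
    move=> zh c'a; apply/negP => zc; have [_ _ ne] := fP _ c'a.
    by rewrite (dL _ _ _ zh zc) eqxx in ne.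
  move=> z c' zD c'a; move: zD; rewrite /D !in_setU ![z \in [set _ in _]]inE => /or3P[zm|zh|].
  + exact: h6.
  + by move: zh; rewrite inE => /andP[zh _]; apply: Lh.
  by move=> /predU1P[->|zm]; [apply: Lh|apply: k6].
- by apply: loI => //; apply: h1; rewrite mem_head.
split => //.
- rewrite /D setUA; apply: connU => //.
  + by rewrite E1; apply: path_conn.
  + apply: connU => //; first exact: path_conn.
    by exists v2, v2; rewrite eqxx v2H inE mem_head.
  exists (last u m1), v1; rewrite E1 inE mem_last h3 orbT; split => //.
  by rewrite in_setU v1H.
- by rewrite /D !in_setU [last _ _ \in [set _ in v2 :: m2]]inE mem_last !orbT.
by apply: loI => //; apply: k1; rewrite inE mem_rcons mem_head orbT.
Qed.

Lemma linked_subfamily (e : rel V) A B q n (L : 'I_q -> seq V) (K : {set 'I_q}) :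
  (forall i, i \in K -> ABpath e A B (L i)) -> disjoint_family L -> n <= #|K| ->
  linked e A B n.
Proof.
move=> HL dL nK; apply: (linkedW nK).
apply: (@linked_of_disjoint _ _ _ _ _ (fun i : 'I_#|K| => L (enum_val i))).
  by move=> i; apply: HL; apply: enum_valP.
by move=> i j z zi zj; apply: enum_val_inj; apply: dL zi zj.
Qed.

Lemma ABpath_restr (e : rel V) (U A B : {set V}) s : ABpath (restr e U) (A :&: U) (B :&: U) s <->
  ABpath e A B s /\ {subset s <= U}.
Proof.
case: s => [|x s]; first by split => [|[]].
rewrite /= !in_setI; split.
  case/and3P => /andP[xA xU] /restr_path[pp sU] /andP[lB _]; rewrite xA pp lB; split => //.
  by move=> z; rewrite inE => /predU1P[->|/sU].
case=> /and3P[xA pp lB] sU; rewrite xA lB (sU x (mem_head _ _)) (sU _ (mem_last _ _)) /= andbT.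
exact: path_restr.
Qed.

End Families.

(* Either the paths of one linkage avoid enough of the others, or two linkages cross so
   often that their union contains a grid. *)
Lemma select_paths a b N : 0 < a -> 0 < b -> exists n, forall (V : finType) (e : rel V)
    (U : {set V}) (A B : nat -> {set V}), symmetric e ->
  (forall r, r < N -> linked (restr e U) (A r :&: U) (B r :&: U) n) ->
  grid_minor e a b U \/ exists f : nat -> seq V,
    (forall r, r < N -> ABpath (restr e U) (A r :&: U) (B r :&: U) (f r)) /\
    forall r r' z, r < N -> r' < N -> z \in f r -> z \in f r' -> r = r'.
Proof.
move=> a0 b0; elim: N => [|N [n0 IH]].
  by exists 0 => V e U A B _ _; right; exists (fun=> [::]); split.
(* If some [P j] meets at most [a ^ a] of the [q] paths of each linkage, at least [n0] of them avoid
   it and induction applies. Otherwise each [P j] gets a colour: a linkage it meets more often, the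
   members met, and the pairs of members it joins directly. [M] paths of one colour are what
   [rows_grid] needs, and [p] is chosen for the pigeonhole principle. *)
pose q := n0 + a ^ a; pose M := 2 * q * (a * b).+1.
pose C := ('I_N * {set 'I_q} * {set 'I_q * 'I_q})%type.
pose p := (#|{: C}| * M).+1.
exists (maxn p q) => V e U A B es lk.
have rs : symmetric (restr e U) by move=> u v; rewrite /restr es andbCA.
have [P [HP dP]] := linkedW (leq_maxl p q) (lk N (ltnSn _)).
have HP' j : [/\ exists x s, P j = x :: s, sorted e (P j), {subset P j <= U} & sorted (restr e U) (P j)].
  have [h _] := HP j; have /ABpath_restr[_ sU] := h; have [x [s [E _ ps _]]] := ABpath_nil h.
  have [pe _] := restr_path ps.
  by split; [exists x, s|rewrite E|exact: sU|rewrite E].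
have Pr i u v : infix [:: u; v] (P i) -> restr e U u v.
  have [[x [s E]] _ _] := HP' i; rewrite E /= => /path_infixP; exact.
have exL (r : 'I_N) := min_linkage es (linkedW (leq_maxr p q) (lk r (ltnW (ltn_ord r)))) Pr.
have [L HL] := choice exL.
pose hit r j := [set i | has (mem (P j)) (L r i)].
case: (pselect (exists j, forall r, #|hit r j| <= a ^ a)) => [[j small]|big].
  pose U' := U :\: [set z in P j].
  have U'U : U' \subset U by apply: subsetDl.
  have lk' r : r < N -> linked (restr e U') (A r :&: U') (B r :&: U') n0.
    move=> rN; pose r' := Ordinal rN; have [H1 H2 _] := HL r'.
    apply: (@linked_subfamily _ _ _ _ q _ (L r') (~: hit r' j)) => //.
      move=> i; rewrite !inE => nh; have [h _] := H1 i; have /ABpath_restr[hA hU] := h.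
      apply/ABpath_restr; split => // z zi; rewrite !inE hU // andbT.
      by apply: contra nh => zP; apply/hasP; exists z.
    rewrite -(leq_add2l #|hit r' j|) cardsC card_ord /q addnC leq_add2l; exact: small.
  case: (IH V e U' A B es lk') => [g|[f [Hf df]]]; first by left; apply: grid_minor_sub g.
  right; exists (fun r => if r == N then P j else f r); split.
    move=> r; rewrite ltnS leq_eqVlt; case: (r =P N) => [-> _|_ /= rN]; first by have [] := HP j.
    have /ABpath_restr[h1 h2] := Hf r rN; apply/ABpath_restr; split => // z /h2.
    exact: (subsetP U'U).
  have off r z : r < N -> z \in f r -> z \in P j -> False.
    by move=> rN zr zP; have /ABpath_restr[_ /(_ z zr)] := Hf r rN; rewrite !inE zP.
  move=> r r' z; rewrite !ltnS (leq_eqVlt r) (leq_eqVlt r').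
  case: (r =P N) => [->|_] /=; case: (r' =P N) => [->|_] //= rN rN' zr zr'.
  - by case: (off r' z).
  - by case: (off r z).
  exact: df zr zr'.
left.
have exr j : exists r, a ^ a < #|hit r j|.
  apply: contrapT => no; apply: big; exists j => r; rewrite leqNgt; apply/negP => h.
  by apply: no; exists r.
have [rho Hrho] := choice exr.
pose on r := [pred z | [exists i, z \in L r i]].
pose col j : C := (rho j, hit (rho j) j, [set w | `[< segment (P j) (mem (L (rho j) w.1)) (mem (L (rho j) w.2)) (on (rho j)) >]]).
have [[[r I] G] cb] := @pigeonhole p M C col (ltnSn _).
have colP j : j \in [set j | col j == (r, I, G)] -> [/\ r = rho j, I = hit r j &
    G = [set w | `[< segment (P j) (mem (L r w.1)) (mem (L r w.2)) (on r) >]]].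
  by rewrite inE => /eqP[<- <- <-].
have M0 : 0 < M.
  rewrite /M !muln_gt0 /= /q addn_gt0 expn_gt0 a0 orbT //.
have [j0 j0J] : exists j, j \in [set j | col j == (r, I, G)].
  by apply/set0Pn; rewrite -card_gt0; apply: leq_trans cb.
have [H1 H2 H3] := HL r.
have L' i : [/\ uniq (L r i), sorted e (L r i), {subset L r i <= U} &
    exists x s, [/\ L r i = x :: s, x \in A r :&: U & last x s \in B r :&: U]].
  have [h u] := H1 i; have /ABpath_restr[_ sU] := h; have [x [s [E xA ps lB]]] := ABpath_nil h.
  have [pe _] := restr_path ps; split => //; first by rewrite E.
  by exists x, s.
apply: (@rows_grid V e U a b p q P (L r) (A r :&: U) (B r :&: U) I
  [set j | col j == (r, I, G)] (fun i i' => (i, i') \in G)) => //.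
- by move=> i; have [] := L' i.
- by move=> j; have [] := HP' j.
- by move=> i; have [] := L' i.
- by move=> j; have [] := HP' j.
- by move=> i; have [] := L' i.
- by move=> i j /colP[_ -> _]; rewrite inE.
- move=> i i' j /colP[_ _ ->]; rewrite inE /=; split; [by move/asboolP|by move=> h; apply/asboolP].
have [Er -> _] := colP _ j0J; have := Hrho j0; by rewrite -Er.
Qed.

(** A comb with [2 * m] blocks, [m = a * b], has large linkages through [C] between any two blocks.
    Either two of them cross into a grid, or there are disjoint paths [p i j] from block [t1 i] to
    block [t2 j] for all [i], [j]. Then block [t1 i], the paths leaving it and block [t2 i] form a
    connected set [M i], connected by [p i i]. The sets [M i] are disjoint and pairwise adjacent,
    and a complete minor on [m] vertices contains the grid. *)
Lemma grid_of_bramble a b : 0 < a -> 0 < b -> exists k, forall (V : finType) (e : rel V)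
  (B : {set {set V}}), symmetric e -> bramble e B k -> grid_minor e a b setT.
Proof.
move=> a0 b0; pose m := a * b; have m0 : 0 < m by rewrite muln_gt0 a0.
(* [n0] may be zero, while the blocks of [comb_blocks] must have at least one leg. *)
have [n0 sel] := select_paths (m * m) a0 b0; pose n := n0.+1.
pose h := (m + m) * n; exists (2 * h) => V e B es br.
have h1 : 1 < h.
  apply: (@leq_trans (m + m)); last by rewrite leq_pmulr.
  by rewrite addnn -muln2 -[2]mul1n leq_mul2r.
have [P [X [C data]]] := comb_exists es br h1 (leqnn _).
have [T [cT dT TC TX]] := comb_blocks es br (leqnn _) data (ltn0Sn _) (erefl h).
have lt_ l r : r < m -> l * m + r < l.+1 * m by move=> rm; rewrite mulSn addnC ltn_add2r.
pose X_ i := T i :&: X.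
have dX i j : i != j -> [disjoint X_ i & X_ j].
  move=> ij; rewrite disjoints_subset; apply/subsetP => z; rewrite !inE => /andP[zi _].
  by rewrite negb_and; apply/orP; left; apply: contra ij => zj; rewrite (dT _ _ _ zi zj).
have links i j : i != j -> linked (restr e C) (nbr e (X_ i) :&: C) (nbr e (X_ j) :&: C) n.
  move=> ij; apply: (comb_links es br (leqnn _) data); rewrite ?subsetIr ?TX //; exact: dX.
have inb i : i < m -> i < m + m by move=> h2; apply: leq_trans h2 (leq_addr _ _).
have inb' i : i < m -> m + i < m + m by rewrite ltn_add2l.
pose t1 (i : 'I_m) : 'I_(m + m) := lshift m i.
pose t2 (i : 'I_m) : 'I_(m + m) := rshift m i.
have t12 i j : t1 i != t2 j by rewrite eq_lrshift.
pose o : 'I_m := Ordinal m0.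
pose A r := nbr e (X_ (t1 (insubd o (r %/ m)))).
pose A' r := nbr e (X_ (t2 (insubd o (r %% m)))).
have lk r : r < m * m -> linked (restr e C) (A r :&: C) (A' r :&: C) n0.
  by move=> _; apply: linkedW (links _ _ (t12 _ _)).
case: (sel V e C A A' es lk) => [g|[f [Hf df]]].
  by apply: grid_minor_sub g; apply: subsetT.
pose r (i j : 'I_m) := i * m + j.
have rb i j : r i j < m * m.
  apply: leq_trans (lt_ i j (ltn_ord j)) _; by rewrite leq_mul2r ltn_ord orbT.
have rd i j : r i j %/ m = i by rewrite divnMDl // divn_small // addn0.
have rm i j : r i j %% m = j by rewrite modnMDl modn_small.
pose p i j := [set z in f (r i j)].
have Hp i j : [/\ conn e (p i j), p i j \subset C,
    exists x y, [/\ x \in T (t1 i), y \in p i j & e x y] &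
    exists x y, [/\ x \in p i j, y \in T (t2 j) & e x y]].
  have /ABpath_restr[+ sC] := Hf _ (rb i j); rewrite /A /A' rd rm !valKd.
  move=> /ABpath_nil[x [s [E /nbrP[y /setIP[yT _] eyx] ps /nbrP[z /setIP[zT _] ezl]]]]; split.
  - by rewrite /p E; apply: path_conn.
  - by apply/subsetP => w; rewrite inE => /sC.
  - by exists y, x; rewrite inE E mem_head.
  by exists (last x s), z; rewrite inE E mem_last es.
have dp i j i' j' z : z \in p i j -> z \in p i' j' -> i = i' /\ j = j'.
  rewrite !inE => h2 h3; have E := df _ _ _ (rb i j) (rb i' j') h2 h3.
  by split; apply: val_inj;
    [exact: (etrans (esym (rd i j)) (etrans (congr1 (fun x => x %/ m) E) (rd i' j')))
    |exact: (etrans (esym (rm i j)) (etrans (congr1 (fun x => x %% m) E) (rm i' j')))].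
have pT i j l z : z \in p i j -> z \in T l -> False.
  by move=> zp /TC; have [_ /subsetP/(_ z zp) -> _ _] := Hp i j.
pose M i := (T (t1 i) :|: \bigcup_(j : 'I_m) p i j) :|: T (t2 i).
have inM i z : z \in M i -> [\/ z \in T (t1 i), exists j, z \in p i j | z \in T (t2 i)].
  by case/setUP => [/setUP[|/bigcupP[j _]]|]; [constructor 1|constructor 2; exists j|constructor 3].
have Mp i j z : z \in p i j -> z \in M i.
  by move=> zp; rewrite !in_setU; apply/orP; left; apply/orP; right; apply/bigcupP; exists j.
have T0 i : T i != set0.
  by have := TX i; case: (set_0Vmem (T i)) => [->|[z zT] _]; [rewrite set0I cards0|apply/set0Pn; exists z].
have cM i : conn e (M i).
  apply: connU => //.
    apply: conn_bigcup => //; first by move=> j _; have [] := Hp i j.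
    by move=> j _; have [_ _ [x [y [xT yp exy]]] _] := Hp i j; exists x, y; rewrite exy orbT.
  have [_ _ _ [x [y [xp yT exy]]]] := Hp i i; exists x, y; rewrite exy orbT; split => //.
  by rewrite in_setU; apply/orP; right; apply/bigcupP; exists i.
have dM i j z : z \in M i -> z \in M j -> i = j.
  have sh1 i' j' : z \in T (t1 i') -> z \in T (t1 j') -> i' = j'.
    by move=> h2 h3; have := dT _ _ _ h2 h3 => /eqP; rewrite eq_lshift => /eqP.
  have sh2 i' j' : z \in T (t2 i') -> z \in T (t2 j') -> i' = j'.
    by move=> h2 h3; have := dT _ _ _ h2 h3 => /eqP; rewrite eq_rshift => /eqP.
  have sh3 i' j' : z \in T (t1 i') -> z \in T (t2 j') -> False.
    by move=> h2 h3; have := t12 i' j'; rewrite (dT _ _ _ h2 h3) eqxx.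
  move=> /inM[h2|[k h2]|h2] /inM[h3|[k' h3]|h3].
  - exact: sh1.
  - by case: (pT _ _ _ _ h3 h2).
  - by case: (sh3 _ _ h2 h3).
  - by case: (pT _ _ _ _ h2 h3).
  - by case: (dp _ _ _ _ _ h2 h3).
  - by case: (pT _ _ _ _ h2 h3).
  - by case: (sh3 _ _ h3 h2).
  - by case: (pT _ _ _ _ h3 h2).
  exact: sh2.
have aM i j : adjacent e (M i) (M j).
  have [_ _ _ [x [y [xp yT exy]]]] := Hp i j; exists x, y; split => //; first exact: Mp xp.
  by rewrite in_setU yT orbT.
exists (fun i j => M (insubd o (i * b + j))).
have bnd i j : i < a -> j < b -> i * b + j < m.
  move=> ia jb; apply: (@leq_trans (i.+1 * b)); first by rewrite mulSn addnC ltn_add2r.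
  by rewrite leq_mul2r ia orbT.
split => [i j _ _|i j i' j' z ia jb ia' jb'|i j _ _|i j _ _]; [|move=> h2 h3|exact: aM|exact: aM].
  split; [exact: cM| |exact: subsetT].
  have /set0Pn[z zT] := T0 (t1 (insubd o (i * b + j))).
  by apply/set0Pn; exists z; rewrite !in_setU zT.
have /(congr1 val) := dM _ _ _ h2 h3; rewrite !val_insubd !bnd // => E.
have := congr1 (fun x => x %% b) E; have := congr1 (fun x => x %/ b) E.
by rewrite /= !divnMDl // !divn_small // !addn0 !modnMDl !modn_small.
Qed.

(** * Minimal vertex sets carrying a bramble *)

Section Structure.
Variables (V : finType) (e : rel V).
Hypothesis es : symmetric e.
Hypothesis ei : irreflexive e.

Definition bramble_in (U : {set V}) k : Prop := exists2 B, bramble e B k & forall b, b \in B -> b \subset U.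

(** * Pushing a bramble out of a set *)

Section Reduce.
Variables (B : {set {set V}}) (k : nat) (U X S Z : {set V}) (v : V) (b0 : {set V}).
Hypothesis br : bramble e B k.
Hypothesis BU : forall b, b \in B -> b \subset U.
Hypothesis clX : forall u w, u \in X -> e u w -> w \in X :|: S.
Hypothesis dXS : [disjoint X & S].
Hypothesis b0B : b0 \in B.
Hypothesis db0 : [disjoint b0 & X :|: S].
Hypothesis XU : X \subset U.
Hypothesis ZX : Z \subset X.
Hypothesis vX : v \notin X.
Hypothesis cZ : conn e (v |: Z).
Hypothesis SS : forall s s', s \in S -> s' \in S -> s != s' ->
  [|| e s s', (s == v) && (s' \in nbr e Z) | (s' == v) && (s \in nbr e Z)].

(** [Z] replaces the detours through [X]: whoever contains [v] can still reach the other vertices of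
    [S] by means of [Z]. *)
Let push (b : {set V}) : {set V} := (b :\: X) :|: (if v \in b then Z else set0).

(** A member contained in [X] could not touch [b0], which avoids [X] and everything adjacent to
    it. *)
Lemma push_meet b : b \in B -> forall z, z \in b -> z \in X -> exists2 s, s \in b & s \in S.
Proof.
move=> bB z zb zX; apply: contrapT => no.
have [cb _] : conn e b /\ b != set0 by case: br => H _ _; apply: H.
have bX : b \subset X.
  apply: (conn_closed cb); last by exists z.
  move=> u w uX _ wb euw; have /setUP[//|wS] := clX uX euw.
  by case: no; exists w.
case: br => _ /(_ b b0 bB b0B)[a [c [ab cb0 ac]]] _.
have aX := subsetP bX _ ab.
have cn : c \notin X :|: S by rewrite (disjointFr db0).
case/orP: ac => [/eqP ac|eac]; first by rewrite -ac inE aX in cn.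
by rewrite (clX aX eac) in cn.
Qed.

Lemma push_in (b : {set V}) z : z \in b -> z \notin X -> z \in push b.
Proof. by move=> zb zX; rewrite in_setU in_setD zX zb. Qed.

Lemma push_Z (b : {set V}) z : v \in b -> z \in Z -> z \in push b.
Proof. by move=> vb zZ; rewrite in_setU vb zZ orbT. Qed.

Lemma push_conn b : b \in B -> conn e (push b).
Proof.
move=> bB; have [cb _] : conn e b /\ b != set0 by case: br => H _ _; apply: H.
case: (pselect (exists2 s, s \in b & s \in S)) => [[s0 s0b s0S]|no]; last first.
  have nX z : z \in b -> z \notin X.
    by move=> zb; apply/negP => zX; apply: no; apply: push_meet bB z zb zX.
  have bX : b :\: X = b by apply/setDidPl; rewrite disjoints_subset; apply/subsetP => z /nX; rewrite inE.
  rewrite /push bX; case: ifP => vb; last by rewrite setU0.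
  rewrite (_ : b :|: Z = b :|: (v |: Z)); last first.
    by rewrite setUA; congr (_ :|: _); apply/esym/setUidPl; rewrite sub1set.
  by apply: connU => //; exists v, v; rewrite vb setU11 eqxx.
(* If [v] is available it must be the base point: vertices of [S] that are not adjacent to each
   other are only assumed to be joined through [v] and [Z]. *)
pose s1 := if v \in b :&: S then v else s0.
have [s1b s1S] : s1 \in b /\ s1 \in S by rewrite /s1; case: ifP => // /setIP[].
have Sn s : s \in S -> s \notin X by move=> sS; rewrite (disjointFl dXS).
have s1p : s1 \in push b by apply: push_in => //; apply: Sn.
apply: (conn_cut es s1p) => Y Yp s1Y clY.
have ZY : v \in b -> v \in Y -> Z \subset Y.
  move=> vb vY; have : v |: Z \subset Y.
    apply: (conn_closed cZ); last by exists v; rewrite ?setU11.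
    move=> y z yY _ zZ eyz; case/setU1P: zZ => [->//|zZ].
    by apply: clY eyz => //; apply: push_Z.
  by rewrite subUset => /andP[].
have SY s : s \in b -> s \in S -> s \in Y.
  move=> sb sS; have sp : s \in push b by apply: push_in => //; apply: Sn.
  case: (s1 =P s) => [<-//|/eqP ne].
  case/or3P: (SS s1S sS ne) => [h|/andP[/eqP h1 /nbrP[z zZ ezs]]|/andP[/eqP h1 /nbrP[z zZ ezs]]].
  - exact: clY h.
  - apply: (clY z) => //; rewrite h1 in s1Y s1b; exact: (subsetP (ZY s1b s1Y)).
  by subst s; move: ne; rewrite /s1 in_setI sb sS eqxx.
have bY : b \subset Y :|: X.
  apply: (conn_closed cb); last by exists s1; rewrite // inE s1Y.
  move=> y z /setUP[yY|yX] yb zb eyz; rewrite inE.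
    case: (boolP (z \in X)) => zX; rewrite ?orbT // orbF.
    by apply: clY eyz => //; apply: push_in.
  by have /setUP[->|/(SY _ zb) ->] := clX yX eyz; rewrite ?orbT.
apply/subsetP => z /setUP[/setDP[zb zX]|].
  by have := subsetP bY z zb; rewrite inE (negbTE zX) orbF.
case: ifP => [vb|_]; last by rewrite inE.
move=> zZ; apply: (subsetP (ZY vb _)) => //.
by have := subsetP bY v vb; rewrite inE (negbTE vX) orbF.
Qed.

(** Pushed members touch: contacts inside [X] are replaced by contacts between vertices of [S],
    direct or through [Z]. The order survives because a hitting set that meets [Z] may be exchanged
    for one containing [v]. *)
Lemma bramble_in_reduce : bramble_in (U :\: (X :\: Z)) k.
Proof.
have Bp b : b \in B -> exists2 z, z \in b & z \notin X.
  move=> bB; case: br => _ /(_ b b0 bB b0B)[a [c [ab cb0 ac]]] _.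
  have cn : c \notin X :|: S by rewrite (disjointFr db0).
  exists a => //; apply/negP => aX; case/orP: ac => [/eqP ac|eac]; first by rewrite -ac inE aX in cn.
  by rewrite (clX aX eac) in cn.
have Sn s : s \in S -> s \notin X by move=> sS; rewrite (disjointFl dXS).
exists [set push b | b in B]; last first.
  move=> _ /imsetP[b bB ->]; apply/subsetP => z /setUP[/setDP[zb zX]|].
    by rewrite !in_setD negb_and zX orbT (subsetP (BU bB)).
  case: ifP => [vb zZ|]; last by rewrite inE.
  by have zX := subsetP ZX _ zZ; rewrite !in_setD negb_and negbK zZ (subsetP XU).
have pN b : b \in B -> exists z, z \in push b.
  by move=> bB; have [z zb zX] := Bp b bB; exists z; apply: push_in.
have tS (b b' : {set V}) s s' : s \in b -> s \in S -> s' \in b' -> s' \in S -> touch e (push b) (push b').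
  move=> sb sS sb' sS'; have sp := push_in sb (Sn _ sS); have sp' := push_in sb' (Sn _ sS').
  case: (s =P s') => [ss|/eqP ne]; first by exists s, s'; rewrite sp sp' ss eqxx.
  case/or3P: (SS sS sS' ne) => [h|/andP[/eqP h1 /nbrP[z zZ ezs]]|/andP[/eqP h1 /nbrP[z zZ ezs]]].
  - by exists s, s'; rewrite sp sp' h orbT.
  - by exists z, s'; rewrite sp' ezs orbT; split => //; apply: push_Z => //; rewrite -h1.
  by exists s, z; rewrite sp es ezs orbT; split => //; apply: push_Z => //; rewrite -h1.
split.
- move=> _ /imsetP[b bB ->]; split; first exact: push_conn.
  by apply/set0Pn; apply: pN.
- move=> _ _ /imsetP[b bB ->] /imsetP[b' bB' ->].
  case: br => _ /(_ b b' bB bB')[x [y [xb yb xy]]] _.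
  case: (boolP (x \in X)) => xX; case: (boolP (y \in X)) => yX.
  + have [s sb sS] := push_meet bB xb xX; have [s' sb' sS'] := push_meet bB' yb yX.
    exact: tS sb sS sb' sS'.
  + have [s sb sS] := push_meet bB xb xX.
    case/orP: xy => [/eqP xy|exy]; first by rewrite -xy xX in yX.
    have := clX xX exy; rewrite inE (negbTE yX) => yS; exact: tS sb sS yb yS.
  + have [s sb sS] := push_meet bB' yb yX.
    case/orP: xy => [/eqP xy|exy]; first by rewrite xy yX in xX.
    rewrite es in exy; have := clX yX exy; rewrite inE (negbTE xX) => xS; exact: tS xb xS sb sS.
  by exists x, y; split => //; apply: push_in.
move=> H Hk; case: (pselect (exists2 z, z \in H & z \in Z)) => [[z zH zZ]|no].
  (* Not larger than [H], since [H] meets [Z]. A member avoiding it does not contain [v], so it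
     receives nothing from [Z] and its image avoids [H]. *)
  pose H' := v |: (H :\: Z).
  have H'k : #|H'| < k.
    apply: leq_ltn_trans Hk; rewrite cardsU1; apply: (@leq_trans (1 + #|H :\: Z|)).
      by rewrite leq_add2r; case: (_ \notin _).
    rewrite add1n; apply: proper_card; rewrite properE subsetDl; apply/subsetPn; exists z => //.
    by rewrite inE zZ.
  case: br => _ _ /(_ H' H'k)[b bB db]; exists (push b); first exact: imset_f.
  have vb : v \notin b by rewrite (disjointFl db) // setU11.
  rewrite disjoints_subset; apply/subsetP => w; rewrite in_setU (negbTE vb) in_set0 orbF => /setDP[wb wX].
  rewrite inE; apply/negP => wH; have := disjointFr db wb; rewrite in_setU1 in_setD wH andbT.
  by rewrite (contra (subsetP ZX w) wX) orbT.
case: br => _ _ /(_ H Hk)[b bB db]; exists (push b); first exact: imset_f.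
rewrite disjoints_subset; apply/subsetP => w /setUP[/setDP[wb _]|].
  by rewrite inE (disjointFr db wb).
case: ifP => [_ wZ|]; last by rewrite inE.
by rewrite inE; apply/negP => wH; apply: no; exists w.
Qed.

End Reduce.

(** * No clique cutsets and no triangles in a minimal set *)

Section Minimal.
Variables (B : {set {set V}}) (k : nat) (U : {set V}).
Hypothesis T1 : T1_free e.
Hypothesis br : bramble e B k.
Hypothesis BU : forall b, b \in B -> b \subset U.
Hypothesis eU : forall u w, e u w -> u \in U.
Hypothesis minU : forall A : {set V}, A \subset U -> bramble_in A k -> A = U.
Hypothesis small : forall K, clique e K -> #|K| < k.
Hypothesis k3 : 3 < k.

Let eU' u w : e u w -> w \in U. Proof. by rewrite es => /eU. Qed.

Lemma bramble_conn b : b \in B -> conn e b. Proof. by case: br => H _ _ /H[]. Qed.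

Lemma reduce_all (X S Z b0 : {set V}) v :
  (forall u w, u \in X -> e u w -> w \in X :|: S) -> [disjoint X & S] ->
  b0 \in B -> [disjoint b0 & X :|: S] -> X \subset U -> Z \subset X -> v \notin X ->
  conn e (v |: Z) ->
  (forall s s', s \in S -> s' \in S -> s != s' ->
    [|| e s s', (s == v) && (s' \in nbr e Z) | (s' == v) && (s \in nbr e Z)]) ->
  X \subset Z.
Proof.
move=> clX dXS b0B db0 XU ZX vX cZ SS.
have h := bramble_in_reduce br BU clX dXS b0B db0 XU ZX vX cZ SS.
have E := minU (subsetDl _ _) h.
apply/subsetP => z zX; apply: contraT => zZ.
by have := subsetP XU z zX; rewrite -E !in_setD zX zZ.
Qed.

(** A member avoiding [K] lies in one component [C] of [U :\: K]. Everything outside [C] and [K] is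
    left only through the clique [K], so it can be pushed away with [Z] empty; by minimality it is
    empty. *)
Lemma no_clique_cut K : clique e K -> conn e (U :\: K).
Proof.
move=> cK; case: br => _ _ /(_ K (small cK))[b bB dbK].
have [x xb] : exists x, x \in b by apply/set0Pn; case: br => /(_ b bB)[].
have bUK : b \subset U :\: K.
  by apply/subsetP => z zb; rewrite in_setD (disjointFr dbK zb) (subsetP (BU bB)).
have xUK := subsetP bUK x xb.
pose C := component e (U :\: K) x.
have bC : b \subset C.
  by apply: comp_max => //; [exact: bramble_conn|exists x => //; apply: comp_in].
have CU : C \subset U :\: K by apply: comp_sub.
have cC : conn e C by apply: comp_conn.
pose X := U :\: K :\: C.
suff /subsetP H : X \subset set0.
  have -> : U :\: K = C.
    apply/eqP; rewrite eqEsubset CU andbT; apply/subsetP => z zU; apply: contraT => zC.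
    by have := H z; rewrite /X in_setD zU zC inE => /(_ isT).
  exact: cC.
apply: (@reduce_all X K set0 b x) => //.
- move=> u w; rewrite /X in_setD => /andP[uC uU] euw.
  rewrite in_setU in_setD; case: (boolP (w \in K)) => wK; rewrite ?orbT // orbF.
  have wU : w \in U :\: K by rewrite in_setD wK (eU' euw).
  rewrite wU andbT; apply: contra uC => wC; apply: (comp_closed wC) => //; by rewrite es.
- by rewrite disjoints_subset; apply/subsetP => z; rewrite !inE => /and3P[].
- rewrite disjoints_subset; apply/subsetP => z zb; rewrite /X in_setC in_setU in_setD negb_or (disjointFr dbK zb) andbT.
  by rewrite negb_and negbK (subsetP bC z zb).
- by apply/subsetP => z; rewrite !inE => /and3P[].
- exact: sub0set.
- by rewrite /X in_setD (subsetP bC x xb).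
- by rewrite setU0; apply: conn1.
by move=> s s' sK sK' ne; rewrite cK.
Qed.

(** The neighbours of [x] closest to [w] on the two sides of [P] bound a stretch of [P] that closes
    up with [x]. *)
Lemma gap_hole P d x w : ipath e P -> x \notin P -> e x (head d P) -> e x (last d P) ->
  w \in P -> ~~ e x w -> exists c u,
  [/\ hole e c, x \in c, w \in c, {subset c <= x :: P} & [/\ u \in c, u \in P & e x u]].
Proof.
move=> iP xP xh xl wP nxw; have [s1 [s2 E]] := mem_split wP.
have h1 : has (e x) s1.
  case: s1 E => [|a s1] E; first by move: xh; rewrite E /= (negbTE nxw).
  by move: xh; rewrite E /= => ->.
have h2 : has (e x) s2.
  case/lastP: s2 E => [|s2 a] E; first by move: xl; rewrite E last_cat /= (negbTE nxw).
  by move: xl; rewrite E last_cat /= last_rcons has_rcons => ->.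
have [t1 [u [t2 [E1 eu n2]]]] := last_split h1.
move: h2 E => /split_find; case Es : _ _ _ / => [u' t3 t4 eu' n3] E.
have {E}E : P = t1 ++ (u :: t2 ++ w :: rcons t3 u') ++ t4.
  by rewrite E E1 -!catA /= -!catA /= cat_rcons.
pose Q := u :: t2 ++ w :: rcons t3 u'.
have QP z : z \in Q -> z \in P by move=> zQ; rewrite E !mem_cat [z \in _ :: _]zQ orbT.
have iQ : ipath e Q by move: iP; rewrite E => /ipath_catr/ipath_catl.
exists (x :: Q), u; split.
- rewrite /hole iQ /=; apply/and3P; split.
  + by rewrite size_cat /= size_rcons !addnS.
  + by apply: contra xP; apply: QP.
  rewrite last_cat /= last_rcons.
  change (is_true (all (fun z => e x z == (z == u) || (z == u')) Q)).
  apply/allP => z zQ; case exz : (e x z).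
    move: zQ; rewrite inE mem_cat inE mem_rcons inE => /or4P[->//|zt|/eqP zw|/orP[->|zt]].
    - by rewrite (negbTE (hasPn n2 _ zt)) in exz.
    - by rewrite -zw exz in nxw.
    - by rewrite orbT.
    by rewrite (negbTE (hasPn n3 _ zt)) in exz.
  by rewrite eq_sym eqbF_neg negb_or; apply/andP; split; apply: contraFneq exz => ->.
- exact: mem_head.
- by rewrite !inE mem_cat mem_head !orbT.
- by move=> z; rewrite inE => /predU1P[->|/QP zP]; rewrite inE ?eqxx // zP orbT.
by split; rewrite ?QP ?inE ?eqxx ?orbT.
Qed.

(** Take a largest clique [K] with at least two vertices that is complete to two nonadjacent
    vertices. An induced path between these, avoiding [K], turns out to be complete to [K]; its
    second vertex then enlarges [K], with the first and the third as the nonadjacent pair. *)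
Lemma no_diamond x y d z : e x y -> e d x -> e d y -> e z x -> e z y -> d != z -> e d z.
Proof.
move=> exy edx edy ezx ezy dz; apply: contraT => ndz.
pose Q (K : {set V}) := [/\ clique e K, 1 < #|K| & exists d z, [/\ d != z, ~~ e d z &
   forall x, x \in K -> e d x /\ e z x]].
have exK : exists K, Q K.
  exists [set x; y]; split.
  - move=> u w; rewrite !inE => /orP[]/eqP -> /orP[]/eqP ->; rewrite ?eqxx ?exy ?[e y x]es ?exy //.
  - by rewrite cards2 (neq_edge ei exy).
  by exists d, z; split => // u; rewrite !inE => /orP[]/eqP ->.
have [K [[cK K1 [d' [z' [dz' ndz' H]]]] Kmax]] := exists_min (fun K : {set V} => #|V| - #|K|) exK.
clear x y d z exy edx edy ezx ezy dz ndz exK.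
have dK : d' \notin K by apply/negP => /H[]; rewrite ei.
have zK : z' \notin K by apply/negP => /H[_]; rewrite ei.
have [x0 x0K] : exists x, x \in K by apply/set0Pn; rewrite -card_gt0; apply: ltnW.
have [ed0 ez0] := H x0 x0K.
have dU : d' \in U :\: K by rewrite in_setD dK (eU ed0).
have zU : z' \in U :\: K by rewrite in_setD zK (eU ez0).
have [p [ip lp sp]] := conn_ipath (no_clique_cut cK) dU zU.
have nK u : u \in d' :: p -> u \notin K by move=> /sp /setDP[].
have up := ipath_uniq ip.
(* If [x] misses [w], a hole through [x] and a neighbour [u] of [x] on the path avoids another
   vertex [x'] of [K], so [x'] misses [u]. A hole through [x'] and [u] then avoids [x], which is
   adjacent to both. *)
have comp w x : w \in d' :: p -> x \in K -> e x w.
  move=> wp xK; apply: contraT => nxw.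
  have [x' /setD1P[x'x x'K]] : exists x', x' \in K :\ x.
    by apply/set0Pn; rewrite -card_gt0; have := cardsD1 x K; rewrite xK; move: K1; clear; lia.
  have G y v : y \in K -> v \in d' :: p -> ~~ e y v -> exists c u,
     [/\ hole e c, y \in c, v \in c, {subset c <= y :: d' :: p} & [/\ u \in c, u \in d' :: p & e y u]].
    move=> yK vp nyv; have [h1 h2] := H y yK; apply: (@gap_hole _ d') => //.
    - by apply/negP => /nK; rewrite yK.
    - by rewrite es.
    by rewrite /= lp es.
  have [c [u [hc xc wc sc [uc uP eu]]]] := G x w xK wp nxw.
  have off y y' (c' : seq V) : y \in K -> y' \in K -> y' != y -> {subset c' <= y :: d' :: p} -> y' \notin c'.
    move=> yK y'K ne sub; apply/negP => /sub; rewrite inE (negbTE ne) /= => /nK; by rewrite y'K.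
  have nx'u : ~~ e x' u.
    apply/negP => ex'u; have ne := nK _ uP.
    have xu : x = u.
      apply: (T1 hc (off _ _ _ xK x'K x'x sc) xc uc) => //; exact: cK.
    by move: ne; rewrite -xu xK.
  have [c' [u' [hc' x'c' uc' sc' _]]] := G x' u x'K uP nx'u.
  have xx' : x != x' by rewrite eq_sym.
  have : x' = u by apply: (T1 hc' (off _ _ _ x'K xK xx' sc') x'c' uc') => //; apply: cK.
  by move=> x'u; move: (nK _ uP); rewrite -x'u x'K.
case: p ip lp sp nK up comp => [|w1 [|w2 p]] ip lp sp nK up comp.
- by move: dz'; rewrite -lp /= eqxx.
- by move: ndz'; rewrite -lp /= (ipath_head ip) ?mem_head //= eqxx.
have /Kmax : Q (w1 |: K).
  split.
  - move=> a b /setU1P[->|aK] /setU1P[->|bK] ne; rewrite ?eqxx // in ne *.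
    + by rewrite es comp // !inE eqxx orbT.
    + by rewrite comp // !inE eqxx orbT.
    exact: cK.
  - by rewrite cardsU1 nK ?inE ?eqxx ?orbT // add1n ltnW.
  exists d', w2; split.
  + by apply: contraTneq up => ->; rewrite /= !inE eqxx !orbT.
  + by rewrite (ipath_head ip) /= ?inE ?eqxx ?orbT //; apply: contraTneq up => ->; rewrite /= !inE eqxx !andbF.
  move=> a /setU1P[->|aK].
    split; first by rewrite (ipath_head ip) ?mem_head //= eqxx.
    by rewrite es; have := ipath_cons ip => /ipath_head ->; rewrite ?mem_head //= eqxx.
  by split; rewrite es comp // !inE eqxx ?orbT.
have w1K : w1 \notin K by apply: nK; rewrite !inE eqxx orbT.
rewrite cardsU1 w1K => le; have : #|w1 |: K| <= #|V| by apply: max_card.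
by rewrite cardsU1 w1K; move: le; clear; lia.
Qed.

(** Let [K] be a largest clique, with at least three vertices. By [no_diamond] a vertex outside has
    at most one neighbour in it, and every vertex of [K] has a neighbour outside, as [K] without
    that vertex is no cutset. A shortest link in [U :\: K] between the neighbours of [a] and of [b]
    closes up to a hole, in which a third vertex of [K] has the neighbours [a] and [b]. *)
Lemma triangle_free x y z : e x y -> e y z -> e x z -> False.
Proof.
move=> exy eyz exz.
have exK : exists K, clique e K /\ 2 < #|K|.
  exists (x |: [set y; z]); split.
    move=> u w; rewrite !inE => /or3P[]/eqP -> /or3P[]/eqP ->; rewrite ?eqxx //; by rewrite ?exy ?eyz ?exz // es ?exy ?eyz ?exz.
  by rewrite cardsU1 cards2 (neq_edge ei eyz) !inE negb_or (neq_edge ei exy) (neq_edge ei exz).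
have [K [[cK K2] Kmax]] := exists_min (fun K : {set V} => #|V| - #|K|) exK.
have one d u w : d \notin K -> u \in K -> w \in K -> e d u -> e d w -> u = w.
  move=> dK uK wK edu edw; apply/eqP; apply: contraT => uw.
  case: (pselect (exists2 v, v \in K & ~~ e d v)) => [[v vK ndv]|no].
    have vu : v != u by apply: contraNneq ndv => ->.
    have vw : v != w by apply: contraNneq ndv => ->.
    have dv : d != v by apply: contraNneq dK => ->.
    by move: ndv; rewrite (@no_diamond u w d v) // cK.
  have /Kmax : clique e (d |: K) /\ 2 < #|d |: K|.
    have H v : v \in K -> e d v by move=> vK; apply: contraT => ndv; case: no; exists v.
    split; last by rewrite cardsU1 dK add1n ltnW.
    move=> a b /setU1P[->|aK] /setU1P[->|bK] ne; rewrite ?eqxx // in ne *.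
    - exact: H.
    - by rewrite es H.
    exact: cK.
  have : #|d |: K| <= #|V| by apply: max_card.
  by rewrite cardsU1 dK; clear; lia.
have [w0 w0D] : exists w, w \in U :\: K.
  case: br => _ _ /(_ K (small cK))[b bB db].
  have [w wb] : exists w, w \in b by apply/set0Pn; case: br => /(_ b bB)[].
  by exists w; rewrite in_setD (disjointFr db wb) (subsetP (BU bB)).
have att u : u \in K -> exists2 w, w \in U :\: K & e u w.
  move=> uK; apply: contrapT => no.
  have cK' : clique e (K :\ u) by move=> a b /setD1P[_ aK] /setD1P[_ bK]; apply: cK.
  have uU : u \in U.
    have [u' /setD1P[u'u u'K]] : exists u', u' \in K :\ u.
      by apply/set0Pn; rewrite -card_gt0; have := cardsD1 u K; rewrite uK; move: K2; clear; lia.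
    by apply: (@eU u u'); apply: cK => //; rewrite eq_sym.
  have : U :\: (K :\ u) \subset [set u].
    apply: (conn_closed (no_clique_cut cK')).
      move=> a b; rewrite !inE => /eqP -> _ /andP[+ bU] eub; rewrite negb_and negbK => /orP[//|bK].
      by case: no; exists b; rewrite // in_setD bK.
    by exists u; rewrite !inE ?eqxx //= uU.
  move=> /subsetP/(_ w0); rewrite in_setD in_setD1 in_set1; case/setDP: w0D => w0U w0K.
  by rewrite negb_and w0K orbT w0U => /(_ isT) /eqP h; rewrite h uK in w0K.
have [a aK] : exists a, a \in K by apply/set0Pn; rewrite -card_gt0; apply: ltn_trans K2.
have [b /setD1P[ba bK]] : exists b, b \in K :\ a.
  by apply/set0Pn; rewrite -card_gt0; have := cardsD1 a K; rewrite aK; move: K2; clear; lia.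
have [c /setD1P[cb /setD1P[ca cK']]] : exists c, c \in K :\ a :\ b.
  apply/set0Pn; rewrite -card_gt0; have := cardsD1 a K; have := cardsD1 b (K :\ a).
  by rewrite aK in_setD1 ba bK; move: K2; clear; lia.
have [p [pN ip sp ga fb]] := conn_link (no_clique_cut cK) (att a aK) (att b bK).
have pK u : u \in p -> u \notin K by move=> /sp /setDP[].
have bp : b \notin p by apply/negP => /pK; rewrite bK.
have ap : a \notin p by apply/negP => /pK; rewrite aK.
have h : hole e (a :: rcons p b).
  rewrite /hole ipath_rcons //=; last first.
    by move=> u up; rewrite es fb // (last_nth b) (last_nth u); case: (p) pN.
  apply/and3P; split.
  - case: p pN ip sp ga fb pK {bp ap} => [|u [|w p]] //= _ _ _ ga fb pK; last by rewrite size_rcons.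
    have := ga u (mem_head _ _); have := fb u (mem_head _ _); rewrite /= !eqxx es => ebu; rewrite es => eau.
    by have := one u a b (pK u (mem_head _ _)) aK bK eau ebu => E; rewrite E eqxx in ba.
  - by rewrite mem_rcons inE negb_or eq_sym ba.
  rewrite last_rcons; apply/allP => u; rewrite mem_rcons inE => /predU1P[->|up].
    by rewrite eqxx orbT cK // eq_sym.
  rewrite ga //; have -> : (u == b) = false by apply: contraNF bp => /eqP <-.
  by rewrite orbF; case: (p) pN.
have cp : c \notin a :: rcons p b.
  by rewrite inE mem_rcons inE !negb_or ca cb; apply/negP => /pK; rewrite cK'.
have := T1 h cp (mem_head _ _) _ (cK _ _ cK' aK ca) (cK _ _ cK' bK cb).
by rewrite inE mem_rcons mem_head orbT => /(_ isT) E; rewrite E eqxx in ba.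
Qed.

End Minimal.
End Structure.

Lemma mem_last_nonempty (T : eqType) (x : T) s : s != [::] -> last x s \in s.
Proof. by case: s => //= a l _; apply: mem_last. Qed.

(** * Residual vertices: existence *)

Section Residual.
Variables (V : finType) (e : rel V).
Hypothesis es : symmetric e.
Hypothesis ei : irreflexive e.
Variables (B : {set {set V}}) (k : nat) (U : {set V}).
Hypothesis T1 : T1_free e.
Hypothesis br : bramble e B k.
Hypothesis BU : forall b, b \in B -> b \subset U.
Hypothesis eU : forall u w, e u w -> u \in U.
Hypothesis minU : forall A : {set V}, A \subset U -> bramble_in e A k -> A = U.
Hypothesis small : forall K, clique e K -> #|K| < k.
Hypothesis k3 : 3 < k.

Let eU' u w : e u w -> w \in U. Proof. by rewrite es => /eU. Qed.
Let tf := triangle_free es ei T1 br BU eU minU small.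
Let red := reduce_all es br BU minU.

Definition deg (x : V) := #|nbr e [set x]|.

Lemma deg_le (x : V) (A : {set V}) : (forall w, e x w -> w \in A) -> deg x <= #|A|.
Proof.
move=> H; apply: subset_leq_card; apply/subsetP => w /nbrP[z]; rewrite inE => /eqP ->.
exact: H.
Qed.

Lemma deg2 x a b : (forall w, e x w -> (w == a) || (w == b)) -> deg x <= 2.
Proof.
move=> H; apply: leq_trans (@deg_le x [set a; b] _) _; first by move=> w /H; rewrite !inE.
by rewrite cards2; case: (_ != _).
Qed.

Lemma nbr_seq (z s : V) (P : seq V) : z \in P -> e z s -> s \in nbr e [set z in P].
Proof. by move=> zP ezs; apply/nbrP; exists z; rewrite // inE. Qed.

Lemma nbr_sub (A A' : {set V}) s : A \subset A' -> s \in nbr e A -> s \in nbr e A'.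
Proof. by move=> sub /nbrP[z zA ezs]; apply/nbrP; exists z; rewrite // (subsetP sub). Qed.

Lemma ipath_deg P z w : ipath e P -> z \in P -> w \in P -> e z w ->
  exists s1 s2, P = s1 ++ z :: s2 /\ ((w == last z s1) || (w == head z s2)).
Proof.
move=> iP zP wP ezw; have [s1 [s2 E]] := mem_split zP; exists s1, s2; split => //.
move: wP iP; rewrite E mem_cat inE => /or3P[ws|/eqP wz|ws] iP.
- have [_ _ /(_ w z ws (mem_head _ _))] := (ipath_cat e _ _).1 iP.
  rewrite es ezw eqxx andbT => -[_ /esym/eqP ->].
  by case: (s1) ws => //= a l _; rewrite eqxx.
- by rewrite wz ei in ezw.
by move: (ipath_catr iP) => /ipath_head -/(_ w ws); rewrite ezw => /esym; by case: (s2) ws => //= a l _ ->; rewrite orbT.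
Qed.

(* A cycle through the whole path, [v], the outside and [s] would give [t] two neighbours. *)
Lemma no_spur x v s t p : ipath e (x :: p) -> e x v -> e x t -> e s t -> v != s -> v != t -> ~~ e v s ->
  (forall z, z \in x :: p -> e z s = (z == last x p)) ->
  (forall z, z \in x :: p -> e z v = (z == x)) ->
  (forall z w, z \in x :: p -> e z w -> w \in x :: p \/ [|| w == v, w == s | w == t]) ->
  v \notin x :: p -> s \notin x :: p -> t \notin x :: p -> False.
Proof.
move=> ip exv ext est vs vt nvs Hs Hv cl vp sp tp.
have cK : clique e [set x; t].
  by move=> a b; rewrite !inE => /orP[]/eqP -> /orP[]/eqP ->; rewrite ?eqxx // ?ext // es ext.
have cU := no_clique_cut es br BU eU minU small cK.
pose A := U :\: (t |: [set z in x :: p]).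
have AE z : (z \in A) = [&& z != t, z \notin x :: p & z \in U].
  by rewrite in_setD in_setU1 negb_or in_set andbA.
have vx : v != x by rewrite eq_sym (neq_edge ei exv).
have vU : v \in U := eU' exv.
have vA : v \in A by rewrite AE vt vp vU.
pose C := component e A v.
have CA z : z \in C -> z \in A by move=> zC; apply: (subsetP (comp_sub e A v)).
have sC : s \in C.
  apply: contraT => nsC.
  have : U :\: [set x; t] \subset C.
    apply: (conn_closed cU); last by exists v; [rewrite !inE negb_or vx vt vU|apply: comp_in].
    move=> u w uC _ /setDP[wU]; rewrite in_set2 negb_or => /andP[wx wt] euw.
    case: (boolP (w \in A)) => [wA|]; first exact: (comp_closed uC wA euw).
    rewrite AE wt wU andbT /= negbK => wp.
    have := CA _ uC; rewrite AE => /and3P[ut up uU].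
    rewrite es in euw; case: (cl _ _ wp euw) => [|/or3P[]/eqP E]; first by rewrite (negbTE up).
    - by move: euw; rewrite E Hv // (negbTE wx).
    - by rewrite -E uC in nsC.
    by rewrite E eqxx in ut.
  have sx : s != x by apply: contraNneq sp => ->; apply: mem_head.
  have sU : s \in U :\: [set x; t] by rewrite !inE negb_or sx (neq_edge ei est) (eU est).
  by move=> /subsetP/(_ s sU); rewrite (negbTE nsC).
have cC : conn e C by apply: comp_conn.
have [r [ir lr sr]] := conn_ipath cC (comp_in e vA) sC.
case/lastP: r ir lr sr => [|r s'] ir lr sr; first by move: vs; rewrite -lr eqxx.
rewrite last_rcons in lr; subst s'.
have rC w : w \in r -> w \in C /\ w != s.
  move=> wr; split; first by apply: sr; rewrite inE mem_rcons inE wr !orbT.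
  apply: contraTneq (ipath_uniq ir) => ws; rewrite /= rcons_uniq -ws wr andbF //.
have rv w : w \in r -> w != v.
  move=> wr; apply: contraTneq (ipath_uniq ir) => wv; by rewrite /= mem_rcons inE -wv wr orbT.
have ip' : ipath e (v :: rcons (x :: p) s).
  have i1 : ipath e (rcons (x :: p) s) by apply: ipath_rcons => // u up; apply: Hs.
  rewrite /ipath /= -/(ipath e) -/(ipath e (rcons (x :: p) s)).
  apply/and3P; split => //.
    by move: vp; rewrite !inE mem_rcons inE !negb_or => /andP[-> ->]; rewrite vs.
  rewrite es exv; apply/allP => z; rewrite mem_rcons inE => /predU1P[->//|zp].
  rewrite es Hv ?inE ?zp ?orbT //; apply: contraTneq (ipath_uniq ip) => <-; by rewrite /= zp.
have h := hole_two_paths es ip' ir nvs _.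
have {}h : hole e (v :: (x :: p) ++ s :: rev r).
  apply: h => u w up wr; have [wC ws] := rC w wr; have := CA _ wC; rewrite AE => /and3P[wt wp _].
  split; first by apply: contraNneq wp => <-.
  apply/negP => euw; case: (cl _ _ up euw) => [|/or3P[]]; first by rewrite (negbTE wp).
  - by rewrite (negbTE (rv w wr)).
  - by rewrite (negbTE ws).
  by rewrite (negbTE wt).
have th : t \notin v :: (x :: p) ++ s :: rev r.
  apply/negP; rewrite inE mem_cat (in_cons s) mem_rev => /or4P[/eqP E|h'|/eqP E|/rC[/CA]].
  - by rewrite E eqxx in vt.
  - by rewrite h' in tp.
  - by move: est; rewrite E ei.
  by rewrite AE eqxx.
have E : x = s.
  apply: (T1 h th); rewrite ?inE ?mem_cat ?inE ?eqxx ?orbT //; by rewrite es.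
by move: sp; rewrite -E mem_head.
Qed.

(* [x] has degree three and starts three paths of degree-two vertices: a trivial
   one to [v] and two nontrivial ones to the adjacent vertices [s] and [t]. *)
Definition residual x v s t (p q : seq V) : Prop :=
  [/\ [/\ ipath e (x :: rcons p s), ipath e (x :: rcons q t), p != [::], q != [::] &
        forall u w, u \in p -> w \in q -> u != w /\ ~~ e u w],
      [/\ e x v, e s t, v != s & v != t],
      [/\ v \notin x :: p ++ q, s \notin x :: p ++ q & t \notin x :: p ++ q],
      forall z w, z \in x :: p ++ q -> e z w -> w \in x :: p ++ q \/
        [|| (z == x) && (w == v), (z == last x p) && (w == s) | (z == last x q) && (w == t)] &
      exists2 b, b \in B & [disjoint b & [set v; s; t] :|: [set z in x :: p ++ q]]].

Lemma residual_sym x v s t p q : residual x v s t p q -> residual x v t s q p.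
Proof.
have E z : (z \in x :: q ++ p) = (z \in x :: p ++ q) by rewrite !inE !mem_cat orbCA orbC -orbA orbC.
case=> [[ip iq pN qN pq] [xv st vs vt] [vX sX tX] cl [b bB db]].
split => //.
- split => // u w uq wp; have [ne nuw] := pq w u wp uq; by rewrite eq_sym es.
- by split; rewrite // es.
- by rewrite !E.
- move=> z w; rewrite !E => zX ezw; case: (cl z w zX ezw) => [->|/or3P[]->]; by [left|right; rewrite ?orbT].
exists b => //; rewrite (_ : [set v; t; s] :|: _ = [set v; s; t] :|: [set z in x :: p ++ q]) //.
by apply/setP => z; rewrite !in_setU !in_set1 !in_set E; congr (_ || _); rewrite -!orbA; congr (_ || _); rewrite orbC.
Qed.

Section Facts.
Variables (x v s t : V) (p q : seq V).
Hypothesis R : residual x v s t p q.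

Lemma residual_deg z : z \in p -> deg z <= 2.
Proof.
case: R => [[ip iq pN qN pq] [xv st vs vt] [vX sX tX] cl _] zp.
have zx : z != x.
  by apply: contraTneq (ipath_uniq ip) => <-; rewrite /= mem_rcons inE zp orbT.
have zX : z \in x :: p ++ q by rewrite inE mem_cat zp orbT.
have N w : e z w -> w \in x :: rcons p s.
  move=> ezw; rewrite inE mem_rcons inE; case: (cl z w zX ezw) => [|/or3P[]/andP[]].
  - rewrite inE mem_cat => /or3P[->//|->|wq]; rewrite ?orbT //.
    by have [_] := pq z w zp wq; rewrite ezw.
  - by rewrite (negbTE zx).
  - by move=> _ ->; rewrite orbT.
  move=> /eqP zq _; case: (q) qN pq zq => // y q' _ pq' /= zq.
  by have [+ _] := pq' z (last y q') zp (mem_last _ _); rewrite zq eqxx.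
have zP : z \in x :: rcons p s by rewrite inE mem_rcons inE zp !orbT.
have [s1 [s2 E]] := mem_split zP.
apply: (@deg2 _ (last z s1) (head z s2)) => w ezw.
have [s1' [s2' [E' H]]] := ipath_deg ip zP (N w ezw) ezw.
have u := ipath_uniq ip.
have : s1 = s1' /\ s2 = s2'.
  have i1 : index z (x :: rcons p s) = size s1.
    have := u; rewrite E cat_uniq index_cat /= negb_or => /and3P[_ /andP[/negbTE -> _] _].
    by rewrite eqxx addn0.
  have i2 : index z (x :: rcons p s) = size s1'.
    have := u; rewrite E' cat_uniq index_cat /= negb_or => /and3P[_ /andP[/negbTE -> _] _].
    by rewrite eqxx addn0.
  have E2 : s1 ++ z :: s2 = s1' ++ z :: s2' by rewrite -E.
  move: E2 => /eqP; rewrite eqseq_cat -?i1 // => /andP[/eqP -> /eqP[->]] //.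
by case=> -> ->.
Qed.

Lemma residual_nbr w : e x w -> w \in [set v; head x p; head x q].
Proof.
case: R => [[ip iq pN qN pq] [xv st vs vt] [vX sX tX] cl _] exw.
have last_neq r y : ipath e (x :: rcons r y) -> r != [::] -> x == last x r = false.
  move=> ir rN; apply: contraTF (ipath_uniq ir) => /eqP xr; rewrite /= mem_rcons inE negb_and negb_or.
  have -> : x \in r by rewrite xr mem_last_nonempty.
  by rewrite andbF.
have hd r y : ipath e (x :: rcons r y) -> r != [::] -> w \in r -> w == head x r.
  move=> ir rN wr; have := ipath_head ir (z := w); rewrite mem_rcons inE wr orbT exw => /(_ isT).
  by case: (r) rN => //= a l _ /esym.
case: (cl x w (mem_head _ _) exw) => [|/or3P[]/andP[]].
- rewrite !inE mem_cat => /or3P[/eqP wx|wp|wq]; first by rewrite wx ei in exw.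
    by rewrite (hd _ _ ip pN wp) orbT.
  by rewrite (hd _ _ iq qN wq) orbT.
- by move=> _ /eqP ->; rewrite !inE eqxx.
- by rewrite (last_neq _ _ ip pN).
by rewrite (last_neq _ _ iq qN).
Qed.

End Facts.

Lemma last_cons_uniq (x : V) p : uniq (x :: p) -> x = last x p -> p = [::].
Proof. by case: p => //= y p /andP[+ _] E; rewrite E mem_last. Qed.

Section Exists.
Variables (X K b0 : {set V}) (x v : V).
Hypothesis cX : conn e X.
Hypothesis xX : x \in X.
Hypothesis vX : v \notin X.
Hypothesis cK : clique e K.
Hypothesis dXK : forall z, z \in X -> z \notin K.
Hypothesis clX : forall u w, u \in X -> e u w -> [|| w \in X, w == v | w \in K].
Hypothesis b0B : b0 \in B.
Hypothesis db0 : forall z, z \in b0 -> [/\ z \notin X, z != v & z \notin K].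
Hypothesis XU : X \subset U.
Hypothesis xv : e x v.
Hypothesis dx : 2 < deg x.

(** [X] is pushed with the attachments in [v |: K] as [S]. An attachment in [K] that is adjacent to
    [v] causes no trouble; any other must be adjacent to [Z]. *)
Let min (Z : {set V}) : Z \subset X -> conn e (v |: Z) ->
  (forall s, s \in K -> s != v -> s \in nbr e X -> e s v || (s \in nbr e Z)) -> X \subset Z.
Proof.
move=> ZX cZ H; apply: (@red X ((v |: K) :&: nbr e X) Z b0 v) => //.
- move=> u w uX euw; rewrite in_setU in_setI in_setU1.
  have -> : w \in nbr e X by apply/nbrP; exists u.
  by rewrite andbT; apply: clX euw.
- rewrite disjoints_subset; apply/subsetP => z zX; rewrite inE in_setI in_setU1 (negbTE (dXK zX)) orbF.
  by apply/negP => /andP[/eqP zv _]; move: vX; rewrite -zv zX.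
- rewrite disjoints_subset; apply/subsetP => z /db0[zX zv zK].
  by rewrite inE in_setU in_setI in_setU1 (negbTE zX) (negbTE zv) (negbTE zK).
move=> s s' /setIP[/setU1P[->|sK] sN] /setIP[/setU1P[->|s'K] s'N] ne; rewrite ?eqxx // in ne *.
- have s'v : s' != v by rewrite eq_sym.
  by case/orP: (H s' s'K s'v s'N) => h; [rewrite es h|rewrite h orbT].
- by case/orP: (H s sK ne sN) => [->//|->]; rewrite !orbT.
by rewrite cK.
Qed.

Let head_nbr p' y w : ipath e (x :: p') -> w \in p' -> e x w -> w == head y p'.
Proof.
move=> ip wp; rewrite (ipath_head ip wp) => /eqP {1}->.
by case: p' wp {ip}.
Qed.

Let connv y p : ipath e (y :: p) -> e v y -> conn e (v |: [set z in y :: p]).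
Proof.
move=> ip evy; apply: connU => //; [exact: conn1|exact: ipath_conn|].
by exists v, y; rewrite !inE !eqxx evy orbT.
Qed.

(** With a single attachment [s] not adjacent to [v], minimality makes [X] an induced path from [v]
    to [s]. Its first vertex is [x], which then has degree at most two. *)
Let one_foot s : s \in K -> s != v -> s \in nbr e X ->
  (forall s', s' \in K -> s' != v -> s' \in nbr e X -> s' != s -> e s' v) -> ~~ e s v -> False.
Proof.
move=> sK sv /nbrP[y yX eys] H nsv.
have [||[|p1 p] [//= _ ip sp gp fp]] := conn_link cX (g := e v) (f := e s).
- by exists x; rewrite // es.
- by exists y; rewrite // es.
have evp1 : e v p1 by rewrite gp ?mem_head.
have sub : X \subset [set z in p1 :: p].
  apply: min; [by apply/subsetP => z; rewrite inE => /sp|exact: connv|].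
  move=> s' s'K s'v s'X; case: (s' =P s) => [->|/eqP ne]; last by rewrite H.
  by apply/orP; right; apply: (nbr_seq (mem_last p1 p)); rewrite es fp ?mem_last.
have xp1 : x = p1.
  have xin : x \in p1 :: p by have := subsetP sub x xX; rewrite inE.
  by have := gp x xin; rewrite es xv => /esym/eqP.
subst p1; move: dx; rewrite ltnNge (@deg2 x v (head s p)) // => w exw.
case/or3P: (clX xX exw) => [wX|->//|wK].
  have := subsetP sub w wX; rewrite inE inE => /predU1P[wx|wp]; first by rewrite wx ei in exw.
  by rewrite (head_nbr s ip wp exw) orbT.
case: (w =P v) => //= /eqP wv; case: (w =P s) => [ws|/eqP ws].
  subst w; have := fp x (mem_head _ _); rewrite es exw => /esym/eqP/= xl.
  by rewrite (last_cons_uniq (ipath_uniq ip) xl) eqxx.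
have wX : w \in nbr e X by apply/nbrP; exists x.
have ewv := H w wK wv wX ws; rewrite es in ewv.
by case: (tf xv ewv exw).
Qed.

(** [K] contains two attachments [s], [t] not adjacent to [v], and nothing else, as there are no
    triangles. By minimality no proper subset of [X] connects [v] to both, so [X] is a path from [v]
    to [s] plus a path towards [t]. As [x] has degree at least three and is adjacent to [v], the two
    paths part exactly at [x]; other shapes contradict the degree, triangle-freeness or
    [no_spur]. *)
Lemma residual_exists : exists s t p q, residual x v s t p q.
Proof.
have [s [sK sv sX nsv]] : exists s, [/\ s \in K, s != v, s \in nbr e X & ~~ e s v].
  apply: contrapT => no; have /subsetP/(_ x xX) : X \subset set0; last by rewrite inE.
  apply: min; [exact: sub0set|rewrite setU0; exact: conn1|].
  move=> s sK sv sX; apply/orP; left; apply: contraT => nsv; case: no; by exists s.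
have [t [tK tv tX [nts ntv]]] : exists t, [/\ t \in K, t != v, t \in nbr e X & t != s /\ ~~ e t v].
  apply: contrapT => no; apply: (one_foot sK sv sX) => // t tK tv tX nts; apply: contraT => ntv.
  by case: no; exists t.
have st : e s t by apply: cK => //; rewrite eq_sym.
have Kst u : u \in K -> (u == s) || (u == t).
  move=> uK; apply: contraT; rewrite negb_or => /andP[us ut].
  by case: (@tf u s t) => //; apply: cK.
have cl u w : u \in X -> e u w -> [|| w \in X, w == v, w == s | w == t].
  by move=> uX euw; case/or3P: (clX uX euw) => [->|->|/Kst ->]; rewrite ?orbT.
have sX' : s \notin X by apply: contraL sK; apply: dXK.
have tX' : t \notin X by apply: contraL tK; apply: dXK.
have vs : v != s by rewrite eq_sym.
have vt : v != t by rewrite eq_sym.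
have nvs : ~~ e v s by rewrite es.
have nvt : ~~ e v t by rewrite es.
have minst (Z : {set V}) : Z \subset X -> conn e (v |: Z) -> s \in nbr e Z -> t \in nbr e Z -> X \subset Z.
  by move=> ZX cZ sZ tZ; apply: min => // u /Kst /orP[]/eqP -> _ _; rewrite ?sZ ?tZ orbT.
have [||[|p1 p] [//= _ ip sp gp fp]] := conn_link cX (g := e v) (f := e s).
- by exists x; rewrite // es.
- by case/nbrP: sX => y yX eys; exists y; rewrite // es.
have evp1 : e v p1 by rewrite gp ?mem_head.
have pX : [set z in p1 :: p] \subset X by apply/subsetP => z; rewrite inE => /sp.
have sP : s \in nbr e [set z in p1 :: p].
  by apply: (nbr_seq (mem_last p1 p)); rewrite es fp ?mem_last.
have xhead : x \in p1 :: p -> x = p1.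
  by move=> xp; have := gp x xp; rewrite es xv => /esym/eqP.
have up := ipath_uniq ip.
have xs : e x s -> x = p1 -> p = [::].
  move=> exs xp1; subst p1; have := fp x (mem_head _ _); rewrite es exs => /esym/eqP/= xl.
  exact: last_cons_uniq xl.
(* If [t] is attached to the path towards [s], this path is all of [X] and [x] is its first vertex.
   Then [x] is adjacent to [t], by its degree, and [no_spur] applies. *)
case htp : (has (e t) (p1 :: p)).
  have sub : X \subset [set z in p1 :: p].
    apply: minst => //; first exact: connv.
    by case/hasP: htp => z zp etz; apply: (nbr_seq zp); rewrite es.
  have xp1 : x = p1 by apply: xhead; have := subsetP sub x xX; rewrite inE.
  subst p1; case ext : (e x t).
    case: (@no_spur x v s t p) => //.
    - by move=> z zp; rewrite es fp.
    - by move=> z zp; rewrite es gp.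
    - move=> z w zp ezw; case/orP: (cl _ _ (sp z zp) ezw) => [wX|]; [left|by right].
      by have := subsetP sub w wX; rewrite inE.
    - by apply: contra vX => /sp.
    - by apply: contra sX' => /sp.
    by apply: contra tX' => /sp.
  move: dx; rewrite ltnNge (@deg2 x v (head s p)) // => w exw.
  case/or4P: (cl _ _ xX exw) => [wX|->//|/eqP ws|/eqP wt].
  - have := subsetP sub w wX; rewrite inE inE => /predU1P[wx|wp]; first by rewrite wx ei in exw.
    by rewrite (head_nbr s ip wp exw) orbT.
  - by rewrite ws in exw *; rewrite (xs exw erefl) eqxx orbT.
  by rewrite wt ext in exw.
have ntp z : z \in p1 :: p -> ~~ e t z.
  by move=> zp; apply/negP => etz; move/negP: htp; apply; apply/hasP; exists z.
(* The second path starts at the last vertex having contact with [v] or with the first path, so only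
   its first vertex [q1] has such contact. *)
pose g := [pred z | [|| z \in p1 :: p, e v z | has (e z) (p1 :: p)]].
have [||[|q1 q] [//= _ iq sq gq fq]] := conn_link cX (g := g) (f := e t).
- by exists p1; rewrite ?sp ?mem_head //= mem_head.
- by case/nbrP: tX => y yX eys; exists y; rewrite // es.
have {}gq z : z \in q1 :: q -> g z = (z == q1) := gq z.
have uq := ipath_uniq iq.
have gq1 : g q1 by rewrite gq ?mem_head.
have ngq z : z \in q -> ~~ g z.
  move=> zq; rewrite gq ?inE ?zq ?orbT //; apply: contraTneq uq => /= <-; by rewrite zq.
have q1p : q1 \notin p1 :: p.
  apply/negP => q1p; case: (q) iq gq fq ngq => [|q2 q'] iq gq fq ngq.
    by move: (fq q1 (mem_head _ _)); rewrite /= eqxx (negbTE (ntp _ q1p)).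
  have /negP := ngq q2 (mem_head _ _); apply; apply/or3P; constructor 3; apply/hasP; exists q1 => //.
  by rewrite es (ipath_head iq) ?mem_head //= eqxx.
have qp z : z \in q1 :: q -> z \notin p1 :: p.
  by rewrite inE => /predU1P[->//|/ngq]; apply: contra => zp; rewrite /= zp.
have qX : [set z in q1 :: q] \subset X by apply/subsetP => z; rewrite inE => /sq.
have tQ (Z : {set V}) : [set z in q1 :: q] \subset Z -> t \in nbr e Z.
  move=> sub; apply: (nbr_sub sub); by apply: (nbr_seq (mem_last q1 q)); rewrite es fq ?mem_last.
have sub : X \subset [set z in p1 :: p] :|: [set z in q1 :: q].
  apply: minst.
  - by rewrite subUset pX qX.
  - rewrite setUA; apply: connU => //; [exact: connv|exact: ipath_conn|].
    case/or3P: gq1 => [|evq|/hasP[z zp eqz]]; first by rewrite (negbTE q1p).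
      by exists v, q1; rewrite setU11 evq orbT inE mem_head.
    by exists z, q1; rewrite es eqz orbT in_setU1 [z \in [set _ in _]]inE zp orbT inE mem_head.
  - by apply: (nbr_sub _ sP); apply: subsetUl.
  by apply: tQ; apply: subsetUr.
have inX z : z \in X -> z \in p1 :: p \/ z \in q1 :: q.
  by move=> /(subsetP sub); rewrite in_setU ![z \in [set _ in _]]inE => /orP[]; [left|right].
have nvq z : z \in q -> ~~ e v z by move=> /ngq; apply: contra => h; rewrite /= h orbT.
have npq z w : z \in q -> w \in p1 :: p -> ~~ e z w.
  by move=> /ngq h wp; apply: contra h => ezw; apply/or3P; constructor 3; apply/hasP; exists w.
have p1Q : p1 \notin q1 :: q by apply/negP => /qp; rewrite mem_head.
(* If both paths start next to [v], then [x] is the first vertex of one of them and has no third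
   neighbour. *)
case evq1 : (e v q1).
  case: (inX x xX) => [xp|xq].
    have xp1 := xhead xp; subst p1.
    move: dx; rewrite ltnNge (@deg2 x v (head s p)) // => w exw.
    case/or4P: (cl _ _ xX exw) => [wX|->//|/eqP ws|/eqP wt].
    - case: (inX w wX) => [|]; rewrite inE => /predU1P[E|wp].
      + by rewrite E ei in exw.
      + by rewrite (head_nbr s ip wp exw) orbT.
      + by subst w; case: (tf xv evq1 exw).
      by have := npq w x wp (mem_head _ _); rewrite es exw.
    - by rewrite ws in exw *; rewrite (xs exw erefl) eqxx orbT.
    by have := ntp x (mem_head _ _); rewrite es -wt exw.
  have xq1 : x = q1.
    move: xq; rewrite inE => /predU1P[//|/nvq]; by rewrite es xv.
  subst q1.
  have nop w : w \in p1 :: p -> ~~ e x w.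
    rewrite inE => /predU1P[->|wp]; apply/negP => exw; first exact: (tf xv evp1 exw).
    have pN : p != [::] by case: (p) wp.
    have iP : ipath e p := ipath_cons ip.
    have /subsetP/(_ p1 (sp _ (mem_head _ _))) : X \subset [set z in x :: q] :|: [set z in p].
      apply: minst.
      - rewrite subUset qX; apply/subsetP => z; rewrite inE => zp; apply: sp; by rewrite inE zp orbT.
      - rewrite setUA; apply: connU => //; [by apply: connv|exact: ipath_conn|].
        by exists x, w; rewrite exw orbT in_setU1 [x \in [set _ in _]]inE mem_head orbT inE wp.
      - apply: (nbr_sub (subsetUr _ _)); apply: (nbr_seq (mem_last_nonempty p1 pN)).
        by rewrite es fp ?mem_last.
      by apply: tQ; apply: subsetUl.
    rewrite in_setU ![p1 \in [set _ in _]]inE (negbTE p1Q) /= => h.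
    by move: up; rewrite /= h.
  case exs : (e x s).
    have /subsetP/(_ p1 (sp _ (mem_head _ _))) : X \subset [set z in x :: q].
      apply: minst => //; [exact: connv| |exact: tQ].
      exact: (nbr_seq (mem_head x q)).
    by rewrite inE (negbTE p1Q).
  move: dx; rewrite ltnNge (@deg2 x v (head t q)) // => w exw.
  case/or4P: (cl _ _ xX exw) => [wX|->//|/eqP ws|/eqP wt].
  - case: (inX w wX) => [wp|]; first by have := nop w wp; rewrite exw.
    rewrite inE => /predU1P[E|wp]; first by rewrite E ei in exw.
    by rewrite (head_nbr t iq wp exw) orbT.
  - by rewrite ws exs in exw.
  have := fq x (mem_head _ _); rewrite es -wt exw => /esym/eqP/= xl.
  by rewrite (last_cons_uniq uq xl) wt eqxx orbT.
have nvq' z : z \in q1 :: q -> ~~ e v z by rewrite inE => /predU1P[->|/nvq//]; rewrite evq1.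
have xp : x \in p1 :: p by case: (inX x xX) => // /nvq'; rewrite es xv.
have xp1 := xhead xp; subst p1.
(* Otherwise the neighbours of [x] are [v] and one vertex towards [s], too few for its degree. *)
have exq1 : e x q1.
  apply: contraT => nxq1.
  move: dx; rewrite ltnNge (@deg2 x v (head s p)) // => w exw.
  case/or4P: (cl _ _ xX exw) => [wX|->//|/eqP ws|/eqP wt].
  - case: (inX w wX) => [|]; rewrite inE => /predU1P[E|wp].
    + by rewrite E ei in exw.
    + by rewrite (head_nbr s ip wp exw) orbT.
    + by rewrite E (negbTE nxq1) in exw.
    by have := npq w x wp (mem_head _ _); rewrite es exw.
  - by rewrite ws in exw *; rewrite (xs exw erefl) eqxx orbT.
  by have := ntp x (mem_head _ _); rewrite es -wt exw.
have ixq : ipath e (x :: q1 :: q).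
  change (is_true [&& x \notin q1 :: q, e x q1 && all (fun z => ~~ e x z) q & ipath e (q1 :: q)]).
  rewrite iq exq1 p1Q andbT; apply/allP => z zq; have := npq z x zq (mem_head _ _); by rewrite es.
have cxq : conn e (v |: [set z in x :: q1 :: q]) by apply: connv.
have xqX : [set z in x :: q1 :: q] \subset X.
  by apply/subsetP => z; rewrite inE inE => /predU1P[->//|]; apply: sq.
have tXQ : t \in nbr e [set z in x :: q1 :: q].
  by apply: tQ; apply/subsetP => z; rewrite !inE => ->; rewrite orbT.
have fxq z : z \in x :: q1 :: q -> e z t = (z == last x (q1 :: q)).
  rewrite inE => /predU1P[->|zq]; last by rewrite es fq.
  rewrite es (negbTE (ntp x xp)); apply/esym/negbTE/negP => /eqP xl.
  case/negP: p1Q; rewrite {1}xl /=; exact: mem_last.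
have pN : p != [::].
  apply/eqP => p0; subst p.
  have exs : e x s by have := fp x (mem_head _ _); rewrite /= eqxx es.
  have subq : X \subset [set z in x :: q1 :: q].
    by apply: minst => //; apply: (nbr_seq (mem_head x _)).
  case: (@no_spur x v t s (q1 :: q)) => //.
  - by rewrite es.
  - move=> z; rewrite inE => /predU1P[->|zq]; first by rewrite xv eqxx.
    rewrite es (negbTE (nvq' z zq)); apply/esym/negbTE; by apply: contraNneq p1Q => <-.
  - move=> z w zq ezw; have zX : z \in X by apply: (subsetP xqX); rewrite inE.
    case/or4P: (cl _ _ zX ezw) => [wX|->|->|->]; rewrite ?orbT; [left|by right..].
    by have := subsetP subq w wX; rewrite inE.
  - by apply: contra vX => h; apply: (subsetP xqX); rewrite inE.
  - by apply: contra tX' => h; apply: (subsetP xqX); rewrite inE.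
  by apply: contra sX' => h; apply: (subsetP xqX); rewrite inE.
have [a [p' Ep]] : exists a p', p = a :: p' by case: (p) pN => // a p' _; exists a, p'.
have ax : a != x by apply: contraTneq up => E; rewrite Ep E /= mem_head.
have aP : a \in x :: p by rewrite Ep !inE eqxx orbT.
have nsq z : z \in q1 :: q -> ~~ e s z.
  move=> zq; apply/negP => esz.
  have /subsetP/(_ a (sp _ aP)) : X \subset [set z in x :: q1 :: q].
    by apply: minst => //; apply: (@nbr_seq z); rewrite 1?es // inE zq orbT.
  rewrite inE inE (negbTE ax) /= => /qp; by rewrite aP.
have nq w : w \in p -> ~~ e q1 w.
  move=> wp; apply/negP => eqw; have [s1 [s2 E]] := mem_split wp.
  have ip2 : ipath e (w :: s2) by have := ipath_cons ip; rewrite E => /ipath_catr.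
  have sub2 : X \subset [set z in x :: q1 :: q] :|: [set z in w :: s2].
    apply: minst.
    - rewrite subUset xqX; apply/subsetP => z; rewrite inE => zs; apply: sp.
      by rewrite inE E mem_cat zs !orbT.
    - rewrite setUA; apply: connU => //; first exact: ipath_conn.
      by exists q1, w; rewrite eqw orbT in_setU1 [q1 \in [set _ in _]]inE !inE !eqxx !orbT.
    - apply: (nbr_sub (subsetUr _ _)); apply: (nbr_seq (mem_last w s2)).
      rewrite es fp; last by rewrite inE E mem_cat mem_last !orbT.
      by rewrite E last_cat.
    by apply: tQ; apply/subsetP => z; rewrite !inE => ->; rewrite !orbT.
  case: s1 E => [|c s1] E.
    have exw : e x w by rewrite (ipath_head ip) // E /= eqxx.
    exact: (tf exq1 eqw exw).
  have cP : c \in x :: p by rewrite E !inE eqxx orbT.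
  have := subsetP sub2 c (sp _ cP); rewrite in_setU ![c \in [set _ in _]]inE inE => /orP[/orP[/eqP cx|/qp]|cs].
  - by move: up; rewrite E /= cx mem_head.
  - by rewrite cP.
  by move: up; rewrite E /= mem_cat cs orbT andbF.
have XE z : z \in X -> z \in x :: p ++ (q1 :: q).
  by move=> /inX[]; rewrite -cat_cons mem_cat => ->; rewrite ?orbT.
have EX z : z \in x :: p ++ (q1 :: q) -> z \in X.
  by rewrite -cat_cons mem_cat => /orP[/sp|/sq].
exists s, t, p, (q1 :: q); split.
- split => //.
  + by rewrite -rcons_cons; apply: ipath_rcons => //; [apply: contra sX' => /sp|move=> u up'; rewrite es fp].
  + rewrite -rcons_cons; apply: ipath_rcons => //; apply: contra tX' => h; apply: (subsetP xqX); by rewrite inE.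
  move=> u w up' wq; have uP : u \in x :: p by rewrite inE up' orbT.
  split; first by apply: contraNneq (qp w wq) => <-.
  by move: wq; rewrite inE es => /predU1P[->|wq]; [apply: nq|apply: npq].
- by [].
- by split; [apply: contra vX|apply: contra sX'|apply: contra tX'] => /EX.
- move=> z w /EX zX ezw; case/or4P: (cl _ _ zX ezw) => [/XE|/eqP wv|/eqP ws|/eqP wt]; [by left|right..].
  + subst w; case: (inX z zX) => [zp|/nvq']; last by rewrite es ezw.
    by have := gp z zp; rewrite es ezw => /esym zl; rewrite zl eqxx.
  + subst w; case: (inX z zX) => [zp|/nsq]; last by rewrite es ezw.
    by have := fp z zp; rewrite es ezw => /esym zl; rewrite zl eqxx orbT.
  subst w; case: (inX z zX) => [/ntp|zq]; first by rewrite es ezw.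
  by have := fq z zq; rewrite es ezw => /esym zl; rewrite [last x (q1 :: q)]/= zl eqxx !orbT.
exists b0 => //; rewrite disjoints_subset; apply/subsetP => z /db0[zX zv zK].
have zn : z \notin x :: p ++ (q1 :: q) by apply: contra zX => /EX.
have zs : z != s by apply: contraNneq zK => ->.
have zt : z != t by apply: contraNneq zK => ->.
by rewrite in_setC !in_setU !in_set1 in_set negb_or zn andbT !negb_or zv zs zt.
Qed.

End Exists.
End Residual.

(** * Residual vertices: the matching and disjointness *)

Section Contract.
Variables (V : finType) (e : rel V).
Hypothesis es : symmetric e.
Hypothesis ei : irreflexive e.
Variables (B : {set {set V}}) (k : nat) (U : {set V}).
Hypothesis T1 : T1_free e.
Hypothesis br : bramble e B k.
Hypothesis BU : forall b, b \in B -> b \subset U.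
Hypothesis eU : forall u w, e u w -> u \in U.
Hypothesis minU : forall A : {set V}, A \subset U -> bramble_in e A k -> A = U.
Hypothesis small : forall K, clique e K -> #|K| < k.
Hypothesis k3 : 3 < k.

Let eU' u w : e u w -> w \in U. Proof. by rewrite es => /eU. Qed.
Let tf := triangle_free es ei T1 br BU eU minU small.
Let red := reduce_all es br BU minU.
Let res := residual e B.
Let deg := deg e.

Lemma clique_le2 K : clique e K -> #|K| <= 2.
Proof.
move=> cK; rewrite leqNgt; apply/negP => K2.
have [a aK] : exists a, a \in K by apply/set0Pn; rewrite -card_gt0; apply: ltn_trans K2.
have [b /setD1P[ba bK]] : exists b, b \in K :\ a.
  by apply/set0Pn; rewrite -card_gt0; have := cardsD1 a K; rewrite aK; move: K2; clear; lia.
have [c /setD1P[cb /setD1P[ca cK']]] : exists c, c \in K :\ a :\ b.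
  apply/set0Pn; rewrite -card_gt0; have := cardsD1 a K; have := cardsD1 b (K :\ a).
  by rewrite aK in_setD1 ba bK; move: K2; clear; lia.
by apply: (@tf a b c); apply: cK; rewrite // eq_sym.
Qed.

Definition is_residual x := 2 < deg x /\ exists v s t p q, res x v s t p q.

Let half (K C b0 : {set V}) v x : clique e K -> C = component e (U :\: (v |: K)) x ->
  x \in U :\: (v |: K) -> b0 \in B -> [disjoint b0 & v |: K] -> [disjoint b0 & C] ->
  e x v -> 2 < deg x -> is_residual x.
Proof.
move=> cK EC xA b0B dK dC exv dx; split => //; subst C.
set A := U :\: (v |: K) in xA dC *.
have CA z : z \in component e A x -> z \in A by apply: (subsetP (comp_sub e A x)).
have inA z : (z \in A) = [&& z != v, z \notin K & z \in U].
  by rewrite in_setD in_setU1 negb_or andbA.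
exists v; apply: (@residual_exists V e es ei B k U T1 br BU eU minU small (component e A x) K b0 x v) => //.
- exact: comp_conn.
- exact: comp_in.
- by apply/negP => /CA; rewrite inA eqxx.
- by move=> z /CA; rewrite inA => /and3P[].
- move=> u w uC euw; case: (boolP (w \in A)) => wA.
    by have -> : w \in component e A x by exact: (comp_closed uC wA euw).
  move: wA; rewrite inA (eU' euw) andbT negb_and !negbK => /orP[->|->]; by rewrite ?orbT.
- move=> z zb; split; first by rewrite (disjointFr dC zb).
    by apply: contraFneq (disjointFr dK zb) => ->; apply: setU11.
  by apply: contraFN (disjointFr dK zb) => zK; rewrite in_setU1 zK orbT.
by apply/subsetP => z /CA; rewrite inA => /and3P[].
Qed.

(** By T1-freeness no hole avoiding [v] contains both [x] and [y], so a clique [K] separates them in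
    [U :\ v]. As [v |: K] has at most three vertices, a member of the bramble avoids it. This member
    misses the component of [x] or that of [y], and [residual_exists] applies to that component. *)
Lemma bad_triple v x y : e v x -> e v y -> x != y -> 2 < deg x -> 2 < deg y -> is_residual x \/ is_residual y.
Proof.
move=> evx evy xy dx dy.
have nxy : ~~ e x y by apply/negP => exy; apply: (@tf v x y).
have xA : x \in U :\ v by rewrite in_setD1 eq_sym (neq_edge ei evx) (eU' evx).
have yA : y \in U :\ v by rewrite in_setD1 eq_sym (neq_edge ei evy) (eU' evy).
case: (hole_or_clique_cut es ei tf T1 xA yA xy nxy) => [[c [hc sc xc yc]]|[K [X [cK [xK yK] XA [xX yX] clX]]]].
  have vc : v \notin c by apply/negP => /sc; rewrite in_setD1 eqxx.
  by move: xy; rewrite (T1 hc vc xc yc evx evy) eqxx.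
have Kk : #|v |: K| < k.
  by apply: leq_ltn_trans k3; rewrite cardsU1; have := clique_le2 cK; case: (_ \notin _) => /=; clear; lia.
case: br => _ _ /(_ _ Kk)[b bB db].
have AE : (U :\ v) :\: K = U :\: (v |: K) by rewrite setDDl.
rewrite AE in XA clX.
have cb := bramble_conn br bB.
have bA z : z \in b -> z \in U :\: (v |: K).
  by move=> zb; rewrite in_setD (disjointFr db zb) (subsetP (BU bB)).
have inA z : z \in U :\ v -> z \notin K -> z \in U :\: (v |: K) by move=> h1 h2; rewrite -AE in_setD h1 h2.
case: (pselect (exists2 z, z \in b & z \in X)) => [bX|nbX].
  right; apply: (half (K := K) (b0 := b) (v := v) cK erefl) => //; [exact: inA| |by rewrite es].
  have sbX : b \subset X by apply: (conn_closed cb) => // u w uX _ /bA; apply: clX.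
  rewrite disjoints_subset; apply/subsetP => z /(subsetP sbX) zX; rewrite inE; apply/negP => zC.
  have /subsetP/(_ y) : component e (U :\: (v |: K)) y \subset X.
    apply: (conn_closed (comp_conn es (inA _ yA yK))); last by exists z.
    by move=> u w uX _ /(subsetP (comp_sub _ _ _)); apply: clX.
  by rewrite (negbTE yX) => H; have := H (comp_in e (inA _ yA yK)).
left; apply: (half (K := K) (b0 := b) (v := v) cK erefl) => //; [exact: inA| |by rewrite es].
have CX : component e (U :\: (v |: K)) x \subset X.
  apply: (conn_closed (comp_conn es (inA _ xA xK))).
    by move=> u w uX _ /(subsetP (comp_sub _ _ _)); apply: clX.
  by exists x => //; apply: comp_in; apply: inA.
rewrite disjoints_subset; apply/subsetP => z zb; rewrite inE; apply/negP => /(subsetP CX) zX.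
by apply: nbX; exists z.
Qed.

Let XS x (p q : seq V) : {set V} := [set z in x :: p ++ q].

Lemma deg_le2_nbr s a b w : deg s <= 2 -> e s a -> e s b -> a != b -> e s w -> (w == a) || (w == b).
Proof.
move=> ds ea eb ab ew; apply: contraT; rewrite negb_or => /andP[wa wb].
move: ds; rewrite leqNgt; case/negP.
apply: (@leq_trans #|w |: [set a; b]|).
  by rewrite cardsU1 cards2 ab !inE negb_or wa wb.
apply: subset_leq_card; apply/subsetP => z; rewrite !inE => /or3P[]/eqP ->; apply/existsP; exists s; by rewrite inE eqxx.
Qed.

Section OneResidual.
Variables (x v s t : V) (p q : seq V).
Hypothesis R : res x v s t p q.
Hypothesis dx : 2 < deg x.

Let X := XS x p q.

Lemma res_last : e (last x p) s /\ e (last x q) t.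
Proof.
case: R => [[/ipath_path + /ipath_path + _ _ _] _ _ _ _].
by rewrite !rcons_path => /andP[_ ->] /andP[_ ->].
Qed.

Lemma res_paths : path e x p /\ path e x q.
Proof.
case: R => [[/ipath_path + /ipath_path + _ _ _] _ _ _ _].
by rewrite !rcons_path => /andP[-> _] /andP[-> _].
Qed.

Lemma res_xnotin : x \notin p /\ x \notin q.
Proof.
case: R => [[/ipath_uniq + /ipath_uniq + _ _ _] _ _ _ _]; rewrite /=.
by rewrite !mem_rcons !inE !negb_or => /andP[/andP[_ ->] _] /andP[/andP[_ ->] _].
Qed.

Lemma res_conn : conn e X.
Proof.
have [pp pq] := res_paths.
have -> : X = [set z in x :: p] :|: [set z in x :: q].
  by apply/setP => z; rewrite !inE mem_cat; case: (z == x); case: (z \in p).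
apply: connU => //; [exact: path_conn|exact: path_conn|].
by exists x, x; rewrite !inE !eqxx.
Qed.

Lemma res_connv r : path e x r -> conn e (v |: [set z in x :: r]).
Proof.
move=> pr; have [_ [xv _ _ _] _ _ _] := R.
apply: connU => //; [exact: conn1|exact: path_conn|].
by exists v, x; rewrite !inE !eqxx es xv orbT.
Qed.

Lemma res_closed u w : u \in X -> e u w -> w \in X :|: [set v; s; t].
Proof.
have [_ _ _ cl _] := R; rewrite inE => uX euw; rewrite in_setU inE.
case: (cl u w uX euw) => [->//|/or3P[]/andP[_ /eqP ->]]; by rewrite !inE eqxx ?orbT.
Qed.

Lemma res_deg z : z \in X -> z != x -> deg z <= 2.
Proof.
rewrite /X /XS inE inE => /predU1P[->|]; first by rewrite eqxx.
rewrite mem_cat => /orP[zp|zq] _; first exact: (residual_deg es ei R).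
exact: (residual_deg es ei (residual_sym es R)).
Qed.

Lemma res_sub : X \subset U.
Proof.
have [pp pq] := res_paths; have [_ [xv _ _ _] _ _ _] := R.
have H r : path e x r -> {subset r <= U}.
  move=> pr z zr; have [s1 [s2 E]] := mem_split zr.
  by move: pr; rewrite E cat_path /= => /and3P[_ /eU' ].
apply/subsetP => z; rewrite inE inE mem_cat => /or3P[/eqP ->|/(H _ pp)|/(H _ pq)] //.
exact: (eU xv).
Qed.

(** Otherwise the only neighbours of [s] are [t] and the end of [p]. Then [s] and the whole
    structure are left only through [v] and [t], and the leg towards [t] could replace them, against
    minimality. *)
Lemma foot_deg : 2 < deg s.
Proof.
case: (R) => [[ip iq pN qN pq] [xv st vs vt] [vX sX tX] cl [b bB db]].
have [es1 et1] := res_last; have [pp pq'] := res_paths; have [xp xq] := res_xnotin.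
rewrite ltnNge; apply/negP => ds.
have lp := mem_last_nonempty x pN.
have Ns w : e s w -> (w == last x p) || (w == t).
  apply: (@deg_le2_nbr s (last x p) t w ds _ st); first by rewrite es.
  by apply: contraNneq tX => <-; rewrite inE mem_cat lp orbT.
have : s |: X \subset [set z in x :: q].
  apply: (@red (s |: X) [set v; t] [set z in x :: q] b v) => //.
  - move=> u w /setU1P[->|uX] euw.
      case/orP: (Ns w euw) => /eqP ->; last by rewrite !in_setU !in_set1 eqxx !orbT.
      by rewrite in_setU in_setU1 [_ \in X]inE inE mem_cat lp !orbT.
    have := res_closed uX euw; rewrite !in_setU !in_set1.
    by case: (w \in X); rewrite ?orbT //=; case: (w == v); case: (w == s); case: (w == t).
  - rewrite disjoints_subset; apply/subsetP => z; rewrite in_setU1 in_setC in_set2 negb_or.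
    case/predU1P => [->|]; first by rewrite eq_sym vs (neq_edge ei st).
    rewrite inE => zX; apply/andP; split; first by apply: contraNneq vX => <-.
    by apply: contraNneq tX => <-.
  - rewrite disjoints_subset; apply/subsetP => z zb; have := disjointFr db zb.
    rewrite in_setC !in_setU !in_set1 => /negbT; rewrite !negb_or.
    by rewrite /X /XS => /andP[/andP[/andP[-> ->] ->] ->].
  - rewrite subUset sub1set (eU st) /=; exact: res_sub.
  - apply/subsetP => z; rewrite in_setU1 inE inE => h.
    by rewrite /X /XS inE inE mem_cat; case/orP: h => ->; rewrite ?orbT.
  - by rewrite in_setU1 negb_or vs inE.
  - exact: res_connv.
  move=> a b'; have tN : t \in nbr e [set z in x :: q] by apply: (nbr_seq (mem_last x q)).
  rewrite !in_set2 => /orP[]/eqP -> /orP[]/eqP ->; by rewrite ?eqxx ?tN ?orbT.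
move=> /subsetP/(_ (last x p)); rewrite in_setU1 ![_ \in X]inE ![_ \in x :: _]inE mem_cat lp !orbT => /(_ isT).
rewrite inE inE => /orP[/eqP lx|lq]; first by rewrite lx (negbTE xp) in lp.
by have [] := pq _ _ lp lq; rewrite eqxx.
Qed.

End OneResidual.

(** The member touches one that avoids the structure and its surroundings, so it cannot stay inside;
    the only exits are [v], [s] and [t]. *)
Lemma residual_meet (x v s t : V) p q b : res x v s t p q -> b \in B ->
  (exists2 z, z \in b & z \in XS x p q) -> exists2 z, z \in b & z \in [set v; s; t].
Proof.
move=> R bB [z zb zX]; apply: contrapT => no; have [_ _ _ _ [b0 b0B db0]] := R.
have bX : b \subset XS x p q.
  apply: (conn_closed (bramble_conn br bB)); last by exists z.
  move=> u w uX _ wb euw; have /setUP[//|wS] := res_closed R uX euw.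
  by case: no; exists w.
case: br => _ /(_ b b0 bB b0B)[a [c [ab cb0 ac]]] _.
have aX := subsetP bX _ ab; have := disjointFr db0 cb0; rewrite in_setU => /norP[cS cX].
case/orP: ac => [/eqP ac|eac]; first by move: cX; rewrite -ac; rewrite /XS in aX; rewrite aX.
by have := res_closed R aX eac; rewrite in_setU (negbTE cX) (negbTE cS).
Qed.

(** By the degrees of the neighbours of [x], the vertex [t'] is [v]. The two structures together are
    then left only through [v] and [s], and the single leg [x :: p] between these could replace
    both. *)
Let twin x v s t p q t' p' q' : res x v s t p q -> 2 < deg x ->
  res t s x t' p' q' -> 2 < deg t -> False.
Proof.
move=> R dx R' dt.
have [[ip iq pN qN pq] [xv st vs vt] [vX sX tX] cl [b bB db]] := R.
have [_ [_ xt' sx st'] [sX' xX' t'X'] _ [b' b'B db']] := R'.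
have dt' : 2 < deg t' by apply: (foot_deg (residual_sym es R')).
have t'v : t' = v.
  have := residual_nbr ei R xt'; rewrite !inE => /orP[/orP[/eqP //|]|] /eqP E.
    have : deg t' <= 2 by apply: (residual_deg es ei R); rewrite E; case: (p) pN => //= a l _; rewrite mem_head.
    by rewrite leqNgt dt'.
  have : deg t' <= 2.
    by apply: (residual_deg es ei (residual_sym es R)); rewrite E; case: (q) qN => //= a l _; rewrite mem_head.
  by rewrite leqNgt dt'.
subst t'.
have [pp pq'] := res_paths R; have [es1 _] := res_last R.
pose X := XS x p q; pose X' := XS t p' q'.
have inX z : (z \in X) = (z \in x :: p ++ q) by rewrite /X /XS [LHS]in_set.
have inX' z : (z \in X') = (z \in t :: p' ++ q') by rewrite /X' /XS [LHS]in_set.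
have bX' z : z \in b -> z \notin X'.
  move=> zb; apply/negP => zX'.
  have sub : b \subset X'.
    apply: (conn_closed (bramble_conn br bB)); last by exists z.
    move=> u w uX _ wb euw; have := res_closed R' uX euw; rewrite in_setU => /orP[//|wS].
    have := disjointFr db wb; rewrite !in_setU in_set; move: wS; rewrite !in_setU !in_set1.
    by case/orP => [/orP[]|] /eqP ->; rewrite ?eqxx ?orbT // mem_head orbT.
  case: br => _ /(_ b b' bB b'B)[a [c [ab cb' ac]]] _.
  have aX := subsetP sub _ ab; have := disjointFr db' cb'; rewrite in_setU => /norP[cS cX].
  case/orP: ac => [/eqP ac|eac]; first by move: cX; rewrite -ac; rewrite /X' /XS in aX; rewrite aX.
  by have := res_closed R' aX eac; rewrite in_setU (negbTE cX) (negbTE cS).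
have : X :|: X' \subset [set z in x :: p].
  apply: (@red (X :|: X') [set v; s] [set z in x :: p] b v) => //.
  - move=> u w /setUP[uX|uX] euw.
      have := res_closed R uX euw; rewrite !in_setU !in_set1 => /orP[->//|/orP[/orP[->|->]|/eqP ->]]; rewrite ?orbT //.
      by rewrite inX' mem_head !orbT.
    have := res_closed R' uX euw; rewrite !in_setU !in_set1 => /orP[->|/orP[/orP[->|/eqP ->]|->]]; rewrite ?orbT //.
    by rewrite inX mem_head.
  - rewrite disjoints_subset; apply/subsetP => z; rewrite in_setC in_set2 negb_or in_setU inX inX' => zX.
    apply/andP; split; apply: contraTneq zX => ->; rewrite negb_or; by apply/andP.
  - rewrite disjoints_subset; apply/subsetP => z zb; have nX' := bX' z zb; rewrite inX' in nX'.
    have /negbT := disjointFr db zb; rewrite in_setU negb_or in_set => /andP[+ hX].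
    rewrite !in_setU !in_set1 !negb_or => /andP[/andP[zv zs] _].
    by rewrite in_setC !in_setU inX inX' !in_set1 (negbTE hX) (negbTE nX') (negbTE zv) (negbTE zs).
  - by rewrite subUset (res_sub R) (res_sub R').
  - by apply/subsetP => z; rewrite in_setU inX inE !inE mem_cat => /orP[]->; rewrite ?orbT.
  - by rewrite in_setU inX inX' negb_or vX.
  - exact: (res_connv R).
  move=> a c; have sN : s \in nbr e [set z in x :: p] by apply: (nbr_seq (mem_last x p)).
  rewrite !in_set2 => /orP[]/eqP -> /orP[]/eqP ->; by rewrite ?eqxx ?sN ?orbT.
move=> /subsetP/(_ t); rewrite in_setU inX' mem_head orbT => /(_ isT); rewrite inE => tp.
by move: tX; rewrite -cat_cons mem_cat tp.
Qed.

(** If [t] were residual, the degree of [s] makes [s] the vertex [v'] of its structure, and the last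
    vertex of [q] lies on one of its legs. Hence the structure of [x] reaches into that of [t] and
    leaves it at a vertex of degree at least three, necessarily [x]. So [x] is a foot of [t], the
    situation excluded by [twin]. *)
Lemma foot_not_res x v s t p q : res x v s t p q -> 2 < deg x -> ~ is_residual t.
Proof.
move=> R dx [dt [v' [s' [t' [p' [q' R']]]]]].
have [[ip iq pN qN pq] [xv st vs vt] [vX sX tX] cl [b bB db]] := R.
have [[ip' iq' pN' qN' _] _ _ _ _] := R'.
have ds : 2 < deg s by apply: (foot_deg R).
have [es1 et1] := res_last R.
have inq r : r != [::] -> head t r \in r by case: r => // a l _; rewrite mem_head.
have legp z : z \in p' -> deg z <= 2 by apply: (residual_deg es ei R').
have legq z : z \in q' -> deg z <= 2 by apply: (residual_deg es ei (residual_sym es R')).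
have sv' : s = v'.
  have ets : e t s by rewrite es.
  have := residual_nbr ei R' ets; rewrite !inE => /orP[/orP[/eqP //|]|] /eqP E.
    by move: ds; rewrite ltnNge E legp // inq.
  by move: ds; rewrite ltnNge E legq // inq.
subst v'.
pose X := XS x p q; pose X' := XS t p' q'.
have inX z : (z \in X) = (z \in x :: p ++ q) by rewrite /X /XS [LHS]in_set.
have inX' z : (z \in X') = (z \in t :: p' ++ q') by rewrite /X' /XS [LHS]in_set.
have lq := mem_last_nonempty x qN.
have lX : last x q \in X by rewrite inX inE mem_cat lq !orbT.
have lX' : last x q \in X'.
  have etl : e t (last x q) by rewrite es.
  have := residual_nbr ei R' etl; rewrite inX' !inE mem_cat => /orP[/orP[|]|] /eqP E.
  - by move: sX; rewrite -E -inX lX.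
  - by rewrite E inq ?orbT.
  by rewrite E inq ?orbT.
have xX' : x \notin X'.
  apply/negP => xX'; have := res_deg R' xX'; rewrite leqNgt dx => H.
  by have : x != t by [apply: contraNneq tX => <-; rewrite mem_head]; move/H.
have [z [z' [zX zX' z'X z'X' ez]]] : exists z z', [/\ z \in X, z \in X', z' \in X, z' \notin X' & e z z'].
  apply: contrapT => no; have /subsetP/(_ x) : X \subset X'; last by rewrite inX mem_head (negbTE xX') => /(_ isT).
  apply: (conn_closed (res_conn R)); last by exists (last x q).
  by move=> u w uX' uX wX euw; apply: contraT => wX'; case: no; exists u, w.
have z'x : 2 < deg z' -> z' = x.
  by move=> d; apply/eqP; apply: contraTT d => ne; rewrite -leqNgt; apply: (res_deg R).
have := res_closed R' zX' ez; rewrite in_setU (negbTE z'X') !in_setU !in_set1 /= => /orP[/orP[|]|] /eqP E.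
- by move: sX; rewrite -E -inX z'X.
- subst z'; have sx := z'x (foot_deg R'); subst s'.
  exact: (twin R dx R' dt).
subst z'; have sx := z'x (foot_deg (residual_sym es R')); subst t'.
exact: (twin R dx (residual_sym es R') dt).
Qed.

(** Otherwise an edge inside the structure of [x'] leaves that of [x]. It does not start in [x], so
    it ends in a foot of [x], which has degree at least three and must be [x']; but feet are not
    residual. *)
Lemma res_disjoint x v s t p q x' v' s' t' p' q' z : res x v s t p q -> 2 < deg x ->
  res x' v' s' t' p' q' -> 2 < deg x' -> z \in XS x p q -> z \in XS x' p' q' -> x = x'.
Proof.
move=> R dx R' dx' zX zX'; apply/eqP; apply: contraT => ne.
have x'X : x' \notin XS x p q.
  by apply/negP => h; have := res_deg R h; rewrite leqNgt dx' eq_sym ne => /(_ isT).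
have xX' : x \notin XS x' p' q'.
  by apply/negP => h; have := res_deg R' h; rewrite leqNgt dx ne => /(_ isT).
have x'X' : x' \in XS x' p' q' by rewrite /XS in_set mem_head.
have [a [c [aX' aX cX' cX eac]]] : exists a c, [/\ a \in XS x' p' q', a \in XS x p q,
    c \in XS x' p' q', c \notin XS x p q & e a c].
  apply: contrapT => no; have /subsetP/(_ x') : XS x' p' q' \subset XS x p q; last by rewrite x'X' (negbTE x'X) => /(_ isT).
  apply: (conn_closed (res_conn R')); last by exists z.
  by move=> u w uX' uX wX euw; apply: contraT => wX'; case: no; exists u, w.
have big : 2 < deg c -> is_residual c.
  move=> dc; have -> : c = x'.
    by apply/eqP; apply: contraTT dc => nc; rewrite -leqNgt; apply: (res_deg R').
  by split => //; exists v', s', t', p', q'.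
have [_ _ _ cl _] := R.
move: aX cX; rewrite {1 2}/XS !in_set => aX cX.
case: (cl _ _ aX eac) => [h|/or3P[]/andP[/eqP ax /eqP E]]; first by rewrite h in cX.
- by rewrite -ax aX' in xX'.
- subst c; case: (foot_not_res (residual_sym es R) dx); apply: big; exact: (foot_deg R).
subst c; case: (foot_not_res R dx); apply: big; exact: (foot_deg (residual_sym es R)).
Qed.

End Contract.

(** * Contracting the residual structures *)

Definition branching (V : finType) (e : rel V) (U : {set V}) u := 2 < #|nbr e [set u] :&: U|.

(* By the last clause, no edge of [U] between two branching vertices joins distinct
   branch sets; this makes a subdivision found inside the minor induced. *)
Definition heavy_grid_minor (V : finType) (e : rel V) a b (U : {set V}) : Prop :=
  exists C : nat -> nat -> {set V},
  [/\ forall i j, i < a -> j < b -> [/\ conn e (C i j), C i j != set0 & C i j \subset U],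
      forall i j i' j' z, i < a -> j < b -> i' < a -> j' < b ->
        z \in C i j -> z \in C i' j' -> i = i' /\ j = j',
      forall i j, i.+1 < a -> j < b -> adjacent e (C i j) (C i.+1 j),
      forall i j, i < a -> j.+1 < b -> adjacent e (C i j) (C i j.+1) &
      forall i j u w, i < a -> j < b -> u \in C i j -> w \in U -> e u w ->
        branching e U u -> branching e U w -> w \in C i j].

(** * Brambles and grid minors in a quotient graph *)

Section Quotient.
Variables (V : finType) (e : rel V) (W : {set V}) (pi : V -> V).
Hypothesis es : symmetric e.

Definition quot : rel V := fun a b =>
  (a != b) && [exists u, exists w, [&& u \in W, w \in W, pi u == a, pi w == b & e u w]].

Lemma quotP a b : reflect (a != b /\ exists u w, [/\ u \in W, w \in W, pi u = a, pi w = b & e u w]) (quot a b).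
Proof.
apply: (iffP andP) => -[ne].
  move=> /existsP[u /existsP[w /and5P[uW wW /eqP ua /eqP wb euw]]]; split => //.
  by exists u, w.
move=> [u [w [uW wW ua wb euw]]]; split => //; apply/existsP; exists u; apply/existsP; exists w.
by rewrite uW wW ua wb euw !eqxx.
Qed.

Lemma quot_sym : symmetric quot.
Proof.
move=> a b; apply/quotP/quotP => -[ne [u [w [uW wW ua wb euw]]]]; split; rewrite 1?eq_sym //;
  by exists w, u; rewrite es.
Qed.

Hypothesis quotE : forall u w, e u w -> pi u = pi w \/ quot (pi u) (pi w).

(** [H s] has at most three vertices and meets every member whose image contains [s]. A hitting set
    of the images would therefore yield one of the members, at most three times as large. *)
Lemma bramble_quot B k (H : V -> {set V}) : bramble e B (3 * k) ->
  (forall b z, b \in B -> z \in b -> #|H (pi z)| <= 3 /\ exists2 y, y \in b & y \in H (pi z)) ->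
  bramble quot [set pi @: b | b : {set V} in B] k.
Proof.
move=> [cB tB oB] HH; split.
- move=> _ /imsetP[b bB ->]; have [cb b0] := cB b bB; split; last first.
    by have /set0Pn[z zb] := b0; apply/set0Pn; exists (pi z); apply: imset_f.
  move=> X Xb /set0Pn[x xX] cl.
  have /imsetP[z0 z0b Ez] := subsetP Xb x xX.
  have sub : b \subset pi @^-1: X.
    apply: (conn_closed cb); last by exists z0; rewrite // inE -Ez.
    move=> u w; rewrite !inE => uX _ wb euw; case: (quotE euw) => [<-//|q].
    by apply: (cl (pi u)) => //; apply: imset_f.
  by apply/subsetP => _ /imsetP[z zb ->]; have := subsetP sub z zb; rewrite inE.
- move=> _ _ /imsetP[b bB ->] /imsetP[b' b'B ->].
  have [x [y [xb yb xy]]] := tB b b' bB b'B.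
  exists (pi x), (pi y); split; [exact: imset_f|exact: imset_f|].
  case/orP: xy => [/eqP ->|exy]; first by rewrite eqxx.
  by case: (quotE exy) => [->|->]; rewrite ?eqxx ?orbT.
(* The bound on [H s] is known only when [s] occurs in the image of a member; the filter discards
   the others. *)
move=> S Sk; pose S' := \bigcup_(s in S | #|H s| <= 3) H s.
have S'k : #|S'| < 3 * k.
  apply: (@leq_ltn_trans (3 * #|S|)); last by rewrite ltn_mul2l.
  apply: (@leq_trans (\sum_(s in S | #|H s| <= 3) #|H s|)).
    rewrite /S'; elim/big_rec2: _ => [|s m A _ le]; first by rewrite cards0.
    have [le2 _] := leq_card_setU (H s) A; apply: leq_trans le2 _; by rewrite leq_add2l.
  rewrite big_mkcondr mulnC -sum_nat_const; apply: leq_sum => s _; by case: ifP.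
have [b bB db] := oB S' S'k; exists (pi @: b); first exact: imset_f.
rewrite disjoints_subset; apply/subsetP => _ /imsetP[z zb ->]; rewrite inE; apply/negP => zS.
have [le [y yb yH]] := HH b z bB zb.
have := disjointFr db yb; rewrite /S' => /negP; apply; apply/bigcupP; exists (pi z) => //.
by rewrite zS.
Qed.

Hypothesis fiber : forall z w, z \in W -> w \in W -> pi z = pi w ->
  exists C : {set V}, [/\ conn e C, C \subset W, z \in C, w \in C & forall y, y \in C -> pi y = pi z].

(** Fibres are connected, so a nonempty closed set contains every fibre it meets, and its image is
    closed in the quotient. *)
Lemma conn_lift A : conn quot A -> conn e [set z in W | pi z \in A].
Proof.
move=> cA X XA /set0Pn[x xX] cl.
have inA z : (z \in [set z in W | pi z \in A]) = (z \in W) && (pi z \in A) by rewrite in_set.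
have XP z : z \in X -> z \in W /\ pi z \in A by move=> /(subsetP XA); rewrite inA => /andP[].
have fib z w : z \in X -> w \in W -> pi z = pi w -> w \in X.
  move=> zX wW E; have [zW zA] := XP z zX; have [C [cC CW zC wC HC]] := fiber zW wW E.
  apply: (subsetP _ w wC); apply: (conn_closed cC); last by exists z.
  by move=> u y uX uC yC euy; apply: (cl u) => //; rewrite inA (subsetP CW) // HC.
have sub : A \subset pi @: X.
  apply: (conn_closed cA); last by exists (pi x); [case: (XP x xX)|apply: imset_f].
  move=> _ tau /imsetP[z zX ->] zA tA /quotP[ne [u [w [uW wW Eu Ew euw]]]].
  apply/imsetP; exists w => //; apply: (cl u) => //; last by rewrite inA wW Ew.
  exact: (fib z).
apply/subsetP => z; rewrite inA => /andP[zW zA].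
by have /imsetP[y yX E] := subsetP sub _ zA; apply: (fib y).
Qed.

Lemma grid_minor_lift a b : 1 < a -> grid_minor quot a b setT ->
  (forall u w, u \in W -> w \in W -> e u w -> branching e W u -> branching e W w -> pi u = pi w) ->
  heavy_grid_minor e a b W.
Proof.
move=> a1 [B [H1 H2 H3 H4]] MM; exists (fun i j => [set z in W | pi z \in B i j]).
have inC i j z : (z \in [set z in W | pi z \in B i j]) = (z \in W) && (pi z \in B i j) by rewrite in_set.
have adj X Y : adjacent quot X Y -> adjacent e [set z in W | pi z \in X] [set z in W | pi z \in Y].
  move=> [x [y [xX yY /quotP[_ [u [w [uW wW Eu Ew euw]]]]]]]; exists u, w.
  by rewrite !in_set uW wW Eu Ew.
split.
- move=> i j ia jb; have [cB _ _] := H1 i j ia jb; split; [exact: conn_lift| |].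
    (* A vertex of the quotient may have no preimage in [W], so nonemptiness is derived from an edge
       to the next or previous row; this is where [1 < a] enters. *)
    case: (ltnP i.+1 a) => ia'.
      by have [u [w [uC _ _]]] := adj _ _ (H3 i j ia' jb); apply/set0Pn; exists u.
    case: i ia ia' {cB} => [|i] ia ia'; first by rewrite ltnNge ia' in a1.
    by have [u [w [_ wC _]]] := adj _ _ (H3 i j ia jb); apply/set0Pn; exists w.
  by apply/subsetP => z; rewrite inC => /andP[].
- move=> i j i' j' z ia jb ia' jb'; rewrite !inC => /andP[_ h] /andP[_ h']; exact: H2 h h'.
- by move=> i j ia jb; apply: adj; apply: H3.
- by move=> i j ia jb; apply: adj; apply: H4.
move=> i j u w ia jb; rewrite !inC => /andP[uW uB] wW euw bu bw.
by rewrite wW -(MM u w uW wW euw bu bw).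
Qed.

End Quotient.

Section Apply.
Variables (V : finType) (e : rel V).
Hypothesis es : symmetric e.
Hypothesis ei : irreflexive e.
Variables (B : {set {set V}}) (k : nat) (U : {set V}).
Hypothesis T1 : T1_free e.
Hypothesis br : bramble e B k.
Hypothesis BU : forall b, b \in B -> b \subset U.
Hypothesis eU : forall u w, e u w -> u \in U.
Hypothesis minU : forall A : {set V}, A \subset U -> bramble_in e A k -> A = U.
Hypothesis small : forall K, clique e K -> #|K| < k.
Hypothesis k3 : 3 < k.

Let eU' u w : e u w -> w \in U. Proof. by rewrite es => /eU. Qed.
Let res := residual e B.
Let deg := deg e.
Let is_residual := is_residual e B.

Record residual_data := RData { rv : V; rs : V; rt : V; rp : seq V; rq : seq V }.

Lemma residual_choice : exists D : V -> residual_data, forall x, is_residual x ->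
  2 < deg x /\ res x (rv (D x)) (rs (D x)) (rt (D x)) (rp (D x)) (rq (D x)).
Proof.
suff [D HD] : exists D : V -> residual_data, forall x, is_residual x -> res x (rv (D x)) (rs (D x)) (rt (D x)) (rp (D x)) (rq (D x)).
  by exists D => x xr; split; [case: xr|apply: HD].
have H x : exists d, is_residual x -> res x (rv d) (rs d) (rt d) (rp d) (rq d).
  case: (pselect (is_residual x)) => [[dx [v [s [t [p [q R]]]]]]|nr].
    by exists (RData v s t p q).
  by exists (RData x x x [::] [::]).
by have [D HD] := choice H; exists D.
Qed.

Section Data.
Variable D : V -> residual_data.
Hypothesis HD : forall x, is_residual x ->
  2 < deg x /\ res x (rv (D x)) (rs (D x)) (rt (D x)) (rp (D x)) (rq (D x)).

(* [pi] contracts each residual structure, which in [W] has lost one of its two legs, to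
   its vertex of degree three, and each edge between other vertices of degree at least
   three; these edges form a matching. *)
Let RR : {set V} := [set x | `[< is_residual x >]].
Let X x : {set V} := [set z in x :: rp (D x) ++ rq (D x)].
Let W : {set V} := U :\: \bigcup_(x in RR) [set z in rq (D x)].
Let D3 : {set V} := [set z | 2 < deg z] :\: RR.
Let cls z : {set V} := if z \in D3 then z |: (nbr e [set z] :&: D3) else [set z].
Let own z := [pick x in RR | z \in X x].
Let pi z := if own z is Some x then x else odflt z [pick w in cls z].

Let RRP x : x \in RR -> is_residual x. Proof. by rewrite inE => /asboolP. Qed.
Let RRD x : x \in RR -> 2 < deg x. Proof. by move=> /RRP[]. Qed.
Let RRR x : x \in RR -> res x (rv (D x)) (rs (D x)) (rt (D x)) (rp (D x)) (rq (D x)).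
Proof. by move=> /RRP/HD[]. Qed.

Let X_disj x y z : x \in RR -> y \in RR -> z \in X x -> z \in X y -> x = y.
Proof.
move=> xR yR; exact: (res_disjoint es ei br BU eU minU (RRR xR) (RRD xR) (RRR yR) (RRD yR)).
Qed.

Let XD3 x z : x \in RR -> z \in X x -> z \notin D3.
Proof.
move=> xR zX; rewrite inE negb_and negbK; case: (z =P x) => [->|/eqP ne]; first by rewrite xR.
by rewrite inE -leqNgt (res_deg es ei (RRR xR) zX ne) orbT.
Qed.

Let xX x : x \in X x. Proof. by rewrite inE mem_head. Qed.

Let own_some x z : x \in RR -> z \in X x -> own z = Some x.
Proof.
move=> xR zX; rewrite /own; case: pickP => [y /andP[yR zY]|/(_ x)]; last by rewrite xR zX.
by rewrite (X_disj yR xR zY zX).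
Qed.

Let own_none z : own z = None -> forall x, x \in RR -> z \notin X x.
Proof. by rewrite /own; case: pickP => // H _ x xR; have := H x; rewrite xR /= => ->. Qed.

Let ownP z x : own z = Some x -> x \in RR /\ z \in X x.
Proof. by rewrite /own; case: pickP => // y /andP[yR zY] [<-]. Qed.

(** By [bad_triple], of two neighbours of degree at least three one is residual. So the edges inside
    [D3] form a matching. *)
Let mate u w w' : w \in D3 -> w' \in D3 -> e u w -> e u w' -> w = w'.
Proof.
move=> /setDP[]; rewrite inE => dw nw /setDP[]; rewrite inE => dw' nw' euw euw'.
apply/eqP; apply: contraT => ne.
case: (bad_triple es ei T1 br BU eU minU small k3 euw euw' ne dw dw') => h.
  by move: nw; rewrite inE; case/negP; apply/asboolP.
by move: nw'; rewrite inE; case/negP; apply/asboolP.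
Qed.

Let cls_mem z w : w \in cls z -> w = z \/ [/\ z \in D3, w \in D3 & e z w].
Proof.
rewrite /cls; case: ifP => [zD /setU1P[->|/setIP[/nbrP[z' ]]]|_ /set1P]; [by left| |by left].
by rewrite inE => /eqP -> ezw wD; right.
Qed.

Let cls_self z : z \in cls z. Proof. by rewrite /cls; case: ifP => _; rewrite ?setU11 ?inE. Qed.

Let cls_mate z w : z \in D3 -> w \in D3 -> e z w -> w \in cls z.
Proof.
move=> zD wD ezw; rewrite /cls zD in_setU1 in_setI wD andbT; apply/orP; right.
by apply/nbrP; exists z; rewrite ?inE.
Qed.

Let cls_eq z w : z \in D3 -> w \in D3 -> e z w -> cls z = cls w.
Proof.
move=> zD wD ezw; have ewz : e w z by rewrite es.
apply/setP => y; apply/idP/idP => /cls_mem[->|[_ yD ey]].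
- exact: cls_mate.
- by rewrite (mate yD wD ey ezw) cls_self.
- exact: cls_mate.
by rewrite (mate yD zD ey ewz) cls_self.
Qed.

Let pi_none z : own z = None -> pi z \in cls z.
Proof.
by rewrite /pi => ->; case: pickP => [//|/(_ z)]; rewrite cls_self.
Qed.

Let piX x z : x \in RR -> z \in X x -> pi z = x.
Proof. by move=> xR zX; rewrite /pi (own_some xR zX). Qed.

Let D3_own z : z \in D3 -> own z = None.
Proof. by move=> zD; case E : (own z) => [x|] //; have [xR zX] := ownP E; move: (XD3 xR zX); rewrite zD. Qed.

(** The representative is picked from the class as a set, and mates have equal classes. *)
Let pi_mate z w : z \in D3 -> w \in D3 -> e z w -> pi z = pi w.
Proof.
move=> zD wD ezw; rewrite /pi !D3_own //= -(cls_eq zD wD ezw).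
by case: pickP => //= /(_ z); rewrite cls_self.
Qed.

Let pi_eq z w : pi z = pi w -> [\/ exists x, [/\ x \in RR, z \in X x & w \in X x], z = w |
  [/\ z \in D3, w \in D3 & e z w]].
Proof.
move=> E; case oz : (own z) => [x|]; case ow : (own w) => [y|].
- have [xR zX] := ownP oz; have [yR wY] := ownP ow; constructor 1; exists x; split => //.
  by move: E; rewrite (piX xR zX) (piX yR wY) => ->.
- have [xR zX] := ownP oz; have := pi_none ow; rewrite -E (piX xR zX) => /cls_mem[xw|[_ xD _]].
    by have := own_none ow xR; rewrite -xw xX.
  by have := XD3 xR (xX x); rewrite xD.
- have [yR wY] := ownP ow; have := pi_none oz; rewrite E (piX yR wY) => /cls_mem[xw|[_ xD _]].
    by have := own_none oz yR; rewrite -xw xX.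
  by have := XD3 yR (xX y); rewrite xD.
have h := pi_none oz; have h' := pi_none ow; rewrite -E in h'.
case: (cls_mem h) => [Ez|[zD uD ezu]]; case: (cls_mem h') => [Ew|[wD uD' ewu]].
- by constructor 2; rewrite -Ez Ew.
- by rewrite Ez in uD' ewu; constructor 3; rewrite es.
- by rewrite Ew in uD ezu; constructor 3.
constructor 2; apply: (mate (u := pi z)) => //; by rewrite es.
Qed.

Let leg_notW x z : x \in RR -> z \in x :: rp (D x) -> forall y, y \in RR -> z \notin rq (D y).
Proof.
move=> xR zp y yR; apply/negP => zq.
have zX : z \in X x by rewrite inE -cat_cons mem_cat zp.
have zY : z \in X y by rewrite inE inE mem_cat zq !orbT.
have E := X_disj xR yR zX zY; subst y.
have [[ip iq _ _ pq] _ _ _ _] := RRR xR; have [_ xq] := res_xnotin (RRR xR).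
move: zp; rewrite inE => /predU1P[zx|zp]; first by rewrite zx (negbTE xq) in zq.
by have [] := pq z z zp zq; rewrite eqxx.
Qed.

Let inW z : (z \in W) = (z \in U) && ~~ [exists x in RR, z \in rq (D x)].
Proof.
rewrite in_setD andbC; congr (_ && ~~ _); apply/bigcupP/exists_inP => -[x xR]; last by exists x; rewrite // inE.
by rewrite inE; exists x.
Qed.

Let legW x z : x \in RR -> z \in x :: rp (D x) -> z \in W.
Proof.
move=> xR zp; rewrite inW; apply/andP; split.
  apply: (subsetP (res_sub es eU (RRR xR))).
  by rewrite inE -cat_cons mem_cat zp.
by apply/exists_inP => -[y yR]; rewrite (negbTE (leg_notW xR zp yR)).
Qed.

Let bigW z : z \in U -> 2 < deg z -> z \in W.
Proof.
move=> zU dz; rewrite inW zU; apply/exists_inP => -[y yR zq].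
have zY : z \in X y by rewrite inE inE mem_cat zq !orbT.
have [_ yq] := res_xnotin (RRR yR).
have ne : z != y by apply/eqP => E; subst z; rewrite zq in yq.
by have := res_deg es ei (RRR yR) zY ne; rewrite leqNgt dz.
Qed.

Let footD3 x : x \in RR -> rs (D x) \in D3 /\ rt (D x) \in D3.
Proof.
move=> xR; have R := RRR xR; have R' := residual_sym es R; have dx := RRD xR.
have ds := foot_deg es ei br BU eU minU R; have dt := foot_deg es ei br BU eU minU R'.
have fs := foot_not_res es ei br BU eU minU R' dx.
have ft := foot_not_res es ei br BU eU minU R dx.
by rewrite !inE ds dt !andbT; split; apply/asboolP.
Qed.

(** The delicate edges have an end on a deleted leg. Inside the structure they are contracted; the
    only other one leads from the end of the leg to [t]. As the edge between the feet [s] and [t] is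
    contracted, the edge from the remaining leg to [s] has the same image. *)
Let piE u w : e u w -> pi u = pi w \/ quot e W pi (pi u) (pi w).
Proof.
move=> euw; case: (pi u =P pi w) => [->|/eqP ne]; [by left|right].
have half a c : e a c -> a \notin W -> pi a != pi c -> quot e W pi (pi a) (pi c).
  move=> eac aW ne'; have aU := eU eac.
  move: aW; rewrite inW aU negbK => /exists_inP[x xR aq].
  have R := RRR xR; have [_ xq] := res_xnotin R; have [es1 et1] := res_last R.
  have [[_ _ pN _ pq] [_ st _ _] _ cl _] := R.
  have aX : a \in X x by rewrite inE inE mem_cat aq !orbT.
  have aX' : a \in x :: rp (D x) ++ rq (D x) by move: aX; rewrite inE.
  case: (cl a c aX' eac) => [cX|/or3P[]/andP[/eqP E /eqP Ec]].
  - by move: ne'; rewrite (piX xR aX) (piX xR (z := c)) ?eqxx // inE.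
  - by subst a; rewrite aq in xq.
  - have lp := mem_last_nonempty x pN; rewrite -E in lp.
    by have [] := pq _ _ lp aq; rewrite eqxx.
  have [sD tD] := footD3 xR.
  have pst : pi (rs (D x)) = pi c by rewrite Ec; apply: pi_mate.
  have lX : last x (rp (D x)) \in X x by rewrite inE -cat_cons mem_cat mem_last.
  apply/quotP; split => //; exists (last x (rp (D x))), (rs (D x)); split => //.
  - by apply: (legW xR); apply: mem_last.
  - by apply: bigW; [apply: eU' es1|move: sD; rewrite !inE => /andP[]].
  by rewrite (piX xR lX) (piX xR aX).
case: (boolP (u \in W)) => uW; last exact: half.
case: (boolP (w \in W)) => wW; last by rewrite quot_sym //; apply: half; rewrite 1?es 1?eq_sym.
by apply/quotP; split => //; exists u, w.
Qed.

Let piF z w : z \in W -> w \in W -> pi z = pi w ->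
  exists C : {set V}, [/\ conn e C, C \subset W, z \in C, w \in C & forall y, y \in C -> pi y = pi z].
Proof.
move=> zW wW /pi_eq[[x [xR zX wX]]|<-|[zD wD ezw]].
- have [pp _] := res_paths (RRR xR).
  have inl y : y \in X x -> y \in W -> y \in x :: rp (D x).
    rewrite inE -cat_cons mem_cat => /orP[//|yq]; rewrite inW => /andP[_ /exists_inP[]].
    by exists x.
  exists [set y in x :: rp (D x)]; split.
  + exact: path_conn.
  + by apply/subsetP => y; rewrite inE; apply: legW.
  + by rewrite inE inl.
  + by rewrite inE inl.
  move=> y; rewrite inE => yp; rewrite (piX xR zX) (piX xR) // inE -cat_cons mem_cat yp //.
- by exists [set z]; split; rewrite ?inE ?sub1set //; [exact: conn1|move=> y; rewrite inE => /eqP ->].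
exists [set z; w]; split; rewrite ?inE ?eqxx ?orbT //.
- by apply: connU => //; [exact: conn1|exact: conn1|exists z, w; rewrite !inE !eqxx ezw orbT].
- by apply/subsetP => y; rewrite in_set2 => /orP[]/eqP ->.
by move=> y; rewrite in_set2 => /orP[]/eqP -> //; rewrite (pi_mate zD wD ezw).
Qed.

(** The hitting sets for [bramble_quot]: the three exits of a residual structure, or the class
    itself, which has at most two vertices. *)
Let H sg : {set V} := if sg \in RR then [set rv (D sg); rs (D sg); rt (D sg)] else cls sg.

Let piH b z : b \in B -> z \in b -> #|H (pi z)| <= 3 /\ exists2 y, y \in b & y \in H (pi z).
Proof.
move=> bB zb; case oz : (own z) => [x|].
  have [xR zX] := ownP oz; rewrite (piX xR zX) /H xR; split.
    rewrite -setUA; apply: leq_trans (leq_card_setU _ _) _; rewrite cards1 cards2.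
    by case: (_ != _).
  by apply: (residual_meet br (RRR xR) bB); exists z.
have h := pi_none oz.
have nR : pi z \notin RR.
  apply/negP => xR; case: (cls_mem h) => [E|[_ xD _]].
    by have := own_none oz xR; rewrite E xX.
  by have := XD3 xR (xX _); rewrite xD.
rewrite /H (negbTE nR); split; last first.
  exists z => //; case: (cls_mem h) => [->|[zD wD ezw]]; first exact: cls_self.
  by apply: cls_mate => //; rewrite es.
rewrite /cls; case: ifP => _; last by rewrite cards1.
rewrite cardsU1; apply: (@leq_trans (1 + 1)); last by [].
apply: leq_add; first by case: (_ \notin _).
rewrite leqNgt; apply/negP => /card_gt1P[a [c [/setIP[/nbrP[a' + ea] aD] /setIP[/nbrP[c' + ec] cD]]]].
rewrite !inE => /eqP E /eqP E'; subst a' c'; by rewrite (mate aD cD ea ec) eqxx.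
Qed.

(** A residual vertex has lost the first vertex of its deleted leg and keeps at most two neighbours
    in [W]. Branching vertices of [W] thus lie in [D3], where adjacent ones are contracted. *)
Let piM u w : u \in W -> w \in W -> e u w -> branching e W u -> branching e W w -> pi u = pi w.
Proof.
have D3P z : z \in W -> branching e W z -> z \in D3.
  move=> zW bz; rewrite in_setD in_set; apply/andP; split; last first.
    by apply: leq_trans bz _; apply: subset_leq_card; apply: subsetIl.
  apply/negP => zR; move: bz; rewrite /branching ltnNge; case/negP.
  apply: (@leq_trans #|[set rv (D z); head z (rp (D z))]|); last by rewrite cards2; case: (_ != _).
  apply: subset_leq_card; apply/subsetP => y /setIP[/nbrP[z' ]]; rewrite inE => /eqP -> ezy yW.
  have := residual_nbr ei (RRR zR) ezy; rewrite !inE => /orP[//|/eqP E].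
  move: yW; rewrite inW => /andP[_ /exists_inP[]]; exists z => //; rewrite E.
  by have [[_ _ _ qN _] _ _ _ _] := RRR zR; case: (rq (D z)) qN => // c l _; rewrite mem_head.
by move=> uW wW euw bu bw; apply: pi_mate => //; apply: D3P.
Qed.

Lemma heavy_grid k' a b : k = 3 * k' -> 1 < a ->
  (forall B', bramble (quot e W pi) B' k' -> grid_minor (quot e W pi) a b setT) -> heavy_grid_minor e a b W.
Proof.
move=> kE a1 G; apply: (@grid_minor_lift V e W pi piF a b a1 _ piM).
apply: G; apply: (bramble_quot piE (H := H) _ piH); by rewrite -kE.
Qed.

End Data.
End Apply.

(** * Induced subdivisions of subcubic graphs *)

Section Tripod.
Variables (V : finType) (e : rel V).
Hypothesis es : symmetric e.
Hypothesis ei : irreflexive e.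
Hypothesis tf : forall x y z, e x y -> e y z -> e x z -> False.

Definition consecutive (s : seq V) u v := infix [:: u; v] s || infix [:: v; u] s.

Lemma consecutive_rev s u v : consecutive (rev s) u v = consecutive s u v.
Proof.
rewrite /consecutive -[in LHS](revK [:: u; v]) -[in X in _ || X](revK [:: v; u]) !infix_rev.
by rewrite /rev /= orbC.
Qed.

Lemma consecutive_cat s1 s2 s3 u v : consecutive s2 u v -> consecutive (s1 ++ s2 ++ s3) u v.
Proof.
by case/orP => h; apply/orP; [left|right]; apply: infix_trans h _; apply/infixP; exists s1, s3.
Qed.

Lemma ipath_consecutive p u v : ipath e p -> u \in p -> v \in p -> e u v -> consecutive p u v.
Proof.
move=> ip up vp euv; have [s1 [s2 [E h]]] := ipath_deg es ei ip up vp euv.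
have vu : v != u by rewrite eq_sym (neq_edge ei euv).
case/orP: h => /eqP h.
  case/lastP: s1 E h => [|s1 w] E; first by rewrite /= => h; rewrite h eqxx in vu.
  rewrite last_rcons => h; subst w; apply/orP; right; apply/infixP; exists s1, s2.
  by rewrite E cat_rcons.
case: s2 E h => [|w s2] E; first by rewrite /= => h; rewrite h eqxx in vu.
by move=> /= h; subst w; apply/orP; left; apply/infixP; exists s1, s2.
Qed.

Lemma split_consecutive s1 u s2 a b : ipath e (s1 ++ u :: s2) -> a \in s1 ++ u :: s2 -> b \in s1 ++ u :: s2 ->
  e a b -> consecutive (u :: rev s1) a b || consecutive (u :: s2) a b.
Proof.
move=> ip ap bp eab.
have E : s1 ++ u :: s2 = rcons s1 u ++ s2 by rewrite cat_rcons.
have i1 : ipath e (rcons s1 u) by apply: (@ipath_catl _ e _ s2); rewrite -E.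
have i2 : ipath e (u :: s2) by apply: (ipath_catr ip).
have cr x y : x \in rcons s1 u -> y \in s2 -> e x y -> x = u.
  move=> xs ys exy; have := ip; rewrite E => /ipath_cat[_ _ /(_ x y xs ys)[_]].
  by rewrite exy last_rcons => /esym/andP[/eqP].
have R x y : consecutive (rcons s1 u) x y -> consecutive (u :: rev s1) x y.
  by rewrite -rev_rcons consecutive_rev.
have u1 : u \in u :: s2 by apply: mem_head.
have w2 x : x \in s2 -> x \in u :: s2 by move=> h; rewrite inE h orbT.
move: ap bp; rewrite E !mem_cat => /orP[a1|a2] /orP[b1|b2]; apply/orP.
- by left; apply: R; apply: ipath_consecutive.
- right; have au := cr a b a1 b2 eab; subst a; apply: ipath_consecutive => //; exact: w2.
- rewrite es in eab; right; have bu := cr b a b1 a2 eab; subst b.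
  by apply: ipath_consecutive => //; [apply: w2|rewrite es].
by right; apply: ipath_consecutive => //; apply: w2.
Qed.

Lemma split_paths s1 u s2 : ipath e (s1 ++ u :: s2) -> path e u (rev s1) /\ path e u s2.
Proof.
move=> ip; split; last exact: (ipath_path (ipath_catr ip)).
have : ipath e (rcons s1 u) by apply: (@ipath_catl _ e _ s2); rewrite cat_rcons.
by rewrite -ipath_rev // rev_rcons; apply: ipath_path.
Qed.

Lemma split_perm s1 (u : V) s2 : perm_eq (s1 ++ u :: s2) (u :: rev s1 ++ s2).
Proof.
rewrite -[u :: s2]/([:: u] ++ s2) perm_catCA perm_cons perm_cat2r perm_sym perm_rev //.
Qed.

(** Take a smallest connected subset containing the three vertices and an induced path from [c1] to
    [c2] in it. A path from [c3] stopped at its first contact with the former attaches at a single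
    vertex [u], which becomes the centre. *)
Lemma tripod (A : {set V}) c1 c2 c3 : conn e A -> c1 \in A -> c2 \in A -> c3 \in A ->
  exists f q1 q2 q3, [/\ uniq (f :: q1 ++ q2 ++ q3), {subset f :: q1 ++ q2 ++ q3 <= A},
    [/\ path e f q1, path e f q2 & path e f q3],
    [/\ last f q1 = c1, last f q2 = c2 & last f q3 = c3] &
    forall u v, u \in f :: q1 ++ q2 ++ q3 -> v \in f :: q1 ++ q2 ++ q3 -> e u v ->
      [|| consecutive (f :: q1) u v, consecutive (f :: q2) u v | consecutive (f :: q3) u v]].
Proof.
move=> cA A1 A2 A3.
have [T [[TA cT T1 [T2 T3]] Tmin]] := exists_min (fun T : {set V} => #|T|)
  (ex_intro (fun T : {set V} => [/\ T \subset A, conn e T, c1 \in T & c2 \in T /\ c3 \in T]) A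
     (And4 (subxx _) cA A1 (conj A2 A3))).
have min (T' : {set V}) : T' \subset T -> conn e T' -> c1 \in T' -> c2 \in T' -> c3 \in T' -> T' = T.
  move=> sT c' t1 t2 t3; apply/eqP; rewrite eqEcard sT /=; apply: Tmin; split => //.
  exact: subset_trans sT TA.
have [p [ip lp sp]] := conn_ipath cT T1 T2.
have up := ipath_uniq ip.
have hl s1 f s2 : c1 :: p = s1 ++ f :: s2 -> last f (rev s1) = c1 /\ last f s2 = c2.
  move=> E; split; last by have := congr1 (last f) E; rewrite /= lp last_cat /= => ->.
  by have := congr1 (head f) E; case: (s1) => [|a l] //= ->; rewrite rev_cons last_rcons.
case: (boolP (c3 \in c1 :: p)) => c3p.
  have [s1 [s2 E]] := mem_split c3p.
  have pm : perm_eq (c1 :: p) (c3 :: rev s1 ++ s2 ++ [::]) by rewrite E cats0 split_perm.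
  have ip' : ipath e (s1 ++ c3 :: s2) by rewrite -E.
  have [h1 h2] := hl _ _ _ E; have [p1 p2] := split_paths ip'.
  exists c3, (rev s1), s2, [::]; split => //.
  - by rewrite -(perm_uniq pm).
  - by move=> z; rewrite -(perm_mem pm) => /sp /(subsetP TA).
  move=> u v; rewrite -!(perm_mem pm) E => uP vP euv.
  by case/orP: (split_consecutive ip' uP vP euv) => ->; rewrite ?orbT.
pose F z := (z \in c1 :: p) || has (e z) (c1 :: p).
have [|r [z [ir fz nf hz sr]]] := conn_first (f := F) cT T3.
  by exists c1; rewrite // /F mem_head.
have rp w : w \in r -> ~~ F w by move=> wr; apply: (hasPn nf).
have zp : z \notin c1 :: p.
  apply/negP => zp; case/lastP: r ir hz rp {nf sr} => [|r w] ir hz rp.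
    by move: c3p; rewrite -hz zp.
  have := rp w; rewrite mem_rcons mem_head => /(_ isT); rewrite /F negb_or => /andP[_ /hasPn/(_ z zp)].
  by rewrite (ipath_rcons_edge ir).
have rp' w : w \in rcons r z -> w \notin c1 :: p.
  by rewrite mem_rcons inE => /predU1P[->//|/rp]; rewrite /F negb_or => /andP[].
have : has (e z) (c1 :: p) by move: fz; rewrite /F (negbTE zp).
move=> /split_find; case E : _ _ _ / => [u s1 s2 ezu n1].
rewrite cat_rcons in E.
have ip' : ipath e (s1 ++ u :: s2) by rewrite -E.
have u' : uniq (s1 ++ u :: s2) by rewrite -E.
have [hl1 hl2] := hl _ _ _ E.
have n2 w : w \in s2 -> ~~ e z w.
  move=> ws; apply/negP => ezw.
  have : has (e z) s2 by apply/hasP; exists w.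
  move=> {w ws ezw} /last_split[m [w [s3 [E2 ezw n3]]]].
  pose T' := [set y in rcons r z] :|: [set y in rcons s1 u] :|: [set y in w :: s3].
  have i1 : ipath e (rcons s1 u) by apply: (@ipath_catl _ e _ s2); rewrite cat_rcons.
  have i2 : ipath e (w :: s3).
    by move: (ipath_catr ip'); rewrite E2 -cat_cons => /ipath_catr.
  have c1m : c1 \in rcons s1 u.
    by have := congr1 (head c1) E; rewrite mem_rcons; case: (s1) => [|a l] /= ->; rewrite !inE eqxx ?orbT.
  have c2m : c2 \in w :: s3.
    by rewrite -hl2 E2 last_cat /= mem_last.
  have c3m : c3 \in rcons r z by rewrite -hz; case: (r) => [|a l] /=; rewrite mem_head.
  have inT' y : (y \in T') = [|| y \in rcons r z, y \in rcons s1 u | y \in w :: s3].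
    by rewrite !in_setU ![y \in [set _ in _]]in_set orbA.
  have ET : T' = T.
    apply: min.
    - apply/subsetP => y; rewrite inT' => /or3P[/sr//|ys|ys]; apply: sp; rewrite E.
        by rewrite -cat_rcons mem_cat ys.
      by rewrite E2 -cat_cons catA mem_cat ys orbT.
    - apply: connU => //; last first.
      + by exists z, w; rewrite in_setU !in_set mem_rcons !mem_head ezw orbT.
      + exact: ipath_conn.
      apply: connU => //; [exact: ipath_conn|exact: ipath_conn|].
      by exists z, u; rewrite !in_set !mem_rcons !mem_head ezu orbT.
    - by rewrite inT' c1m orbT.
    - by rewrite inT' c2m !orbT.
    by rewrite inT' c3m.
  case: m E2 => [|a m] E2.
    apply: (tf ezu _ ezw); have := ipath_catr ip'; rewrite E2 => /ipath_head -> //=; by rewrite ?mem_head ?eqxx.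
  have aP : a \in c1 :: p by rewrite E E2 mem_cat !inE eqxx !orbT.
  have : a \in T' by rewrite ET sp.
  rewrite inT' => /or3P[/rp'|as1|as3]; first by rewrite aP.
    move: u'; rewrite -cat_rcons cat_uniq => /and3P[_ /hasPn/(_ a) + _]; rewrite E2 mem_head as1 => /(_ isT) //.
  move: u'; rewrite E2 cat_uniq /= => /and4P[_ _ _ /andP[+ _]].
  by rewrite mem_cat as3 orbT.
have [p1 p2] := split_paths ip'.
have ir' : ipath e (z :: rev r) by rewrite -rev_rcons ipath_rev.
have pm : perm_eq ((c1 :: p) ++ rcons r z) (u :: rev s1 ++ s2 ++ z :: rev r).
  rewrite E -rev_rcons catA -cat_cons; apply: perm_cat; first exact: split_perm.
  by rewrite perm_sym perm_rev.
exists u, (rev s1), s2, (z :: rev r); split => //.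
- rewrite -(perm_uniq pm) cat_uniq up (ipath_uniq ir) andbT /=; apply/hasPn => w /rp' //.
- by move=> w; rewrite -(perm_mem pm) mem_cat => /orP[/sp|/sr]; apply: (subsetP TA).
- split => //=; rewrite es ezu; exact: ipath_path.
- split => //=; rewrite -hz; case: (r) => //= a l; by rewrite rev_cons last_rcons.
have mix a b : a \in c1 :: p -> b \in rcons r z -> e b a -> consecutive [:: u, z & rev r] a b.
  move=> ap br eba; have bz : b = z.
    move: br; rewrite mem_rcons inE => /predU1P[//|/rp]; rewrite /F negb_or => /andP[_ /hasPn/(_ a ap)].
    by rewrite eba.
  subst b; have -> : a = u.
    move: ap; rewrite E mem_cat inE => /or3P[as1|/eqP //|/n2]; last by rewrite eba.
    by have := hasPn n1 a as1; rewrite eba.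
  by apply/orP; left; apply/infixP; exists [::], (rev r).
move=> a b; rewrite -!(perm_mem pm) !mem_cat => /orP[ap|ar] /orP[bp|br] eab.
- by rewrite E in ap bp; case/orP: (split_consecutive ip' ap bp eab) => ->; rewrite ?orbT.
- by rewrite mix ?orbT // es.
- by have := mix b a bp ar eab; rewrite /consecutive orbC => ->; rewrite !orbT.
have := ipath_consecutive ir ar br eab; rewrite -consecutive_rev rev_rcons => h.
by have := consecutive_cat [:: u] [::] h; rewrite cats0 => ->; rewrite !orbT.
Qed.

End Tripod.

(** Repetitions among [a], [b], [c] are allowed, so that degrees two and three are treated alike. *)
Lemma set3_of_card (T : finType) (N : {set T}) : N != set0 -> #|N| <= 3 ->
  exists a b c, N = [set a; b; c].
Proof.
have E : N =i enum N by move=> z; rewrite mem_enum.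
rewrite -cards_eq0 cardE; case: (enum N) E => [|a [|b [|c [|]]]] //= E _ _.
- by exists a, a, a; apply/setP => z; rewrite E !inE !orbb.
- by exists a, a, b; apply/setP => z; rewrite E !inE orbb.
by exists a, b, c; apply/setP => z; rewrite E !inE orbA.
Qed.

Lemma infix_nil_pair (T : eqType) (f u v : T) : infix [:: u; v] [:: f] = false.
Proof. by apply/negP => /size_infix. Qed.

(** * From a minor model to an induced subdivision *)

Section Subdivide.
Variables (V : finType) (e : rel V) (W : {set V}) (F : sgraph) (C : F -> {set V}).
Hypothesis es : symmetric e.
Hypothesis ei : irreflexive e.
Hypothesis tf : forall x y z, e x y -> e y z -> e x z -> False.
Hypothesis cC : forall x, conn e (C x).
Hypothesis CW : forall x, C x \subset W.
Hypothesis dC : forall x y z, z \in C x -> z \in C y -> x = y.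
Hypothesis aC : forall x y, x -- y -> adjacent e (C x) (C y).
Hypothesis heavy : forall x u w, u \in C x -> w \in W -> e u w ->
  branching e W u -> branching e W w -> w \in C x.
Hypothesis deg2 : forall x : F, 2 <= degree x.
Hypothesis deg3 : forall x : F, degree x <= 3.

(** [f] is the branch vertex inside [C x], and [Q y] is the leg from it to the contact [c y] with
    the branch set of [y], without [f] itself; it is empty when that contact is [f]. *)
Definition star (x : F) (c : F -> V) (f : V) (Q : F -> seq V) : Prop :=
  [/\ f \in C x,
      forall y, x -- y -> [/\ path e f (Q y), last f (Q y) = c y, {subset Q y <= C x} & uniq (f :: Q y)],
      forall y y' z, x -- y -> x -- y' -> z \in Q y -> z \in Q y' -> y = y' &
      forall u v, (u = f \/ exists2 y, x -- y & u \in Q y) -> (v = f \/ exists2 y, x -- y & v \in Q y) ->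
        e u v -> exists2 y, x -- y & consecutive (f :: Q y) u v].

Lemma star_exists x (c : F -> V) : (forall y, x -- y -> c y \in C x) -> exists f Q, star x c f Q.
Proof.
move=> Hc.
have N0 : neighbors x != set0 by rewrite -card_gt0; apply: leq_trans (deg2 x).
have [y1 [y2 [y3 EN]]] := set3_of_card N0 (deg3 x).
have NE y : (x -- y) = [|| y == y1, y == y2 | y == y3].
  by have := in_set (fun y => x -- y) y; rewrite -/(neighbors x) EN !inE orbA => ->.
have n1 : x -- y1 by rewrite NE eqxx.
have n2 : x -- y2 by rewrite NE eqxx orbT.
have n3 : x -- y3 by rewrite NE eqxx !orbT.
have [f [q1 [q2 [q3 [uq sub [p1 p2 p3] [l1 l2 l3] H]]]]] := tripod es ei tf (@cC x) (Hc _ n1) (Hc _ n2) (Hc _ n3).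
have [u1 u2 u3 [d12 d13 d23]] : [/\ uniq (f :: q1), uniq (f :: q2), uniq (f :: q3) & [/\
   forall z, z \in q1 -> z \in q2 -> False, forall z, z \in q1 -> z \in q3 -> False &
   forall z, z \in q2 -> z \in q3 -> False]].
  move: uq; rewrite /= !mem_cat !negb_or !cat_uniq has_cat negb_or.
  move=> /andP[/and3P[-> -> ->] /and3P[-> /andP[/hasPn h1 /hasPn h2] /and3P[-> /hasPn h3 ->]]].
  split => //; split => z z1 z2; [have := h1 z z2|have := h2 z z2|have := h3 z z2]; by rewrite /= z1.
(* For a repeated neighbour two legs of the tripod have the same end. Being disjoint, the second is
   empty, so dropping it loses nothing. *)
have same q q' : last f q = last f q' -> uniq (f :: q) -> uniq (f :: q') ->
    (forall z, z \in q -> z \in q' -> False) -> q' = [::].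
  move=> E uf uf' d; case: (q' =P [::]) => // /eqP q'N.
  have h' := mem_last_nonempty f q'N.
  case: (q =P [::]) => [q0|/eqP qN].
    by move: uf'; rewrite /= -[X in X \notin _]/(last f [::]) -q0 E h'.
  by case: (d (last f q')) => //; rewrite -E mem_last_nonempty.
pose Q y := if y == y1 then q1 else if y == y2 then q2 else q3.
have Q1 : Q y1 = q1 by rewrite /Q eqxx.
have Q2 : q2 != [::] -> Q y2 = q2.
  rewrite /Q eqxx; case: (y2 =P y1) => // E; case/negP; apply/eqP.
  by apply: (same q1 q2) => //; rewrite l1 l2 E.
have Q3 : q3 != [::] -> Q y3 = q3.
  rewrite /Q; case: (y3 =P y1) => [E|_].
    by case/negP; apply/eqP; apply: (same q1 q3) => //; rewrite l1 l3 E.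
  case: (y3 =P y2) => // E; case/negP; apply/eqP.
  by apply: (same q2 q3) => //; rewrite l2 l3 E.
have sub' q : {subset q <= q1 ++ q2 ++ q3} -> {subset q <= C x}.
  by move=> s z /s h; apply: sub; rewrite inE h orbT.
have s1 : {subset q1 <= q1 ++ q2 ++ q3} by move=> z h; rewrite mem_cat h.
have s2 : {subset q2 <= q1 ++ q2 ++ q3} by move=> z h; rewrite !mem_cat h orbT.
have s3 : {subset q3 <= q1 ++ q2 ++ q3} by move=> z h; rewrite !mem_cat h !orbT.
have QP y : x -- y -> [/\ path e f (Q y), last f (Q y) = c y, {subset Q y <= q1 ++ q2 ++ q3} & uniq (f :: Q y)].
  rewrite NE /Q; case: eqP => [-> _|_]; first by split.
  by case: eqP => [-> _|_ /eqP ->]; split.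
exists f, Q; split.
- by apply: sub; rewrite mem_head.
- by move=> y /QP[h1 h2 h3 h4]; split => //; apply: sub'.
- have Qc y : x -- y -> [\/ y = y1 /\ Q y = q1, y = y2 /\ Q y = q2 | y = y3 /\ Q y = q3].
    rewrite NE /Q; case: eqP => [-> _|_]; first by constructor 1.
    by case: eqP => [-> _|_ /eqP ->]; [constructor 2|constructor 3].
  move=> y y' z /Qc[] -[-> ->] /Qc[] -[-> ->] // z1 z2.
  + by case: (d12 z).
  + by case: (d13 z).
  + by case: (d12 z).
  + by case: (d23 z).
  + by case: (d13 z).
  by case: (d23 z).
have inT u : (u = f \/ exists2 y, x -- y & u \in Q y) -> u \in f :: q1 ++ q2 ++ q3.
  case=> [->|[y xy uQ]]; first exact: mem_head.
  by rewrite inE; have [_ _ s _] := QP y xy; rewrite (s _ uQ) orbT.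
move=> u v /inT uT /inT vT euv.
have nn q : consecutive (f :: q) u v -> q != [::].
  by case: q => //; rewrite /consecutive !infix_nil_pair.
case/or3P: (H u v uT vT euv) => h.
- by exists y1; rewrite ?Q1.
- by exists y2; rewrite ?Q2 ?(nn _ h).
by exists y3; rewrite ?Q3 ?(nn _ h).
Qed.

(** Each edge of [F] occurs in both orientations; the order given by [enum_rank] makes both use the
    same edge between the branch sets. *)
Lemma contact_exists : exists c : F -> F -> V, forall x y, x -- y -> c x y \in C x /\ e (c x y) (c y x).
Proof.
have nbr0 (x : F) : exists y, x -- y.
  have : neighbors x != set0 by rewrite -card_gt0; apply: leq_trans (deg2 x).
  by case/set0Pn => y; rewrite inE; exists y.
have HK (p : F * F) : exists w : V * V, p.1 -- p.2 -> [/\ w.1 \in C p.1, w.2 \in C p.2 & e w.1 w.2].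
  case: (boolP (p.1 -- p.2)) => [h|_].
    by have [u [w [uC wC euw]]] := aC h; exists (u, w).
  by have [y xy] := nbr0 p.1; have [u [w _]] := aC xy; exists (u, w).
have [K {}HK] := choice HK.
exists (fun x y => if enum_rank x < enum_rank y then (K (x, y)).1 else (K (y, x)).2) => x y xy.
have yx : y -- x by rewrite edge_sym.
have ne : x != y by apply: contraTneq xy => ->; rewrite edge_irrefl.
have [h1 h2 h3] := HK (x, y) xy; have [k1 k2 k3] := HK (y, x) yx.
case: (ltngtP (enum_rank x) (enum_rank y)) => // [lt|E].
  by rewrite es.
by move: ne; rewrite (enum_rank_inj (val_inj E)) eqxx.
Qed.

(** [is_subdivision] phrased for a vertex set and a relation, which postpones the passage to the
    type of the induced subgraph. *)
Definition subdivided (A : {set V}) (phi : F -> V) (P : F -> F -> seq V) : Prop :=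
  let full x y := phi x :: rcons (P x y) (phi y) in
  [/\ injective phi /\ (forall x y z, x -- y -> z \in full x y -> z \in A),
      forall x y, x -- y ->
        [/\ path e (phi x) (rcons (P x y) (phi y)), uniq (P x y), P y x = rev (P x y)
          & forall z, phi z \notin P x y],
      forall x y x' y', x -- y -> x' -- y' ->
        [set x; y] != [set x'; y'] -> ~~ has (mem (P x y)) (P x' y'),
      forall u, u \in A -> (exists x, u = phi x) \/ (exists x y, x -- y /\ u \in P x y)
    & forall u v, u \in A -> v \in A -> e u v ->
        exists x y, x -- y /\ infix [:: u; v] (full x y) ].

Lemma subdivide : exists (A : {set V}) phi P, A \subset W /\ subdivided A phi P.
Proof.
have [c Hc] := contact_exists.
have exS x : exists s : V * (F -> seq V), star x (c x) s.1 s.2.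
  have [|f [Q S]] := @star_exists x (c x); first by move=> y /Hc[].
  by exists (f, Q).
have [S HS] := choice exS.
pose phi x := (S x).1; pose Q x := (S x).2.
have phiC x : phi x \in C x by have [] := HS x.
have QP x y : x -- y -> [/\ path e (phi x) (Q x y), last (phi x) (Q x y) = c x y, {subset Q x y <= C x} & uniq (phi x :: Q x y)].
  by have [_ h _ _] := HS x; apply: h.
have Qd x y y' z : x -- y -> x -- y' -> z \in Q x y -> z \in Q x y' -> y = y'.
  by have [_ _ h _] := HS x; apply: h.
have yx (x y : F) : x -- y -> y -- x by rewrite edge_sym.
have xny (x y : F) : x -- y -> x != y by move=> xy; apply: contraTneq xy => ->; rewrite edge_irrefl.
pose P x y := Q x y ++ rev (Q y x).
have Prev x y : P y x = rev (P x y) by rewrite /P rev_cat revK.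
have full_eq x y : phi x :: rcons (P x y) (phi y) = (phi x :: Q x y) ++ rev (phi y :: Q y x).
  by rewrite /P rev_cons -cats1 -!cats1 -catA.
have full_rev x y : phi y :: rcons (P y x) (phi x) = rev (phi x :: rcons (P x y) (phi y)).
  by rewrite !full_eq rev_cat revK.
pose T x : {set V} := [set z | (z == phi x) || [exists y, (x -- y) && (z \in Q x y)]].
have TP x z : reflect (z = phi x \/ exists2 y, x -- y & z \in Q x y) (z \in T x).
  rewrite inE; apply: (iffP orP).
    by case=> [/eqP|/existsP[y /andP[xy zQ]]]; [left|right; exists y].
  by case=> [->|[y xy zQ]]; [left|right; apply/existsP; exists y; rewrite xy].
have TC x : {subset T x <= C x}.
  by move=> z /TP[->//|[y xy zQ]]; have [_ _ s _] := QP x y xy; apply: s.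
pose A := \bigcup_x T x.
have TA x z : z \in T x -> z \in A by move=> h; apply/bigcupP; exists x.
have AP z : z \in A -> exists x, z \in T x by case/bigcupP => x _ h; exists x.
have phiT x : phi x \in T x by apply/TP; left.
have QT x y z : x -- y -> z \in Q x y -> z \in T x by move=> xy zQ; apply/TP; right; exists y.
have cT x y : x -- y -> c x y \in T x.
  move=> xy; have [_ <- _ _] := QP x y xy; have := mem_last (phi x) (Q x y).
  by rewrite inE => /predU1P[->//|]; apply: QT.
have fullT x y z : x -- y -> z \in phi x :: rcons (P x y) (phi y) -> z \in T x \/ z \in T y.
  move=> xy; rewrite full_eq mem_cat mem_rev (in_cons (phi x)) (in_cons (phi y)) =>
    /orP[]/predU1P[->|zQ]; [by left; apply: phiT| |by right; apply: phiT|].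
    by left; apply: QT zQ.
  by right; apply: QT zQ; apply: yx.
have TW x z : z \in T x -> z \in W by move=> /TC; apply: (subsetP (CW x)).
have contact_full x y : x -- y -> infix [:: c x y; c y x] (phi x :: rcons (P x y) (phi y)).
  move=> xy; rewrite full_eq; have [_ l1 _ _] := QP x y xy; have [_ l2 _ _] := QP y x (yx _ _ xy).
  rewrite [phi x :: Q x y]lastI [phi y :: _]lastI l1 l2 rev_rcons; apply/infixP.
  exists (belast (phi x) (Q x y)), (rev (belast (phi y) (Q y x))).
  by rewrite -cats1 -catA.
have Ppath x y : x -- y -> path e (phi x) (rcons (P x y) (phi y)).
  move=> xy; have [p1 l1 _ _] := QP x y xy; have [p2 l2 _ _] := QP y x (yx _ _ xy).
  rewrite /P rcons_cat cat_path p1 l1 /= -rev_cons [phi y :: _]lastI l2 rev_rcons /=.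
  have [_ ->] := Hc x y xy.
  have : sorted e (rev (phi y :: Q y x)).
    rewrite rev_sorted; apply: sub_sorted (_ : sorted e (phi y :: Q y x)) => // a b; by rewrite es.
  by rewrite [phi y :: _]lastI l2 rev_rcons.
exists A, phi, P; split.
  by apply/subsetP => z /AP[x /TW].
split.
- split; last by move=> x y z xy /(fullT _ _ _ xy)[]; apply: TA.
  by move=> x y E; apply: (dC (phiC x)); rewrite E.
- move=> x y xy; have [_ _ s1 u1] := QP x y xy; have [_ _ s2 u2] := QP y x (yx _ _ xy).
  split => //; first exact: Ppath.
    move: u1 u2 => /= /andP[_ u1] /andP[_ u2]; rewrite /P cat_uniq u1 rev_uniq u2 andbT /=.
    apply/hasPn => z; rewrite mem_rev => zQ; apply/negP => zQ'.
    by move: (xny _ _ xy); rewrite (dC (s1 _ zQ') (s2 _ zQ)) eqxx.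
  move=> z; rewrite /P mem_cat mem_rev negb_or; apply/andP; split; apply/negP => h.
    have E := dC (s1 _ h) (phiC z); subst z; move: u1; by rewrite /= h.
  have E := dC (s2 _ h) (phiC z); subst z; move: u2; by rewrite /= h.
- move=> x y x' y' xy xy' ne; apply/hasPn => z zP'; apply/negP => zP.
  have [_ _ s1 _] := QP x y xy; have [_ _ s2 _] := QP y x (yx _ _ xy).
  have [_ _ s3 _] := QP x' y' xy'; have [_ _ s4 _] := QP y' x' (yx _ _ xy').
  case/negP: ne; apply/eqP; move: zP zP'; rewrite /P /= !mem_cat !mem_rev => /orP[z1|z1] /orP[z2|z2].
  + have E := dC (s1 _ z1) (s3 _ z2); subst x'; by rewrite (Qd _ _ _ _ xy xy' z1 z2).
  + have E := dC (s1 _ z1) (s4 _ z2); subst y'; by rewrite (Qd _ _ _ _ xy (yx _ _ xy') z1 z2) setUC.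
  + have E := dC (s2 _ z1) (s3 _ z2); subst x'; by rewrite (Qd _ _ _ _ (yx _ _ xy) xy' z1 z2) setUC.
  have E := dC (s2 _ z1) (s4 _ z2); subst y'; by rewrite (Qd _ _ _ _ (yx _ _ xy) (yx _ _ xy') z1 z2).
- move=> u /AP[x /TP[->|[y xy uQ]]]; [by left; exists x|right; exists x, y].
  by split => //; rewrite /P mem_cat uQ.
have consf x y u v : x -- y -> consecutive (phi x :: Q x y) u v ->
    exists x y, x -- y /\ infix [:: u; v] (phi x :: rcons (P x y) (phi y)).
  move=> xy /(consecutive_cat [::] (rev (phi y :: Q y x))); rewrite cat0s -full_eq => /orP[h|h].
    by exists x, y.
  exists y, x; split; first exact: yx.
  by rewrite full_rev -[[:: u; v]]/(rev [:: v; u]) infix_rev.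
move=> u v /AP[x ux] /AP[x' vx'] euv.
case: (x =P x') => [E|/eqP xx'].
  subst x'; have [_ _ _ h] := HS x.
  by have [y xy hc] := h u v (TP _ _ ux) (TP _ _ vx') euv; apply: consf hc.
case: (pselect (x -- x' /\ u = c x x' /\ v = c x' x)) => [[h1 [-> ->]]|nc].
  by exists x, x'; split => //; apply: contact_full.
exfalso.
(* every vertex of a star has two neighbours on the subdivision, so an extra edge makes it branching *)
have br y y' a b : a \in T y -> b \in T y' -> y != y' -> e a b -> ~ (y -- y' /\ a = c y y' /\ b = c y' y) -> branching e W a.
  move=> aT bT yy' eab nc'.
  have nb z : z \in T y -> z != b.
    apply: contraTneq => ->; apply/negP => h; move: yy'.
    by rewrite (dC (TC _ _ h) (TC _ _ bT)) eqxx.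
  have nb' z : y -- z -> a = c y z -> c z y != b.
    move=> yz az; apply/eqP => E; apply: nc'.
    have Ez := dC (TC _ _ (cT _ _ (yx _ _ yz))); have zy' : z = y' by apply: Ez; rewrite E; apply: TC.
    by subst z; rewrite E.
  have three p q : p != q -> p != b -> q != b -> e a p -> e a q -> p \in W -> q \in W -> branching e W a.
    move=> pq pb qb eap eaq pW qW; rewrite /branching.
    apply: (@leq_trans #|b |: [set p; q]|).
      by rewrite cardsU1 cards2 pq !inE negb_or eq_sym pb eq_sym qb.
    apply: subset_leq_card; apply/subsetP => z; rewrite !inE => /or3P[]/eqP ->.
    - by rewrite (TW y') // andbT; apply/existsP; exists a; rewrite inE eqxx.
    - by rewrite pW andbT; apply/existsP; exists a; rewrite inE eqxx.
    by rewrite qW andbT; apply/existsP; exists a; rewrite inE eqxx.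
  (* The neighbour of [a] on the way to the branch set of [z]: the following vertex of the leg, or
     the contact on the other side if [a] ends the leg. Together with [b], two such neighbours, or
     one and the preceding vertex, make [a] branching. *)
  have next z s1 s2 : y -- z -> phi y :: Q y z = rcons s1 a ++ s2 ->
      [/\ head (c z y) s2 != b, e a (head (c z y) s2) & head (c z y) s2 \in W].
    move=> yz E; have [p1 l1 sQ _] := QP y z yz; have [_ ecc] := Hc y z yz.
    case: s2 E => [|d s2] E /=.
      have al : a = c y z.
        have := congr1 (last a) E; by rewrite cats0 last_rcons /= l1.
      by rewrite nb' // al ecc (TW z) //; apply: cT; apply: yx.
    have dT : d \in T y.
      have : d \in phi y :: Q y z by rewrite E mem_cat mem_head orbT.
      by rewrite inE => /predU1P[->//|]; apply: QT.
    have sE : sorted e (phi y :: Q y z) by [].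
    rewrite (nb d dT) (TW y) //; split => //.
    by move: sE; rewrite E cat_rcons => /cat_sorted2[_ /= /andP[]].
  case: (TP _ _ aT) => [ay|[z yz aQ]].
    have /card_gt1P[z1 [z2 [z1N z2N z12]]] := deg2 y.
    rewrite !inE in z1N z2N.
    have E0 z : phi y :: Q y z = rcons [::] a ++ Q y z by rewrite /= ay.
    have [h1 h2 h3] := next z1 [::] (Q y z1) z1N (E0 z1); have [k1 k2 k3] := next z2 [::] (Q y z2) z2N (E0 z2).
    have hin z : y -- z -> head (c z y) (Q y z) \in Q y z \/ head (c z y) (Q y z) = c z y.
      by move=> _; case: (Q y z) => [|d l]; [right|left; apply: mem_head].
    apply: (three _ _ _ h1 k1 h2 k2 h3 k3).
    apply/eqP => E.
    have cnT z : y -- z -> c z y \notin T y.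
      move=> yz; apply/negP => h; move: (xny _ _ yz); rewrite (dC (TC _ _ h) (TC _ _ (cT _ _ (yx _ _ yz)))) eqxx //.
    case: (hin z1 z1N) => a1; case: (hin z2 z2N) => a2.
    - by move: z12; rewrite (Qd _ _ _ _ z1N z2N a1 _) ?eqxx // E.
    - by move: (cnT z2 z2N); rewrite -a2 -E (QT y z1).
    - by move: (cnT z1 z1N); rewrite -a1 E (QT y z2).
    have := cT _ _ (yx _ _ z1N); rewrite -a1 E a2 => h.
    by move: z12; rewrite (dC (TC _ _ h) (TC _ _ (cT _ _ (yx _ _ z2N)))) eqxx.
  have [s1 [s2 E]] := mem_split aQ.
  have [p1 l1 sQ u1] := QP y z yz.
  have E2 : phi y :: Q y z = rcons (phi y :: s1) a ++ s2 by rewrite /= cat_rcons -E.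
  have [h1 h2 h3] := next z _ _ yz E2.
  pose pr := last (phi y) s1.
  have prT : pr \in T y.
    have : pr \in phi y :: s1 by apply: mem_last.
    rewrite inE => /predU1P[->//|h]; apply: (QT y z) => //; by rewrite E mem_cat h.
  apply: (three pr _ _ _ h1 _ h2 _ h3).
  - apply/eqP => Ep; case: s2 E E2 {h1 h2 h3} Ep => [|d s2] E E2 /= Ep.
      have h := cT _ _ (yx _ _ yz); rewrite -Ep in h.
      by move: (xny _ _ yz); rewrite (dC (TC _ _ prT) (TC _ _ h)) eqxx.
    have := u1; rewrite E -cat_cons cat_uniq => /and3P[_ /hasPn/(_ d) + _].
    by rewrite !inE eqxx orbT /= -Ep => /(_ isT); rewrite -in_cons mem_last.
  - exact: nb.
  - by move: p1; rewrite E cat_path /= es => /and3P[_ ->].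
  exact: (TW y).
have bu := br x x' u v ux vx' xx' euv nc.
have evu : e v u by rewrite es.
have bv : branching e W v.
  apply: (br x' x v u vx' ux _ evu); first by rewrite eq_sym.
  by case=> h1 [h2 h3]; apply: nc; rewrite h2 h3; split; [apply: yx|].
have := heavy (TC _ _ ux) (TW _ _ vx') euv bu bv => vC.
by move: xx'; rewrite (dC vC (TC _ _ vx')) eqxx.
Qed.

End Subdivide.

Section Induced.
Variables (G F : sgraph) (e : rel G) (A : {set G}) (phi : F -> G) (P : F -> F -> seq G).
Hypothesis eE : forall u v, u \in A -> v \in A -> e u v = (u -- v).
Hypothesis sub : subdivided e A phi P.
Hypothesis nb : forall x : F, exists y, x -- y.

Let H := induced A.
Let lift (s : seq G) : seq H := pmap insub s.

Let val_lift s : {subset s <= A} -> map val (lift s) = s.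
Proof.
elim: s => //= z s IH sA; have zA : z \in A by apply: sA; rewrite mem_head.
by rewrite /lift /= insubT /= IH // => y ys; apply: sA; rewrite inE ys orbT.
Qed.

Let lift_val (s : seq H) : lift (map val s) = s.
Proof. by elim: s => //= z s IH; rewrite /lift /= valK /= -/(lift _) IH. Qed.

Let path_val (x : H) s : path (@edge H) x s = path e (val x) (map val s).
Proof. by elim: s x => //= y s IH x; rewrite IH eE ?(valP x) ?(valP y). Qed.

Lemma is_subdivision_induced : is_subdivision F H.
Proof.
have [[phiI fullA] HP dP cov edg] := sub.
have phiA x : phi x \in A by have [y xy] := nb x; apply: (fullA x y) => //; apply: mem_head.
pose phi' x : H := Sub (phi x) (phiA x).
have PA x y : x -- y -> {subset P x y <= A}.
  by move=> xy z zP; apply: (fullA x y) => //; rewrite inE mem_rcons inE zP !orbT.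
have vP x y : x -- y -> map val (lift (P x y)) = P x y by move=> /PA /val_lift.
have inP x y (z : H) : x -- y -> (z \in lift (P x y)) = (val z \in P x y).
  by move=> xy; rewrite -(mem_map val_inj) vP.
have yx (x y : F) : x -- y -> y -- x by rewrite edge_sym.
exists phi', (fun x y => lift (P x y)); split.
- by move=> x y /(congr1 val) /= /phiI.
- move=> x y xy; have [p u r n] := HP x y xy; split.
  + by rewrite path_val map_rcons vP.
  + by rewrite -(map_inj_uniq val_inj) vP.
  + by apply: (inj_map val_inj); rewrite map_rev (vP _ _ xy) (vP _ _ (yx _ _ xy)).
  by move=> z; rewrite inP //; apply: n.
- move=> x y x' y' xy xy' ne; apply/hasPn => z; rewrite inP // => zP'; rewrite /= inP //.
  by have := hasPn (dP _ _ _ _ xy xy' ne) _ zP'.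
- move=> u; case: (cov (val u) (valP u)) => [[x E]|[x [y [xy uP]]]].
    by left; exists x; apply: val_inj.
  by right; exists x, y; rewrite inP.
move=> u v; have -> : (u -- v) = e (val u) (val v) by rewrite eE ?(valP u) ?(valP v).
move=> euv.
have [x [y [xy /infixP[s1 [s2 E]]]]] := edg _ _ (valP u) (valP v) euv.
exists x, y; split => //; apply/infixP; exists (lift s1), (lift s2).
have {}E : map val (phi' x :: rcons (lift (P x y)) (phi' y)) = s1 ++ [:: val u; val v] ++ s2.
  by rewrite /= map_rcons vP.
rewrite -[LHS]lift_val E /lift !pmap_cat; congr (_ ++ (_ ++ _)).
by rewrite -[RHS]lift_val.
Qed.

End Induced.

(** * Walls in grids *)

Section Wall.
Variable k : nat.
Hypothesis k1 : 1 < k.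

(* The positions of [gamma k] without a neighbour in another row. *)
Definition flat i j := ((i == 0) && odd j) || ((i.+1 == k) && odd (k + j)).

Lemma gammaE (x y : gamma k) : (x -- y) =
  [|| (x.1 == y.1 :> nat) && (y.2 == x.2.+1 :> nat), (x.1 == y.1 :> nat) && (x.2 == y.2.+1 :> nat),
      [&& y.1 == x.1.+1 :> nat, y.2 == x.2 :> nat & odd (x.1.+1 + x.2)] |
      [&& x.1 == y.1.+1 :> nat, y.2 == x.2 :> nat & odd (y.1.+1 + y.2)]].
Proof.
rewrite /edge /= /gamma_edge /gamma_arc /row_number !eqSS [x.2 == y.2]eq_sym.
rewrite -!val_eqE /= [val y.1 == val x.1]eq_sym.
by case: (_ == _); case: (_ == _); case: (_ == _); case: (_ == _); rewrite ?orbT ?orbF //=; lia.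
Qed.

Lemma edge_flat (x y : gamma k) : x -- y -> (x.1 : nat) <> y.1 -> ~~ flat x.1 x.2.
Proof.
rewrite gammaE /flat; have := ltn_ord x.1; have := ltn_ord y.1.
move: (x.1 : nat) (y.1 : nat) (x.2 : nat) (y.2 : nat) k1 => i i' j j' + + +; clear.
move=> h1 h2 h3 h4 ne; lia.
Qed.

Lemma vertical (x : gamma k) : ~~ flat x.1 x.2 -> exists y : gamma k, x -- y /\ (x.1 : nat) <> y.1.
Proof.
case: x => i j; case: (boolP (odd (i + j))) => oij.
  case: i oij => [[|i] ik] oij; first by rewrite /flat /= oij.
  move=> _; have ik' : i < k by apply: ltnW.
  exists (Ordinal ik', j); split; last by rewrite /=; clear; lia.
  apply: etrans (@gammaE (Ordinal ik, j) (Ordinal ik', j)) _.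
  by apply/or4P; constructor 4; rewrite /= !eqxx.
case: (ltnP i.+1 k) => ik.
  move=> _; exists (Ordinal ik, j); split; last by rewrite /=; clear; lia.
  apply: etrans (@gammaE (i, j) (Ordinal ik, j)) _.
  by apply/or4P; constructor 3; rewrite /= !eqxx.
by rewrite /flat /=; have := ltn_ord i; move: oij ik k1; clear; lia.
Qed.

Lemma vertical_unique (x y y' : gamma k) : x -- y -> x -- y' -> (x.1 : nat) <> y.1 -> (x.1 : nat) <> y'.1 -> y = y'.
Proof.
rewrite !gammaE => h h' ne ne'.
suff [E1 E2] : (y.1 : nat) = y'.1 /\ (y.2 : nat) = y'.2.
  by case: y y' E1 E2 {h h' ne ne'} => a b [a' b'] /= /val_inj -> /val_inj ->.
move: h h' ne ne'; clear; lia.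
Qed.

Lemma horizontal (x : gamma k) : exists y : gamma k, x -- y /\ (x.1 : nat) = y.1.
Proof.
case: x => i j; case: (ltnP j.+1 (2 * k)) => jk.
  exists (i, Ordinal jk); split => //; apply: etrans (@gammaE (i, j) (i, Ordinal jk)) _.
  by rewrite /= !eqxx.
have j0 : j.-1 < 2 * k by have := ltn_ord j; lia.
exists (i, Ordinal j0); split => //; apply: etrans (@gammaE (i, j) (i, Ordinal j0)) _.
by rewrite /= eqxx; have := ltn_ord j; move: jk k1; clear; lia.
Qed.

Lemma trimmed_mem (x : gamma k) : ~~ flat x.1 x.2 -> x \in [set x : gamma k | degree x != 1].
Proof.
move=> nf; rewrite inE; have [y [xy ny]] := vertical nf; have [y' [xy' ny']] := horizontal x.
suff : 1 < degree x by case: (degree x) => [|[]].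
by apply/card_gt1P; exists y, y'; rewrite !inE; split => //; apply/eqP => E; apply: ny; rewrite E ny'.
Qed.

Lemma suppressible_flat (s : trimmed_gamma k) : s \in suppressible k -> flat (val s).1 (val s).2.
Proof.
rewrite inE => /andP[_ /forall_inP H]; apply: contraT => nf.
have [y [sy ny]] := vertical nf.
have ys : y -- val s by rewrite edge_sym.
have nfy : ~~ flat y.1 y.2 by apply: (edge_flat ys); apply/nesym.
pose y' : trimmed_gamma k := Sub y (trimmed_mem nfy).
have : y' \in neighbors s by rewrite inE.
by move=> /H; rewrite /wall_row /row_number eqSS => /eqP h; case: ny; rewrite -h.
Qed.

Lemma flat_suppressible (s : trimmed_gamma k) : flat (val s).1 (val s).2 -> s \in suppressible k.
Proof.
move=> fl; rewrite inE /wall_row /row_number; apply/andP; split.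
  by move: fl; rewrite /flat eqSS => /orP[]/andP[-> _]; rewrite ?orbT.
apply/forall_inP => y; rewrite inE => sy; rewrite eqSS; apply: contraT => ne.
by move: fl; rewrite (negbTE (edge_flat sy _)) // => E; rewrite E eqxx in ne.
Qed.

Definition coord (w : wall k) : gamma k := val (val w).

Lemma coord_inj : injective coord.
Proof. by move=> w w' E; apply/val_inj/val_inj. Qed.

Lemma wall_flat w : ~~ flat (coord w).1 (coord w).2.
Proof. by apply/negP => /flat_suppressible h; have := valP w; rewrite inE h. Qed.

(** A nonflat position has a vertical and a horizontal neighbour, so it survives trimming, and the
    vertical one prevents suppression. With [wall_flat], the vertices of the wall are the nonflat
    positions. *)
Lemma wall_vertex (x : gamma k) : ~~ flat x.1 x.2 -> exists w, coord w = x.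
Proof.
move=> nf; pose y : trimmed_gamma k := Sub x (trimmed_mem nf).
have yS : y \in ~: suppressible k by rewrite inE; apply/negP => /suppressible_flat h; case/negP: (nf).
by exists (Sub y yS).
Qed.

Lemma flat_row (x y : gamma k) : flat x.1 x.2 -> x -- y -> (x.1 : nat) = y.1.
Proof.
move=> fl xy; apply/eqP; apply: contraT => /eqP ne.
by move: fl; rewrite (negbTE (edge_flat xy ne)).
Qed.

(** A suppressed vertex is flat, so its two neighbours lie in its own row, one on each side of
    it. *)
Lemma wall_edge w w' : w -- w' -> coord w -- coord w' \/ [/\ ((coord w).1 : nat) = (coord w').1 &
  (coord w').2 = (coord w).2.+2 :> nat /\ flat (coord w).1 (coord w).2.+1 \/
  (coord w).2 = (coord w').2.+2 :> nat /\ flat (coord w').1 (coord w').2.+1].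
Proof.
move=> /andP[ne /orP[h|/exists_inP[s sS /eqP E]]]; [by left|right].
have fl := suppressible_flat sS.
have n1 : s -- val w by have : val w \in neighbors s; [rewrite E !inE eqxx|rewrite inE].
have n2 : s -- val w' by have : val w' \in neighbors s; [rewrite E !inE eqxx orbT|rewrite inE].
have r1 := flat_row fl n1; have r2 := flat_row fl n2.
have ne' : coord w <> coord w' by move=> /coord_inj h; rewrite h eqxx in ne.
have ne2 : ((coord w).2 : nat) <> (coord w').2.
  move=> E2; apply: ne'; have E1 : ((coord w).1 : nat) = (coord w').1 by rewrite /coord -r1.
  by move: E1 E2; rewrite (surjective_pairing (coord w)) (surjective_pairing (coord w')) /= => /val_inj -> /val_inj ->.
have n1' : val s -- coord w := n1; have n2' : val s -- coord w' := n2.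
rewrite /coord in ne2 n1' n2' *; move: n1' n2'; rewrite !gammaE.
move: r1 r2 fl ne2; move: (val (val w)) (val (val w')) (val s) => x y z.
move: (x.1 : nat) (y.1 : nat) (z.1 : nat) (x.2 : nat) (y.2 : nat) (z.2 : nat) => i i' i'' j j' j'' <- <- fl ne2 h1 h2.
split => //.
have [[Ea Eb]|[Ea Eb]] : (j'' = j.+1 /\ j' = j''.+1) \/ (j'' = j'.+1 /\ j = j''.+1) by lia.
  by left; rewrite Eb Ea; split => //; rewrite -Ea.
by right; rewrite Eb Ea; split => //; rewrite -Ea.
Qed.

Lemma wall_edge_gamma w w' : coord w -- coord w' -> w -- w'.
Proof.
move=> h; apply/andP; split; last by apply/orP; left.
by apply: contraTneq h => ->; rewrite edge_irrefl.
Qed.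

Lemma wall_edge_flat w w' : ((coord w).1 : nat) = (coord w').1 -> (coord w').2 = (coord w).2.+2 :> nat ->
  flat (coord w).1 (coord w).2.+1 -> w -- w'.
Proof.
move=> r c fl; have jk : (coord w).2.+1 < 2 * k.
  by have := ltn_ord (coord w').2; rewrite c => /ltnW.
pose x : gamma k := ((coord w).1, Ordinal jk).
have xw : x -- coord w by rewrite gammaE /= !eqxx orbT.
have xw' : x -- coord w' by rewrite gammaE /= r c !eqxx.
have ne : coord w != coord w'.
  by apply/eqP => E; move: c; rewrite E; clear; lia.
(* The flat position between [w] and [w'] has both as neighbours, so it is not trimmed, and it is
   then suppressed. *)
have xT : x \in [set x : gamma k | degree x != 1].
  rewrite inE; suff : 1 < degree x by case: (degree x) => [|[]].
  by apply/card_gt1P; exists (coord w), (coord w'); rewrite !inE.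
pose s : trimmed_gamma k := Sub x xT.
have sS : s \in suppressible k by apply: flat_suppressible.
apply/andP; split; first by apply: contraNneq ne => ->.
apply/orP; right; apply/exists_inP; exists s => //; apply/eqP/setP => y; rewrite !inE.
apply/idP/orP => [sy|[]/eqP -> //].
have sy' : x -- val y by [].
have ry := flat_row (x := x) fl sy'.
have HE (z : gamma k) : x -- z -> (x.1 : nat) = z.1 ->
    (z.2 = (coord w).2 :> nat) \/ (z.2 = (coord w').2 :> nat).
  rewrite gammaE /= => h rz; move: h rz c.
  move: (z.1 : nat) (z.2 : nat) ((coord w).1 : nat) ((coord w).2 : nat) ((coord w').2 : nat) => a1 a2 a3 a4 a5.
  clear; lia.
case: (HE _ sy' ry) => E.
- left; apply/eqP/val_inj; rewrite [LHS]surjective_pairing -[RHS]/(coord w) [RHS]surjective_pairing.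
  by congr pair; apply: val_inj.
right; apply/eqP/val_inj; rewrite [LHS]surjective_pairing -[RHS]/(coord w') [RHS]surjective_pairing.
by congr pair; apply: val_inj; rewrite //= -ry.
Qed.

(** At most one neighbour is vertical, one to the left and one to the right. On the same side,
    neighbours at distance one and two exclude each other: distance two means that the position
    between them is flat. *)
Lemma wall_deg_le (w : wall k) : degree w <= 3.
Proof.
pose f (y : wall k) : 'I_3 := if ((coord w).1 != (coord y).1 :> nat) then @Ordinal 3 0 isT
  else if (coord y).2 < (coord w).2 then @Ordinal 3 1 isT else @Ordinal 3 2 isT.
rewrite /degree -[3]card_ord -(@card_in_imset _ _ f) ?max_card // => y y'; rewrite !inE => wy wy' E.
apply: coord_inj; move: E; rewrite /f.
have flat_no (x z : wall k) j : ((coord x).1 : nat) = (coord z).1 -> (coord z).2 = j :> nat -> flat (coord x).1 j -> False.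
  by move=> r c fl; have := wall_flat z; rewrite -r c fl.
have hor z : w -- z -> ((coord w).1 : nat) = (coord z).1 ->
   [\/ (coord z).2 = (coord w).2.+1 :> nat, (coord w).2 = (coord z).2.+1 :> nat,
       (coord z).2 = (coord w).2.+2 :> nat /\ flat (coord w).1 (coord w).2.+1 |
       (coord w).2 = (coord z).2.+2 :> nat /\ flat (coord z).1 (coord z).2.+1].
  move=> /wall_edge[h|[_ [[h1 h2]|[h1 h2]]]] r; [|by constructor 3|by constructor 4].
  move: h; rewrite gammaE => h; case: (ltngtP (coord w).2 (coord z).2) => c.
  - by constructor 1; move: h r c; clear; lia.
  - by constructor 2; move: h r c; clear; lia.
  by move: h r c; clear; lia.
case: (boolP ((coord w).1 != (coord y).1 :> nat)) => r; case: (boolP ((coord w).1 != (coord y').1 :> nat)) => r' //.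
- move=> _; have ge z : w -- z -> (coord w).1 != (coord z).1 :> nat -> coord w -- coord z.
    by move=> /wall_edge[//|[h _]] /eqP.
  by apply: (@vertical_unique (coord w)); [apply: ge|apply: ge|apply/eqP|apply/eqP].
- by case: ifP.
- by case: ifP.
move: r r'; rewrite !negbK => /eqP r /eqP r'.
have same : ((coord y).2 : nat) = (coord y').2 -> coord y = coord y'.
  move=> c; rewrite [LHS]surjective_pairing [RHS]surjective_pairing.
  by congr pair; apply: val_inj; rewrite //= -r.
have f' : (coord y).1 = (coord w).1 by apply: val_inj.
have f'' : (coord y').1 = (coord w).1 by apply: val_inj.
have no := @flat_no.
case: ltnP => c; case: ltnP => c' // _; apply: same.
- case: (hor y wy r) => h; case: (hor y' wy' r') => h'.
  + by move: h c; clear; lia.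
  + by move: h c; clear; lia.
  + by move: h c; clear; lia.
  + by move: h c; clear; lia.
  + by move: h' c'; clear; lia.
  + by move: h h'; clear; lia.
  + by case: h' => h' _; move: h' c'; clear; lia.
  + case: h' => h' fl; case: (flat_no y' y (coord y').2.+1) => //; last by move: h h'; clear; lia.
    by rewrite -r' -r.
  + by case: h => h _; move: h c; clear; lia.
  + by case: h => h _; move: h c; clear; lia.
  + by case: h => h _; move: h c; clear; lia.
  + by case: h => h _; move: h c; clear; lia.
  + by move: h' c'; clear; lia.
  + case: h => h fl; case: (flat_no y y' (coord y).2.+1) => //; last by move: h h'; clear; lia.
    by rewrite -r' -r.
  + by case: h' => h' _; move: h' c'; clear; lia.
  by case: h => h _; case: h' => h' _; move: h h'; clear; lia.
case: (hor y wy r) => h; case: (hor y' wy' r') => h'.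
- by rewrite h h'.
- by move: h' c'; clear; lia.
- case: h' => h' fl; by case: (flat_no w y (coord w).2.+1).
- by case: h' => h' _; move: h' c'; clear; lia.
- by move: h c; clear; lia.
- by move: h c; clear; lia.
- by move: h c; clear; lia.
- by move: h c; clear; lia.
- case: h => h fl; by case: (flat_no w y' (coord w).2.+1).
- by move: h' c'; clear; lia.
- by case: h => h _; case: h' => h' _; rewrite h h'.
- by case: h' => h' _; move: h' c'; clear; lia.
- by case: h => h _; move: h c; clear; lia.
- by case: h => h _; move: h c; clear; lia.
- by case: h => h _; move: h c; clear; lia.
by case: h => h _; move: h c; clear; lia.
Qed.

(** One neighbour is vertical. In an inner row no position is flat, so a horizontal neighbour
    remains. In the first and last row flat and nonflat positions alternate, and the second
    neighbour is at distance two, to the left if there is no room to the right. *)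
Lemma wall_deg_ge (w : wall k) : 2 <= degree w.
Proof.
have nf := wall_flat w; have [y [wy ny]] := vertical nf.
have yw : y -- coord w by rewrite edge_sym.
have nfy : ~~ flat y.1 y.2 by apply: (edge_flat yw); apply/nesym.
have [z1 E1] := wall_vertex nfy.
suff [z2 [wz2 r]] : exists z2, w -- z2 /\ ((coord w).1 : nat) = (coord z2).1.
  apply/card_gt1P; exists z1, z2; rewrite !inE; split => //.
    by apply: wall_edge_gamma; rewrite E1.
  by apply/eqP => E; apply: ny; rewrite -E1 E r.
have wk := ltn_ord (coord w).2.
case: (boolP (((coord w).1 == 0 :> nat) || ((coord w).1.+1 == k))) => bd.
  have fl j : j < 2 * k -> odd j != odd (coord w).2 -> flat (coord w).1 j.
    by move=> _; move: nf bd; rewrite /flat; clear; lia.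
  have nfl j : odd j == odd (coord w).2 -> ~~ flat (coord w).1 j.
    by move: nf; rewrite /flat !oddD => + /eqP ->.
  case: (ltnP (coord w).2.+2 (2 * k)) => jk.
    have [|z2 E2] := @wall_vertex ((coord w).1, Ordinal jk).
      by apply: nfl; rewrite /= negbK.
    have wz : w -- z2.
      apply: wall_edge_flat; [by rewrite E2|by rewrite E2|apply: fl; first exact: ltnW].
      by rewrite /=; case: (odd _).
    by exists z2; rewrite wz E2.
  have j2 : (coord w).2.-2 < 2 * k by apply: leq_ltn_trans wk; clear; lia.
  have j2' : 1 < (coord w).2 by move: jk k1; clear; lia.
  have jE : (coord w).2 = (coord w).2.-2.+2 :> nat by move: j2'; clear; lia.
  have [|z2 E2] := @wall_vertex ((coord w).1, Ordinal j2).
    by apply: nfl; rewrite /= {2}jE /= negbK.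
  have wz : z2 -- w.
    apply: wall_edge_flat; [by rewrite E2|by rewrite E2|rewrite E2 /=; apply: fl].
      by apply: leq_ltn_trans wk; rewrite [X in _ <= X]jE.
    by rewrite [in X in _ != X]jE /=; case: (odd _).
  by exists z2; rewrite edge_sym wz E2.
have nfl j : ~~ flat (coord w).1 j.
  by move: bd; rewrite /flat negb_or => /andP[/negbTE -> /negbTE ->].
have [y' [wy' r]] := horizontal (coord w).
have [|z2 E2] := @wall_vertex y'; first by rewrite -r.
by exists z2; rewrite E2; split => //; apply: wall_edge_gamma; rewrite E2.
Qed.

Section Model.
Variables (V : finType) (e : rel V) (W : {set V}) (C : nat -> nat -> {set V}).
Hypothesis es : symmetric e.
Hypothesis H1 : forall i j, i < k -> j < 2 * k -> [/\ conn e (C i j), C i j != set0 & C i j \subset W].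
Hypothesis H2 : forall i j i' j' z, i < k -> j < 2 * k -> i' < k -> j' < 2 * k ->
  z \in C i j -> z \in C i' j' -> i = i' /\ j = j'.
Hypothesis H3 : forall i j, i.+1 < k -> j < 2 * k -> adjacent e (C i j) (C i.+1 j).
Hypothesis H4 : forall i j, i < k -> j.+1 < 2 * k -> adjacent e (C i j) (C i j.+1).
Hypothesis H5 : forall i j u w, i < k -> j < 2 * k -> u \in C i j -> w \in W -> e u w ->
  branching e W u -> branching e W w -> w \in C i j.

(* A suppressed vertex joins the branch set of its left neighbour. *)
Definition wall_model (w : wall k) : {set V} := let: (i, j) := coord w in
  C i j :|: (if (j.+1 < 2 * k) && flat i j.+1 then C i j.+1 else set0).

Lemma wall_modelE w : wall_model w = C (coord w).1 (coord w).2 :|: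
  (if ((coord w).2.+1 < 2 * k) && flat (coord w).1 (coord w).2.+1 then C (coord w).1 (coord w).2.+1 else set0).
Proof. by rewrite /wall_model; case: (coord w). Qed.

Lemma wall_modelP w z : z \in wall_model w -> exists j, [/\ j < 2 * k, z \in C (coord w).1 j &
  j = (coord w).2 :> nat \/ j = (coord w).2.+1 /\ flat (coord w).1 j].
Proof.
rewrite wall_modelE => /setUP[h|].
  by exists ((coord w).2 : nat); split => //; left.
by case: ifP => [/andP[h1 h2] h|]; [exists (coord w).2.+1; split => //; right|rewrite inE].
Qed.

Lemma adjacent_sym (X Y : {set V}) : adjacent e X Y -> adjacent e Y X.
Proof. by move=> [x [y [xX yY exy]]]; exists y, x; rewrite es. Qed.

Lemma adjacent_sub (X Y X' Y' : {set V}) : X \subset X' -> Y \subset Y' -> adjacent e X Y -> adjacent e X' Y'.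
Proof. by move=> sX sY [x [y [xX yY exy]]]; exists x, y; rewrite (subsetP sX) // (subsetP sY). Qed.

Lemma wall_model_conn w : conn e (wall_model w).
Proof.
rewrite wall_modelE; have [c _ _] := H1 (ltn_ord (coord w).1) (ltn_ord (coord w).2).
case: ifP => [/andP[jk _]|_]; last by rewrite setU0.
apply: connU => //; first by have [] := H1 (ltn_ord (coord w).1) jk.
by have [x [y [xX yY exy]]] := H4 (ltn_ord (coord w).1) jk; exists x, y; rewrite exy orbT.
Qed.

Lemma wall_model_sub w : wall_model w \subset W.
Proof.
apply/subsetP => z /wall_modelP[j [jk zC _]].
by have [_ _ s] := H1 (ltn_ord (coord w).1) jk; apply: (subsetP s).
Qed.

Lemma wall_model_disjoint w w' z : z \in wall_model w -> z \in wall_model w' -> w = w'.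
Proof.
move=> /wall_modelP[j [jk zC jE]] /wall_modelP[j' [jk' zC' jE']].
have [r c] := H2 (ltn_ord _) jk (ltn_ord _) jk' zC zC'; subst j'.
have rr : (coord w).1 = (coord w').1 by apply: val_inj.
have fw := wall_flat w; have fw' := wall_flat w'.
have cc : (coord w).2 = (coord w').2 :> nat.
  case: jE jE' => [E|[E fl]] [E'|[E' fl']].
  - by rewrite -E.
  - by move: fw; rewrite -E rr fl'.
  - by move: fw'; rewrite -E' -rr fl.
  by move: E'; rewrite E => -[].
apply: coord_inj; rewrite [LHS]surjective_pairing [RHS]surjective_pairing; congr pair => //.
exact: val_inj.
Qed.

Lemma wall_model_adjacent w w' : w -- w' -> adjacent e (wall_model w) (wall_model w').
Proof.
have base x : C (coord x).1 (coord x).2 \subset wall_model x by rewrite wall_modelE subsetUl.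
have two x x' : ((coord x).1 : nat) = (coord x').1 -> (coord x').2 = (coord x).2.+2 :> nat ->
   flat (coord x).1 (coord x).2.+1 -> adjacent e (wall_model x) (wall_model x').
  move=> r c fl; have j2 := ltn_ord (coord x').2; rewrite c in j2.
  apply: (@adjacent_sub (C (coord x).1 (coord x).2.+1) (C (coord x').1 (coord x').2)).
  - by rewrite (wall_modelE x) (ltnW j2) fl subsetUr.
  - exact: base.
  by rewrite -r c; apply: H4.
move=> /wall_edge[|[r [[c fl]|[c fl]]]]; last 2 first.
- exact: two.
- by apply: adjacent_sym; apply: two.
have k1' := ltn_ord (coord w).1; have k1'' := ltn_ord (coord w').1.
have k2' := ltn_ord (coord w).2; have k2'' := ltn_ord (coord w').2.
rewrite gammaE => /or4P[/andP[/eqP r /eqP c]|/andP[/eqP r /eqP c]|/and3P[/eqP r /eqP c _]|/and3P[/eqP r /eqP c _]].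
- by apply: (adjacent_sub (base w) (base w')); rewrite -r c; apply: H4; rewrite // -c.
- by apply: adjacent_sym; apply: (adjacent_sub (base w') (base w)); rewrite r c; apply: H4; rewrite // -c.
- by apply: (adjacent_sub (base w) (base w')); rewrite r c; apply: H3; rewrite // -r.
by apply: adjacent_sym; apply: (adjacent_sub (base w') (base w)); rewrite r -c; apply: H3; rewrite // -r.
Qed.

Lemma wall_model_heavy w u v : u \in wall_model w -> v \in W -> e u v ->
  branching e W u -> branching e W v -> v \in wall_model w.
Proof.
rewrite wall_modelE => uw vW euv bu bv; case/setUP: uw => [h|].
  by rewrite inE (H5 _ _ h vW euv bu bv).
case: ifP => [/andP[jk fl] h|]; last by rewrite inE.
by rewrite inE (H5 _ jk h vW euv bu bv) ?orbT.
Qed.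

End Model.
End Wall.

(** * Translation between lists and the graphs of the statement *)

Lemma ipath_nth (V : finType) (e : rel V) (es : symmetric e) (ei : irreflexive e) d p i j :
  ipath e p -> i < size p -> j < size p ->
  e (nth d p i) (nth d p j) = (j == i.+1) || (i == j.+1).
Proof.
have side x q l : ipath e (x :: q) -> l < size q -> e x (nth d q l) = (l == 0).
  move=> ip lq; rewrite (ipath_head ip) ?mem_nth //.
  case: q ip lq => [//|y q] ip lq; rewrite -(nth_uniq d lq (ltn0Sn _)) //.
  by apply: ipath_uniq; apply: (@ipath_cons _ e x).
elim: p i j => [//|x p IH] [|i] [|j] ip /= ip1 jp.
- by rewrite ei.
- by rewrite side // eqSS orbF.
- by rewrite es side // eqSS.
by rewrite !eqSS IH //; apply: (@ipath_cons _ e x).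
Qed.

Lemma succ_modn n i : i < n -> i.+1 %% n = if i.+1 == n then 0 else i.+1.
Proof. by case: eqP => [->|]; [rewrite modnn|move=> ? ?; rewrite modn_small //; lia]. Qed.

(** The right-hand side is [cycle_edge], so that a hole becomes an embedding of [cycle_graph]. *)
Lemma hole_nth (V : finType) (e : rel V) (es : symmetric e) (ei : irreflexive e) d c i j :
  hole e c -> i < size c -> j < size c ->
  e (nth d c i) (nth d c j) = (i != j) && ((i.+1 %% size c == j) || (j.+1 %% size c == i)).
Proof.
case: c => [//|x p] /and4P[ip sp xp /allP xE] ic jc.
have pu : uniq p := ipath_uniq ip.
have side l : l < size p -> e x (nth d p l) = (l == 0) || (l.+1 == size p).
  move=> lp; rewrite (eqP (xE _ (mem_nth d lp))); congr orb.
    by case: p lp pu {ip sp xp xE ic jc} => [//|y q] lp pu; rewrite -(nth_uniq d lp (ltn0Sn _)).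
  rewrite -[last x p](_ : nth d p (size p).-1 = _); last by case: p lp {ip sp xp xE ic jc pu} => [//|y q] _; rewrite nth_last.
  have pp : size p = (size p).-1.+1 by rewrite prednK //; apply: leq_ltn_trans lp.
  have lt : (size p).-1 < size p by rewrite [X in _ < X]pp.
  by rewrite (nth_uniq d lp lt pu) -eqSS -pp.
have s0 : (0 == size p) = false by move: sp; clear; case: (size p).
rewrite !succ_modn //; case: i j ic jc => [|i] [|j] /= ic jc.
- by rewrite ei.
- rewrite side // !eqSS s0; case: (j.+1 == size p); by rewrite ?orbT // !orbF eq_sym.
- rewrite es side // !eqSS s0; case: (i.+1 == size p); by rewrite ?orbT //= !orbF // eq_sym.
rewrite (ipath_nth es ei d ip) //.
have if_succ l m : ((if l.+2 == (size p).+1 then 0 else l.+2) == m.+1) = (l.+1 == m) && (l.+1 != size p).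
  by rewrite !eqSS; case: (l.+1 == size p); rewrite ?eqSS ?andbF ?andbT.
rewrite !if_succ !(eq_sym _ (size p)) !eqSS.
by move: ic jc; clear; case: (size p =P i.+1) => ?; case: (size p =P j.+1) => ?; rewrite ?andbF ?andbT /=; lia.
Qed.

Lemma restr_sym (V : finType) (e : rel V) U : symmetric e -> symmetric (restr e U).
Proof. by move=> es u w; rewrite /restr es andbCA. Qed.

Lemma restr_irrefl (V : finType) (e : rel V) U : irreflexive e -> irreflexive (restr e U).
Proof. by move=> ei u; rewrite /restr ei !andbF. Qed.

Lemma contains_induced (G : sgraph) (A : {set G}) : contains G (induced A).
Proof. by exists val; split; first exact: val_inj. Qed.

(** A hole of the restriction together with a vertex having two neighbours on it induces a member of
    the excluded family in [G] itself, since on [U] the two edge relations agree. *)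
Lemma T1_free_restr (G : sgraph) (U : {set G}) :
  (forall H : sgraph, in_T1 H -> ~ contains G H) -> T1_free (restr (@edge G) U).
Proof.
move=> noT c v a b hc vc ac bc va vb; apply: contrapT => /eqP ab.
pose e := restr (@edge G) U.
have es : symmetric e := restr_sym U (@edge_sym G).
have ei : irreflexive e := restr_irrefl U (@edge_irrefl G).
have c4 := hole_size hc; have cu := hole_uniq hc.
(* Every vertex of the hole has an edge of the restricted relation, which forces it into [U]. *)
have cU i : i < size c -> nth v c i \in U.
  move=> ic; have jc : i.+1 %% size c < size c by rewrite ltn_mod; move: c4; clear; lia.
  have : e (nth v c i) (nth v c (i.+1 %% size c)).
    rewrite (hole_nth es ei v hc) // eqxx andbT succ_modn //.
    by move: c4; clear; case: (i.+1 =P size c) => [<-|_] ?; lia.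
  by case/and3P.
pose S : {set G} := [set z in v :: c].
have vS : v \in S by rewrite inE mem_head.
have cS z : z \in c -> z \in S by move=> zc; rewrite inE in_cons zc orbT.
pose f (i : cycle_graph (size c)) : induced S :=
  Sub (nth v c i) (cS _ (mem_nth v (ltn_ord i))).
apply: (noT (induced S)); last exact: contains_induced.
exists (size c), f, (Sub v vS); split=> //.
- split=> [i j /(congr1 val)|i j].
    rewrite /f !SubK => /eqP; rewrite nth_uniq ?ltn_ord // => /eqP E; exact: val_inj.
  rewrite [RHS]/edge /= /cycle_edge -(hole_nth es ei v hc) ?ltn_ord //.
  by rewrite /e /restr !cU ?ltn_ord.
- move=> x; rewrite -val_eqE SubK; apply/codomP/idP => [[i ->]|xv].
    by rewrite /f SubK; apply: contraNneq vc => <-; rewrite mem_nth.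
  have : val x \in S := valP x; rewrite inE in_cons (negbTE xv) /= => xc.
  have lt : index (val x) c < size c by rewrite index_mem.
  by exists (Ordinal lt); apply: val_inj; rewrite /f SubK nth_index.
have mem z (zc : z \in c) : e v z ->
    (Sub z (cS z zc) : induced S) \in neighbors (Sub v vS : induced S) :&: [set x in codom f].
  case/and3P=> _ _ vz; rewrite in_setI !in_set; apply/andP; split; first by rewrite /= /induced_edge !SubK.
  have lt : index z c < size c by rewrite index_mem.
  by apply/codomP; exists (Ordinal lt); apply: val_inj; rewrite /f !SubK nth_index.
apply/card_gt1P; exists (Sub a (cS a ac)), (Sub b (cS b bc)).
by split; [exact: mem|exact: mem|rewrite -val_eqE !SubK].
Qed.

Lemma clique_small (G : sgraph) t (K : {set G}) : ~ contains G (complete_graph t) ->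
  clique (@edge G) K -> #|K| < t.
Proof.
move=> no cK; rewrite ltnNge; apply/negP => tK; apply: no.
exists (fun i : 'I_t => enum_val (widen_ord tK i)).
have inj : injective (fun i : 'I_t => enum_val (widen_ord tK i)).
  by move=> i j /enum_val_inj /(congr1 val) /= /val_inj.
split=> // i j; rewrite [RHS]/edge /= /complete_edge.
have [<-|ij] := eqVneq i j; first exact: edge_irrefl.
by apply: cK; rewrite ?enum_valP // (inj_eq inj).
Qed.

Lemma bramble_leq (V : finType) (e : rel V) B k k' : k' <= k -> bramble e B k -> bramble e B k'.
Proof. by move=> kk [H1 H2 H3]; split=> // S /leq_trans - /(_ _ kk) /H3. Qed.

Lemma bramble_restr (V : finType) (e : rel V) B k (U : {set V}) : bramble e B k ->
  (forall b, b \in B -> b \subset U) -> bramble (restr e U) B k.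
Proof.
case=> H1 H2 H3 BU; split=> // [b bB|b b' bB b'B].
  have [cb b0] := H1 _ bB; split=> // X Xb X0 cl; apply: cb => // x y xX yb exy.
  by apply: (cl x) => //; rewrite /restr exy !(subsetP (BU _ bB)) // (subsetP Xb).
have [x [y [xb yb]]] := H2 _ _ bB b'B; exists x, y; split=> //.
by rewrite /restr (subsetP (BU _ bB)) // (subsetP (BU _ b'B)).
Qed.

Lemma bramble_in_unrestr (V : finType) (e : rel V) k (U A : {set V}) :
  bramble_in (restr e U) A k -> bramble_in e A k.
Proof.
case=> B [H1 H2 H3] BA; exists B => //; split=> // [b bB|b b' bB b'B].
  have [cb b0] := H1 _ bB; split=> // X Xb X0 cl; apply: cb => // x y xX yb.
  by case/and3P=> _ _; apply: cl.
have [x [y [xb yb h]]] := H2 _ _ bB b'B; exists x, y; split=> //.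
by case/orP: h => [->//|/and3P[_ _ ->]]; rewrite orbT.
Qed.

Section Minimal.
Variables (V : finType) (e : rel V).
Hypothesis es : symmetric e.
Hypothesis ei : irreflexive e.
Variables (B : {set {set V}}) (k k' a b : nat) (U : {set V}).
Hypothesis T1 : T1_free e.
Hypothesis br : bramble e B k.
Hypothesis BU : forall c, c \in B -> c \subset U.
Hypothesis eU : forall u w, e u w -> u \in U.
Hypothesis minU : forall A : {set V}, A \subset U -> bramble_in e A k -> A = U.
Hypothesis small : forall K, clique e K -> #|K| < k.
Hypothesis k3 : 3 < k.
Hypothesis kE : k = 3 * k'.
Hypothesis a1 : 1 < a.
Hypothesis grid : forall (e' : rel V) B', symmetric e' -> bramble e' B' k' -> grid_minor e' a b setT.

Lemma heavy_grid_minor_minimal : exists2 W : {set V}, W \subset U & heavy_grid_minor e a b W.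
Proof.
have [D HD] := residual_choice e B.
have := heavy_grid es ei T1 br BU eU minU small k3 HD (b := b) kE a1.
move/(_ (fun B' => grid (quot_sym _ _ es))) => H; eexists; last exact: H.
exact: subsetDl.
Qed.
End Minimal.

Theorem theorem1p4 (t : nat) (t_gt0 : 0 < t) :
  exists c : nat, forall G : sgraph,
    (forall H : sgraph, in_T1 H -> ~ contains G H) ->
    c < treewidth G ->
    [\/ contains G (complete_graph t),
        contains G (complete_bipartite t t),
        exists H : sgraph, is_subdivision (wall t) H /\ contains G H
      | exists H : sgraph, is_subdivision (wall t) H /\
          contains G (line_graph H)].
Proof.
have t2 : 0 < 2 * t by lia.
have [kg grid] := grid_of_bramble t_gt0 t2.
(* [kg] is for the grid theorem, [t] makes cliques smaller than [k], and [2] ensures [3 < k]. The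
   factor three in [k] is consumed by the contraction, the one in [3 * k] by the passage from
   treewidth to brambles. *)
pose k' := kg + t + 2; pose k := 3 * k'.
exists (3 * k) => G noT tw.
have [hK|noK] := pselect (contains G (complete_graph t)); first exact: Or41.
have small0 K := clique_small (K := K) noK.
have tk : t <= k by rewrite /k /k'; clear; lia.
have k3 : 3 < k by rewrite /k /k'; clear; lia.
have [B0 br0] := @bramble_of_treewidth G k (ltnW (ltnW (ltnW k3))) tw.
(* For [t = 1] a single vertex, taken from a member of the bramble, is already the complete
   graph. *)
have t1 : 1 < t.
  rewrite ltnNge; apply/negP => t1.
  have [|b bB _] := (let: And3 _ _ h := br0 in h) set0; first by rewrite cards0; apply: leq_ltn_trans k3.
  have [_ /set0Pn[x _]] := (let: And3 h _ _ := br0 in h) b bB.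
  have := small0 [set x]; rewrite cards1 ltnNge t1 => h; suff : false by []; apply: h.
  by move=> y z /set1P-> /set1P->; rewrite eqxx.
have [U [[B br BU] minU0]] : exists U : {set G}, bramble_in (@edge G) U k /\
    forall A, bramble_in (@edge G) A k -> #|U| <= #|A|.
  apply: (@exists_min _ (fun U => bramble_in (@edge G) U k) (fun U => #|U|)).
  by exists setT, B0 => // b _; apply: subsetT.
(* Restricting the relation instead of passing to a subgraph keeps the vertex type; vertices outside
   [U] become isolated. *)
pose e := restr (@edge G) U.
have es : symmetric e := restr_sym U (@edge_sym G).
have ei : irreflexive e := restr_irrefl U (@edge_irrefl G).
have T1 : T1_free e := T1_free_restr noT.
have bre : bramble e B k := bramble_restr br BU.
have eU u w : e u w -> u \in U by case/and3P.
have minU (A : {set G}) : A \subset U -> bramble_in e A k -> A = U.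
  by move=> AU /bramble_in_unrestr /minU0 le; apply/eqP; rewrite eqEcard AU.
have small (K : {set G}) : clique e K -> #|K| < k.
  move=> cK; apply: leq_trans tk; apply: small0 => x y xK yK xy.
  by case/and3P: (cK x y xK yK xy).
(* A grid with [t] rows and [2 * t] columns, the dimensions of [gamma t]. *)
have [||W WU [C [H1 H2 H3 H4 H5]]] := @heavy_grid_minor_minimal G e es ei B k k' t (2 * t) U T1 bre BU eU minU small k3 _ t1.
- by [].
- move=> e' B' es' br'; apply: grid es' _; apply: bramble_leq br'.
  by rewrite /k'; clear; lia.
have tf x y z := @triangle_free G e es ei B k U T1 bre BU eU minU small x y z.
have [A [phi [P [AW sub]]]] := subdivide es ei tf
  (@wall_model_conn t G e W C es H1 H4) (wall_model_sub H1) (wall_model_disjoint t1 H2)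
  (wall_model_adjacent t1 es H3 H4) (wall_model_heavy H5) (wall_deg_ge t1) (wall_deg_le t1).
apply: Or43; exists (induced A); split; last exact: contains_induced.
apply: (is_subdivision_induced _ sub) => [u v uA vA|x].
  by rewrite /e /restr !(subsetP WU) ?(subsetP AW).
have : 0 < degree x by apply: ltnW; apply: wall_deg_ge.
by case/card_gt0P=> y; rewrite in_set; exists y.
Qed.
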